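(* Consider the discrete-time Rayleigh fading MIMO channel (no channel state information) with $N_T$ transmit and $N_R$ receive antennas described in the context, and let $\beta\ge1$ be fixed. If the channel is transmit separable, with constants $\alpha_0,\dots,\alpha_{N_T-1}\ge0$ and autocorrelation functions $R_0,\dots,R_{N_R-1}$, then $$\lim_{\rho\to0}\frac{C_{mimo-i}(\rho,\beta)}{\rho^2}=\frac12\Big(\sum_{k=0}^{N_T-1}\alpha_k\Big)^2\max_{0\le a\le\frac1\beta}\ \sum_{l=0}^{N_R-1}\left\{a\lambda_l-a^2R_l^2(0)\right\}.$$
   Context: Channel model. For $n\in\mathbb{N}$ the input is $\sqrt{\rho}\,\underline{Z}(n)$ ($\rho>0$) with $\underline{Z}(n)=(Z_0(n),\dots,Z_{N_T-1}(n))\in\mathbb{C}^{N_T}$, and the output $\underline{Y}(n)\in\mathbb{C}^{N_R}$ is $$Y_l(n)=\sqrt{\rho}\sum_{k=0}^{N_T-1}H_{k,l}(n)Z_k(n)+W_l(n),\qquad 0\le l\le N_R-1 .$$ The fading processes $H_{k,l}=(H_{k,l}(n):n\in\mathbb{Z})$ are zero-mean, stationary and ergodic, jointly proper complex normal (i.e. jointly circularly symmetric complex Gaussian), and mutually independent for distinct pairs $(k,l)$. $H_{k,l}$ has autocorrelation function $R_{k,l}(n)=E[H_{k,l}(n)H_{k,l}^*(0)]$ and a spectral density. The $W_l(n)$ are iid (over $l$ and $n$) proper complex normal with zero mean and unit variance. Fading, additive noise and input are mutually independent (neither transmitter nor receiver observes the fading). Information is measured in nats. The channel is transmit separable if there are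 nonnegative constants $(\alpha_k:0\le k\le N_T-1)$ and autocorrelation functions $(R_l:0\le l\le N_R-1)$ such that $R_{k,l}(n)=\alpha_kR_l(n)$ for all $k,l,n$. In that case set $\phi_l=\sum_{n=1}^\infty|R_l(n)|^2$ (assumed finite for all $l$) and $\lambda_l=(R_l(0))^2+2\phi_l$. Individual power constraints: $|Z_k(n)|^2\le1$ and $E[|Z_k(n)|^2]\le1/\beta$ for all $k\in[0,N_T-1]$ and all $n$. $C_{mimo-i}(\rho,\beta)$ denotes the information theoretic capacity under these constraints, i.e. $\lim_{N\to\infty}\frac1N\sup I(\underline{Z}(1),\dots,\underline{Z}(N);\underline{Y}(1),\dots,\underline{Y}(N))$, the supremum being over joint distributions of $(\underline{Z}(1),\dots,\underline{Z}(N))$ satisfying the constraints for $1\le n\le N$. *)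

(* Defs.v *)
From HB Require Import structures.
From mathcomp Require Import all_boot all_order all_algebra finmap.
From mathcomp Require Import all_classical all_reals all_analysis.
From mathcomp Require Import measurable_realfun complex.

Set Implicit Arguments.
Unset Strict Implicit.
Unset Printing Implicit Defensive.

Import Order.TTheory GRing.Theory Num.Theory.
Import numFieldNormedType.Exports.

Local Open Scope classical_set_scope.
Local Open Scope ring_scope.
Local Open Scope complex_scope.

Local Notation Re := complex.Re.
Local Notation Im := complex.Im.

(* The Borel sigma-algebra of R[i], identified with R * R: the smallest
   sigma-algebra making Re and Im measurable. *)
Section complex_measurable.
Context {R : realType}.

HB.instance Definition _ := isPointed.Build R[i] 0.

Definition complex_measurable : set (set R[i]) :=
  g_sigma_preimageU (@complex.Re R : R[i] -> R) (@complex.Im R : R[i] -> R).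

Let complex_measurable0 : complex_measurable set0.
Proof. exact: (@sigma_algebra0 _ setT). Qed.

Let complex_measurableC A : complex_measurable A -> complex_measurable (~` A).
Proof. exact: sigma_algebraC. Qed.

Let complex_measurableU (F : (set R[i])^nat) :
  (forall i, complex_measurable (F i)) ->
  complex_measurable (\bigcup_i (F i)).
Proof. exact: (@sigma_algebra_bigcup _ setT). Qed.

HB.instance Definition _ := @isMeasurable.Build default_measure_display
  R[i] complex_measurable complex_measurable0 complex_measurableC
  complex_measurableU.

Lemma measurable_fun_complexP d (T : measurableType d) (f : T -> R[i]) :
  measurable_fun setT f <->
  measurable_fun setT (fun x => Re (f x)) /\
  measurable_fun setT (fun x => Im (f x)).
Proof.
split=> [mf|[mr mi]].
  by split=> _ B mB; rewrite setTI;
    [have := mf measurableT (@complex.Re R @^-1` B)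
    |have := mf measurableT (@complex.Im R @^-1` B)]; rewrite setTI; apply;
    apply: sub_sigma_algebra; [left|right]; exists B => //; rewrite setTI.
apply: (@measurability _ _ T R[i] setT f
  (preimage_set_system setT (@complex.Re R) measurable `|`
   preimage_set_system setT (@complex.Im R) measurable)) => //.
by move=> _ [_ [] [B mB <-] <-]; rewrite !setTI;
  [have := mr measurableT B mB|have := mi measurableT B mB]; rewrite setTI.
Qed.

Lemma measurable_complexD d (T : measurableType d) (f g : T -> R[i]) :
  measurable_fun setT f -> measurable_fun setT g ->
  measurable_fun setT (fun x => f x + g x).
Proof.
move=> /measurable_fun_complexP[fr fi] /measurable_fun_complexP[gr gi].
apply/measurable_fun_complexP; split.
  rewrite (_ : (fun x => _) = (fun x => Re (f x) + Re (g x))).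
    exact: measurable_funD.
  by apply/funext => x; case: (f x) (g x) => ? ? [].
rewrite (_ : (fun x => _) = (fun x => Im (f x) + Im (g x))).
  exact: measurable_funD.
by apply/funext => x; case: (f x) (g x) => ? ? [].
Qed.

Lemma measurable_complexM d (T : measurableType d) (f g : T -> R[i]) :
  measurable_fun setT f -> measurable_fun setT g ->
  measurable_fun setT (fun x => f x * g x).
Proof.
move=> /measurable_fun_complexP[fr fi] /measurable_fun_complexP[gr gi].
apply/measurable_fun_complexP; split.
  rewrite (_ : (fun x => _) =
    (fun x => Re (f x) * Re (g x) - Im (f x) * Im (g x))).
    by apply: measurable_funB; exact: measurable_funM.
  by apply/funext => x; case: (f x) (g x) => ? ? [].
rewrite (_ : (fun x => _) =
  (fun x => Re (f x) * Im (g x) + Im (f x) * Re (g x))).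
  by apply: measurable_funD; exact: measurable_funM.
by apply/funext => x; case: (f x) (g x) => ? ? [].
Qed.

Lemma measurable_complex_sum d (T : measurableType d) (I : Type) (s : seq I)
    (f : I -> T -> R[i]) :
  (forall i, measurable_fun setT (f i)) ->
  measurable_fun setT (fun x => \sum_(i <- s) f i x).
Proof.
move=> mf; elim: s => [|i s ih].
  rewrite (_ : (fun x => _) = cst 0); first exact: measurable_cst.
  by apply/funext => x; rewrite big_nil.
rewrite (_ : (fun x => _) = (fun x => f i x + \sum_(j <- s) f j x)).
  exact: measurable_complexD.
by apply/funext => x; rewrite big_cons.
Qed.

End complex_measurable.

Definition Cintegral d (T : measurableType d) (R : realType)
    (mu : {measure set T -> \bar R}) (D : set T) (f : T -> R[i]) : R[i] :=
  (\int[mu]_(x in D) Re (f x)) +i* (\int[mu]_(x in D) Im (f x)).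

Definition Cexpectation d (T : measurableType d) (R : realType)
    (P : probability T R) (X : T -> R[i]) : R[i] := Cintegral P setT X.

Section processes.
Context d (T : measurableType d) (R : realType) (P : probability T R).

Definition sigma_of (T' : Type) (I : Type) (X : I -> T' -> R[i]) :
    set (set T') :=
  <<s \bigcup_i preimage_set_system setT (X i) measurable >>.

Definition mutually_independent (I : choiceType) (F : I -> set (set T)) :=
  forall (J : {fset I}) (E : I -> set T),
    (forall i, i \in J -> F i (E i)) ->
    P (\bigcap_(i in [set` J]) E i) = (\prod_(i <- J) P (E i))%E.

Definition independent (F G : set (set T)) :=
  forall A B, F A -> G B -> P (A `&` B) = (P A * P B)%E.

(* The case s = 0 is separated because normal_prob m 0 is not the Dirac
   measure at m. *)
Definition is_normal (X : T -> R) :=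
  exists m s : R, forall B, measurable B ->
    P (X @^-1` B) = if s == 0 then \d_m B else normal_prob m s B.

(* Jointly normal: every finite real linear combination of real and imaginary
   parts is normal.  Proper: the pseudo-covariances vanish. *)
Definition jointly_proper_normal (I : Type) (X : I -> T -> R[i]) :=
  (forall (J : seq I) (a b : I -> R),
     is_normal (fun w =>
       \sum_(i <- J) (a i * Re (X i w) + b i * Im (X i w))))
  /\
  (forall i j, Cexpectation P (fun w =>
     (X i w - Cexpectation P (X i)) * (X j w - Cexpectation P (X j))) = 0).

Definition path_events : set (set (int -> R[i])) :=
  sigma_of (fun (n : int) (x : int -> R[i]) => x n).

Definition shift_path (m : int) (x : int -> R[i]) : int -> R[i] :=
  fun n => x (n + m).

Definition stationary (X : int -> T -> R[i]) :=
  forall (m : int) A, path_events A ->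
    P [set w | A (shift_path m (X ^~ w))] = P [set w | A (X ^~ w)].

(* Meaningful for a stationary X. *)
Definition ergodic (X : int -> T -> R[i]) :=
  forall A, path_events A -> shift_path 1 @^-1` A = A ->
    P [set w | A (X ^~ w)] = 0%E \/ P [set w | A (X ^~ w)] = 1%E.

Definition autocorrelation (X : int -> T -> R[i]) (n : int) : R[i] :=
  Cexpectation P (fun w => X n w * conjc (X 0 w)).

End processes.

Definition is_autocorrelation (R : realType) (r : int -> R[i]) :=
  exists (d : measure_display) (T : measurableType d) (P : probability T R)
         (X : int -> {RV P >-> R[i]}),
    [/\ stationary P X,
        forall n, (\int[P]_w (Normc.normc (X n w) ^+ 2)%:E < +oo)%E &
        forall n, autocorrelation P X n = r n].

Definition has_spectral_density (R : realType) (r : int -> R[i]) :=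
  exists S : R -> R,
    [/\ forall x, x \in `[- pi, pi] -> 0 <= S x,
        lebesgue_measure.-integrable `[- pi, pi] (EFin \o S) &
        forall n : int, r n = ((2 * pi)^-1)%:C *
          Cintegral lebesgue_measure `[- pi, pi]
            (fun x => (S x)%:C * (cos (n%:~R * x) +i* sin (n%:~R * x)))].

Section information.
Context (R : realType).

Definition pair_fun (T T1 T2 : Type) (X : T -> T1) (Y : T -> T2) (w : T) :=
  (X w, Y w).

Section pair_mfun.
Context d d1 d2 (T : measurableType d) (T1 : measurableType d1)
  (T2 : measurableType d2) (X : {mfun T >-> T1}) (Y : {mfun T >-> T2}).

Let measurable_pair_fun : measurable_fun setT (pair_fun X Y).
Proof. by apply: measurable_fun_pair. Qed.

HB.instance Definition _ :=
  @isMeasurableFun.Build _ _ _ _ (pair_fun X Y) measurable_pair_fun.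
End pair_mfun.

(* Kullback-Leibler divergence D(P || Q) in nats; the values of ln on the
   P-null set where the chosen density is <= 0 do not matter. *)
Definition KL d (T : measurableType d) (P Q : probability T R) : \bar R :=
  if `[< P `<< Q >] then
    (\int[P]_x
       (ln (fine (Radon_Nikodym (charge_of_finite_measure P) Q x)))%:E)%E
  else +oo%E.

Definition mutual_information d d1 d2 (T : measurableType d)
    (T1 : measurableType d1) (T2 : measurableType d2) (P : probability T R)
    (X : {mfun T >-> T1}) (Y : {mfun T >-> T2}) : \bar R :=
  KL (distribution P (pair_fun X Y))
     (distribution P X \x distribution P Y)%E.

End information.

Section channel.
Context (R : realType) (NT NR : nat) d (Omega : measurableType d)
  (P : probability Omega R)
  (H : 'I_NT -> 'I_NR -> int -> {RV P >-> R[i]})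
  (W : 'I_NR -> nat -> {RV P >-> R[i]}).

Record rayleigh_mimo : Prop := RayleighMimo {
  fading_mean0 : forall k l n, Cexpectation P (H k l n) = 0 ;
  fading_stationary : forall k l, stationary P (H k l) ;
  fading_ergodic : forall k l, ergodic P (H k l) ;
  fading_normal : jointly_proper_normal P
    (fun i : 'I_NT * 'I_NR * int => H i.1.1 i.1.2 i.2) ;
  fading_independent : mutually_independent P
    (fun kl : 'I_NT * 'I_NR => sigma_of (fun n => H kl.1 kl.2 n)) ;
  fading_spectral : forall k l,
    has_spectral_density (autocorrelation P (H k l)) ;
  noise_mean0 : forall l n, Cexpectation P (W l n) = 0 ;
  noise_var1 : forall l n,
    (\int[P]_w (Normc.normc (W l n w) ^+ 2)%:E = 1)%E ;
  noise_normal : forall l n, jointly_proper_normal P (fun _ : unit => W l n) ;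
  noise_independent : mutually_independent P
    (fun ln : 'I_NR * nat => sigma_of (fun _ : unit => W ln.1 ln.2)) ;
  fading_noise_independent : independent P
    (sigma_of (fun i : 'I_NT * 'I_NR * int => H i.1.1 i.1.2 i.2))
    (sigma_of (fun ln : 'I_NR * nat => W ln.1 ln.2))
}.

Definition transmit_separable (alpha : 'I_NT -> R) (r : 'I_NR -> int -> R[i]) :=
  [/\ forall k, 0 <= alpha k,
      forall l, is_autocorrelation (r l) &
      forall k l n, autocorrelation P (H k l) n = (alpha k)%:C * r l n].

(* Entry (n, k) of an input block is Z_k(n + 1) and entry (n, l) of an output
   block is Y_l(n + 1): 0-based positions stand for the times 1, ..., N. *)
Local Notation input_block N := (N.-tuple (NT.-tuple R[i])).
Local Notation output_block N := (N.-tuple (NR.-tuple R[i])).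

Definition channel_output (rho : R) (N : nat)
    (zw : input_block N * Omega) : output_block N :=
  [tuple [tuple
    (Num.sqrt rho)%:C *
      \sum_(k < NT) H k l (n.+1)%:Z zw.2 * tnth (tnth zw.1 n) k
    + W l n.+1 zw.2 | l < NR] | n < N].

Let measurable_channel_output rho N :
  measurable_fun setT (@channel_output rho N).
Proof.
apply/measurable_fun_tnthP => n; apply/measurable_fun_tnthP => l.
rewrite (_ : _ \o _ = (fun zw : input_block N * Omega =>
    (Num.sqrt rho)%:C *
      \sum_(k < NT) H k l (n.+1)%:Z zw.2 * tnth (tnth zw.1 n) k
    + W l n.+1 zw.2)); last first.
  by apply/funext => zw /=; rewrite !tnth_mktuple.
apply: measurable_complexD; last by apply: measurableT_comp.
apply: measurable_complexM; first exact: measurable_cst.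
apply: measurable_complex_sum => k; apply: measurable_complexM.
  by apply: measurableT_comp.
apply: (measurableT_comp (measurable_tnth k)).
by apply: (measurableT_comp (measurable_tnth n)).
Qed.

HB.instance Definition _ rho N := @isMeasurableFun.Build _ _ _ _
  (@channel_output rho N) (@measurable_channel_output rho N).

Definition block_input (N : nat) (zw : input_block N * Omega) :=
  zw.1.

Let measurable_block_input N : measurable_fun setT (@block_input N).
Proof. exact: measurable_fst. Qed.

HB.instance Definition _ N := @isMeasurableFun.Build _ _ _ _
  (@block_input N) (@measurable_block_input N).

Definition power_constraints (beta : R) (N : nat)
    (mu : probability (input_block N) R) :=
  forall (k : 'I_NT) (n : 'I_N),
    {ae mu, forall z, Normc.normc (tnth (tnth z n) k) ^+ 2 <= 1} /\
    (\int[mu]_z (Normc.normc (tnth (tnth z n) k) ^+ 2)%:E <= (beta^-1)%:E)%E.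

(* Under mu \x P the input has law mu and is independent of fading and
   noise. *)
Definition block_information (rho : R) (N : nat)
    (mu : probability (input_block N) R) : \bar R :=
  mutual_information (mu \x P)%E (@block_input N) (@channel_output rho N).

Definition C_mimo_i (rho beta : R) : \bar R :=
  limn (fun N : nat => ((N%:R)^-1)%:E *
    ereal_sup [set block_information rho mu
              | mu in @power_constraints beta N])%E.

End channel.

Section low_snr.
Context (R : realType).

Definition phi (r : int -> R[i]) : \bar R :=
  (\sum_(1 <= n <oo) (Normc.normc (r n%:Z) ^+ 2)%:E)%E.

(* r 0 is real for an autocorrelation function r *)
Definition lambda (r : int -> R[i]) : R :=
  Re (r 0) ^+ 2 + 2 * fine (phi r).

End low_snr.

(* Main.v *)
(** Write gamma for the law of the noise block and L(z, y) for the density of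
    the output given the input z with respect to gamma.  For every positive
    g(z, y) such that g times the output density integrates to at most 1, and
    every density q, one has
      E ln g(Z, Y) <= I(Z; Y) <= E ln (L(Z, Y) / q(Y)).

    Since the fading is Gaussian, L(z, .) is explicit in the eigenbasis of the
    covariance A of the received signal, and E_z ln L(z, Y) lies between
    |A|^2/2 - tr A |A|^2/3 and |A|^2/2 (Hilbert-Schmidt norm).  For the upper
    bound, q is a product of proper normals with the variances of the Y_l(n);
    transmit separability and Cauchy-Schwarz bound |A|^2, and each time
    contributes at most rho^2/2 (sum alpha_k)^2 sum_l (a lambda_l - a^2 R_l(0)^2)
    + O(rho^3), where a is the mean power used at that time.

    For the lower bound, all antennas send the same block, which is zero with
    probability 1 - a and a uniformly random sign sequence otherwise.  Distinct
    output coordinates are then uncorrelated, so replacing the output density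
    by the product q costs only ln (1 + O(rho^3)): with g = L / (c q), this is
    a bound on the second moment of the output density relative to q, i.e. an
    exponential moment of the inner product of two independent copies of the
    signal.  The O(rho^3) depends on the block length N; concatenating
    independent blocks makes the optimal block information superadditive in N,
    so by Fekete's lemma the capacity is at least the rate achieved at any fixed
    N, while the rho^2 coefficient tends to the right-hand side as N grows. *)

Require Import Defs.
From HB Require Import structures.
From mathcomp Require Import all_boot all_order all_algebra.
From mathcomp Require Import all_classical all_reals all_analysis.
From mathcomp Require Import complex.
From mathcomp Require Import finmap spectral ring lra measurable_realfun.

Set Implicit Arguments.
Unset Strict Implicit.
Unset Printing Implicit Defensive.

Import Order.TTheory GRing.Theory Num.Theory.
Import numFieldNormedType.Exports.

Local Open Scope classical_set_scope.
Local Open Scope ring_scope.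

(** The cubic error comes from matching. The reference q has the second moments of the true output,
    so when the exponent in the second-moment bound is expanded in rho, the linear term has mean
    zero and the two terms of order rho^2 cancel; this uses uncorrelated coordinates and properness.
    The same matching leaves only diagonal powers in the subtracted term, quadratic in a, whereas E
    |A|^2 is linear in a and keeps all lags: a block that is on or off as a whole retains the
    correlation between times within a codeword, and the signs remove it on average.

    Normality is given only through real linear combinations and may be degenerate, so the signal
    need not have a density. The factor exp (-(y - x)^2) is therefore written as a Gaussian average
    of cosines; the characteristic function then yields the likelihood, and also the law of the
    noise, without Fourier inversion. Since the likelihood depends on the signal only through its
    covariance, a later block sees the same channel, although the memory of the fading makes the
    outputs of two blocks dependent. *)

Section density.
Context d (T : measurableType d) (R : realType).
Variables (m m' : {measure set T -> \bar R}) (h : T -> R).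
Hypothesis mh : measurable_fun setT h.
Hypothesis h0 : forall x, 0 <= h x.
Hypothesis m'E : forall A, measurable A -> m' A = (\int[m]_(x in A) (h x)%:E)%E.

Import HBNNSimple.

(** Simple functions and monotone convergence. The measure [m'] is known only by its values on
    measurable sets, which is all that [normal_prob] and a shifted normal law provide. *)
Lemma ge0_integral_density (f : T -> \bar R) :
  measurable_fun setT f -> (forall x, (0 <= f x)%E) ->
  (\int[m']_x f x = \int[m]_x (f x * (h x)%:E))%E.
Proof.
move=> mf f0.
have mhE : measurable_fun setT (EFin \o h) by exact/measurable_EFinP.
pose f_ := nnsfun_approx measurableT mf.
transitivity (limn (fun n => \int[m']_x (f_ n x)%:E)%E).
  rewrite -monotone_convergence//.
  - by apply: eq_integral => y _; apply/esym/cvg_lim => //;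
      apply: cvg_nnsfun_approx.
  - by move=> n; exact/measurable_EFinP/measurable_funP.
  - by move=> n y _; rewrite lee_fin.
  - by move=> y _ p n mn; rewrite lee_fin; exact/lefP/nd_nnsfun_approx.
rewrite [X in limn X](_ : _ =
    (fun n => \int[m]_x ((f_ n x)%:E * (h x)%:E))%E).
  rewrite -monotone_convergence//; last 3 first.
  - by move=> n; apply: emeasurable_funM => //;
      exact/measurable_EFinP/measurable_funP.
  - by move=> n x _; rewrite mule_ge0// lee_fin.
  - move=> x _ p n mn; apply: lee_wpmul2r => //; first by rewrite lee_fin.
    by rewrite lee_fin; exact/lefP/nd_nnsfun_approx.
  apply: eq_integral => x _; apply/cvg_lim => //.
  by apply: cvgeZr => //; apply: cvg_nnsfun_approx.
apply/funext => n.
have mfk k : measurable (f_ n @^-1` [set k]) by [].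
transitivity (\sum_(k \in range (f_ n))
    \int[m]_x ((k * \1_(f_ n @^-1` [set k]) x)%:E * (h x)%:E))%E.
  under eq_integral do rewrite fimfunE -fsumEFin//.
  rewrite ge0_integral_fsum//; last 2 first.
  - by move=> y; exact/measurable_EFinP/measurable_funM.
  - by move=> y x _; rewrite nnfun_muleindic_ge0.
  apply: eq_fsbigr => r _; rewrite integralZl_indic_nnsfun// integral_indic//=.
  rewrite setIT m'E//.
  have [r0|r0] := ltP r 0.
    by rewrite preimage_nnfun0// integral_set0 mule0 integral0_eq// => x _;
      rewrite indicE in_set0 mulr0 mul0e.
  rewrite integral_mkcond -ge0_integralZl_EFin//; last 2 first.
  - by move=> x _; rewrite patchE; case: ifP; rewrite ?lee_fin.
  - by apply/(measurable_restrictT _ _).1 => //; exact: measurable_funTS.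
  apply: eq_integral => x _; rewrite patchE indicE.
  by case: ifP => _; rewrite ?mulr1 ?mulr0 ?mule0 ?mul0e.
rewrite -ge0_integral_fsum//.
- apply: eq_integral => x _; rewrite fimfunE -fsumEFin//.
  by rewrite ge0_mule_fsuml// => k; exact: nnfun_muleindic_ge0.
- move=> r; apply: emeasurable_funM => //.
  exact/measurable_EFinP/measurable_funM.
- by move=> r x _; rewrite mule_ge0// ?nnfun_muleindic_ge0// lee_fin.
Qed.

Lemma integrable_density (f : T -> \bar R) : measurable_fun setT f ->
  m'.-integrable setT f <-> m.-integrable setT (fun x => (f x * (h x)%:E)%E).
Proof.
move=> mf; have mfh : measurable_fun setT (fun x => (f x * (h x)%:E)%E).
  by apply: emeasurable_funM => //; exact/measurable_EFinP.
have E : (\int[m']_x `|f x| = \int[m]_x `|f x * (h x)%:E|)%E.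
  rewrite ge0_integral_density//; last exact: measurableT_comp.
  by apply: eq_integral => x _; rewrite abseM (@gee0_abs _ (h x)%:E)// lee_fin.
by split=> /integrableP[_ fi]; apply/integrableP; split => //;
  [rewrite -E|rewrite E].
Qed.

Lemma integral_density (f : T -> \bar R) : measurable_fun setT f ->
  (\int[m']_x f x = \int[m]_x (f x * (h x)%:E))%E.
Proof.
move=> mf; rewrite integralE [RHS]integralE.
have H x : (0 <= (h x)%:E)%E by rewrite lee_fin.
congr (_ - _)%E; rewrite ge0_integral_density//.
- apply: eq_integral => x _; rewrite muleC.
  transitivity ((fun _ : T => (h x)%:E * f x)^\+ x)%E.
    by rewrite (ge0_funeposM (fun _ => f x) (h0 x)) funeposE [in RHS]funeposE.
  by rewrite !funeposE muleC.
- exact: measurable_funepos.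
- apply: eq_integral => x _; rewrite muleC.
  transitivity ((fun _ : T => (h x)%:E * f x)^\- x)%E.
    by rewrite (ge0_funenegM (fun _ => f x) (h0 x)) funenegE [in RHS]funenegE.
  by rewrite !funenegE muleC.
- exact: measurable_funeneg.
Qed.

End density.

(** * Integrals of real functions and image measures *)

Section Rintegrable_extra.
Context d (T : measurableType d) (R : realType).
Variable m : {measure set T -> \bar R}.
Variable D : set T.
Hypothesis mD : measurable D.
Implicit Types f g : T -> R.

Lemma integrable_EFinZl (c : R) f : m.-integrable D (EFin \o f) ->
  m.-integrable D (EFin \o (fun x => c * f x)).
Proof. by move=> fi; rewrite /comp; under eq_fun do rewrite EFinM; apply: integrableZl. Qed.

Lemma integrable_EFinZr (c : R) f : m.-integrable D (EFin \o f) ->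
  m.-integrable D (EFin \o (fun x => f x * c)).
Proof. by move=> fi; under eq_fun do rewrite mulrC; apply: integrable_EFinZl. Qed.

Lemma integrable_EFinD f g : m.-integrable D (EFin \o f) ->
  m.-integrable D (EFin \o g) -> m.-integrable D (EFin \o (fun x => f x + g x)).
Proof.
by move=> fi gi; rewrite /comp; under eq_fun do rewrite EFinD; apply: integrableD.
Qed.

Lemma integrable_EFinN f : m.-integrable D (EFin \o f) ->
  m.-integrable D (EFin \o (fun x => - f x)).
Proof.
by move=> fi; under eq_fun do rewrite -mulN1r; apply: integrable_EFinZl.
Qed.

Lemma integrable_EFinB f g : m.-integrable D (EFin \o f) ->
  m.-integrable D (EFin \o g) -> m.-integrable D (EFin \o (fun x => f x - g x)).
Proof. by move=> fi gi; apply: integrable_EFinD => //; apply: integrable_EFinN. Qed.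

Lemma integrable_EFin_sum (I : Type) (s : seq I) (F : I -> T -> R) :
  (forall i, m.-integrable D (EFin \o F i)) ->
  m.-integrable D (EFin \o (fun x => \sum_(i <- s) F i x)).
Proof.
move=> Fi; elim: s => [|i s ih].
  under eq_fun do rewrite big_nil.
  exact: integrable0.
by under eq_fun do rewrite big_cons; apply: integrable_EFinD.
Qed.

Lemma Rintegral_sum (I : Type) (s : seq I) (F : I -> T -> R) :
  (forall i, m.-integrable D (EFin \o F i)) ->
  \int[m]_(x in D) (\sum_(i <- s) F i x) = \sum_(i <- s) \int[m]_(x in D) F i x.
Proof.
move=> Fi; elim: s => [|i s ih].
  rewrite big_nil; under eq_Rintegral do rewrite big_nil.
  by rewrite /Rintegral integral0.
rewrite big_cons; under eq_Rintegral do rewrite big_cons.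
by rewrite RintegralD// ?ih//; exact: integrable_EFin_sum.
Qed.

Lemma RintegralN f : m.-integrable D (EFin \o f) ->
  \int[m]_(x in D) (- f x) = - \int[m]_(x in D) f x.
Proof.
by move=> fi; under eq_Rintegral do rewrite -mulN1r; rewrite RintegralZl// mulN1r.
Qed.

Lemma le_EFin_integrable f g : measurable_fun D f ->
  (forall x, D x -> `|f x| <= g x) ->
  m.-integrable D (EFin \o g) -> m.-integrable D (EFin \o f).
Proof.
move=> mf fg gi; apply: le_integrable gi => //; first exact/measurable_EFinP.
by move=> x Dx /=; rewrite lee_fin (le_trans (fg _ Dx))// ler_norm.
Qed.

Lemma EFin_Rintegral f : m.-integrable D (EFin \o f) ->
  (\int[m]_(x in D) f x)%:E = (\int[m]_(x in D) (f x)%:E)%E.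
Proof. by move=> fi; rewrite fineK//; exact: integrable_fin_num. Qed.

End Rintegrable_extra.

Section ge0_Rintegral.
Context d (T : measurableType d) (R : realType).
Variable m : {measure set T -> \bar R}.

Lemma ge0_Rintegrable (f : T -> R) c : measurable_fun setT f ->
  (forall x, 0 <= f x) -> (\int[m]_x (f x)%:E = c%:E)%E ->
  m.-integrable setT (EFin \o f).
Proof.
move=> mf f0 fc; apply/integrableP; split; first exact/measurable_EFinP.
by under eq_integral do rewrite /= ger0_norm//; rewrite fc ltry.
Qed.

Lemma ge0_Rintegrable_le (f : T -> R) c : measurable_fun setT f ->
  (forall x, 0 <= f x) -> (\int[m]_x (f x)%:E <= c%:E)%E ->
  m.-integrable setT (EFin \o f).
Proof.
move=> mf f0 fc; apply/integrableP; split; first exact/measurable_EFinP.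
by under eq_integral do rewrite /= ger0_norm//; rewrite (le_lt_trans fc)// ltry.
Qed.

End ge0_Rintegral.

Section image_measure.
Context d1 d2 (T1 : measurableType d1) (T2 : measurableType d2) (R : realType).
Variables (m1 : {measure set T1 -> \bar R}) (m2 : {measure set T2 -> \bar R}).
Variable X : T1 -> T2.
Hypothesis mX : measurable_fun setT X.
Hypothesis m12 : forall A, measurable A -> m1 (X @^-1` A) = m2 A.
Local Open Scope ereal_scope.

(** [m2] need only agree with the image of [m1] on measurable sets, so that laws identified by other
    means, such as [noise_law], can be used directly in place of a pushforward. *)
Lemma ge0_integral_image (f : T2 -> \bar R) :
  measurable_fun setT f -> (forall x, 0 <= f x) ->
  \int[m2]_x f x = \int[m1]_x f (X x).
Proof.
move=> mf f0; transitivity (\int[pushforward m1 X]_x f x).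
  by apply: eq_measure_integral => A mA _; rewrite -m12.
by rewrite (ge0_integral_pushforward mX).
Qed.

Lemma integral_image (f : T2 -> \bar R) : measurable_fun setT f ->
  \int[m2]_x f x = \int[m1]_x f (X x).
Proof.
move=> mf; rewrite integralE [RHS]integralE.
rewrite (ge0_integral_image (measurable_funepos mf))//.
rewrite (ge0_integral_image (measurable_funeneg mf))//.
by congr (_ - _); apply: eq_integral => x _; rewrite ?funeposE ?funenegE.
Qed.

Lemma integrable_image (f : T2 -> \bar R) : measurable_fun setT f ->
  m2.-integrable setT f <-> m1.-integrable setT (f \o X).
Proof.
move=> mf; have E : \int[m2]_x `|f x| = \int[m1]_x `|(f \o X) x|.
  by rewrite ge0_integral_image//; exact: measurableT_comp.
split=> /integrableP[_ fi]; apply/integrableP; split => //.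
- exact: measurableT_comp.
- by rewrite -E.
- by rewrite E.
Qed.

Lemma Rintegral_image (f : T2 -> R) : measurable_fun setT f ->
  (\int[m2]_x f x = \int[m1]_x f (X x))%R.
Proof. by move=> mf; rewrite /Rintegral integral_image//; exact/measurable_EFinP. Qed.

End image_measure.

(** * Real Gaussian integrals *)

Section gauss.
Context {R : realType}.
Local Notation mu := (@lebesgue_measure R).

(** The fundamental theorem on [-n - 1, n + 1] and dominated convergence; decay of [F] along the
    integers suffices. This is the integration by parts behind the Gaussian identities below, where
    [F] is a normal density times a simple factor. *)
Lemma integral_derivative_eq0 (F f : R -> R) :
  continuous f -> (forall x, is_derive x (1 : R) F (f x)) ->
  mu.-integrable setT (EFin \o f) ->
  F n%:R @[n --> \oo] --> (0 : R) -> F (- n%:R) @[n --> \oo] --> (0 : R) ->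
  (\int[mu]_x (f x)%:E = 0)%E.
Proof.
move=> cf dF intf F1 F2.
have cF : continuous F.
  by move=> x; apply: differentiable_continuous; apply/derivable1_diffP.
have mf : measurable_fun setT f by exact: continuous_measurable_fun.
have mEf : measurable_fun setT (EFin \o f) by exact/measurable_EFinP.
pose I (n : nat) : set R := [set` `[- n.+1%:R, n.+1%:R]].
have mI n : measurable (I n) by exact: measurable_itv.
have H (n : nat) : (\int[mu]_(x in I n) (f x)%:E =
    (F n.+1%:R - F (- n.+1%:R))%R%:E)%E.
  have nn : - n.+1%:R < n.+1%:R :> R by rewrite gtrN.
  rewrite /I (@continuous_FTC2 _ f F)// ?EFinB//.
  - by apply: continuous_subspaceT.
  - split.
    + by move=> x _.
    + by apply: cvg_at_right_filter; exact: cF.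
    + by apply: cvg_at_left_filter; exact: cF.
  - by move=> x _; rewrite derive1E; apply: derive_val.
have cv1 : (F n.+1%:R - F (- n.+1%:R))%:E @[n --> \oo] --> (0 : R)%:E.
  apply: cvg_EFin; first exact: nearW.
  rewrite -(subr0 (0 : R)); apply: cvgB.
    by move: F1; rewrite -cvg_shiftS; apply.
  by move: F2; rewrite -cvg_shiftS; apply.
have cv2 : (\int[mu]_(x in I n) (f x)%:E)%E @[n --> \oo] -->
    (\int[mu]_x (f x)%:E)%E.
  under eq_fun do rewrite integral_mkcond.
  have -> : (\int[mu]_x (f x)%:E = lim ((\int[mu]_x ((EFin \o f) \_ (I n)) x) @[n --> \oo]))%E.
    apply/esym/cvg_lim => //.
    apply: (@dominated_cvg _ _ _ mu setT measurableT _ (EFin \o f) (abse \o (EFin \o f))) => //=.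
    - move=> n; exact: ((measurable_restrictT (EFin \o f) (mI n)).1 (measurable_funTS mEf)).
    - move=> x _.
      have [N xN] : exists N : nat, `|x| <= N%:R.
        by exists (Num.truncn `|x|).+1; exact/ltW/truncnS_gt.
      apply: cvg_near_cst; exists N => // n /= Nn.
      rewrite patchE ifT//; apply: mem_set; rewrite /I/= in_itv/= -ler_norml.
      by rewrite (le_trans xN)// ler_nat (leq_trans Nn).
    - exact: integrable_abse.
    - move=> n x _; rewrite patchE; case: ifP => //= _.
      by rewrite normr0 lee_fin.
  have : cvg ((\int[mu]_x ((EFin \o f) \_ (I n)) x)%E @[n --> \oo]).
    under eq_fun do rewrite -integral_mkcond.
    apply/cvg_ex; exists 0%E; rewrite /I; under eq_fun do rewrite H.
    exact: cv1.
  by [].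
rewrite (_ : (fun n => _) = (fun n : nat => (F n.+1%:R - F (- n.+1%:R))%:E)) in cv2; last first.
  by apply/funext => n; exact: H.
by apply: (cvg_unique _ cv2 cv1).
Qed.

Lemma integral_normal (m s : R) (f : R -> \bar R) : measurable_fun setT f ->
  (\int[normal_prob m s]_x f x = \int[mu]_x (f x * (normal_pdf m s x)%:E))%E.
Proof.
move=> mf; apply: (integral_density (m := mu) (m' := normal_prob m s)) => //.
- exact: measurable_normal_pdf.
- by move=> x; exact: normal_pdf_ge0.
Qed.

Lemma integrable_normal (m s : R) (f : R -> \bar R) : measurable_fun setT f ->
  (normal_prob m s).-integrable setT f <->
  mu.-integrable setT (fun x => (f x * (normal_pdf m s x)%:E)%E).
Proof.
move=> mf; apply: (integrable_density (m := mu) (m' := normal_prob m s)) => //.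
- exact: measurable_normal_pdf.
- by move=> x; exact: normal_pdf_ge0.
Qed.

Let exp_square_completion (c x b s k : R) : s != 0 -> k != 0 ->
  k = 1 + 2 * b * s ^+ 2 ->
  c * x - b * x ^+ 2 + - x ^+ 2 / (s ^+ 2 * 2) =
  c ^+ 2 * s ^+ 2 / (2 * k) + - (x - c * (s ^+ 2 / k)) ^+ 2 / (s ^+ 2 / k * 2).
Proof.
move=> s0 k0 kE; have -> : b = (k - 1) / (2 * s ^+ 2) by rewrite kE; field.
by clear kE; field; rewrite ?s0 ?k0.
Qed.

(** Completing the square turns the tilted density into a constant times the normal density of mean
    [c * s' ^+ 2] and variance [s ^+ 2 / k]. Negative [b] is allowed as long as the tilted variance
    stays positive, which is how exponential moments of squares arise. *)
Lemma integral_normal_exp (s b c : R) : 0 < s -> 0 < 1 + 2 * b * s ^+ 2 ->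
  (\int[normal_prob 0 s]_x (expR (c * x - b * x ^+ 2))%:E =
   ((Num.sqrt (1 + 2 * b * s ^+ 2))^-1 *
     expR (c ^+ 2 * s ^+ 2 / (2 * (1 + 2 * b * s ^+ 2))))%R%:E)%E.
Proof.
move=> s0 k0; set k := 1 + _ in k0 *.
pose s' := s / Num.sqrt k; pose m' := c * s' ^+ 2.
have sk0 : 0 < Num.sqrt k by rewrite sqrtr_gt0.
have s'0 : 0 < s' by rewrite divr_gt0.
have s'2 : s' ^+ 2 = s ^+ 2 / k by rewrite /s' expr_div_n sqr_sqrtr// ltW.
rewrite integral_normal; last first.
  apply/measurable_EFinP; apply: measurableT_comp => //.
  by apply: measurable_funB; apply: measurable_funM => //;
    exact: measurable_funX.
transitivity (\int[mu]_x (((Num.sqrt k)^-1 *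
    expR (c ^+ 2 * s ^+ 2 / (2 * k)))%R%:E * (normal_pdf m' s' x)%:E))%E.
  apply: eq_integral => x _; rewrite -!EFinM; congr EFin.
  rewrite !normal_pdfE ?gt_eqF// /normal_fun /normal_peak.
  rewrite mulrCA -expRD mulrACA -expRD; congr (_ * expR _).
    rewrite -invfM; congr (_^-1).
    rewrite -sqrtrM ?(ltW k0)//; congr Num.sqrt.
    by rewrite s'2; field; rewrite gt_eqF.
  rewrite /m' s'2 subr0 -(mulr_natr (s ^+ 2)) -(mulr_natr (s ^+ 2 / k)).
  by apply: exp_square_completion; rewrite ?gt_eqF.
rewrite ge0_integralZl_EFin//.
- by rewrite integral_normal_pdf mule1.
- by move=> x _; rewrite lee_fin normal_pdf_ge0.
- by apply/measurable_EFinP; exact: measurable_normal_pdf.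
Qed.

Lemma integrable_normal_exp (s b c : R) : 0 < s -> 0 < 1 + 2 * b * s ^+ 2 ->
  (normal_prob 0 s).-integrable setT
    (EFin \o (fun x : R => expR (c * x - b * x ^+ 2))).
Proof.
move=> s0 k0; apply/integrableP; split.
  apply/measurable_EFinP; apply: measurableT_comp => //.
  by apply: measurable_funB; apply: measurable_funM => //;
    exact: measurable_funX.
under eq_integral do rewrite /= ger0_norm ?expR_ge0//.
by rewrite integral_normal_exp// ltry.
Qed.

(** [|x| <= expR x + expR (- x)] reduces the first moment to exponential ones. *)
Lemma integrable_normal_id (s : R) : 0 < s ->
  (normal_prob 0 s).-integrable setT (EFin \o (fun x : R => x)).
Proof.
move=> s0.
have i c : (normal_prob 0 s).-integrable setT
    (EFin \o (fun x : R => expR (c * x - 0 * x ^+ 2))).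
  by apply: integrable_normal_exp; rewrite // mulr0 mul0r addr0.
apply: (@le_integrable _ _ _ (normal_prob 0 s) setT measurableT (EFin \o (fun x : R => x)) (fun x : R =>
  (expR (1 * x - 0 * x ^+ 2))%:E + (expR (- 1 * x - 0 * x ^+ 2))%:E)%E).
- by apply/measurable_EFinP; exact: measurable_id.
- move=> x _ /=; rewrite lee_fin !mul0r !subr0 mul1r mulN1r.
  rewrite [leRHS]ger0_norm ?addr_ge0 ?expR_ge0//.
  rewrite ler_norml; apply/andP; split.
    have := expR_ge1Dx (- x); have := expR_ge0 x; lra.
  have := expR_ge1Dx x; have := expR_ge0 (- x); lra.
- by apply: integrableD => //; exact: i.
Qed.

Lemma integrable_normal_bounded (s : R) (f : R -> R) M :
  measurable_fun setT f -> (forall x, `|f x| <= M) ->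
  (normal_prob 0 s).-integrable setT (EFin \o f).
Proof.
move=> mf fM; apply: measurable_bounded_integrable => //.
  exact: le_lt_trans (probability_le1 _ _) (ltry _).
by exists M; split; [exact: num_real|move=> x Mx y _; exact: le_trans (ltW Mx)].
Qed.

Lemma normal_pdf_cvg0 (s : R) : 0 < s ->
  normal_pdf 0 s n%:R @[n --> \oo] --> (0 : R).
Proof.
move=> s0; pose c := expR (- (s ^+ 2 *+ 2)^-1).
have s20 : 0 < s ^+ 2 *+ 2 by rewrite pmulrn_lgt0// exprn_gt0.
have c1 : `|c| < 1.
  by rewrite ger0_norm ?expR_ge0// /c expR_lt1 oppr_lt0 invr_gt0.
apply: (@squeeze_cvgr _ _ _ _ (cst 0) (fun n : nat => normal_peak s * c ^+ n)).
- near=> n; rewrite normal_pdf_ge0/= normal_pdfE ?gt_eqF//.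
  rewrite ler_wpM2l ?normal_peak_ge0// /normal_fun /c -expRM_natl ler_expR.
  rewrite subr0 mulrN mulNr lerN2.
  rewrite ler_wpM2r ?invr_ge0 ?(ltW s20)//.
  by rewrite -natrX ler_nat; case: (n) => // k; rewrite expnS leq_pmulr.
- exact: cvg_cst.
- rewrite -(mulr0 (normal_peak s)); apply: cvgM; first exact: cvg_cst.
  exact: cvg_expr.
Unshelve. all: by end_near. Qed.

Lemma is_derive_normal_pdf (s x : R) : 0 < s ->
  is_derive x (1 : R) (normal_pdf 0 s) (- (x / s ^+ 2) * normal_pdf 0 s x).
Proof.
move=> s0; rewrite normal_pdfE ?gt_eqF// /normal_fun.
have -> : (fun y : R => normal_peak s * expR (- (y - 0) ^+ 2 / (s ^+ 2 *+ 2))) =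
  (fun y : R => normal_peak s * expR (y ^+ 2 * - (s ^+ 2 *+ 2)^-1)).
  by apply/funext => y; rewrite subr0 mulNr mulrN.
apply: is_derive_eq.
rewrite subr0 !mulNr mulrN /GRing.scale/= -mulr_natr.
by field; rewrite gt_eqF.
Qed.

(** With [psi t] the left-hand side, differentiation under the integral and integration by parts
    give [psi' = - s ^+ 2 * t * psi], so [psi t * expR (s ^+ 2 * t ^+ 2 / 2)] is constant. The phase
    [th] carries the sine along with the cosine; characteristic functions are used in this real form
    throughout. *)
Lemma normal_cos (s t th : R) : 0 < s ->
  \int[normal_prob 0 s]_x cos (t * x + th) = expR (- (s ^+ 2 * t ^+ 2 / 2)) * cos th.
Proof.
move=> s0; pose N := normal_prob 0 s.
have cl u : continuous (fun x : R => u * x + th).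
  by move=> x; apply: cvgD; [exact: mulrl_continuous|exact: cvg_cst].
pose psi t := \int[N]_x cos (t * x + th).
have mc u : measurable_fun setT (fun x : R => cos (u * x + th)).
  apply: measurable_funTS; apply: continuous_measurable_fun => x.
  by apply: continuous_comp; [exact: cl|exact: continuous_cos].
have ms u : measurable_fun setT (fun x : R => sin (u * x + th)).
  apply: measurable_funTS; apply: continuous_measurable_fun => x.
  by apply: continuous_comp; [exact: cl|exact: continuous_sin].
have mid : measurable_fun setT (fun x : R => x) by exact: measurable_id.
have mxs u : measurable_fun setT (fun x : R => x * sin (u * x + th)).
  exact: measurable_funM.
have muc u : measurable_fun setT (fun x : R => u * cos (u * x + th)).
  exact: measurable_funM.
have mB u : measurable_fun setT
    (fun x : R => u * cos (u * x + th) - x * sin (u * x + th) / s ^+ 2).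
  by apply: measurable_funB => //; exact: measurable_funM.
have ic u : N.-integrable setT (EFin \o (fun x : R => cos (u * x + th))).
  by apply: (@integrable_normal_bounded _ _ 1) => // x; exact: cos_max.
have ix : N.-integrable setT (EFin \o (fun x : R => `|x|)).
  by apply: integrable_norm; exact: integrable_normal_id.
have ixs u : N.-integrable setT (EFin \o (fun x : R => x * sin (u * x + th))).
  apply: le_integrable ix => //.
    by apply/measurable_EFinP; exact: mxs.
  move=> x _ /=; rewrite lee_fin normrM normr_id.
  by rewrite ler_piMr// sin_max.
(* Stein's identity, from the derivative of [sin (u * x + th) * normal_pdf 0 s x]. *)
have ibp u : \int[N]_x (x * sin (u * x + th)) = s ^+ 2 * u * psi u.
  have : (\int[N]_x (u * cos (u * x + th) - x * sin (u * x + th) / s ^+ 2)%R%:E = 0)%E.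
    rewrite integral_normal; last first.
      by apply/measurable_EFinP; exact: mB.
    under eq_integral do rewrite -EFinM.
    apply: (@integral_derivative_eq0 (fun x => sin (u * x + th) * normal_pdf 0 s x)).
    - move=> x; apply: cvgM; last exact/continuous_normal_pdf/lt0r_neq0.
      apply: cvgB.
        apply: cvgM; first exact: cvg_cst.
        by apply: continuous_comp; [exact: cl|exact: continuous_cos].
      apply: cvgM; last exact: cvg_cst.
      apply: cvgM; first exact: cvg_id.
      by apply: continuous_comp; [exact: cl|exact: continuous_sin].
    - move=> x; have := is_derive_normal_pdf x s0 => ?.
      apply: is_derive_eq; rewrite /GRing.scale/=.
      by field; rewrite gt_eqF.
    - rewrite (_ : _ \o _ = (fun x => (u * cos (u * x + th) - x * sin (u * x + th) / s ^+ 2)%R%:E * (normal_pdf 0 s x)%:E)%E); last first.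
        by apply/funext => x /=; rewrite EFinM.
      apply/integrable_normal.
        by apply/measurable_EFinP; exact: mB.
      apply: integrable_EFinB => //; first exact: integrable_EFinZl.
      exact: integrable_EFinZr.
    - apply: (@squeeze_cvgr _ _ _ _ (fun n : nat => - normal_pdf 0 s n%:R) (fun n : nat => normal_pdf 0 s n%:R)).
      + near=> n; rewrite -ler_norml normrM (ger0_norm (normal_pdf_ge0 _ _ _)).
        by rewrite ler_piMl ?normal_pdf_ge0// sin_max.
      + by have := cvgN (normal_pdf_cvg0 s0); rewrite oppr0; exact.
      + exact: normal_pdf_cvg0.
    - apply: (@squeeze_cvgr _ _ _ _ (fun n : nat => - normal_pdf 0 s n%:R) (fun n : nat => normal_pdf 0 s n%:R)).
      + near=> n; rewrite -ler_norml normrM (ger0_norm (normal_pdf_ge0 _ _ _)).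
        have -> : normal_pdf 0 s (- n%:R) = normal_pdf 0 s n%:R.
          by rewrite normal_pdfE ?gt_eqF// /normal_fun !subr0 sqrrN.
        by rewrite ler_piMl ?normal_pdf_ge0// sin_max.
      + by have := cvgN (normal_pdf_cvg0 s0); rewrite oppr0; exact.
      + exact: normal_pdf_cvg0.
  move=> /(congr1 fine) /=; rewrite -/(Rintegral _ _ _).
  rewrite RintegralB//; last 2 first.
    exact: integrable_EFinZl.
    exact: integrable_EFinZr.
  rewrite RintegralZl// RintegralZr// => /eqP; rewrite subr_eq0 => /eqP E.
  by rewrite /psi -mulrA E mulrC divfK// gt_eqF// exprn_gt0.
have dpsi u : is_derive u (1 : R) psi (- (s ^+ 2 * u * psi u)).
  pose f (v x : R) := cos (v * x + th).
  have df v x : is_derive v (1 : R) (f ^~ x) (- (x * sin (v * x + th))).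
    by apply: is_derive_eq; rewrite /GRing.scale/=; ring.
  have d1f v x : partial1of2 f v x = - (x * sin (v * x + th)).
    by rewrite /partial1of2 derive1E; exact: derive_val.
  have Iu : [set` `](u - 1), (u + 1)[] u by rewrite /= in_itv/=; apply/andP; split; lra.
  have ub x y : [set` `](u - 1), (u + 1)[] x -> setT y -> `|partial1of2 f x y| <= `|y|.
    by move=> _ _; rewrite d1f normrN normrM ler_piMr// sin_max.
  apply: DeriveDef.
    exact: (@derivable_under_integral _ _ _ N f setT measurableT u (u - 1) (u + 1) Iu
      (fun x _ => ic x) (fun x y _ _ => @ex_derive _ _ _ _ _ _ _ (df x y)) (fun y => `|y|)
      (fun y => normr_ge0 y) ix ub).
  rewrite -derive1E (@differentiation_under_integral _ _ _ N f setT measurableT u (u - 1) (u + 1) Iu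
      (fun x _ => ic x) (fun x y _ _ => @ex_derive _ _ _ _ _ _ _ (df x y)) (fun y => `|y|)
      (fun y => normr_ge0 y) ix ub).
  rewrite -ibp; under eq_Rintegral do rewrite d1f -mulN1r.
  by rewrite RintegralZl// mulN1r.
have psi0 : psi 0 = cos th.
  rewrite /psi; under eq_Rintegral do rewrite mul0r add0r.
  rewrite Rintegral_cst//.
  rewrite -[RHS]mulr1; congr (_ * _).
  exact: (congr1 fine (@probability_setT _ _ _ (normal_prob 0 s))).
have E : psi t * expR (s ^+ 2 * t ^+ 2 / 2) = psi 0 * expR (s ^+ 2 * 0 ^+ 2 / 2).
  apply: (@is_derive_0_is_cst _ (fun u => psi u * expR (s ^+ 2 * u ^+ 2 / 2))) => u.
  have := dpsi u => ?.
  apply: is_derive_eq; rewrite /GRing.scale/=.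
  by field.
rewrite -/(psi t) expRN; apply: (mulIf (lt0r_neq0 (expR_gt0 (s ^+ 2 * t ^+ 2 / 2)))).
rewrite E psi0 expr0n/= mulr0 mul0r expR0 mulr1 mulrAC.
by rewrite mulVf ?mul1r// gt_eqF ?expR_gt0.
Unshelve. all: by end_near. Qed.

End gauss.

Section half_normal.
Context {R : realType}.
Local Notation mu := (@lebesgue_measure R).

(** Standard deviation of the real and imaginary parts of a unit-variance proper complex normal.
    With it the density is proportional to [expR (- x ^+ 2)], so a shift by [c] costs exactly the
    factor [expR (2 * c * x - c ^+ 2)]. *)
Definition half_sd : R := (Num.sqrt 2)^-1.

Lemma half_sd_gt0 : 0 < half_sd.
Proof. by rewrite invr_gt0 sqrtr_gt0. Qed.

Lemma half_sd2 : half_sd ^+ 2 = 2^-1.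
Proof. by rewrite exprVn sqr_sqrtr. Qed.

Local Notation half_normal := (normal_prob 0 half_sd).

Lemma half_normal_exp (b c : R) : -1 < b ->
  (\int[half_normal]_x (expR (c * x - b * x ^+ 2))%:E =
   ((Num.sqrt (1 + b))^-1 * expR (c ^+ 2 / (4 * (1 + b))))%R%:E)%E.
Proof.
move=> b1; have b0 : 0 < 1 + b by lra.
have E : 1 + 2 * b * half_sd ^+ 2 = 1 + b by rewrite half_sd2; field.
rewrite integral_normal_exp ?half_sd_gt0 ?E// half_sd2.
by congr (_ * expR _)%:E; field; rewrite gt_eqF.
Qed.

Lemma half_normal_cos (t th : R) :
  \int[half_normal]_x cos (t * x + th) = expR (- (t ^+ 2 / 4)) * cos th.
Proof.
rewrite normal_cos ?half_sd_gt0// half_sd2; congr (expR _ * _); by field.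
Qed.

(** The weight [expR (- (b * x ^+ 2))] changes the variance to 1 / (2 (1 + b)) and the mass to (1 +
    b)^(-1/2); what remains is [normal_cos] at the new variance. *)
Lemma half_normal_exp_cos (b t th : R) : -1 < b ->
  \int[half_normal]_x (expR (- (b * x ^+ 2)) * cos (t * x + th)) =
  (Num.sqrt (1 + b))^-1 * expR (- (t ^+ 2 / (4 * (1 + b)))) * cos th.
Proof.
move=> b1; have b0 : 0 < 1 + b by lra.
pose s' := half_sd / Num.sqrt (1 + b).
have sb0 : 0 < Num.sqrt (1 + b) by rewrite sqrtr_gt0.
have s'0 : 0 < s' by rewrite divr_gt0// half_sd_gt0.
have s'2 : s' ^+ 2 = (2 * (1 + b))^-1.
  by rewrite /s' expr_div_n half_sd2 sqr_sqrtr ?ltW// invfM.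
have mc : measurable_fun setT (fun x : R => cos (t * x + th)).
  apply: continuous_measurable_fun => x; apply: continuous_comp.
    by apply: cvgD; [exact: mulrl_continuous|exact: cvg_cst].
  exact: continuous_cos.
have me : measurable_fun setT (fun x : R => expR (- (b * x ^+ 2))).
  apply: measurableT_comp => //; apply: measurableT_comp => //.
  by apply: measurable_funM => //; exact: measurable_funX.
have mec : measurable_fun setT (fun x : R => expR (- (b * x ^+ 2)) * cos (t * x + th)).
  exact: measurable_funM.
have ic : (normal_prob 0 s').-integrable setT (EFin \o (fun x : R => cos (t * x + th))).
  by apply: (@integrable_normal_bounded _ _ _ 1) => // x; exact: cos_max.
transitivity (\int[mu]_x ((Num.sqrt (1 + b))^-1 * (cos (t * x + th) * normal_pdf 0 s' x))).
  rewrite /Rintegral; congr fine; rewrite integral_normal; last first.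
    by apply/measurable_EFinP; exact: mec.
  apply: eq_integral => x _; rewrite -EFinM; congr EFin.
  rewrite !normal_pdfE ?gt_eqF ?half_sd_gt0// /normal_fun /normal_peak.
  rewrite mulrAC [RHS]mulrCA mulrC; congr (_ * _).
  rewrite mulrCA -expRD [RHS]mulrA; congr (_ * expR _).
    rewrite -invfM -sqrtrM ?(ltW b0)//; congr (Num.sqrt _)^-1.
    by rewrite half_sd2 s'2; field; rewrite gt_eqF.
  rewrite half_sd2 s'2 subr0 -(mulr_natr 2^-1) -(mulr_natr (_^-1)).
  by field; rewrite gt_eqF.
have ip : mu.-integrable setT (EFin \o (fun x : R => cos (t * x + th) * normal_pdf 0 s' x)).
  rewrite (_ : _ \o _ = (fun x => (cos (t * x + th))%:E * (normal_pdf 0 s' x)%:E)%E).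
    by apply/integrable_normal => //; apply/measurable_EFinP; exact: mc.
  by apply/funext => x.
rewrite RintegralZl// -mulrA; congr (_ * _).
transitivity (\int[normal_prob 0 s']_x cos (t * x + th)).
  rewrite /Rintegral; congr fine; rewrite integral_normal//.
  by apply/measurable_EFinP; exact: mc.
by rewrite normal_cos// s'2; congr (expR _ * _); field; rewrite gt_eqF.
Qed.

(** Read from right to left, a squared exponent becomes an average of cosines of linear expressions
    in [u], to which a characteristic function applies. This linearisation drives
    [gaussian_smoothing]. *)
Lemma half_normal_gauss (u th : R) :
  \int[half_normal]_g cos (2 * u * g + th) = expR (- u ^+ 2) * cos th.
Proof. by rewrite half_normal_cos; congr (expR _ * _); field. Qed.

Lemma lebesgue_measure_shift (c : R) (A : set R) : measurable A ->
  pushforward mu (fun x : measurableTypeR R => x + c : measurableTypeR R) A = mu A.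
Proof.
move=> mA.
have mc : measurable_fun setT (fun x : measurableTypeR R => x + c : measurableTypeR R).
  by apply: measurable_funD => //; exact: measurable_id.
pose m := isMeasurableFun.Build _ _ _ _ _ mc.
pose f : {mfun _ >-> _} := HB.pack (fun x : measurableTypeR R => x + c : measurableTypeR R) m.
apply/esym; apply: (@lebesgue_measure_unique _ (pushforward mu f)) => //= _ [[a b]] _ <-.
rewrite /pushforward.
have -> : f @^-1` `]a, b] = `](a - c), (b - c)]%classic.
  by apply/seteqP; split => x /=; rewrite !in_itv/= ltrBlDr lerBrDr.
rewrite !lebesgue_measure_itv/= !lte_fin ltrD2r.
by case: ifP => // _; rewrite -!EFinB; congr EFin; ring.
Qed.

(** One-dimensional Cameron-Martin formula, from the translation invariance of Lebesgue measure. *)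
Lemma half_normal_shift (c : R) (A : set R) : measurable A ->
  half_normal [set x | A (x + c)] =
  (\int[half_normal]_(x in A) (expR (2 * c * x - c ^+ 2))%:E)%E.
Proof.
move=> mA.
have mc : measurable_fun setT (fun x : measurableTypeR R => x + c : measurableTypeR R).
  by apply: measurable_funD => //; exact: measurable_id.
have mAc : measurable [set x : R | A (x + c)].
  by have := mc measurableT A mA; rewrite setTI.
have me : measurable_fun setT (fun x : R => expR (2 * c * x - c ^+ 2)).
  apply: measurableT_comp => //; apply: measurable_funB => //.
transitivity (\int[mu]_x ((\1_A (x + c))%:E * (normal_pdf 0 half_sd x)%:E))%E.
  rewrite -integral_normal; last first.
    apply/measurable_EFinP.
    exact: (@measurableT_comp _ _ _ _ _ _ (\1_A : R -> R) _ (fun x : R => x + c)).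
  transitivity (\int[half_normal]_x (\1_[set x : R | A (x + c)] x)%:E)%E.
    by rewrite integral_indic// setIT.
  by apply: eq_integral => x _; rewrite !indicE.
pose sh := fun x : measurableTypeR R => (x + c : measurableTypeR R).
transitivity (\int[mu]_x ((\1_A x)%:E * (normal_pdf 0 half_sd (x - c))%:E))%E.
  transitivity (\int[pushforward mu sh]_x ((\1_A x)%:E * (normal_pdf 0 half_sd (x - c))%:E))%E; last first.
    by apply: eq_measure_integral => B mB _; exact: lebesgue_measure_shift.
  rewrite ge0_integral_pushforward//.
  - by apply: eq_integral => x _ /=; rewrite addrK.
  - apply: emeasurable_funM; apply/measurable_EFinP; first exact: measurable_indic.
    apply: (measurableT_comp (measurable_normal_pdf 0 half_sd)).
    by apply: measurable_funB.
  - by move=> x _; rewrite mule_ge0// lee_fin// normal_pdf_ge0.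
rewrite [in RHS]integral_mkcond [RHS]integral_normal; last first.
  have mE : measurable_fun setT (fun x : R => (expR (2 * c * x - c ^+ 2))%:E).
    by apply/measurable_EFinP; exact: me.
  exact: ((measurable_restrictT _ mA).1 (measurable_funTS mE)).
apply: eq_integral => x _; rewrite patchE indicE.
case: ifP => _; last by rewrite !mul0e.
rewrite mul1e -EFinM; congr EFin.
rewrite !normal_pdfE ?gt_eqF ?half_sd_gt0// /normal_fun.
rewrite mulrCA -expRD; congr (_ * expR _).
by rewrite half_sd2 -(mulr_natr 2^-1) !subr0; field.
Qed.

End half_normal.

Section Fubini_bounded.
Context d1 d2 (T1 : measurableType d1) (T2 : measurableType d2) (R : realType).
Variables (P : probability T1 R) (Q : probability T2 R).
Variables (f : T1 * T2 -> R) (M : R).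
Hypothesis mf : measurable_fun setT f.
Hypothesis fM : forall z, `|f z| <= M.

Lemma Fubini_bounded :
  \int[P]_x \int[Q]_y f (x, y) = \int[Q]_y \int[P]_x f (x, y).
Proof.
have iPQ : (P \x Q)%E.-integrable setT (EFin \o f).
  apply: measurable_bounded_integrable => //.
    exact: le_lt_trans (probability_le1 _ _) (ltry _).
  by exists M; split; [exact: num_real|move=> x Mx y _; exact: le_trans (ltW Mx)].
have i1 x : Q.-integrable setT (fun y => (f (x, y))%:E).
  apply: (@measurable_bounded_integrable _ _ _ _ (fun y => f (x, y))) => //.
  - exact: le_lt_trans (probability_le1 _ _) (ltry _).
  - exact: measurableT_comp.
  - by exists M; split; [exact: num_real|move=> u Mx y _; exact: le_trans (ltW Mx)].
have i2 y : P.-integrable setT (fun x => (f (x, y))%:E).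
  apply: (@measurable_bounded_integrable _ _ _ _ (fun x => f (x, y))) => //.
  - exact: le_lt_trans (probability_le1 _ _) (ltry _).
  - exact: measurableT_comp.
  - by exists M; split; [exact: num_real|move=> u Mx x _; exact: le_trans (ltW Mx)].
transitivity (fine (\int[P]_x \int[Q]_y (f (x, y))%:E)%E).
  by congr fine; apply: eq_integral => x _; exact: (EFin_Rintegral measurableT (i1 x)).
rewrite (Fubini iPQ); congr fine.
by apply: eq_integral => y _; exact: (esym (EFin_Rintegral measurableT (i2 y))).
Qed.

End Fubini_bounded.

Section gaussian_smoothing.
Context d (T : measurableType d) (R : realType) (P : probability T R).
Context (I : finType) (xi : I -> T -> R) (sigma : I -> R).
Hypothesis mxi : forall i, measurable_fun setT (xi i).
Hypothesis sigma0 : forall i, 0 <= sigma i.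
Hypothesis cf : forall (c : I -> R) (th : R),
  \int[P]_w cos (\sum_i c i * xi i w + th) =
  expR (- (\sum_i sigma i * c i ^+ 2) / 4) * cos th.

Local Notation half_normal := (normal_prob 0 (@half_sd R)).

Let W (y : I -> R) (s : seq I) w := \prod_(i <- s) expR (- (y i - xi i w) ^+ 2).

Let W_ge0 y s w : 0 <= W y s w.
Proof. by apply: prodr_ge0 => i _; exact: expR_ge0. Qed.

Let W_le1 y s w : W y s w <= 1.
Proof.
by rewrite /W; elim: s => [|i s ih]; rewrite ?big_nil// big_cons mulr_ile1//
  ?expR_ge0 ?W_ge0// -expR0 ler_expR oppr_le0 sqr_ge0.
Qed.

Let mW y s : measurable_fun setT (W y s).
Proof.
apply: measurable_prod => i _; apply: measurableT_comp => //.
apply: measurableT_comp => //; apply: measurable_funX.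
exact: measurable_funB.
Qed.

Let mcosR : measurable_fun setT (@cos R).
Proof. by apply: continuous_measurable_fun; exact: continuous_cos. Qed.

Let V (c : I -> R) (s : seq I) w := \sum_(i | i \notin s) c i * xi i w.

Let mV c s : measurable_fun setT (V c s).
Proof.
rewrite (_ : V c s = fun w => \sum_i (if i \notin s then c i else 0) * xi i w).
  by apply: measurable_sum => i; apply: measurable_funM.
apply/funext => w; rewrite /V big_mkcond; apply: eq_bigr => i _.
by case: ifP => //; rewrite mul0r.
Qed.

(** Induction on the coordinates [s] that are smoothed; the others stay inside the cosine. For a new
    coordinate [i], the factor [expR (- (y i - xi i w) ^+ 2)] is opened by [half_normal_gauss], the
    integrals are exchanged, the induction hypothesis is applied with coefficient [- 2 * g] at [i],
    and the integral over [g] is Gaussian. Arbitrary [c] and [th] are needed because each step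
    changes them. *)
Let smooth y (s : seq I) : uniq s -> forall (c : I -> R) (th : R),
  \int[P]_w (W y s w * cos (V c s w + th)) =
  (\prod_(i <- s) ((Num.sqrt (1 + sigma i))^-1 * expR (- (y i ^+ 2 / (1 + sigma i)))))
  * expR (- (\sum_(i | i \notin s) sigma i * c i ^+ 2) / 4) * cos th.
Proof.
elim: s => [|i s ih] /=; last move=> /andP[nis us] c th.
  move=> _ c th; rewrite big_nil mul1r -cf; apply: eq_Rintegral => w _.
  by rewrite /W big_nil mul1r.
have mcos : measurable_fun setT (fun z : T * R =>
    W y s z.1 * cos (2 * (y i - xi i z.1) * z.2 + (V c (i :: s) z.1 + th))).
  apply: measurable_funM; first exact: measurableT_comp.
  apply: (measurableT_comp mcosR).
  apply: measurable_funD.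
    apply: measurable_funM => //; apply: measurable_funM => //.
    apply: measurable_funB => //; exact: measurableT_comp.
  by apply: measurable_funD => //; exact: measurableT_comp.
transitivity (\int[P]_w \int[half_normal]_g
    (W y s w * cos (2 * (y i - xi i w) * g + (V c (i :: s) w + th)))).
  apply: eq_Rintegral => w _; rewrite RintegralZl//; last first.
    apply: (@integrable_normal_bounded _ _ _ 1).
      apply: (measurableT_comp mcosR).
      by apply: measurable_funD => //; exact: measurable_funM.
    by move=> x; exact: cos_max.
  by rewrite half_normal_gauss /W big_cons mulrCA mulrA.
have bcos z : `|W y s z.1 * cos (2 * (y i - xi i z.1) * z.2 + (V c (i :: s) z.1 + th))| <= 1.
  rewrite normrM -[leRHS]mulr1 ler_pM//; last exact: cos_max.
  by rewrite ger0_norm ?W_ge0 ?W_le1.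
apply: etrans; first exact: (@Fubini_bounded _ _ T (measurableTypeR R) R P half_normal _ 1 mcos bcos).
pose K := \prod_(i <- s) ((Num.sqrt (1 + sigma i))^-1 * expR (- (y i ^+ 2 / (1 + sigma i)))).
pose S := \sum_(j | j \notin i :: s) sigma j * c j ^+ 2.
transitivity (\int[half_normal]_g ((K * expR (- S / 4)) *
   (expR (- (sigma i * g ^+ 2)) * cos (2 * y i * g + th)))).
  apply: eq_Rintegral => g _ /=.
  pose c' j := if j == i then - 2 * g else c j.
  have isE j : (j \notin s) && (j != i) = (j \notin i :: s).
    by rewrite inE negb_or andbC.
  transitivity (\int[P]_w (W y s w * cos (V c' s w + (2 * y i * g + th)))).
    apply: eq_Rintegral => w _; congr (_ * cos _).
    rewrite /V [in RHS](bigD1 i)//= /c' eqxx.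
    under [in RHS]eq_bigr => j /andP[_ /negbTE ->] do over.
    under [in RHS]eq_bigl do rewrite isE.
    by ring.
  have ES : \sum_(j | (j \notin s) && (j != i)) sigma j * c' j ^+ 2 = S.
    by rewrite /S; apply: eq_big => [j|j /andP[_ /negbTE jn]]; rewrite ?isE// /c' jn.
  rewrite ih// -/K [X in expR (- X / 4)](bigD1 i)//= ES /c' eqxx -!mulrA; congr (_ * _); rewrite !mulrA; congr (_ * _).
  by rewrite -expRD; congr expR; field.
rewrite RintegralZl//; last first.
  apply: (@integrable_normal_bounded _ _ _ 1).
    apply: measurable_funM; last apply: (measurableT_comp mcosR).
    - apply: measurableT_comp => //.
      by apply: measurableT_comp => //; apply: measurable_funM.
    - by apply: measurable_funD => //; exact: measurable_funM.
  move=> x; rewrite normrM -[1]mulr1 ler_pM//; last exact: cos_max.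
  by rewrite ger0_norm ?expR_ge0// -expR0 ler_expR oppr_le0 mulr_ge0 ?sqr_ge0.
rewrite half_normal_exp_cos; last by rewrite (lt_le_trans _ (sigma0 i))// ltrN10.
rewrite big_cons -/K -/S.
have -> : (2 * y i) ^+ 2 / (4 * (1 + sigma i)) = y i ^+ 2 / (1 + sigma i).
  have s0 : 1 + sigma i != 0 by rewrite gt_eqF// (lt_le_trans ltr01)// lerDl.
  by field.
by ring.
Qed.

(** A convolution with Gaussian noise computed from the characteristic function alone: the
    coordinates behave as independent centred normals of variance [sigma i / 2], where [sigma i = 0]
    is allowed. *)
Lemma gaussian_smoothing (y : I -> R) :
  \int[P]_w (\prod_i expR (- (y i - xi i w) ^+ 2)) =
  \prod_i ((Num.sqrt (1 + sigma i))^-1 * expR (- (y i ^+ 2 / (1 + sigma i)))).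
Proof.
have := smooth y (index_enum_uniq I) (fun=> 0) 0.
have bp (F : I -> R) : \sum_(i | i \notin index_enum I) F i = 0.
  by rewrite big_pred0// => i; apply/negbTE; rewrite negbK mem_index_enum.
rewrite cos0 mulr1 bp oppr0 mul0r expR0 mulr1 => <-.
apply: eq_Rintegral => w _; rewrite /V bp.
by rewrite addr0 cos0 mulr1.
Qed.

End gaussian_smoothing.

(** * Laws on tuples: uniqueness and powers *)

Section measure_unique_rect.
Context d (T : measurableType d) d' (S : measurableType d') (R : realType).
Variables (I : finType) (pr : I -> T -> S).
Hypothesis mpr : forall i, measurable_fun setT (pr i).
Hypothesis prP : forall d0 (T0 : measurableType d0) (f : T0 -> T),
  (forall i, measurable_fun setT (pr i \o f)) -> measurable_fun setT f.

(** Rectangles are stable under intersection, and [prP] says that the coordinates generate the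
    sigma-algebra: it is applied to the identity from the space carrying the sigma-algebra generated
    by rectangles. *)
Lemma measure_unique_rect (m1 m2 : probability T R) :
  (forall B : I -> set S, (forall i, measurable (B i)) ->
    m1 [set x | forall i, B i (pr i x)] = m2 [set x | forall i, B i (pr i x)]) ->
  forall A, measurable A -> m1 A = m2 A.
Proof.
move=> m12 A mA.
pose G := [set A | exists2 B : I -> set S, (forall i, measurable (B i)) &
  A = [set x | forall i, B i (pr i x)]].
have mG B : (forall i, measurable (B i)) -> measurable [set x | forall i, B i (pr i x)].
  move=> mB; rewrite (_ : [set x | _] = \bigcap_(i in [set: I]) (pr i @^-1` B i)).
    apply: fin_bigcap_measurable => // i _.
    by have := mpr i measurableT (mB i); rewrite setTI.
  by apply/seteqP; split => [x /= xB i _|x xB i]; [exact: xB|exact: (xB i)].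
have GA : <<s G >> A.
  have mid : measurable_fun setT (id : g_sigma_algebraType G -> T).
    apply: prP => i _ B mB; rewrite setTI; apply: sub_sigma_algebra.
    exists (fun j => if j == i then B else setT).
      by move=> j; case: ifP.
    apply/seteqP; split => [x /= xB j|x /(_ i)/=]; last by rewrite eqxx.
    by case: eqP => // ->.
  by have := mid measurableT A mA; rewrite setTI.
apply: (@g_sigma_algebra_measure_unique _ _ _ G _ (fun=> setT)) GA => //.
- by move=> _ [B mB ->]; exact: mG.
- move=> _; exists (fun=> setT) => //.
  by apply/seteqP; split.
- by rewrite bigcup_const//; exists 0%N.
- move=> _ _ [B mB ->] [C mC ->]; exists (fun i => B i `&` C i).
    by move=> i; exact: measurableI.
  apply/seteqP; split => [x [xB xC] i|x xBC] /=; first by split; [exact: xB|exact: xC].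
  by split => i; case: (xBC i).
- by move=> _ [B mB ->]; exact: m12.
- by move=> _; rewrite (le_lt_trans (probability_le1 _ _))// ltry.
Qed.

End measure_unique_rect.

Section tuple_power.
Context d (T : measurableType d) (R : realType) (m : probability T R).
Local Open Scope ereal_scope.

Definition tuple_cons n (x : T * n.-tuple T) : n.+1.-tuple T :=
  [tuple of x.1 :: x.2].

Lemma measurable_tuple_cons n : measurable_fun setT (@tuple_cons n).
Proof. exact: (measurable_cons measurable_fst measurable_snd). Qed.

HB.instance Definition _ n := @isMeasurableFun.Build _ _ _ _
  (@tuple_cons n) (@measurable_tuple_cons n).

(** The product law on tuples, built so that integrals peel off one coordinate at a time and so that
    it can be iterated: the noise block is a power of a power. *)
Fixpoint tuple_power n : probability (n.-tuple T) R :=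
  if n is k.+1 then distribution (m \x tuple_power k) (@tuple_cons k)
  else \d_[tuple].

Lemma ge0_integral_tuple_power0 (F : 0.-tuple T -> \bar R) :
  measurable_fun setT F -> (forall x, 0 <= F x) ->
  \int[tuple_power 0]_y F y = F [tuple].
Proof. by move=> mF F0; rewrite integral_dirac// diracT mul1e. Qed.

Lemma ge0_integral_tuple_powerS n (F : n.+1.-tuple T -> \bar R) :
  measurable_fun setT F -> (forall x, 0 <= F x) ->
  \int[tuple_power n.+1]_y F y =
  \int[m]_x \int[tuple_power n]_y F (tuple_cons (x, y)).
Proof.
move=> mF F0; rewrite /= ge0_integral_distribution// fubini_tonelli1//.
  exact: measurableT_comp.
by move=> x; exact: F0.
Qed.

Lemma tuple_cons0 n x y : tnth (@tuple_cons n (x, y)) ord0 = x.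
Proof. by []. Qed.

Lemma tuple_consS n x y i : tnth (@tuple_cons n (x, y)) (lift ord0 i) = tnth y i.
Proof. by rewrite tnthS. Qed.

Lemma measurable_prod_tnth n (f : 'I_n -> T -> R) :
  (forall i, measurable_fun setT (f i)) ->
  measurable_fun setT (fun y : n.-tuple T => \prod_(i < n) f i (tnth y i))%R.
Proof.
move=> mf; apply: measurable_prod => i _.
exact: (measurableT_comp (mf i) (measurable_tnth i)).
Qed.

Lemma integral_tuple_power_prod n (f : 'I_n -> T -> R) (c : 'I_n -> R) :
  (forall i, measurable_fun setT (f i)) -> (forall i x, 0 <= f i x)%R ->
  (forall i, \int[m]_x (f i x)%:E = (c i)%:E) ->
  \int[tuple_power n]_y (\prod_(i < n) f i (tnth y i))%R%:E =
  (\prod_(i < n) c i)%R%:E.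
Proof.
elim: n f c => [|n ih] f c mf f0 fc.
  rewrite ge0_integral_tuple_power0 ?big_ord0//.
    by apply/measurable_EFinP; exact: measurable_prod_tnth.
  by move=> x; rewrite lee_fin prodr_ge0.
rewrite ge0_integral_tuple_powerS//; last 2 first.
- by apply/measurable_EFinP; exact: measurable_prod_tnth.
- by move=> x; rewrite lee_fin prodr_ge0.
transitivity (\int[m]_x ((f ord0 x)%:E * (\prod_(i < n) c (lift ord0 i))%R%:E)).
  apply: eq_integral => x _.
  under eq_integral => y _.
    rewrite big_ord_recl tuple_cons0.
    under eq_bigr do rewrite tuple_consS.
    rewrite EFinM; over.
  rewrite ge0_integralZl_EFin//; last 2 first.
  - by move=> y _; rewrite lee_fin prodr_ge0.
  - apply/measurable_EFinP.
    exact: (@measurable_prod_tnth _ (fun i => f (lift ord0 i))).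
  by rewrite (ih (fun i => f (lift ord0 i)) (fun i => c (lift ord0 i))).
have pc : (0 <= \prod_(i < n) c (lift ord0 i))%R.
  apply: prodr_ge0 => i _; rewrite -lee_fin -fc.
  by apply: integral_ge0 => x _; rewrite lee_fin.
rewrite ge0_integralZr//; last 2 first.
- by apply/measurable_EFinP.
- by move=> x _; rewrite lee_fin.
by rewrite fc -EFinM big_ord_recl.
Qed.

(** The hypothesis on one coordinate and the conclusion on tuples have the same form, so the lemma
    can be applied first to antennas and then to times. *)
Lemma tuple_power_shift n (s : 'I_n -> T -> T) (h : 'I_n -> T -> R) :
  (forall i, measurable_fun setT (s i)) ->
  (forall i, measurable_fun setT (h i)) -> (forall i x, 0 <= h i x)%R ->
  (forall i (F : T -> \bar R), measurable_fun setT F -> (forall x, 0 <= F x) ->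
    \int[m]_x F (s i x) = \int[m]_x (F x * (h i x)%:E)) ->
  forall F : n.-tuple T -> \bar R,
    measurable_fun setT F -> (forall x, 0 <= F x) ->
    \int[tuple_power n]_y F [tuple s i (tnth y i) | i < n] =
    \int[tuple_power n]_y (F y * (\prod_(i < n) h i (tnth y i))%R%:E).
Proof.
elim: n s h => [|n ih] s h ms mh h0 sh F mF F0.
  rewrite !ge0_integral_tuple_power0//.
  - by rewrite big_ord0 mule1; congr F; apply: eq_from_tnth => -[].
  - apply: emeasurable_funM => //; apply/measurable_EFinP.
    exact: measurable_prod_tnth.
  - by move=> x; rewrite mule_ge0// lee_fin prodr_ge0.
  - apply: measurableT_comp => //; apply/measurable_fun_tnthP => -[].
    by [].
have mt k (s' : 'I_k -> T -> T) : (forall i, measurable_fun setT (s' i)) ->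
    measurable_fun setT (fun y : k.-tuple T => [tuple s' i (tnth y i) | i < k]).
  move=> ms'; apply/measurable_fun_tnthP => i.
  rewrite (_ : _ \o _ = fun y => s' i (tnth y i)); last first.
    by apply/funext => y /=; rewrite tnth_mktuple.
  exact: (measurableT_comp (ms' i) (measurable_tnth i)).
have mhp : measurable_fun setT (fun y : n.-tuple T =>
    (\prod_(i < n) h (lift ord0 i) (tnth y i))%R).
  exact: (@measurable_prod_tnth _ (fun i => h (lift ord0 i))).
have hp0 (y : n.-tuple T) : (0 <= \prod_(i < n) h (lift ord0 i) (tnth y i))%R.
  by apply: prodr_ge0.
have mF2 : measurable_fun setT (fun z => F (@tuple_cons n z)).
  exact: measurableT_comp.
rewrite !ge0_integral_tuple_powerS//; last 3 first.
- apply: emeasurable_funM => //; apply/measurable_EFinP.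
  exact: measurable_prod_tnth.
- by move=> x; rewrite mule_ge0// lee_fin prodr_ge0.
- exact: (measurableT_comp mF (mt _ _ ms)).
transitivity (\int[m]_x \int[tuple_power n]_y
  (F (tuple_cons (s ord0 x, y)) * (\prod_(i < n) h (lift ord0 i) (tnth y i))%R%:E)).
  apply: eq_integral => x _.
  rewrite -(ih (fun i => s (lift ord0 i)) (fun i => h (lift ord0 i)) _ _ _
     (fun i => sh (lift ord0 i)) (fun y => F (tuple_cons (s ord0 x, y))))//; last exact: (measurableT_comp mF2).
  apply: eq_integral => y _; congr F; apply: eq_from_tnth => i.
  rewrite tnth_mktuple; case: (unliftP ord0 i) => [j ->|->].
    by rewrite !tuple_consS tnth_mktuple.
  by rewrite !tuple_cons0.
pose G x := \int[tuple_power n]_y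
  (F (tuple_cons (x, y)) * (\prod_(i < n) h (lift ord0 i) (tnth y i))%R%:E).
have mG2 : measurable_fun setT (fun z : T * n.-tuple T => F (tuple_cons z) *
    (\prod_(i < n) h (lift ord0 i) (tnth z.2 i))%R%:E).
  apply: emeasurable_funM => //; apply/measurable_EFinP.
  exact: (measurableT_comp mhp).
have G0 x : 0 <= G x.
  by apply: integral_ge0 => y _; rewrite mule_ge0// lee_fin.
have mG : measurable_fun setT G.
  apply: (@measurable_fun_fubini_tonelli_F _ _ _ _ _ _ (fun z : T * n.-tuple T =>
    F (tuple_cons z) * (\prod_(i < n) h (lift ord0 i) (tnth z.2 i))%R%:E)) => //.
  by move=> z; rewrite mule_ge0// lee_fin.
rewrite -/(G _) (sh ord0 G)//; apply: eq_integral => x _.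
rewrite /G -ge0_integralZr//; last 3 first.
- by apply: emeasurable_funM; [exact: (measurableT_comp mF2)|exact/measurable_EFinP].
- by move=> y _; rewrite mule_ge0// lee_fin.
- by rewrite lee_fin.
apply: eq_integral => y _; rewrite big_ord_recl tuple_cons0.
under [in RHS]eq_bigr do rewrite tuple_consS.
by rewrite EFinM -muleA [X in _ * X]muleC.
Qed.

End tuple_power.

(** * Moments of normal laws *)

Section normal_moments.
Context {R : realType}.
Local Notation mu := (@lebesgue_measure R).

(** The rate is half of the critical value 1 / (2 s^2); the factor [1 + 2 * b * s ^+ 2] is then
    1/2. *)
Lemma integrable_normal_sqr_exp (s : R) : 0 < s ->
  (normal_prob 0 s).-integrable setT
    (EFin \o (fun x : R => expR ((4 * s ^+ 2)^-1 * x ^+ 2))).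
Proof.
move=> s0.
rewrite (_ : (fun x : R => _) =
    (fun x : R => expR (0 * x - (- (4 * s ^+ 2)^-1) * x ^+ 2))); last first.
  by apply/funext => x; congr expR; rewrite mul0r sub0r mulNr opprK.
apply: integrable_normal_exp => //.
rewrite (_ : _ + _ = 2^-1) ?invr_gt0//.
by field; rewrite gt_eqF.
Qed.

Lemma integrable_normal_sqr (s : R) : 0 < s ->
  (normal_prob 0 s).-integrable setT (EFin \o (fun x : R => x ^+ 2)).
Proof.
move=> s0.
have m2 : measurable_fun setT (fun x : R => x ^+ 2) by exact: measurable_funX.
apply: (@le_EFin_integrable _ _ _ (normal_prob 0 s) setT measurableT (fun x : R => x ^+ 2)
  (fun x : R => 4 * s ^+ 2 * expR ((4 * s ^+ 2)^-1 * x ^+ 2))) => //.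
  move=> x _; rewrite ger0_norm ?sqr_ge0//.
  have k0 : 0 < 4 * s ^+ 2 by rewrite mulr_gt0// exprn_gt0.
  rewrite -ler_pdivrMl// (le_trans _ (expR_ge1Dx _))// lerDr//.
apply: integrable_EFinZl => //.
exact: integrable_normal_sqr_exp.
Qed.

(** The boundary term for the variance; [expR (- u) <= u^-1] is enough decay to beat the factor
    [n%:R]. *)
Lemma normal_pdf_sqr_cvg0 (s : R) : 0 < s ->
  n%:R * normal_pdf 0 s n%:R @[n --> \oo] --> (0 : R).
Proof.
move=> s0; pose K := 2 * s ^+ 2 * normal_peak s.
have s20 : 0 < s ^+ 2 by rewrite exprn_gt0.
have expN (u : R) : 0 < u -> expR (- u) <= u^-1.
  move=> u0; rewrite expRN lef_pV2 ?posrE ?expR_gt0//.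
  by rewrite (le_trans _ (expR_ge1Dx u))// lerDr.
apply: (@squeeze_cvgr _ _ _ _ (cst 0) (fun n : nat => K * n%:R^-1)).
- near=> n; rewrite mulr_ge0 ?normal_pdf_ge0//=.
  have n0 : 0 < n%:R :> R by rewrite ltr0n; near: n; exists 1%N.
  have u0 : 0 < n%:R ^+ 2 / (s ^+ 2 * 2) :> R.
    by rewrite divr_gt0 ?exprn_gt0// mulr_gt0.
  rewrite normal_pdfE ?gt_eqF// /normal_fun subr0 mulNr -(mulr_natr (s ^+ 2)).
  apply: (le_trans (ler_wpM2l (ltW n0) (ler_wpM2l (normal_peak_ge0 s) (expN _ u0)))).
  rewrite le_eqVlt; apply/orP; left; apply/eqP; rewrite /K.
  by field; rewrite !gt_eqF.
- exact: cvg_cst.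
- rewrite -(mulr0 K); apply: cvgM; first exact: cvg_cst.
  by rewrite -(cvg_shiftS (fun n : nat => n%:R^-1 : R)); exact: cvg_harmonic.
Unshelve. all: by end_near. Qed.

Lemma normal_mean (s : R) : 0 < s -> \int[normal_prob 0 s]_x x = 0.
Proof.
move=> s0; have s20 : s ^+ 2 != 0 by rewrite gt_eqF ?exprn_gt0.
have mid : measurable_fun setT (fun x : R => x) by exact: measurable_id.
have ii := integrable_normal_id s0.
have : (\int[normal_prob 0 s]_x (- (x / s ^+ 2))%:E = 0)%E.
  have mB : measurable_fun setT (fun x : R => - (x / s ^+ 2)).
    by apply: measurableT_comp => //; exact: measurable_funM.
  rewrite integral_normal; last by apply/measurable_EFinP; exact: mB.
  under eq_integral do rewrite -EFinM.
  apply: (@integral_derivative_eq0 _ (normal_pdf 0 s)).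
  - move=> x; apply: cvgM; last exact/continuous_normal_pdf/lt0r_neq0.
    by apply: cvgN; apply: cvgM; [exact: cvg_id|exact: cvg_cst].
  - by move=> x; exact: is_derive_normal_pdf.
  - rewrite (_ : _ \o _ = (fun x => (- (x / s ^+ 2))%:E * (normal_pdf 0 s x)%:E)%E).
      apply/integrable_normal; first by apply/measurable_EFinP; exact: mB.
      by apply: integrable_EFinN => //; apply: integrable_EFinZr.
    by apply/funext => x /=; rewrite EFinM.
  - exact: normal_pdf_cvg0.
  - rewrite (_ : (fun n : nat => _) = (fun n : nat => normal_pdf 0 s n%:R)).
      exact: normal_pdf_cvg0.
    apply/funext => n.
    by rewrite normal_pdfE ?gt_eqF// /normal_fun !subr0 sqrrN.
move=> /(congr1 fine) /=; rewrite -/(Rintegral _ _ _).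
rewrite RintegralN//; last exact: integrable_EFinZr.
rewrite RintegralZr// => /eqP; rewrite oppr_eq0 mulf_eq0 invr_eq0 (negbTE s20) orbF.
by move=> /eqP.
Qed.

(** The derivative of [x * normal_pdf 0 s x] is the density times [1 - x ^+ 2 / s ^+ 2], and it
    integrates to zero. *)
Lemma normal_variance (s : R) : 0 < s -> \int[normal_prob 0 s]_x (x ^+ 2) = s ^+ 2.
Proof.
move=> s0; have s20 : s ^+ 2 != 0 by rewrite gt_eqF ?exprn_gt0.
have m2 : measurable_fun setT (fun x : R => x ^+ 2) by exact: measurable_funX.
have ii := integrable_normal_sqr s0.
have i1 : (normal_prob 0 s).-integrable setT (EFin \o (fun _ : R => 1 : R)).
  by apply: (@integrable_normal_bounded _ _ _ 1) => // x; rewrite normr1.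
have ib : (normal_prob 0 s).-integrable setT
    (EFin \o (fun x : R => 1 - x ^+ 2 / s ^+ 2)).
  by apply: integrable_EFinB => //; exact: integrable_EFinZr.
have : (\int[normal_prob 0 s]_x (1 - x ^+ 2 / s ^+ 2)%R%:E = 0)%E.
  have mB : measurable_fun setT (fun x : R => 1 - x ^+ 2 / s ^+ 2).
    by apply: measurable_funB => //; exact: measurable_funM.
  rewrite integral_normal; last by apply/measurable_EFinP; exact: mB.
  under eq_integral do rewrite -EFinM.
  apply: (@integral_derivative_eq0 _ (fun x => x * normal_pdf 0 s x)).
  - move=> x; apply: cvgM; last exact/continuous_normal_pdf/lt0r_neq0.
    apply: cvgB; first exact: cvg_cst.
    by apply: cvgM; [exact: exprn_continuous|exact: cvg_cst].
  - move=> x; have := is_derive_normal_pdf x s0 => ?.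
    by apply: is_derive_eq; rewrite /GRing.scale/=; field; rewrite gt_eqF.
  - rewrite (_ : _ \o _ = (fun x => (1 - x ^+ 2 / s ^+ 2)%:E * (normal_pdf 0 s x)%:E)%E).
      by apply/integrable_normal => //; apply/measurable_EFinP; exact: mB.
    by apply/funext => x /=; rewrite EFinM.
  - exact: normal_pdf_sqr_cvg0.
  - rewrite (_ : (fun n : nat => _) = (fun n : nat => - (n%:R * normal_pdf 0 s n%:R))).
      by have := cvgN (normal_pdf_sqr_cvg0 s0); rewrite oppr0; exact.
    apply/funext => n.
    by rewrite normal_pdfE ?gt_eqF// /normal_fun !subr0 sqrrN mulNr.
move=> /(congr1 fine) /=; rewrite -/(Rintegral _ _ _).
rewrite RintegralB//; last exact: integrable_EFinZr.
rewrite RintegralZr// Rintegral_cst// mul1r.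
rewrite (_ : fine _ = 1); last first.
  exact: (congr1 fine (@probability_setT _ _ _ (normal_prob 0 s))).
move=> /eqP; rewrite subr_eq0 eq_sym => /eqP E.
by rewrite -[LHS](divfK s20) E mul1r.
Qed.

Lemma normal_prob_shift (m s : R) A : s != 0 -> measurable A ->
  pushforward (normal_prob 0 s) (fun x : measurableTypeR R => x + m : measurableTypeR R) A
  = normal_prob m s A.
Proof.
move=> s0 mA.
have mc : measurable_fun setT (fun x : measurableTypeR R => x + m : measurableTypeR R).
  by apply: measurable_funD => //; exact: measurable_id.
have mAc : measurable [set x : R | A (x + m)].
  by have := mc measurableT A mA; rewrite setTI.
pose sh := fun x : measurableTypeR R => (x + m : measurableTypeR R).
transitivity (\int[mu]_x ((\1_A (x + m))%:E * (normal_pdf 0 s x)%:E))%E.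
  rewrite -integral_normal; last first.
    apply/measurable_EFinP.
    exact: (@measurableT_comp _ _ _ _ _ _ (\1_A : R -> R) _ (fun x : R => x + m)).
  transitivity (\int[normal_prob 0 s]_x (\1_[set x : R | A (x + m)] x)%:E)%E.
    by rewrite integral_indic// setIT.
  by apply: eq_integral => x _; rewrite !indicE.
transitivity (\int[mu]_x ((\1_A x)%:E * (normal_pdf m s x)%:E))%E; last first.
  rewrite /normal_prob [in RHS]integral_mkcond.
  by apply: eq_integral => x _; rewrite patchE indicE; case: ifP; rewrite ?mul1e ?mul0e.
have msh : measurable_fun setT sh by exact: mc.
rewrite [RHS](ge0_integral_image (m1 := mu) msh (fun B mB => lebesgue_measure_shift m mB)).
- apply: eq_integral => x _ /=; congr (_ * _%:E)%E.
  by rewrite !normal_pdfE// /normal_fun /sh addrK subr0.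
- apply: emeasurable_funM; apply/measurable_EFinP; first exact: measurable_indic.
  exact: measurable_normal_pdf.
- by move=> x; rewrite mule_ge0// lee_fin// normal_pdf_ge0.
Qed.

(** [is_normal] leaves the sign of [s] free, whereas the Gaussian integrals assume a positive
    deviation. *)
Lemma normal_prob_norm (m s : R) : normal_prob m `|s| = normal_prob m s.
Proof.
apply/funext => A; rewrite /normal_prob; apply: eq_integral => x _; congr EFin.
rewrite /normal_pdf normr_eq0; case: eqP => // _.
by rewrite /normal_peak /normal_fun real_normK// num_real.
Qed.

End normal_moments.

Section is_normal_law.
Context d (T : measurableType d) (R : realType) (P : probability T R).
Variable V : T -> R.
Hypothesis mV : measurable_fun setT V.

Lemma ge0_integral_is_normal (m s : R) (f : R -> \bar R) :
  (forall B, measurable B -> P (V @^-1` B) = if s == 0 then \d_m B else normal_prob m s B) ->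
  measurable_fun setT f -> (forall x, (0 <= f x)%E) ->
  (\int[P]_w f (V w))%E =
  if s == 0 then f m else (\int[normal_prob 0 `|s|%R]_x f (x + m)%R)%E.
Proof.
move=> Vms mf f0.
have mfm : measurable_fun setT (fun x : R => f (x + m)).
  by apply: (measurableT_comp mf); apply: measurable_funD => //; exact: measurable_id.
pose sh := fun x : measurableTypeR R => (x + m : measurableTypeR R).
have msh : measurable_fun setT sh.
  by apply: measurable_funD => //; exact: measurable_id.
have [s0|s0] := eqVneq s 0.
  have H A : measurable A -> P (V @^-1` A) = \d_m A.
    by move=> mA; have := Vms A mA; rewrite s0 eqxx.
  transitivity (\int[\d_m]_x f x)%E; first exact: esym (ge0_integral_image mV H mf f0).
  by rewrite integral_dirac// diracT mul1e.
have H A : measurable A -> P (V @^-1` A) = normal_prob m s A.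
  by move=> mA; have := Vms A mA; rewrite (negbTE s0).
have H2 A : measurable A -> normal_prob 0 `|s| (sh @^-1` A) = normal_prob m s A.
  move=> mA; rewrite -(normal_prob_norm m s).
  by have sn : `|s| != 0; [rewrite normr_eq0|exact: (normal_prob_shift m sn mA)].
transitivity (\int[normal_prob m s]_x f x)%E.
  by apply/esym; exact: (@ge0_integral_image _ _ T (measurableTypeR R) R P (normal_prob m s) V mV H f mf f0).
exact: (ge0_integral_image msh H2 mf f0).
Qed.

Lemma integrable_is_normal (m s : R) (f : R -> R) :
  (forall B, measurable B -> P (V @^-1` B) = if s == 0 then \d_m B else normal_prob m s B) ->
  measurable_fun setT f ->
  (s != 0 -> (normal_prob 0 `|s|).-integrable setT (EFin \o (fun x : R => f (x + m)))) ->
  P.-integrable setT (EFin \o (f \o V)) /\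
  \int[P]_w f (V w) = if s == 0 then f m else \int[normal_prob 0 `|s|]_x f (x + m).
Proof.
move=> Vms mf fi; split.
  apply/integrableP; split; first by apply/measurable_EFinP; exact: measurableT_comp.
  rewrite /=.
  rewrite (ge0_integral_is_normal (f := fun x => `|(f x)%:E|%E) Vms)//.
  - case: eqP => [_|/eqP s0]; first by rewrite ltry.
    by have /integrableP[] := fi s0.
  - by apply: measurableT_comp => //; exact/measurable_EFinP.
rewrite /Rintegral integralE.
have mE : measurable_fun setT (EFin \o f) by exact/measurable_EFinP.
have -> : ((fun w => (f (V w))%:E)^\+ = (fun w => (EFin \o f)^\+ (V w)))%E.
  by apply/funext => w; rewrite !funeposE.
have -> : ((fun w => (f (V w))%:E)^\- = (fun w => (EFin \o f)^\- (V w)))%E.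
  by apply/funext => w; rewrite !funenegE.
rewrite (ge0_integral_is_normal Vms); last 2 first.
  exact: measurable_funepos. by move=> x; exact: funepos_ge0.
rewrite (ge0_integral_is_normal Vms); last 2 first.
  exact: measurable_funeneg. by move=> x; exact: funeneg_ge0.
case: eqP => [_|/eqP s0].
  transitivity (fine ((EFin \o f) m)) => //; congr fine.
  exact: (esym (congr1 (@^~ m) (funeposneg (EFin \o f)))).
rewrite [in RHS]integralE; congr (fine (_ - _)).
  by apply: eq_integral => x _; rewrite !funeposE.
by apply: eq_integral => x _; rewrite !funenegE.
Qed.

(** Identifies the existential parameters of [is_normal]: [m] is the mean and [s ^+ 2] the variance,
    in the degenerate case too. *)
Lemma normal_law_moments (m s : R) :
  (forall B, measurable B -> P (V @^-1` B) = if s == 0 then \d_m B else normal_prob m s B) ->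
  [/\ P.-integrable setT (EFin \o V),
      P.-integrable setT (EFin \o (fun w => V w ^+ 2)),
      \int[P]_w V w = m &
      \int[P]_w (V w ^+ 2) = m ^+ 2 + s ^+ 2].
Proof.
move=> Vms.
have mid : measurable_fun setT (fun x : R => x) by exact: measurable_id.
have m2 : measurable_fun setT (fun x : R => x ^+ 2) by exact: measurable_funX.
have ic (c s' : R) : (normal_prob 0 s').-integrable setT (EFin \o (fun _ : R => c)).
  by apply: (@integrable_normal_bounded _ _ _ `|c|) => // x.
have sn : s != 0 -> 0 < `|s| by rewrite normr_gt0.
have i1 : s != 0 -> (normal_prob 0 `|s|).-integrable setT (EFin \o (fun x : R => x + m)).
  move=> s0; apply: (@integrable_EFinD _ (measurableTypeR R) R (normal_prob 0 `|s|) setT measurableT (fun x : R => x) (fun=> m)) => //.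
    by apply: integrable_normal_id; exact: sn.
  exact: ic.
have i2' : s != 0 -> (normal_prob 0 `|s|).-integrable setT
    (EFin \o (fun x : R => x ^+ 2 + (2 * m * x + m ^+ 2))).
  move=> s0; apply: integrable_EFinD => //.
    by apply: integrable_normal_sqr; exact: sn.
  apply: integrable_EFinD => //; last exact: ic.
  by apply: integrable_EFinZl => //; apply: integrable_normal_id; exact: sn.
have i2 : s != 0 -> (normal_prob 0 `|s|).-integrable setT
    (EFin \o (fun x : R => (x + m) ^+ 2)).
  move=> s0; rewrite (_ : (fun x : R => _) = (fun x : R => x ^+ 2 + (2 * m * x + m ^+ 2))).
    exact: i2'.
  by apply/funext => x; ring.
have [iV EV] := integrable_is_normal Vms mid i1.
have [iV2 EV2] := integrable_is_normal Vms m2 i2.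
have intc (c : R) : \int[normal_prob 0 `|s|]_x c = c.
  rewrite Rintegral_cst// -[RHS]mulr1; congr (_ * _).
  exact: (congr1 fine (@probability_setT _ _ _ (normal_prob 0 `|s|))).
have inx : s != 0 -> (normal_prob 0 `|s|).-integrable setT (EFin \o (fun x : R => x)).
  by move=> s0; apply: integrable_normal_id; exact: sn.
have in2 : s != 0 -> (normal_prob 0 `|s|).-integrable setT (EFin \o (fun x : R => x ^+ 2)).
  by move=> s0; apply: integrable_normal_sqr; exact: sn.
split => //.
- rewrite EV; case: eqP => // /eqP s0.
  rewrite (RintegralD measurableT (inx s0) (ic m _)) intc normal_mean ?add0r//.
  exact: sn.
- rewrite EV2; case: eqP => [->|/eqP s0]; first by rewrite expr0n addr0.
  have i3 : (normal_prob 0 `|s|).-integrable setT (EFin \o (fun x : R => 2 * m * x)).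
    by apply: integrable_EFinZl => //; exact: inx.
  have i4 : (normal_prob 0 `|s|).-integrable setT (EFin \o (fun x : R => 2 * m * x + m ^+ 2)).
    by apply: integrable_EFinD => //; exact: ic.
  transitivity (\int[normal_prob 0 `|s|]_x (x ^+ 2 + (2 * m * x + m ^+ 2))).
    by apply: eq_Rintegral => x _; ring.
  rewrite (RintegralD measurableT (in2 s0) i4) (RintegralD measurableT i3 (ic _ _)) intc.
  rewrite (RintegralZl _ measurableT (inx s0)) normal_mean ?normal_variance ?sn//.
  by rewrite mulr0 add0r real_normK ?num_real// addrC.
Qed.

(** Besides square integrability, this is what is used of a real normal law later: its
    characteristic function in terms of the second moment, and some exponential moment of its
    square. *)
Lemma centered_normal_law (m s : R) :
  (forall B, measurable B -> P (V @^-1` B) = if s == 0 then \d_m B else normal_prob m s B) ->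
  \int[P]_w V w = 0 ->
  (forall th, \int[P]_w cos (V w + th) = expR (- ((\int[P]_w (V w ^+ 2)) / 2)) * cos th) /\
  exists2 delta, 0 < delta & P.-integrable setT (EFin \o (fun w => expR (delta * V w ^+ 2))).
Proof.
move=> Vms EV0; have [_ _ EV EV2] := normal_law_moments Vms.
have m0 : m = 0 by rewrite -EV EV0.
rewrite EV2 m0 expr0n add0r; split => [th|].
  have mcos : measurable_fun setT (fun x : R => cos (x + th)).
    apply: continuous_measurable_fun => x; apply: continuous_comp.
      by apply: cvgD; [exact: cvg_id|exact: cvg_cst].
    exact: continuous_cos.
  have [_ ->] := integrable_is_normal (f := fun x => cos (x + th)) Vms mcos
    (fun s0 => @integrable_normal_bounded _ _ (fun x => cos (x + m + th)) 1
       ltac:(by rewrite m0; under eq_fun do rewrite addr0; exact: mcos)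
       (fun x => cos_max _)).
  rewrite m0; case: eqP => [->|/eqP s0].
    by rewrite expr0n mul0r oppr0 expR0 mul1r add0r.
  under eq_Rintegral do rewrite addr0 -[X in cos (X + _)]mul1r.
  by rewrite normal_cos ?normr_gt0// expr1n mulr1 real_normK ?num_real.
have [s0|s0] := eqVneq s 0.
  exists 1 => //.
  have [] := @integrable_is_normal m s (fun x => expR (1 * x ^+ 2)) Vms _ _ => //.
    by apply: measurableT_comp => //; apply: measurable_funM => //; exact: measurable_funX.
  by rewrite s0 eqxx.
have sn : 0 < `|s| by rewrite normr_gt0.
exists (4 * `|s| ^+ 2)^-1; first by rewrite invr_gt0 mulr_gt0// exprn_gt0.
have [] := @integrable_is_normal m s (fun x => expR ((4 * `|s| ^+ 2)^-1 * x ^+ 2)) Vms _ _ => //.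
  by apply: measurableT_comp => //; apply: measurable_funM => //; exact: measurable_funX.
move=> _; rewrite m0.
rewrite (_ : (fun x : R => _) = (fun x : R => expR ((4 * `|s| ^+ 2)^-1 * x ^+ 2))).
  exact: integrable_normal_sqr_exp.
by apply/funext => x; rewrite addr0.
Qed.

End is_normal_law.

(** * Proper complex normal laws *)

Section complex_gaussian.
Context {R : realType}.
Local Notation C := R[i].
Local Notation Re := (@complex.Re R).
Local Notation Im := (@complex.Im R).
Local Notation half_normal := (normal_prob 0 (@half_sd R)).

Definition csq (z : C) : R := Re z ^+ 2 + Im z ^+ 2.
Definition cdot (u z : C) : R := Re u * Re z + Im u * Im z.

Lemma normc_sqr (z : C) : Normc.normc z ^+ 2 = csq z.
Proof. by case: z => a b; rewrite /csq /= sqr_sqrtr// addr_ge0// sqr_ge0. Qed.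

Lemma csq_ge0 z : 0 <= csq z.
Proof. by rewrite addr_ge0// sqr_ge0. Qed.

Lemma csqD u z : csq (u + z) = csq u + csq z + 2 * cdot u z.
Proof. by case: u z => a b [c e]; rewrite /csq /cdot /=; ring. Qed.

Lemma csqB u z : csq (u - z) = csq u + csq z - 2 * cdot u z.
Proof. by case: u z => a b [c e]; rewrite /csq /cdot /=; ring. Qed.

Lemma measurable_cRe : measurable_fun setT Re.
Proof. by have /measurable_fun_complexP[] := @measurable_id _ C setT. Qed.

Lemma measurable_cIm : measurable_fun setT Im.
Proof. by have /measurable_fun_complexP[] := @measurable_id _ C setT. Qed.

Lemma measurable_csq : measurable_fun setT csq.
Proof.
by apply: measurable_funD; apply: measurable_funX;
  [exact: measurable_cRe|exact: measurable_cIm].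
Qed.

Lemma measurable_cdot d (T : measurableType d) (f g : T -> C) :
  measurable_fun setT f -> measurable_fun setT g ->
  measurable_fun setT (fun x => cdot (f x) (g x)).
Proof.
by move=> /measurable_fun_complexP[fr fi] /measurable_fun_complexP[gr gi];
  apply: measurable_funD; exact: measurable_funM.
Qed.

Definition cplx (p : measurableTypeR R * measurableTypeR R) : C := (p.1 +i* p.2)%C.

Lemma measurable_cplx : measurable_fun setT cplx.
Proof.
by apply/measurable_fun_complexP; split; [exact: measurable_fst|exact: measurable_snd].
Qed.

HB.instance Definition _ := @isMeasurableFun.Build _ _ _ _ cplx measurable_cplx.

Definition std_cnormal : probability C R :=
  distribution (half_normal \x half_normal)%E cplx.

Lemma ge0_integral_std_cnormal (F : C -> \bar R) :
  measurable_fun setT F -> (forall x, (0 <= F x)%E) ->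
  (\int[std_cnormal]_z F z =
   \int[half_normal]_a \int[half_normal]_b F (a +i* b)%C)%E.
Proof.
move=> mF F0; rewrite ge0_integral_distribution// fubini_tonelli1//.
  exact: (measurableT_comp mF measurable_cplx).
by move=> x; exact: F0.
Qed.

Lemma std_cnormal_exp (b : R) (u : C) : -1 < b ->
  (\int[std_cnormal]_z (expR (2 * cdot u z - b * csq z))%:E =
   ((1 + b)^-1 * expR (csq u / (1 + b)))%R%:E)%E.
Proof.
move=> b1; have b0 : 0 < 1 + b by lra.
have mexp (c : R) : measurable_fun setT (fun x : measurableTypeR R => expR (2 * c * x - b * x ^+ 2)).
  apply: measurableT_comp => //; apply: measurable_funB; apply: measurable_funM => //.
rewrite ge0_integral_std_cnormal//; last first.
  apply/measurable_EFinP; apply: measurableT_comp => //; apply: measurable_funB.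
    by apply: measurable_funM => //; apply: measurable_cdot.
  by apply: measurable_funM => //; exact: measurable_csq.
under eq_integral => x _.
  under eq_integral => y _.
    rewrite (_ : expR _ = expR (2 * Re u * x - b * x ^+ 2) *
      expR (2 * Im u * y - b * y ^+ 2)); last first.
      by rewrite -expRD; congr expR; rewrite /cdot /csq /=; ring.
    rewrite EFinM; over.
  rewrite ge0_integralZl_EFin//; last by apply/measurable_EFinP; exact: mexp.
  rewrite half_normal_exp//.
  over.
rewrite ge0_integralZr//=; last by apply/measurable_EFinP; exact: mexp.
rewrite half_normal_exp// -EFinM; congr EFin.
rewrite mulrACA -expRD -invfM -expr2 sqr_sqrtr ?ltW//; congr (_ * expR _).
by rewrite /csq; field; rewrite gt_eqF.
Qed.

Lemma half_normal_shift_integral (c : R) (F : R -> \bar R) :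
  measurable_fun setT F -> (forall x, (0 <= F x)%E) ->
  (\int[half_normal]_x F (x + c)%R =
   \int[half_normal]_x (F x * (expR (2 * c * x - c ^+ 2))%:E))%E.
Proof.
move=> mF F0.
pose sh := fun x : measurableTypeR R => (x + c : measurableTypeR R).
have msh : measurable_fun setT sh.
  by apply: measurable_funD => //; exact: measurable_id.
have mexp : measurable_fun setT (fun x : measurableTypeR R => expR (2 * c * x - c ^+ 2)).
  apply: measurableT_comp => //; apply: measurable_funB => //.
transitivity (\int[pushforward half_normal sh]_x F x)%E.
  by rewrite (ge0_integral_pushforward msh).
apply: (ge0_integral_density (m := half_normal) mexp) => //.
by move=> A mA; exact: half_normal_shift.
Qed.

Lemma std_cnormal_shift (c : C) (F : C -> \bar R) :
  measurable_fun setT F -> (forall x, (0 <= F x)%E) ->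
  (\int[std_cnormal]_z F (z + c)%R =
   \int[std_cnormal]_z (F z * (expR (2 * cdot c z - csq c))%:E))%E.
Proof.
move=> mF F0.
have mexp (t : R) : measurable_fun setT (fun x : measurableTypeR R => expR (2 * t * x - t ^+ 2)).
  apply: measurableT_comp => //; apply: measurable_funB => //.
have mexpC : measurable_fun setT (fun z : C => expR (2 * cdot c z - csq c)).
  apply: measurableT_comp => //; apply: measurable_funB => //.
  by apply: measurable_funM => //; apply: measurable_cdot.
have mFc : measurable_fun setT (fun z : C => F (z + c)).
  by apply: (measurableT_comp mF); apply: measurable_complexD.
rewrite !ge0_integral_std_cnormal//; last 2 first.
- by apply: emeasurable_funM => //; exact/measurable_EFinP.
- by move=> z; rewrite mule_ge0// lee_fin expR_ge0.
have mF2 : measurable_fun setT (fun p : measurableTypeR R * measurableTypeR R => F (cplx p)).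
  exact: (measurableT_comp mF measurable_cplx).
have mF1 a : measurable_fun setT (fun b : measurableTypeR R => F (a +i* b)%C).
  exact: (measurableT_comp mF2 (pair1_measurable a)).
have mexpb (t : R) : measurable_fun setT (fun p : measurableTypeR R * measurableTypeR R =>
    (expR (2 * t * p.2 - t ^+ 2))%:E).
  by apply/measurable_EFinP; apply: (measurableT_comp (mexp t)).
pose G a := (\int[half_normal]_b (F (a +i* b)%C * (expR (2 * Im c * b - Im c ^+ 2))%:E))%E.
transitivity (\int[half_normal]_a G (a + Re c)%R)%E.
  apply: eq_integral => a _.
  rewrite /G -(half_normal_shift_integral (Im c) (F := fun b => F ((a + Re c) +i* b)%C))//; last exact: (mF1 _).
  by apply: eq_integral => b _; congr F; case: (c).
have G0 a : (0 <= G a)%E.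
  by apply: integral_ge0 => b _; rewrite mule_ge0// lee_fin expR_ge0.
have mG : measurable_fun setT G.
  apply: (@measurable_fun_fubini_tonelli_F _ _ (measurableTypeR R) (measurableTypeR R) _ half_normal
    (fun p => F (cplx p) * (expR (2 * Im c * p.2 - Im c ^+ 2))%:E)%E).
    exact: emeasurable_funM.
  by move=> p; rewrite mule_ge0// lee_fin expR_ge0.
rewrite half_normal_shift_integral//; apply: eq_integral => a _.
rewrite /G -ge0_integralZr//; last 2 first.
- by apply: emeasurable_funM => //; apply/measurable_EFinP; exact: mexp.
- by move=> b _; rewrite mule_ge0// lee_fin expR_ge0.
apply: eq_integral => b _; rewrite -muleA -EFinM -expRD; congr (_ * (expR _)%:E)%E.
by rewrite /cdot /csq /=; ring.
Qed.

Lemma std_cnormal_cos (s t th : R) :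
  \int[std_cnormal]_z cos (s * Re z + t * Im z + th) =
  expR (- ((s ^+ 2 + t ^+ 2) / 4)) * cos th.
Proof.
have mcosR : measurable_fun setT (@cos R).
  by apply: continuous_measurable_fun; exact: continuous_cos.
have mc : measurable_fun setT (fun z : C => cos (s * Re z + t * Im z + th)).
  apply: (measurableT_comp mcosR); apply: measurable_funD => //; apply: measurable_funD;
  apply: measurable_funM => //; [exact: measurable_cRe|exact: measurable_cIm].
have mc2 : measurable_fun setT (fun p : measurableTypeR R * measurableTypeR R =>
    cos (s * p.1 + t * p.2 + th)).
  exact: (measurableT_comp mc measurable_cplx).
have ic2 : (half_normal \x half_normal)%E.-integrable setT
    (EFin \o (fun p : measurableTypeR R * measurableTypeR R => cos (s * p.1 + t * p.2 + th))).
  apply: measurable_bounded_integrable => //.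
    exact: le_lt_trans (probability_le1 _ _) (ltry _).
  by exists 1; split; [exact: num_real|move=> x Mx y _; exact: le_trans (cos_max _) (ltW Mx)].
transitivity (\int[(half_normal \x half_normal)%E]_p cos (s * p.1 + t * p.2 + th)).
  exact: (@Rintegral_image _ _ (measurableTypeR R * measurableTypeR R)%type C R
   (half_normal \x half_normal)%E std_cnormal cplx measurable_cplx (fun A mA => erefl) _ mc).
have i1 (u v : R) : half_normal.-integrable setT (EFin \o (fun x : R => cos (u * x + v))).
  apply: (@integrable_normal_bounded _ _ _ 1); last by move=> x; exact: cos_max.
  by apply: (measurableT_comp mcosR); apply: measurable_funD.
rewrite /Rintegral -integral12_prod_meas1//= /fubini_F/=.
have inner (x : R) : (\int[half_normal]_y (cos (s * x + t * y + th))%:E)%E =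
    (expR (- (t ^+ 2 / 4)) * cos (s * x + th))%:E.
  rewrite -half_normal_cos (EFin_Rintegral measurableT (i1 t (s * x + th))).
  by apply: eq_integral => y _; congr (cos _)%:E; ring.
under eq_integral do rewrite inner.
transitivity (\int[half_normal]_x (expR (- (t ^+ 2 / 4)) * cos (s * x + th))) => //.
rewrite (RintegralZl _ measurableT (i1 s th)).
by rewrite half_normal_cos mulrA -expRD; congr (expR _ * _); field.
Qed.

End complex_gaussian.

Section bounded_convergence.
Context d (T : measurableType d) (R : realType) (P : probability T R).

Lemma bounded_cvg (f : nat -> T -> R) (g : T -> R) :
  (forall n, measurable_fun setT (f n)) ->
  (forall n x, `|f n x| <= 1) ->
  (forall x, f n x @[n --> \oo] --> g x) ->
  (\int[P]_x (f n x)%:E)%E @[n --> \oo] --> (\int[P]_x (g x)%:E)%E.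
Proof.
move=> mf f1 fg.
apply: (@dominated_cvg _ _ _ P setT measurableT (fun n x => (f n x)%:E) (EFin \o g) (cst 1%E)) => //=.
- by move=> n; exact/measurable_EFinP.
- by move=> x _; apply: cvg_EFin; [exact: nearW|exact: fg].
- exact: (@finite_measure_integrable_cst _ _ _ P setT 1).
- by move=> n x _; rewrite lee_fin.
Qed.

End bounded_convergence.

Lemma measurable_fun_lt d (T : measurableType d) (R : realType) (f : T -> R) :
  (forall a, measurable (f @^-1` `]-oo, a[)) -> measurable_fun setT f.
Proof.
move=> mf mD; apply: (measurability _ (RGenInftyO.measurableE R)) => //.
by move=> _ [_ [a ->] <-]; rewrite setTI; exact: mf.
Qed.

Section proper_normal_law.
Context d (T : measurableType d) (R : realType) (P : probability T R).
Local Notation C := R[i].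
Local Notation Re := (@complex.Re R).
Local Notation Im := (@complex.Im R).

Definition rscale (k : R) (z : C) : C := ((k * Re z) +i* (k * Im z))%C.

Lemma measurable_rscale k : measurable_fun setT (rscale k).
Proof.
by apply/measurable_fun_complexP; split => /=; apply: measurable_funM => //;
  [exact: measurable_cRe|exact: measurable_cIm].
Qed.

Variable W : T -> C.
Hypothesis mW : measurable_fun setT W.
Hypothesis cfW : forall s t th : R,
  \int[P]_w cos (s * Re (W w) + t * Im (W w) + th) =
  expR (- ((s ^+ 2 + t ^+ 2) / 4)) * cos th.

(** The right-hand side does not mention [W]: adding a Gaussian of scale [k^-1] gives a law with a
    density, which the shift formula and [gaussian_smoothing] compute from the characteristic
    function. Two variables with this characteristic function thus agree after smoothing. *)
Lemma smoothed_law (k : R) (f : C -> R) : 0 < k -> measurable_fun setT f ->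
  (forall z, 0 <= f z) ->
  (\int[P]_w \int[std_cnormal]_g (f (W w + rscale k^-1 g))%:E =
   \int[std_cnormal]_g ((f (rscale k^-1 g))%:E *
     (expR (csq g) * \prod_(b : bool) ((Num.sqrt (1 + k ^+ 2))^-1 *
       expR (- ((if b then Re g else Im g) ^+ 2 / (1 + k ^+ 2)))))%R%:E))%E.
Proof.
move=> k0 mf f0.
have mfE : measurable_fun setT (fun z => (f z)%:E) by exact/measurable_EFinP.
pose F g := (f (rscale k^-1 g))%:E.
have mF : measurable_fun setT F by exact: (measurableT_comp mfE (measurable_rscale _)).
have F0 g : (0 <= F g)%E by rewrite lee_fin.
have mkW : measurable_fun setT (fun w => rscale k (W w)).
  exact: (measurableT_comp (measurable_rscale k) mW).
have mexp2 : measurable_fun setT (fun p : T * C =>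
    expR (2 * cdot (rscale k (W p.1)) p.2 - csq (rscale k (W p.1)))).
  apply: measurableT_comp => //; apply: measurable_funB.
    apply: measurable_funM => //; apply: measurable_cdot => //.
    exact: (measurableT_comp mkW).
  exact: (measurableT_comp measurable_csq (measurableT_comp mkW _)).
transitivity (\int[P]_w \int[std_cnormal]_g (F g *
    (expR (2 * cdot (rscale k (W w)) g - csq (rscale k (W w))))%:E))%E.
  apply: eq_integral => w _; rewrite -std_cnormal_shift//.
  apply: eq_integral => g _; rewrite /F; congr (f _)%:E.
  case: (W w) g => a b [a' b']; rewrite /rscale /=.
  by congr (_ +i* _)%C; field; rewrite gt_eqF.
rewrite (@fubini_tonelli _ _ _ _ _ _ _ (fun p : T * C => F p.2 *
    (expR (2 * cdot (rscale k (W p.1)) p.2 - csq (rscale k (W p.1))))%:E)%E)/=; last 2 first.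
- by apply: emeasurable_funM; [exact: (measurableT_comp mF)|exact/measurable_EFinP].
- by move=> p; rewrite mule_ge0// lee_fin expR_ge0.
apply: eq_integral => g _.
rewrite ge0_integralZl//; last first.
  by apply/measurable_EFinP; exact: (measurableT_comp mexp2 (pair2_measurable g)).
congr (_ * _)%E.
pose xi (b : bool) w := if b then k * Re (W w) else k * Im (W w).
have [mr mi] := (measurable_fun_complexP _).1 mW.
have mxi b : measurable_fun setT (xi b).
  by case: b; apply: measurable_funM.
have cf (c : bool -> R) (th : R) :
    \int[P]_w cos (\sum_i c i * xi i w + th) =
    expR (- (\sum_i k ^+ 2 * c i ^+ 2) / 4) * cos th.
  transitivity (\int[P]_w cos ((c true * k) * Re (W w) + (c false * k) * Im (W w) + th)).
    by apply: eq_Rintegral => w _; rewrite big_bool /xi/= !mulrA.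
  by rewrite cfW big_bool/=; congr (expR _ * _); field.
have sigma0 (b : bool) : 0 <= (fun=> k ^+ 2) b by rewrite sqr_ge0.
have mG : measurable_fun setT (fun w => \prod_(b : bool) expR (- ((if b then Re g else Im g) - xi b w) ^+ 2)).
  apply: measurable_prod => b _; apply: measurableT_comp => //; apply: measurableT_comp => //.
  by apply: measurable_funX; apply: measurable_funB.
have G0 w : 0 <= \prod_(b : bool) expR (- ((if b then Re g else Im g) - xi b w) ^+ 2).
  by apply: prodr_ge0 => b _; exact: expR_ge0.
rewrite -(gaussian_smoothing mxi sigma0 cf) EFinM EFin_Rintegral//; last first.
  apply: measurable_bounded_integrable => //.
    exact: le_lt_trans (probability_le1 _ _) (ltry _).
  exists 1; split; [exact: num_real|move=> x x1 w _ /=].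
  rewrite ger0_norm// (le_trans _ (ltW x1))// big_bool/= mulr_ile1 ?expR_ge0//;
  by rewrite -expR0 ler_expR oppr_le0 sqr_ge0.
rewrite -ge0_integralZl//; last 2 first.
- exact/measurable_EFinP.
- by move=> w _; rewrite lee_fin.
apply: eq_integral => w _; rewrite -EFinM big_bool/= -!expRD; congr (expR _)%:E.
by rewrite /cdot /csq /rscale /xi /=; ring.
Qed.

End proper_normal_law.

Section proper_normal_law_unique.
Context d (T : measurableType d) (R : realType) (P : probability T R).
Local Notation C := R[i].
Local Notation Re := (@complex.Re R).
Local Notation Im := (@complex.Im R).
Variable W : T -> C.
Hypothesis mW : measurable_fun setT W.
Hypothesis cfW : forall s t th : R,
  \int[P]_w cos (s * Re (W w) + t * Im (W w) + th) =
  expR (- ((s ^+ 2 + t ^+ 2) / 4)) * cos th.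

(** Continuous and bounded, zero for t <= 0, and increasing with [m] to 1 for t > 0: it approximates
    the indicator of an open half-line from below. *)
Let ramp (m : R) (t : R) : R := 1 - expR (- (m * (t + `|t|))).

Let ramp_ge0 m t : 0 <= m -> 0 <= ramp m t.
Proof.
move=> m0; rewrite subr_ge0 -expR0 ler_expR oppr_le0 mulr_ge0//.
by have := ler_norm (- t); rewrite normrN; lra.
Qed.

Let ramp_le1 m t : ramp m t <= 1.
Proof. by rewrite lerBlDr lerDl expR_ge0. Qed.

Let ramp_continuous m : continuous (ramp m).
Proof.
move=> t; apply: cvgB; first exact: cvg_cst.
apply: (cvg_comp _ expR); last exact: continuous_expR.
apply: cvgN; apply: cvgM; first exact: cvg_cst.
by apply: cvgD; [exact: cvg_id|exact: norm_continuous].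
Qed.

Let ramp_cvg t : ramp n%:R t @[n --> \oo] --> (((0 < t)%R)%:R : R).
Proof.
have [t0|t0] := ltP 0 t; last first.
  have E n : ramp n%:R t = 0.
    by rewrite /ramp ler0_norm// subrr mulr0 oppr0 expR0 subrr.
  by under eq_fun do rewrite E; exact: cvg_cst.
have c1 : `|expR (- (t + `|t|))| < 1.
  by rewrite ger0_norm ?expR_ge0// expR_lt1 oppr_lt0 gtr0_norm// addr_gt0.
rewrite -[X in _ --> X]subr0; apply: cvgB; first exact: cvg_cst.
under eq_fun do rewrite -mulrN expRM_natl.
exact: cvg_expr.
Qed.

Let box (a b : R) (m : R) (z : C) : R := ramp m (a - Re z) * ramp m (b - Im z).

Let mbox a b m : measurable_fun setT (box a b m).
Proof.
have mr : measurable_fun setT (ramp m).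
  by apply: continuous_measurable_fun; exact: ramp_continuous.
by apply: measurable_funM; apply: (measurableT_comp mr); apply: measurable_funB => //;
  [exact: measurable_cRe|exact: measurable_cIm].
Qed.

Let box01 a b (n : nat) z : 0 <= box a b n%:R z <= 1.
Proof. by rewrite mulr_ge0 ?ramp_ge0//= mulr_ile1 ?ramp_ge0. Qed.

Let box_norm a b (n : nat) z : `|box a b n%:R z| <= 1.
Proof. by have /andP[h1 h2] := box01 a b n z; rewrite ger0_norm. Qed.

(** Both expectations are limits, as the smoothing scale tends to zero with [n] fixed, of the same
    smoothed expectations. *)
Let expect_box a b (n : nat) :
  (\int[P]_w (box a b n%:R (W w))%:E = \int[std_cnormal]_z (box a b n%:R z)%:E)%E.
Proof.
have key (k : nat) : (\int[(P \x std_cnormal)]_p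
      (box a b n%:R (W p.1 + rscale k.+1%:R^-1 p.2))%:E =
    \int[(std_cnormal \x std_cnormal)]_p
      (box a b n%:R (p.1 + rscale k.+1%:R^-1 p.2))%:E)%E.
  have b0 z : 0 <= box a b n%:R z by case/andP: (box01 a b n z).
  have mE d' (T' : measurableType d') (g : T' -> C) : measurable_fun setT g ->
      measurable_fun setT (fun x => (box a b n%:R (g x))%:E).
    by move=> mg; apply/measurable_EFinP; exact: (measurableT_comp (mbox a b n%:R) mg).
  have ms : measurable_fun setT (fun p : T * C => W p.1 + rscale k.+1%:R^-1 p.2).
    apply: measurable_complexD; first exact: (measurableT_comp mW).
    exact: (measurableT_comp (measurable_rscale _)).
  have ms2 : measurable_fun setT (fun p : C * C => p.1 + rscale k.+1%:R^-1 p.2).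
    apply: measurable_complexD => //.
    exact: (measurableT_comp (measurable_rscale _)).
  rewrite fubini_tonelli1//; [|exact: mE|by move=> p; rewrite lee_fin].
  rewrite [in RHS]fubini_tonelli1//; [|exact: mE|by move=> p; rewrite lee_fin].
  rewrite /fubini_F/= (smoothed_law mW cfW)// (smoothed_law (W := id) _ std_cnormal_cos)//.
have cv d' (T' : measurableType d') (P' : probability T' R) (V : T' -> C) :
    measurable_fun setT V ->
    (\int[(P' \x std_cnormal)]_p
      (box a b n%:R (V p.1 + rscale k.+1%:R^-1 p.2))%:E)%E @[k --> \oo] -->
    (\int[(P' \x std_cnormal)]_p (box a b n%:R (V p.1))%:E)%E.
  move=> mV; apply: (@bounded_cvg _ _ _ (P' \x std_cnormal)%E
    (fun k p => box a b n%:R (V p.1 + rscale k.+1%:R^-1 p.2)) (fun p => box a b n%:R (V p.1))).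
  - move=> k; apply: (measurableT_comp (mbox a b n%:R)).
    apply: measurable_complexD; first exact: (measurableT_comp mV).
    exact: (measurableT_comp (measurable_rscale _)).
  - by move=> k p; exact: box_norm.
  - move=> p.
    have h (u v x : R) : u - (v + k.+1%:R^-1 * x) @[k --> \oo] --> u - v.
      rewrite -[in X in _ --> X](addr0 v) -[in X in _ --> X](mul0r x).
      apply: cvgB; first exact: cvg_cst.
      apply: cvgD; first exact: cvg_cst.
      by apply: cvgM; [exact: cvg_harmonic|exact: cvg_cst].
    apply: cvgM.
      apply: (cvg_comp (fun k : nat => a - Re (V p.1 + rscale k.+1%:R^-1 p.2)) (ramp n%:R)); last exact: ramp_continuous.
      have := h a (Re (V p.1)) (Re p.2).
      by rewrite (_ : (fun k : nat => _) = (fun k : nat => a - Re (V p.1 + rscale k.+1%:R^-1 p.2)))//;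
        apply/funext => k; case: (V p.1).
    apply: (cvg_comp (fun k : nat => b - Im (V p.1 + rscale k.+1%:R^-1 p.2)) (ramp n%:R)); last exact: ramp_continuous.
    have := h b (Im (V p.1)) (Im p.2).
    by rewrite (_ : (fun k : nat => _) = (fun k : nat => b - Im (V p.1 + rscale k.+1%:R^-1 p.2)))//;
      apply/funext => k; case: (V p.1).
have E d' (T' : measurableType d') (P' : probability T' R) (V : T' -> C) :
    measurable_fun setT V ->
    (\int[(P' \x std_cnormal)]_p (box a b n%:R (V p.1))%:E =
     \int[P']_w (box a b n%:R (V w))%:E)%E.
  move=> mV; rewrite fubini_tonelli1//=.
  - apply: eq_integral => w _; rewrite /fubini_F/= integral_cst//.
    rewrite -[RHS]mule1; congr (_ * _)%E; exact: (@probability_setT _ _ _ std_cnormal).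
  - by apply/measurable_EFinP; apply: (measurableT_comp (mbox a b n%:R)); exact: (measurableT_comp mV).
  - by move=> p; rewrite lee_fin; case/andP: (box01 a b n (V p.1)).
rewrite -(E _ _ P W mW) -(E _ _ std_cnormal id)//.
apply: (cvg_unique _ (cv _ _ P W mW)) => //.
by rewrite (funext key); exact: (cv _ _ std_cnormal id).
Qed.

Let quad a b : set C := [set z | Re z < a /\ Im z < b].

Let mquad a b : measurable (quad a b).
Proof.
rewrite (_ : quad a b = Re @^-1` `]-oo, a[ `&` Im @^-1` `]-oo, b[).
  apply: measurableI.
    by have := measurable_cRe measurableT (measurable_itv `]-oo, a[); rewrite setTI.
  by have := measurable_cIm measurableT (measurable_itv `]-oo, b[); rewrite setTI.
by apply/seteqP; split => z /=; rewrite !in_itv.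
Qed.

Let law_quad a b : P (W @^-1` quad a b) = std_cnormal (quad a b).
Proof.
have cv d' (T' : measurableType d') (P' : probability T' R) (V : T' -> C) :
    measurable_fun setT V ->
    (\int[P']_w (box a b n%:R (V w))%:E)%E @[n --> \oo] --> P' (V @^-1` quad a b).
  move=> mV; have mVq : measurable (V @^-1` quad a b).
    by have := mV measurableT _ (mquad a b); rewrite setTI.
  rewrite (_ : P' _ = \int[P']_w (\1_(V @^-1` quad a b) w)%:E)%E; last first.
    by rewrite integral_indic// setIT.
  apply: (@bounded_cvg _ _ _ P' (fun n w => box a b n%:R (V w))).
  - by move=> n; exact: (measurableT_comp (mbox a b n%:R) mV).
  - by move=> n w; exact: box_norm.
  - move=> w; rewrite indicE.
    rewrite (_ : (_ \in _)%:R = (((0 < a - Re (V w))%R)%:R : R) * (((0 < b - Im (V w))%R)%:R)); last first.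
      rewrite -natrM mulnb !subr_gt0; congr ((nat_of_bool _)%:R).
      by apply/idP/andP => [/set_mem //|h]; exact/mem_set.
    by apply: cvgM; exact: ramp_cvg.
apply: (cvg_unique _ (cv _ _ P W mW)) => //.
by rewrite (funext (expect_box a b)); exact: (cv _ _ std_cnormal id).
Qed.

(** Uniqueness without Fourier inversion: smoothed laws agree, hence so do the expectations of
    continuous boxes, hence the masses of open quadrants, which form a generating class stable under
    intersection. *)
Lemma proper_normal_law A : measurable A -> P (W @^-1` A) = std_cnormal A.
Proof.
move=> mA.
pose X : {mfun T >-> C} := HB.pack W (isMeasurableFun.Build _ _ _ _ _ mW).
pose G := [set B : set C | exists a b, B = quad a b].
have GA : <<s G >> A.
  have qG a b : measurable (quad a b : set (g_sigma_algebraType G)).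
    by apply: sub_sigma_algebra; exists a, b.
  have mid : measurable_fun setT (id : g_sigma_algebraType G -> C).
    apply/measurable_fun_complexP; split.
      apply: measurable_fun_lt => a.
      rewrite (_ : _ @^-1` _ = \bigcup_n quad a n%:R); first exact: bigcupT_measurable.
      apply/seteqP; split => [z /=|z [n _ []]]; rewrite /= in_itv//= => za.
      by exists (Num.truncn (Im z)).+1 => //; split => //; exact: truncnS_gt.
    apply: measurable_fun_lt => b.
    rewrite (_ : _ @^-1` _ = \bigcup_n quad n%:R b); first exact: bigcupT_measurable.
    apply/seteqP; split => [z /=|z [n _ []]]; rewrite /= in_itv//= => za.
    by exists (Num.truncn (Re z)).+1 => //; split => //; exact: truncnS_gt.
  by have := mid measurableT A mA; rewrite setTI.
apply: (@g_sigma_algebra_measure_unique _ _ _ G _ (fun n => quad n%:R n%:R) _ _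
  (distribution P X) std_cnormal) GA => //.
- by move=> _ [a [b ->]].
- by move=> n; exists n%:R, n%:R.
- apply/seteqP; split => // z _.
  exists (maxn (Num.truncn (Re z)).+1 (Num.truncn (Im z)).+1) => //; split.
    by rewrite (lt_le_trans (truncnS_gt _))// ler_nat leq_maxl.
  by rewrite (lt_le_trans (truncnS_gt _))// ler_nat leq_maxr.
- move=> _ _ [a [b ->]] [a' [b' ->]]; exists (Num.min a a'), (Num.min b b').
  apply/seteqP; split => [z [[h1 h2] [h3 h4]]|z []]; first by split; rewrite lt_min ?h1 ?h2.
  by rewrite !lt_min => /andP[? ?] /andP[? ?].
- by move=> _ [a [b ->]]; exact: law_quad.
- by move=> n; rewrite (le_lt_trans (probability_le1 _ _))// ltry.
Qed.

End proper_normal_law_unique.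

Section noise_block.
Context {R : realType} {N NR : nat}.
Local Notation C := R[i].
Local Notation I := ('I_N * 'I_NR)%type.
Local Notation B := (N.-tuple (NR.-tuple C)).

Definition coord (y : B) (i : I) : C := tnth (tnth y i.1) i.2.

Definition block (f : I -> C) : B := [tuple [tuple f (n, l) | l < NR] | n < N].

Lemma coord_block f i : coord (block f) i = f i.
Proof. by rewrite /coord !tnth_mktuple; case: i. Qed.

Lemma measurable_coord i : measurable_fun setT (coord ^~ i).
Proof. exact: (measurableT_comp (measurable_tnth i.2) (measurable_tnth i.1)). Qed.

Lemma measurable_from_coord d (T : measurableType d) (f : T -> B) :
  (forall i, measurable_fun setT (coord ^~ i \o f)) -> measurable_fun setT f.
Proof.
move=> mf; apply/measurable_fun_tnthP => n; apply/measurable_fun_tnthP => l.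
exact: (mf (n, l)).
Qed.

Lemma measurable_block d (T : measurableType d) (f : I -> T -> C) :
  (forall i, measurable_fun setT (f i)) ->
  measurable_fun setT (fun w => block (f ^~ w)).
Proof.
move=> mf; apply: measurable_from_coord => i.
by rewrite (_ : _ \o _ = f i)//; apply/funext => w /=; rewrite coord_block.
Qed.

Definition noise_law : probability B R := tuple_power (tuple_power std_cnormal NR) N.

Lemma integral_noise_law_prod (f : I -> C -> R) (c : I -> R) :
  (forall i, measurable_fun setT (f i)) -> (forall i x, 0 <= f i x) ->
  (forall i, \int[std_cnormal]_x (f i x)%:E = (c i)%:E)%E ->
  (\int[noise_law]_y (\prod_i f i (coord y i))%:E = (\prod_i c i)%:E)%E.
Proof.
move=> mf f0 fc.
transitivity (\int[noise_law]_y (\prod_n (fun y => \prod_l f (n, l) (tnth y l)) (tnth y n))%:E)%E.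
  apply: eq_integral => y _; congr _%:E.
  by rewrite [RHS]pair_bigA; apply: eq_bigr => -[].
rewrite (@integral_tuple_power_prod _ _ R (tuple_power std_cnormal NR) N
  (fun n y => \prod_l f (n, l) (tnth y l)) (fun n => \prod_l c (n, l))).
- by rewrite pair_bigA/=; congr _%:E; apply: eq_bigr => -[].
- by move=> n; apply: (measurable_prod_tnth (f := fun l => f (n, l))) => l; exact: mf.
- by move=> n x; apply: prodr_ge0.
- by move=> n; apply: (integral_tuple_power_prod (f := fun l => f (n, l))).
Qed.

(** Cameron-Martin formula for a whole block; averaging the exponential factor over a random [x]
    gives [likelihood]. *)
Lemma noise_law_shift (x : I -> C) (F : B -> \bar R) :
  measurable_fun setT F -> (forall y, (0 <= F y)%E) ->
  (\int[noise_law]_y F (block (fun i => (coord y i + x i)%R)) =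
   \int[noise_law]_y (F y * (expR (\sum_i (2 * cdot (x i) (coord y i) - csq (x i))))%R%:E))%E.
Proof.
move=> mF F0.
have msh c : measurable_fun setT (fun z : C => z + c).
  by apply: measurable_complexD => //; exact: measurable_cst.
have mh c : measurable_fun setT (fun z : C => expR (2 * cdot c z - csq c)).
  apply: measurableT_comp => //; apply: measurable_funB => //.
  by apply: measurable_funM => //; apply: measurable_cdot => //; exact: measurable_cst.
have mtup n : measurable_fun setT (fun y : NR.-tuple C => [tuple tnth y l + x (n, l) | l < NR]).
  apply/measurable_fun_tnthP => l.
  rewrite (_ : _ \o _ = (fun z => z + x (n, l)) \o (fun y => tnth y l)).
    exact: (measurableT_comp (msh _) (measurable_tnth l)).
  by apply/funext => y /=; rewrite tnth_mktuple.
have := @tuple_power_shift _ _ R (tuple_power std_cnormal NR) N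
  (fun n y => [tuple tnth y l + x (n, l) | l < NR])
  (fun n y => \prod_l expR (2 * cdot (x (n, l)) (tnth y l) - csq (x (n, l))))
  mtup _ _ _ F mF F0.
rewrite -/noise_law => key.
transitivity (\int[noise_law]_y F [tuple [tuple (tnth (tnth y i) l + x (i, l))%R  | l < NR]  | i < N])%E.
  by apply: eq_integral.
rewrite key.
- apply: eq_integral => y _; congr (_ * _%:E)%E.
  rewrite expR_sum pair_bigA/=; apply: eq_bigr => -[n l] _ //.
- by move=> n; apply: (measurable_prod_tnth (f := fun l z => expR (2 * cdot (x (n, l)) z - csq (x (n, l))))) => l; exact: mh.
- by move=> n y; apply: prodr_ge0 => l _; exact: expR_ge0.
- move=> n G mG G0.
  apply: (@tuple_power_shift _ _ R std_cnormal NR (fun l z => z + x (n, l))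
    (fun l z => expR (2 * cdot (x (n, l)) z - csq (x (n, l))))) => //.
  by move=> l K mK K0; exact: std_cnormal_shift.
Qed.

Lemma noise_law_unique d (T : measurableType d) (P : probability T R) (V : I -> T -> C) :
  (forall i, measurable_fun setT (V i)) ->
  (forall i A, measurable A -> P (V i @^-1` A) = std_cnormal A) ->
  (forall A : I -> set C, (forall i, measurable (A i)) ->
    P [set w | forall i, A i (V i w)] = (\prod_i P (V i @^-1` A i))%E) ->
  forall A, measurable A -> P ((fun w => block (V ^~ w)) @^-1` A) = noise_law A.
Proof.
move=> mV lV iV.
have mX := measurable_block mV.
pose X : {mfun T >-> B} := HB.pack (fun w => block (V ^~ w)) (isMeasurableFun.Build _ _ _ _ _ mX).
apply: (@measure_unique_rect _ B _ C R I (fun i y => coord y i) measurable_coord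
  measurable_from_coord (distribution P X) noise_law) => A mA.
have mAi i : measurable (coord ^~ i @^-1` A i).
  by have := @measurable_coord i measurableT _ (mA i); rewrite setTI.
have E : [set x | forall i, A i (coord x i)] = \bigcap_(i in [set: I]) (coord ^~ i @^-1` A i).
  by apply/seteqP; split => [y h i _|y h i]; [exact: h|exact: h].
have mE : measurable [set x | forall i, A i (coord x i)].
  by rewrite E; apply: fin_bigcap_measurable => //; exact: finite_finset.
transitivity (\prod_i P (V i @^-1` A i))%E.
  rewrite -iV//; congr (P _).
  by apply/seteqP; split => w h i; have := h i; rewrite /= coord_block.
under eq_bigr do rewrite lV//.
have -> : noise_law [set x | forall i, A i (coord x i)] =
    (\int[noise_law]_y (\prod_i \1_(A i) (coord y i))%:E)%E.
  rewrite -[X in noise_law X]setIT -integral_indic//; apply: eq_integral => y _.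
  congr _%:E; rewrite indicE; have [h|h] := boolP (y \in _).
    by rewrite big1// => i _; rewrite indicE mem_set//; exact: (set_mem h i).
  have /existsNP[i hi] : ~ (forall i, A i (coord y i)) by move=> k; move/negP: h; apply; exact/mem_set.
  by rewrite (bigD1 i)//= indicE memNset// mul0r.
rewrite (integral_noise_law_prod (f := fun i => \1_(A i)) (c := fun i => fine (std_cnormal (A i)))).
- rewrite -prodEFin; apply: eq_bigr => i _; rewrite fineK//; exact: fin_num_measure.
- by move=> i; exact: measurable_indic.
- by move=> i z; rewrite indicE.
- move=> i; rewrite integral_indic// setIT fineK//; exact: fin_num_measure.
Qed.

End noise_block.

(** * Independence and expectations of products *)

Section independence.
Context d (T : measurableType d) (R : realType) (P : probability T R).

Section pair.
Context d1 d2 (T1 : measurableType d1) (T2 : measurableType d2).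
Variables (U : T -> T1) (V : T -> T2).
Hypotheses (mU : measurable_fun setT U) (mV : measurable_fun setT V).
Hypothesis UV : forall A B, measurable A -> measurable B ->
  P (U @^-1` A `&` V @^-1` B) = (P (U @^-1` A) * P (V @^-1` B))%E.

Let X : {mfun T >-> T1} := HB.pack U (isMeasurableFun.Build _ _ _ _ _ mU).
Let Y : {mfun T >-> T2} := HB.pack V (isMeasurableFun.Build _ _ _ _ _ mV).

Let mUV : measurable_fun setT (fun w => (U w, V w)).
Proof. exact: measurable_fun_pair. Qed.

Lemma law_pair_indep A : measurable A ->
  P ((fun w => (U w, V w)) @^-1` A) = (distribution P X \x distribution P Y)%E A.
Proof.
move=> mA; pose Z : {mfun T >-> (T1 * T2)%type} :=
  HB.pack (fun w => (U w, V w)) (isMeasurableFun.Build _ _ _ _ _ mUV).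
symmetry; apply: (@product_measure_unique _ _ _ _ R (distribution P X) (distribution P Y)
  (distribution P Z)) => //.
Qed.

Lemma ge0_integral_indep (f : T1 * T2 -> \bar R) :
  measurable_fun setT f -> (forall x, 0 <= f x)%E ->
  (\int[P]_w f (U w, V w) = \int[P]_w \int[P]_w' f (U w, V w'))%E.
Proof.
move=> mf f0; rewrite -(ge0_integral_image mUV law_pair_indep)// fubini_tonelli1//.
rewrite (@ge0_integral_image _ _ _ _ R P (distribution P X) U)//; last 2 first.
- exact: measurable_fun_fubini_tonelli_F.
- by move=> x; apply: integral_ge0.
apply: eq_integral => w _; rewrite /fubini_F.
rewrite (@ge0_integral_image _ _ _ _ R P (distribution P Y) V)//.
exact: (measurableT_comp mf (pair1_measurable _)).
Qed.

End pair.

Lemma Rintegral_mul_indep (X Y : T -> R) :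
  measurable_fun setT X -> measurable_fun setT Y ->
  P.-integrable setT (EFin \o (fun w => X w ^+ 2)) ->
  P.-integrable setT (EFin \o (fun w => Y w ^+ 2)) ->
  (forall A B, measurable A -> measurable B ->
    P (X @^-1` A `&` Y @^-1` B) = (P (X @^-1` A) * P (Y @^-1` B))%E) ->
  \int[P]_w (X w * Y w) = (\int[P]_w X w) * (\int[P]_w Y w).
Proof.
move=> mX mY IX IY XY.
have mU : measurable_fun setT (X : T -> measurableTypeR R) by [].
have mV : measurable_fun setT (Y : T -> measurableTypeR R) by [].
pose U : {mfun T >-> measurableTypeR R} := HB.pack (X : T -> measurableTypeR R) (isMeasurableFun.Build _ _ _ _ _ mU).
pose V : {mfun T >-> measurableTypeR R} := HB.pack (Y : T -> measurableTypeR R) (isMeasurableFun.Build _ _ _ _ _ mV).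
have mUV : measurable_fun setT (fun w => (U w, V w)) by exact: measurable_fun_pair.
have law := law_pair_indep mU mV XY.
have mf : measurable_fun setT (fun p : measurableTypeR R * measurableTypeR R => (p.1 * p.2)%:E).
  by apply/measurable_EFinP; apply: measurable_funM.
have Ip : (distribution P U \x distribution P V)%E.-integrable setT (fun p => (p.1 * p.2)%:E).
  apply/(integrable_image mUV law mf).
  apply: (@le_EFin_integrable _ _ _ P setT measurableT _ (fun w => X w ^+ 2 + Y w ^+ 2)).
  - exact: measurable_funM.
  - by move=> w _; rewrite ler_norml; have := sqr_ge0 (X w + Y w); have := sqr_ge0 (X w - Y w);
      have := sqr_ge0 (X w); have := sqr_ge0 (Y w); rewrite /=; nra.
  - exact: integrable_EFinD.
have mid : measurable_fun setT (fun x : measurableTypeR R => x%:E) by exact/measurable_EFinP.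
have I1 (Z : T -> R) : measurable_fun setT Z -> P.-integrable setT (EFin \o (fun w => Z w ^+ 2)) ->
    P.-integrable setT (EFin \o Z).
  move=> mZ IZ.
  apply: (@le_EFin_integrable _ _ _ P setT measurableT _ (fun w => Z w ^+ 2 + 1)) => //.
    by move=> w _; rewrite ler_norml; have := sqr_ge0 (Z w - 1); have := sqr_ge0 (Z w + 1); nra.
  apply: integrable_EFinD => //; exact: (@finite_measure_integrable_cst _ _ _ P setT 1).
have IVd : (distribution P V).-integrable setT (fun x : measurableTypeR R => x%:E).
  by apply/(@integrable_image _ _ _ _ R P (distribution P V) V) => //; exact: I1.
rewrite /Rintegral -(integral_image mUV law mf) -integral12_prod_meas1//.
transitivity (fine (\int[distribution P U]_x (x * \int[P]_w Y w)%:E)%E).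
  congr fine; apply: eq_integral => x _; rewrite /fubini_F/=.
  under eq_integral do rewrite EFinM.
  rewrite integralZl// EFinM; congr (_ * _)%E.
  rewrite (@integral_image _ _ _ _ R P (distribution P V) V)//.
  by rewrite EFin_Rintegral//; exact: I1.
rewrite (@integral_image _ _ _ _ R P (distribution P U) U)//; last first.
  by apply/measurable_EFinP; apply: measurable_funM.
by rewrite -[LHS]/(\int[P]_w (X w * _)) RintegralZr//; exact: I1.
Qed.

End independence.

(** * Likelihood of a Gaussian vector in white noise *)

Section hermitian.
Variables (K : numClosedFieldType) (I : finType).
Implicit Types (A U V : I -> I -> K).

Lemma parseval V (g h : I -> K) :
  (forall k l, \sum_i V k i * (V l i)^* = (k == l)%:R) ->
  \sum_i (\sum_k g k * V k i) * (\sum_k h k * V k i)^* = \sum_k g k * (h k)^*.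
Proof.
move=> VV.
transitivity (\sum_k \sum_l g k * (h l)^* * \sum_i V k i * (V l i)^*).
  under [RHS]eq_bigr do under eq_bigr do rewrite mulr_sumr.
  under [RHS]eq_bigr do rewrite exchange_big/=.
  rewrite [RHS]exchange_big/=; apply: eq_bigr => i _.
  rewrite mulr_suml; apply: eq_bigr => k _; rewrite rmorph_sum mulr_sumr.
  by apply: eq_bigr => l _; rewrite rmorphM; ring.
apply: eq_bigr => k _; rewrite (bigD1 k)//= VV eqxx mulr1 big1 ?addr0// => l lk.
by rewrite VV eq_sym (negbTE lk) mulr0.
Qed.

(** The spectral theorem for matrices, transported to functions on a finite type. Orthonormality of
    the rows serves the traces and quadratic forms, that of the columns the change of coordinates of
    vectors. *)
Lemma hermitian_diagonalization A : (forall i j, A j i = (A i j)^*) ->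
  exists U (d : I -> K),
  [/\ forall k, d k \is Num.real,
      forall k l, \sum_i U k i * (U l i)^* = (k == l)%:R,
      forall i j, \sum_k U k i * (U k j)^* = (i == j)%:R &
      forall i j, A i j = \sum_k (U k i)^* * d k * U k j].
Proof.
move=> hA; pose n := #|I|.
pose B : 'M[K]_n := \matrix_(i, j) A (enum_val i) (enum_val j).
have hB : B \is hermsymmx.
  by apply/is_hermitianmxP; rewrite expr0 scale1r; apply/matrixP => i j; rewrite !mxE.
set S := spectralmx B; have uS : S \is unitarymx := spectral_unitarymx B.
have sumE (F : I -> K) : \sum_i F i = \sum_(i < n) F (enum_val i).
  by rewrite /n -(big_enum_val F).
exists (fun k i => S (enum_rank k) (enum_rank i)), (fun k => spectral_diag B 0 (enum_rank k)).
split.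
- by move=> k; have /mxOverP := hermitian_spectral_diag_real hB; apply.
- move=> k l; rewrite sumE; have /unitarymxP/matrixP/(_ (enum_rank k) (enum_rank l)) := uS.
  rewrite !mxE (inj_eq enum_rank_inj) => <-; apply: eq_bigr => i _.
  by rewrite !enum_valK !mxE.
- move=> i j; rewrite sumE.
  have : S^T \is unitarymx by rewrite trmx_unitary.
  move=> /unitarymxP/matrixP/(_ (enum_rank i) (enum_rank j)).
  rewrite !mxE (inj_eq enum_rank_inj) => <-; apply: eq_bigr => k _.
  by rewrite !enum_valK !mxE.
- move=> i j; have /orthomx_spectralP := hermitian_normalmx hB.
  rewrite invmx_unitary// -/S => /matrixP/(_ (enum_rank i) (enum_rank j)).
  rewrite !mxE !enum_rankK => ->; rewrite sumE; apply: eq_bigr => k _.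
  by rewrite mul_mx_diag !mxE !enum_valK.
Qed.

Section diagonal.
Variables (A U : I -> I -> K) (d : I -> K).
Hypothesis d_real : forall k, d k \is Num.real.
Hypothesis UU : forall k l, \sum_i U k i * (U l i)^* = (k == l)%:R.
Hypothesis AE : forall i j, A i j = \sum_k (U k i)^* * d k * U k j.

Lemma diagonal_quad (g : I -> K) (w := fun i => \sum_k g k * U k i) :
  \sum_i \sum_j w i * A i j * (w j)^* = \sum_k g k * (g k)^* * d k.
Proof.
transitivity (\sum_i w i * (\sum_k (d k * g k) * U k i)^*).
  apply: eq_bigr => i _; under eq_bigr do rewrite -mulrA.
  rewrite -mulr_sumr; congr (_ * _); under eq_bigr do rewrite AE.
  rewrite parseval// rmorph_sum; apply: eq_bigr => k _.
  by rewrite !rmorphM/= (CrealP (d_real k)); ring.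
rewrite parseval//; apply: eq_bigr => k _.
by rewrite rmorphM/= (CrealP (d_real k)); ring.
Qed.

Lemma diagonal_trace : \sum_i A i i = \sum_k d k.
Proof.
under eq_bigr do rewrite AE; rewrite exchange_big/=; apply: eq_bigr => k _.
transitivity (d k * \sum_i U k i * (U k i)^*); last by rewrite UU eqxx mulr1.
by rewrite mulr_sumr; apply: eq_bigr => i _; ring.
Qed.

Lemma diagonal_frobenius : \sum_i \sum_j A i j * (A i j)^* = \sum_k d k ^+ 2.
Proof.
transitivity (\sum_i \sum_k d k ^+ 2 * (U k i * (U k i)^*)).
  apply: eq_bigr => i _; under eq_bigr do rewrite AE.
  rewrite parseval//; apply: eq_bigr => k _.
  by rewrite rmorphM/= (CrealP (d_real k)) conjCK; ring.
rewrite exchange_big/=; apply: eq_bigr => k _.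
by rewrite -mulr_sumr UU eqxx mulr1.
Qed.

End diagonal.

End hermitian.

Section complex_hermitian.
Context {R : realType} {I : finType}.
Local Notation C := R[i].
Local Notation Re := (@complex.Re R).
Local Notation Im := (@complex.Im R).

Lemma Re_sum (J : Type) (s : seq J) (P : pred J) (F : J -> C) :
  Re (\sum_(j <- s | P j) F j) = \sum_(j <- s | P j) Re (F j).
Proof. by apply: (big_morph Re) => // -[? ?] [? ?]. Qed.

Lemma Im_sum (J : Type) (s : seq J) (P : pred J) (F : J -> C) :
  Im (\sum_(j <- s | P j) F j) = \sum_(j <- s | P j) Im (F j).
Proof. by apply: (big_morph Im) => // -[? ?] [? ?]. Qed.

Lemma Re_conjM (u z : C) : Re (u * z^*) = cdot u z.
Proof. by case: u z => ? ? [? ?]; rewrite /cdot /=; ring. Qed.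

Lemma mul_conj (z : C) : z * z^* = (csq z)%:C%C.
Proof. by case: z => a b; rewrite /csq /=; apply/eqP; rewrite eq_complex /=; apply/andP; split; apply/eqP; ring. Qed.

Lemma cdotzz (z : C) : cdot z z = csq z. Proof. by rewrite /cdot /csq; ring. Qed.

(** The conjugate falls on the second factor so that, for [A i j] the expectation of [X i] times the
    conjugate of [X j], this is the mean squared modulus of [\sum_i w i * X i]. *)
Definition quad (A : I -> I -> C) (w : I -> C) : R :=
  Re (\sum_i \sum_j w i * A i j * (w j)^*).

Lemma hermitian_coordinates (A : I -> I -> C) :
  (forall i j, A j i = (A i j)^*) ->
  exists (U : I -> I -> C) (d : I -> R),
  [/\ forall g, quad A (fun i => \sum_k g k * U k i) = \sum_k csq (g k) * d k,
      forall x y, \sum_k cdot (\sum_i U k i * x i) (\sum_i U k i * y i) =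
        \sum_i cdot (x i) (y i),
      forall k, \sum_i csq (U k i) = 1,
      \sum_i Re (A i i) = \sum_k d k &
      \sum_i \sum_j csq (A i j) = \sum_k d k ^+ 2].
Proof.
move=> hA; have [U [d [dR UU UU' AE]]] := hermitian_diagonalization hA.
have dE k : d k = (Re (d k))%:C%C by rewrite RRe_real.
exists U, (fun k => Re (d k)); split.
- move=> g; rewrite /quad (diagonal_quad dR UU AE) Re_sum; apply: eq_bigr => k _.
  by rewrite mul_conj dE /=; ring.
- move=> x y; under [RHS]eq_bigr do rewrite -Re_conjM.
  rewrite -Re_sum -(parseval (V := fun i k => U k i))// Re_sum.
  apply: eq_bigr => k _; rewrite -Re_conjM.
  by congr (Re (_ * _^*)); apply: eq_bigr => i _; rewrite mulrC.
- move=> k; have := UU k k; under eq_bigr do rewrite mul_conj.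
  by rewrite eqxx => /(congr1 Re); rewrite Re_sum.
- by rewrite -Re_sum (diagonal_trace UU AE) Re_sum.
- have /(congr1 Re) := diagonal_frobenius dR UU AE.
  rewrite !Re_sum; under eq_bigr do rewrite Re_sum; under eq_bigr do under eq_bigr do rewrite mul_conj.
  by move=> ->; apply: eq_bigr => k _; rewrite dE /= expr2 /=; ring.
Qed.

End complex_hermitian.

Lemma big_pair_bool (V : Type) (idx : V) (op : Monoid.com_law idx) (I : finType)
    (F : I * bool -> V) :
  \big[op/idx]_k F k = \big[op/idx]_i op (F (i, true)) (F (i, false)).
Proof.
transitivity (\big[op/idx]_i \big[op/idx]_b F (i, b)).
  by rewrite pair_bigA; apply: eq_bigr => -[].
by apply: eq_bigr => i _; rewrite big_bool.
Qed.

Section gaussian_likelihood.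
Context (R : realType) (I : finType).
Local Notation C := R[i].
Local Notation Re := (@complex.Re R).
Local Notation Im := (@complex.Im R).

(** Density at [y] of [X] plus standard noise with respect to the law of the noise: the
    Cameron-Martin factor averaged over [X]. *)
Definition likelihood d (T : measurableType d) (P : probability T R)
    (X : I -> T -> C) (y : I -> C) : R :=
  \int[P]_w expR (\sum_i (2 * cdot (X i w) (y i) - csq (X i w))).

(** Characteristic function of a centred proper complex Gaussian vector of covariance [A]: the real
    part of a linear form has variance [quad A c / 2], whence the 4. Singular [A] is allowed. *)
Definition gaussian_vector d (T : measurableType d) (P : probability T R)
    (A : I -> I -> C) (X : I -> T -> C) :=
  forall (c : I -> C) (th : R),
  \int[P]_w cos (Re (\sum_i c i * X i w) + th) =
  expR (- (quad A c / 4)) * cos th.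

Variable A : I -> I -> C.
Hypothesis hA : forall i j, A j i = (A i j)^*.
Hypothesis A_psd : forall c, 0 <= quad A c.

(** In an eigenbasis of [A] the real and imaginary parts of the coordinates of [X] have the
    characteristic function of independent normals of variance [v k / 2], so [gaussian_smoothing]
    applies. [U] and [v] are chosen before [P] and [X], hence the same formula holds for every
    Gaussian vector of covariance [A]. *)
Lemma likelihood_eigen : exists (U : I -> I -> C) (v : I -> R),
  [/\ forall k, 0 <= v k,
      forall k, quad A (U k) = v k,
      forall k, \sum_i csq (U k i) = 1,
      \sum_i Re (A i i) = \sum_k v k /\ \sum_i \sum_j csq (A i j) = \sum_k v k ^+ 2 &
      forall d (T : measurableType d) (P : probability T R) (X : I -> T -> C),
        (forall i, measurable_fun setT (X i)) -> gaussian_vector P A X ->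
        forall y, likelihood P X y =
        \prod_k ((1 + v k)^-1 * expR (csq (\sum_i U k i * y i) * (v k / (1 + v k))))].
Proof.
have [U [v [qU dU U1 trA frA]]] := hermitian_coordinates hA.
have qUv k : quad A (U k) = v k.
  transitivity (quad A (fun i => \sum_l (l == k)%:R * U l i)).
    congr (quad A _); apply/funext => i; rewrite (bigD1 k)//= eqxx mul1r big1 ?addr0//.
    by move=> l /negbTE ->; rewrite mul0r.
  rewrite qU (bigD1 k)//= eqxx big1 ?addr0; last first.
    by move=> l /negbTE ->; rewrite /csq /= expr0n /= addr0 mul0r.
  by rewrite (_ : csq _ = 1) ?mul1r; last by rewrite /csq /=; ring.
have v0 k : 0 <= v k by rewrite -qUv.
exists U, v; split=> // d T P X mX gX y.
pose xi (k : I) w := \sum_i U k i * X i w.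
pose eta k := \sum_i U k i * y i.
have mxi k : measurable_fun setT (xi k).
  by apply: measurable_complex_sum => i; apply: measurable_complexM => //; exact: measurable_cst.
pose re (k : I * bool) (z : C) := if k.2 then Re z else Im z.
have mre k : measurable_fun setT (fun w => re k (xi k.1 w)).
  case: k => k [] /=.
    exact: (measurableT_comp measurable_cRe (mxi k)).
  exact: (measurableT_comp measurable_cIm (mxi k)).
have cf (c : I * bool -> R) (th : R) :
    \int[P]_w cos (\sum_k c k * re k (xi k.1 w) + th) =
    expR (- (\sum_k v k.1 * c k ^+ 2) / 4) * cos th.
  (* This coefficient turns a real combination of the real and imaginary parts of [xi k w] into the
     real part of a complex multiple. *)
  pose g k : C := (c (k, true) +i* - c (k, false))%C.
  transitivity (\int[P]_w cos (Re (\sum_i (\sum_k g k * U k i) * X i w) + th)).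
    apply: eq_Rintegral => w _; congr (cos (_ + _)).
    rewrite big_pair_bool.
    transitivity (\sum_k Re (g k * xi k w)).
      apply: eq_bigr => k _; rewrite /re /=.
      by case: (xi k w) => a b /=; ring.
    rewrite -Re_sum; congr Re; rewrite /xi.
    under eq_bigr do rewrite mulr_sumr.
    by rewrite exchange_big/=; apply: eq_bigr => i _; rewrite mulr_suml; apply: eq_bigr => k _; rewrite mulrA.
  rewrite gX qU big_pair_bool mulNr.
  congr (_ * _); congr expR; congr (- _).
  by congr (_ * _); apply: eq_bigr => k _; rewrite /csq /g /=; ring.
have := gaussian_smoothing mre (fun k => v0 k.1) cf (fun k => re k (eta k.1)).
rewrite [RHS]big_pair_bool => smooth.
(* Twice the inner product of x and y minus |x|^2 is |y|^2 - |y - x|^2, and the unitary change of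
   basis preserves the sum over coordinates. *)
transitivity (expR (\sum_k csq (eta k)) * \int[P]_w (\prod_k expR (- (re k (eta k.1) - re k (xi k.1 w)) ^+ 2))).
  rewrite -RintegralZl//; last first.
    apply: measurable_bounded_integrable => //.
    - exact: le_lt_trans (probability_le1 _ _) (ltry _).
    - apply: measurable_prod => k _; apply: measurableT_comp => //; apply: measurableT_comp => //.
      by apply: measurable_funX; apply: measurable_funB.
    - exists 1; split; [exact: num_real|move=> x x1 w _ /=].
      rewrite ger0_norm ?prodr_ge0//.
      rewrite (le_trans _ (ltW x1))// prodr_ile1// => k _.
      by rewrite expR_ge0/= -expR0 ler_expR oppr_le0 sqr_ge0.
  apply: eq_Rintegral => w _; rewrite -expR_sum -expRD; congr expR.
  rewrite big_pair_bool.
  transitivity (\sum_k (2 * cdot (xi k w) (eta k) - csq (xi k w))).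
    rewrite !sumrB -!mulr_sumr dU; congr (_ - _).
    by under [RHS]eq_bigr do rewrite -cdotzz; rewrite dU; apply: eq_bigr => i _; rewrite cdotzz.
  rewrite -big_split; apply: eq_bigr => k _; rewrite /re /cdot /csq /=; ring.
rewrite smooth expR_sum -big_split; apply: eq_bigr => k _ /=.
have v1 : 0 < 1 + v k by rewrite ltr_pwDl.
rewrite /re /= mulrACA -expRD -invfM -expr2 sqr_sqrtr ?(ltW v1)//.
rewrite mulrCA -expRD; congr (_ * expR _); rewrite -/(eta k) /csq; field.
by rewrite gt_eqF.
Qed.

End gaussian_likelihood.

(** * Elementary inequalities for [ln] and [expR] *)

Section elementary_bounds.
Context {R : realType}.

Lemma ge0_of_derive (f df : R -> R) (v : R) :
  (forall x : R, 0 <= x -> is_derive x (1 : R) f (df x)) ->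
  (forall x : R, 0 <= x -> 0 <= df x) -> f 0 = 0 -> 0 <= v -> 0 <= f v.
Proof.
move=> Df df0 f0 v0.
have [] := @MVT_segment R f df 0 v v0.
- by move=> x; rewrite in_itv/= => /andP[/ltW x0 _]; exact: Df.
- apply: derivable_within_continuous => x; rewrite in_itv/= => /andP[x0 _].
  exact: (@ex_derive _ _ _ _ _ _ _ (Df x x0)).
- move=> c; rewrite in_itv/= => /andP[c0 _]; rewrite f0 !subr0 => ->.
  by rewrite mulr_ge0// df0.
Qed.

Lemma ln1D_ge (v : R) : 0 <= v -> v - ln (1 + v) <= v ^+ 2 / 2.
Proof.
move=> v0; rewrite -subr_ge0.
pose f (x : R) := x ^+ 2 / 2 - x + ln (1 + x).
have -> : v ^+ 2 / 2 - (v - ln (1 + v)) = f v by rewrite /f; ring.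
apply: (@ge0_of_derive f (fun x => x ^+ 2 / (1 + x)) v _ _ _ v0).
- move=> x x0; have x1 : 0 < 1 + x by rewrite ltr_pwDl.
  have := is_derive1_ln x1 => ?.
  have : is_derive x (1 : R) (@ln R \o (fun x : R => 1 + x)) ((1 + x)^-1 * (0 + 1)).
    by apply: is_derive1_comp.
  move=> ?; rewrite /f; apply: is_derive_eq.
  by rewrite /GRing.scale/=; field; rewrite gt_eqF.
- by move=> x x0; rewrite divr_ge0 ?sqr_ge0// addr_ge0.
- by rewrite /f addr0 ln1; ring.
Qed.

(** The difference has derivative [x ^+ 3 / (1 + x)]; in [ln1D_ge] it is [x ^+ 2 / (1 + x)]. The two
    bounds produce the factors 1/2 and 1/3 of the information bounds. *)
Lemma ln1D_le (v : R) : 0 <= v -> v ^+ 2 / 2 - v ^+ 3 / 3 <= v - ln (1 + v).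
Proof.
move=> v0; rewrite -subr_ge0.
pose f (x : R) := x - x ^+ 2 / 2 + x ^+ 3 / 3 - ln (1 + x).
have -> : v - ln (1 + v) - (v ^+ 2 / 2 - v ^+ 3 / 3) = f v by rewrite /f; ring.
apply: (@ge0_of_derive f (fun x => x ^+ 3 / (1 + x)) v _ _ _ v0).
- move=> x x0; have x1 : 0 < 1 + x by rewrite ltr_pwDl.
  have := is_derive1_ln x1 => ?.
  have : is_derive x (1 : R) (@ln R \o (fun x : R => 1 + x)) ((1 + x)^-1 * (0 + 1)).
    by apply: is_derive1_comp.
  move=> ?; rewrite /f; apply: is_derive_eq.
  by rewrite /GRing.scale/=; field; rewrite gt_eqF.
- by move=> x x0; rewrite divr_ge0 ?exprn_ge0// addr_ge0.
- by rewrite /f addr0 ln1; ring.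
Qed.

(** For nonnegative [x], the bound [expR y <= 1 + y * expR y] is integrated twice; for negative [x]
    the quadratic Taylor polynomial is itself an upper bound. The remainder has a form that an
    exponential moment can absorb. *)
Lemma expR_le_taylor2 (x : R) :
  expR x <= 1 + x + x ^+ 2 / 2 + `|x| ^+ 3 * expR `|x|.
Proof.
have L1 (y : R) : 0 <= y -> expR y <= 1 + y * expR y.
  move=> y0; have := expR_ge1Dx (- y); have e0 := expR_gt0 y; rewrite expRN => h.
  have := ler_wpM2l (ltW e0) h; rewrite mulfV ?gt_eqF//; nra.
have L2 (y : R) : 0 <= y -> 0 <= 1 + y + y ^+ 2 * expR y - expR y.
  apply: (@ge0_of_derive (fun y => 1 + y + y ^+ 2 * expR y - expR y)
    (fun y => 1 + 2 * y * expR y + y ^+ 2 * expR y - expR y)).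
  - by move=> z z0; apply: is_derive_eq; rewrite /GRing.scale/=; ring.
  - by move=> z z0; have := L1 z z0; have := expR_gt0 z; nra.
  - by rewrite expR0; ring.
have [x0|x0] := leP 0 x.
  rewrite ger0_norm// -subr_ge0.
  apply: (@ge0_of_derive (fun y => 1 + y + y ^+ 2 / 2 + y ^+ 3 * expR y - expR y)
    (fun y => 1 + y + 3 * y ^+ 2 * expR y + y ^+ 3 * expR y - expR y)) x0.
  - by move=> z z0; apply: is_derive_eq; rewrite /GRing.scale/=; field.
  - move=> z z0; have := L2 z z0; have := expR_gt0 z => e0.
    have h1 : 0 <= z ^+ 2 * expR z by rewrite mulr_ge0 ?sqr_ge0 ?expR_ge0.
    have h2 : 0 <= z ^+ 3 * expR z by rewrite mulr_ge0 ?exprn_ge0 ?expR_ge0.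
    lra.
  - by rewrite expR0; ring.
have {x0}y0 : 0 <= - x by rewrite oppr_ge0 ltW.
have : 0 <= 1 - (- x) + (- x) ^+ 2 / 2 - expR (- (- x)).
  apply: (@ge0_of_derive (fun y => 1 - y + y ^+ 2 / 2 - expR (- y))
    (fun y => - 1 + y + expR (- y))) y0.
  - by move=> z z0; apply: is_derive_eq; rewrite /GRing.scale/=; field.
  - by move=> z z0; have := expR_ge1Dx (- z); lra.
  - by rewrite oppr0 expR0; ring.
rewrite opprK sqrrN => h.
have : 0 <= `|x| ^+ 3 * expR `|x| by rewrite mulr_ge0 ?exprn_ge0 ?expR_ge0.
lra.
Qed.

End elementary_bounds.

Lemma Rintegral_prob_cst d (T : measurableType d) (R : realType) (P : probability T R) (c : R) :
  \int[P]_x c = c.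
Proof.
rewrite Rintegral_cst// -[RHS]mulr1; congr (_ * _).
exact: (congr1 fine (@probability_setT _ _ _ P)).
Qed.

Lemma integrable_prob_cst d (T : measurableType d) (R : realType) (P : probability T R) (c : R) :
  P.-integrable setT (EFin \o (fun=> c)).
Proof. exact: (@finite_measure_integrable_cst _ _ _ P setT c). Qed.

Lemma integral_prob_cst d (T : measurableType d) (R : realType) (P : probability T R) (c : R) :
  (\int[P]_x c%:E = c%:E)%E.
Proof.
by rewrite -(EFin_Rintegral _ (integrable_prob_cst P c))// Rintegral_prob_cst.
Qed.

(** * Bounds on the likelihood and expectation of its logarithm *)

Section likelihood_integral.
Context d (T : measurableType d) (R : realType) (P : probability T R) (I : finType).
Local Notation C := R[i].
Variable X : I -> T -> C.
Hypothesis mX : forall i, measurable_fun setT (X i).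

Lemma likelihood_exponent_le (y : I -> C) w :
  \sum_i (2 * cdot (X i w) (y i) - csq (X i w)) <= \sum_i csq (y i).
Proof.
apply: ler_sum => i _.
by have := csq_ge0 (X i w - y i); rewrite csqB; lra.
Qed.

Lemma measurable_likelihood_exponent d' (S : measurableType d') (U V : I -> S -> C) :
  (forall i, measurable_fun setT (U i)) -> (forall i, measurable_fun setT (V i)) ->
  measurable_fun setT (fun s => expR (\sum_i (2 * cdot (U i s) (V i s) - csq (U i s)))).
Proof.
move=> mU mV; apply: measurableT_comp => //; apply: measurable_sum => i.
apply: measurable_funB.
  by apply: measurable_funM => //; exact: measurable_cdot.
exact: (measurableT_comp measurable_csq).
Qed.

Lemma integrable_likelihood (y : I -> C) :
  P.-integrable setT (EFin \o
    (fun w => expR (\sum_i (2 * cdot (X i w) (y i) - csq (X i w))))).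
Proof.
apply: (@le_EFin_integrable _ _ _ P setT measurableT _ (fun=> expR (\sum_i csq (y i)))).
- by apply: measurable_likelihood_exponent => // i; exact: measurable_cst.
- by move=> w _; rewrite ger0_norm ?expR_ge0// ler_expR likelihood_exponent_le.
- exact: integrable_prob_cst.
Qed.

Lemma EFin_likelihood y : ((likelihood P X y)%:E =
  \int[P]_w (expR (\sum_i (2 * cdot (X i w) (y i) - csq (X i w))))%:E)%E.
Proof. exact/EFin_Rintegral/integrable_likelihood. Qed.

Lemma likelihood_le y : likelihood P X y <= expR (\sum_i csq (y i)).
Proof.
rewrite -[leRHS](Rintegral_prob_cst P).
apply: le_Rintegral => //.
- exact: integrable_likelihood.
- exact: integrable_prob_cst.
- by move=> w _; rewrite ler_expR likelihood_exponent_le.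
Qed.

End likelihood_integral.

Section likelihood_facts.
Context (R : realType) (I : finType).
Local Notation C := R[i].
Local Notation Re := (@complex.Re R).
Variable A : I -> I -> C.
Hypothesis hA : forall i j, A j i = (A i j)^*.
Hypothesis A_psd : forall c, 0 <= quad A c.

(** By [likelihood_eigen] the likelihood depends on the covariance only. This is how a block at a
    later time comes to have the same transition density. *)
Lemma likelihood_unique d (T : measurableType d) (P : probability T R) (X : I -> T -> C)
    d' (T' : measurableType d') (P' : probability T' R) (X' : I -> T' -> C) :
  (forall i, measurable_fun setT (X i)) -> gaussian_vector P A X ->
  (forall i, measurable_fun setT (X' i)) -> gaussian_vector P' A X' ->
  likelihood P X = likelihood P' X'.
Proof.
move=> mX gX mX' gX'; have [U [v [_ _ _ _ LE]]] := likelihood_eigen hA A_psd.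
by apply/funext => y; rewrite (LE _ _ P X)// (LE _ _ P' X').
Qed.

Variables (d : measure_display) (T : measurableType d) (P : probability T R).
Variable X : I -> T -> C.
Hypothesis mX : forall i, measurable_fun setT (X i).
Hypothesis gX : gaussian_vector P A X.

(** Each eigenvalue contributes at least [(1 + v k)^-1 >= expR (- v k)], uniformly in [y]. Such a
    floor keeps logarithms of densities integrable. *)
Lemma likelihood_ge y : expR (- \sum_i Re (A i i)) <= likelihood P X y.
Proof.
have [U [v [v0 _ _ [-> _] LE]]] := likelihood_eigen hA A_psd.
rewrite (LE _ _ P X)// -sumrN expR_sum; apply: ler_prod => k _.
have v1 : 0 < 1 + v k by rewrite ltr_pwDl.
rewrite expR_ge0/= (@le_trans _ _ (1 + v k)^-1)//.
  by rewrite expRN lef_pV2 ?posrE ?expR_gt0// expR_ge1Dx.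
rewrite ler_peMr ?invr_ge0 ?(ltW v1)// -[leLHS]expR0 ler_expR mulr_ge0 ?csq_ge0//.
by rewrite divr_ge0 ?(ltW v1).
Qed.

Lemma likelihood_gt0 y : 0 < likelihood P X y.
Proof. exact: lt_le_trans (expR_gt0 _) (likelihood_ge y). Qed.

(** The logarithm is a constant plus a quadratic form in [Y], so only second moments of [Y] enter.
    In the eigenbasis the squared coordinates have mean [1 + v k], and the expectation is exactly
    the sum of [v k - ln (1 + v k)]; the cubes are bounded by
    [v k ^+ 3 <= (\sum_i v i) * v k ^+ 2]. *)
Lemma expect_ln_likelihood d' (T' : measurableType d') (P' : probability T' R)
    (Y : I -> T' -> C) (F := \sum_i \sum_j csq (A i j)) :
  (forall i, measurable_fun setT (Y i)) ->
  (forall u, \int[P']_w (csq (\sum_i u i * Y i w))%:E =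
    (quad A u + \sum_i csq (u i))%:E)%E ->
  let E := \int[P']_w ln (likelihood P X (Y ^~ w)) in
  [/\ P'.-integrable setT (EFin \o (fun w => ln (likelihood P X (Y ^~ w)))),
      E <= F / 2 & F / 2 - (\sum_i Re (A i i)) * F / 3 <= E].
Proof.
move=> mY EY E.
have [U [v [v0 qU U1 [trE FE] LE]]] := likelihood_eigen hA A_psd.
have v1 k : 0 < 1 + v k by rewrite ltr_pwDl.
pose s k w := csq (\sum_i U k i * Y i w).
have lnE w : ln (likelihood P X (Y ^~ w)) =
    \sum_k (s k w * (v k / (1 + v k)) - ln (1 + v k)).
  rewrite (LE _ _ P X)// -[RHS]expRK expR_sum; congr ln; apply: eq_bigr => k _.
  by rewrite expRD expRN lnK ?posrE// mulrC.
have ms k : measurable_fun setT (s k).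
  apply: (measurableT_comp measurable_csq).
  by apply: measurable_complex_sum => i; apply: measurable_complexM => //; exact: measurable_cst.
have Es k : (\int[P']_w (s k w)%:E = (1 + v k)%:E)%E by rewrite EY qU U1 addrC.
have Is k : P'.-integrable setT (EFin \o s k).
  by apply: (ge0_Rintegrable (ms k) _ (Es k)) => w; exact: csq_ge0.
have Ik k : P'.-integrable setT (EFin \o (fun w => s k w * (v k / (1 + v k)) - ln (1 + v k))).
  apply: integrable_EFinB => //; first exact: integrable_EFinZr.
  exact: integrable_prob_cst.
have EE : E = \sum_k (v k - ln (1 + v k)).
  rewrite /E (_ : (fun w => _) = (fun w => \sum_k (s k w * (v k / (1 + v k)) - ln (1 + v k)))); last exact/funext.
  rewrite Rintegral_sum//; apply: eq_bigr => k _.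
  rewrite RintegralB//; [|exact: integrable_EFinZr|exact: integrable_prob_cst].
  rewrite RintegralZr// Rintegral_prob_cst /Rintegral Es/=.
  by congr (_ - _); field; rewrite gt_eqF.
split.
- rewrite (_ : _ \o _ = EFin \o (fun w => \sum_k (s k w * (v k / (1 + v k)) - ln (1 + v k)))).
    exact: integrable_EFin_sum.
  by apply/funext => w /=; rewrite lnE.
- by rewrite EE /F FE mulr_suml; apply: ler_sum => k _; exact: ln1D_ge.
- rewrite EE /F FE trE.
  apply: (@le_trans _ _ (\sum_k (v k ^+ 2 / 2 - v k ^+ 3 / 3))); last first.
    by apply: ler_sum => k _; exact: ln1D_le.
  rewrite sumrB -!mulr_suml lerD2l lerN2 ler_pM2r ?invr_gt0// mulr_sumr.
  apply: ler_sum => k _; rewrite exprS ler_wpM2r ?sqr_ge0//.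
  by rewrite (bigD1 k)//= lerDl sumr_ge0.
Qed.

End likelihood_facts.

(** * Second moments of complex random variables *)

Section square_integrable.
Context d (T : measurableType d) (R : realType) (P : probability T R).
Local Notation C := R[i].
Local Notation Re := (@complex.Re R).
Local Notation Im := (@complex.Im R).
Local Notation CE := (Cexpectation P).

Definition Cintegrable (F : T -> C) :=
  P.-integrable setT (EFin \o (Re \o F)) /\ P.-integrable setT (EFin \o (Im \o F)).

Lemma CintegrableD F G : Cintegrable F -> Cintegrable G ->
  Cintegrable (fun w => F w + G w).
Proof.
move=> [rF iF] [rG iG]; split.
  rewrite (_ : _ \o _ = EFin \o (fun w => Re (F w) + Re (G w))).
    exact: integrable_EFinD.
  by apply/funext => w /=; case: (F w) (G w) => ? ? [].
rewrite (_ : _ \o _ = EFin \o (fun w => Im (F w) + Im (G w))).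
  exact: integrable_EFinD.
by apply/funext => w /=; case: (F w) (G w) => ? ? [].
Qed.

Lemma CexpectationD F G : Cintegrable F -> Cintegrable G ->
  CE (fun w => F w + G w) = CE F + CE G.
Proof.
move=> [rF iF] [rG iG]; apply/eqP; rewrite eq_complex /=; apply/andP; split; apply/eqP.
  by rewrite -RintegralD//; apply: eq_Rintegral => w _; case: (F w) (G w) => ? ? [].
by rewrite -RintegralD//; apply: eq_Rintegral => w _; case: (F w) (G w) => ? ? [].
Qed.

Lemma CintegrableZ c F : Cintegrable F -> Cintegrable (fun w => c * F w).
Proof.
move=> [rF iF]; split.
  rewrite (_ : _ \o _ = EFin \o (fun w => Re c * Re (F w) - Im c * Im (F w))).
    by apply: integrable_EFinB => //; exact: integrable_EFinZl.
  by apply/funext => w /=; case: c (F w) => ? ? [].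
rewrite (_ : _ \o _ = EFin \o (fun w => Re c * Im (F w) + Im c * Re (F w))).
  by apply: integrable_EFinD => //; exact: integrable_EFinZl.
by apply/funext => w /=; case: c (F w) => ? ? [].
Qed.

Lemma CexpectationZ c F : Cintegrable F -> CE (fun w => c * F w) = c * CE F.
Proof.
move=> [rF iF]; apply/eqP; rewrite eq_complex; apply/andP; split; apply/eqP.
  transitivity (\int[P]_w (Re c * Re (F w) - Im c * Im (F w))).
    by apply: eq_Rintegral => w _; case: c (F w) => ? ? [].
  rewrite RintegralB//; [|exact: integrable_EFinZl|exact: integrable_EFinZl].
  by rewrite !RintegralZl//; case: c.
transitivity (\int[P]_w (Re c * Im (F w) + Im c * Re (F w))).
  by apply: eq_Rintegral => w _; case: c (F w) => ? ? [].
rewrite RintegralD//; [|exact: integrable_EFinZl|exact: integrable_EFinZl].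
by rewrite !RintegralZl//; case: c.
Qed.

Lemma Cintegrable_sum (J : Type) (s : seq J) (F : J -> T -> C) :
  (forall j, Cintegrable (F j)) -> Cintegrable (fun w => \sum_(j <- s) F j w).
Proof.
move=> iF; elim: s => [|j s ih].
  rewrite (_ : (fun w => _) = fun=> 0); last by apply/funext => w; rewrite big_nil.
  by split; exact: integrable_prob_cst.
rewrite (_ : (fun w => _) = fun w => F j w + \sum_(j <- s) F j w).
  exact: CintegrableD.
by apply/funext => w; rewrite big_cons.
Qed.

Lemma Cexpectation_sum (J : Type) (s : seq J) (F : J -> T -> C) :
  (forall j, Cintegrable (F j)) ->
  CE (fun w => \sum_(j <- s) F j w) = \sum_(j <- s) CE (F j).
Proof.
move=> iF; elim: s => [|j s ih].
  rewrite big_nil (_ : (fun w => _) = fun=> 0); last by apply/funext => w; rewrite big_nil.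
  by rewrite /Cexpectation /Cintegral /= !Rintegral_prob_cst.
rewrite big_cons -ih -CexpectationD//; last exact: Cintegrable_sum.
by congr CE; apply/funext => w; rewrite big_cons.
Qed.

Lemma Cexpectation_conj F : Cintegrable F -> CE (fun w => (F w)^*) = (CE F)^*.
Proof.
move=> [_ iF]; apply/eqP; rewrite eq_complex /=; apply/andP; split; apply/eqP.
  by apply: eq_Rintegral => w _; case: (F w).
by rewrite -RintegralN//; apply: eq_Rintegral => w _; case: (F w).
Qed.

Definition square_integrable (F : T -> C) :=
  measurable_fun setT F /\ P.-integrable setT (EFin \o (csq \o F)).

Lemma square_integrableD F G : square_integrable F -> square_integrable G ->
  square_integrable (fun w => F w + G w).
Proof.
move=> [mF iF] [mG iG]; split; first exact: measurable_complexD.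
apply: (@le_EFin_integrable _ _ _ P setT measurableT _
  (fun w => 2 * csq (F w) + 2 * csq (G w))).
- by apply: (measurableT_comp measurable_csq); exact: measurable_complexD.
- move=> w _ /=; rewrite ger0_norm ?csq_ge0// csqD.
  by have := csq_ge0 (F w - G w); rewrite csqB; lra.
- by apply: integrable_EFinD => //; exact: integrable_EFinZl.
Qed.

Lemma square_integrableZ c F : square_integrable F ->
  square_integrable (fun w => c * F w).
Proof.
move=> [mF iF]; have mcF : measurable_fun setT (fun w => c * F w).
  by apply: measurable_complexM => //; exact: measurable_cst.
split=> //.
rewrite (_ : _ \o _ = EFin \o (fun w => csq c * csq (F w))).
  exact: integrable_EFinZl.
by apply/funext => w /=; congr _%:E; rewrite /csq; case: c {mcF} (F w) => a b [a' b'] /=; ring.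
Qed.

Lemma square_integrable_sum (J : Type) (s : seq J) (F : J -> T -> C) :
  (forall j, square_integrable (F j)) ->
  square_integrable (fun w => \sum_(j <- s) F j w).
Proof.
move=> iF; elim: s => [|j s ih].
  rewrite (_ : (fun w => _) = fun=> 0); last by apply/funext => w; rewrite big_nil.
  split; first exact: measurable_cst.
  by rewrite (_ : _ \o _ = EFin \o fun=> csq 0)//; exact: integrable_prob_cst.
rewrite (_ : (fun w => _) = fun w => F j w + \sum_(j <- s) F j w).
  exact: square_integrableD.
by apply/funext => w; rewrite big_cons.
Qed.

Lemma measurable_conj (F : T -> C) : measurable_fun setT F -> measurable_fun setT (fun w => (F w)^*).
Proof.
move=> /measurable_fun_complexP[mr mi]; apply/measurable_fun_complexP; split.
  by rewrite (_ : (fun w => _) = fun w => Re (F w))//; apply/funext => w; case: (F w).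
rewrite (_ : (fun w => _) = fun w => - Im (F w)); first exact: measurableT_comp.
by apply/funext => w; case: (F w).
Qed.

Lemma square_integrable_conj F : square_integrable F ->
  square_integrable (fun w => (F w)^*).
Proof.
move=> [mF iF]; split; first exact: measurable_conj.
rewrite (_ : _ \o _ = EFin \o (csq \o F))//; apply/funext => w /=.
by case: (F w) => a b; rewrite /csq /= sqrrN.
Qed.

Lemma square_integrable_Re F : square_integrable F ->
  P.-integrable setT (EFin \o (fun w => Re (F w) ^+ 2)).
Proof.
move=> [mF iF]; have [mr mi] := (measurable_fun_complexP F).1 mF.
apply: (@le_EFin_integrable _ _ _ P setT measurableT _ (csq \o F)) => //.
  exact: measurable_funX.
by move=> w _; rewrite ger0_norm ?sqr_ge0// lerDl sqr_ge0.
Qed.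

Lemma square_integrable_Im F : square_integrable F ->
  P.-integrable setT (EFin \o (fun w => Im (F w) ^+ 2)).
Proof.
move=> [mF iF]; have [mr mi] := (measurable_fun_complexP F).1 mF.
apply: (@le_EFin_integrable _ _ _ P setT measurableT _ (csq \o F)) => //.
  exact: measurable_funX.
by move=> w _; rewrite ger0_norm ?sqr_ge0// lerDr sqr_ge0.
Qed.

Lemma integrable_sqr_mul (f g : T -> R) :
  measurable_fun setT f -> measurable_fun setT g ->
  P.-integrable setT (EFin \o (fun w => f w ^+ 2)) ->
  P.-integrable setT (EFin \o (fun w => g w ^+ 2)) ->
  P.-integrable setT (EFin \o (fun w => f w * g w)).
Proof.
move=> mf mg If Ig.
apply: (@le_EFin_integrable _ _ _ P setT measurableT _ (fun w => f w ^+ 2 + g w ^+ 2)).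
- exact: measurable_funM.
- by move=> w _; rewrite ler_norml; have := sqr_ge0 (f w + g w); have := sqr_ge0 (f w - g w);
    have := sqr_ge0 (f w); have := sqr_ge0 (g w); rewrite /=; nra.
- exact: integrable_EFinD.
Qed.

Lemma Cintegrable_mul F G : square_integrable F -> square_integrable G ->
  Cintegrable (fun w => F w * G w).
Proof.
move=> sF sG; have [mFr mFi] := (measurable_fun_complexP F).1 sF.1.
have [mGr mGi] := (measurable_fun_complexP G).1 sG.1.
have [rF iF] := (square_integrable_Re sF, square_integrable_Im sF).
have [rG iG] := (square_integrable_Re sG, square_integrable_Im sG).
split.
  rewrite (_ : _ \o _ = EFin \o (fun w => Re (F w) * Re (G w) - Im (F w) * Im (G w))).
    by apply: integrable_EFinB => //; exact: integrable_sqr_mul.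
  by apply/funext => w /=; case: (F w) (G w) => ? ? [].
rewrite (_ : _ \o _ = EFin \o (fun w => Re (F w) * Im (G w) + Im (F w) * Re (G w))).
  by apply: integrable_EFinD => //; exact: integrable_sqr_mul.
by apply/funext => w /=; case: (F w) (G w) => ? ? [].
Qed.

Lemma Cexpectation_mul_sum (I J : finType) (F : I -> T -> C) (G : J -> T -> C)
    (a : I -> C) (b : J -> C) :
  (forall i, square_integrable (F i)) -> (forall j, square_integrable (G j)) ->
  CE (fun w => (\sum_i a i * F i w) * (\sum_j b j * G j w)) =
  \sum_i \sum_j a i * b j * CE (fun w => F i w * G j w).
Proof.
move=> sF sG.
have iFG i j : Cintegrable (fun w => F i w * G j w) by exact: Cintegrable_mul.
transitivity (CE (fun w => \sum_i \sum_j a i * b j * (F i w * G j w))).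
  congr CE; apply/funext => w; rewrite mulr_suml; apply: eq_bigr => i _.
  by rewrite mulr_sumr; apply: eq_bigr => j _; ring.
rewrite Cexpectation_sum; last first.
  by move=> i; apply: Cintegrable_sum => j; exact: CintegrableZ.
apply: eq_bigr => i _; rewrite Cexpectation_sum; last by move=> j; exact: CintegrableZ.
by apply: eq_bigr => j _; rewrite CexpectationZ.
Qed.

Lemma expect_csq_sum (I : finType) (F : I -> T -> C) (K : I -> I -> C) (u : I -> C) :
  (forall i, square_integrable (F i)) ->
  (forall i j, CE (fun w => F i w * (F j w)^*) = K i j) ->
  (\int[P]_w (csq (\sum_i u i * F i w))%:E = (quad K u)%:E)%E.
Proof.
move=> sF cK; have sS : square_integrable (fun w => \sum_i u i * F i w).
  by apply: square_integrable_sum => i; exact: square_integrableZ.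
rewrite -EFin_Rintegral//; last exact: sS.2.
congr _%:E; rewrite /quad.
transitivity (Re (CE (fun w => (\sum_i u i * F i w) * (\sum_j (u j)^* * (F j w)^*)))).
  apply: eq_Rintegral => w _; rewrite -cdotzz -Re_conjM rmorph_sum.
  by congr (Re (_ * _)); apply: eq_bigr => i _; rewrite rmorphM.
rewrite Cexpectation_mul_sum//; last by move=> j; exact: square_integrable_conj.
by congr Re; apply: eq_bigr => i _; apply: eq_bigr => j _; rewrite cK; ring.
Qed.

(** The squared real part of S is half of |S|^2 plus half of the real part of S^2, and vanishing
    pseudo-covariances kill the second term. *)
Lemma expect_Re_sum_sqr (I : finType) (F : I -> T -> C) (K : I -> I -> C) (u : I -> C) :
  (forall i, square_integrable (F i)) ->
  (forall i j, CE (fun w => F i w * (F j w)^*) = K i j) ->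
  (forall i j, CE (fun w => F i w * F j w) = 0) ->
  \int[P]_w (Re (\sum_i u i * F i w) ^+ 2) = quad K u / 2.
Proof.
move=> sF cK pK; have sS : square_integrable (fun w => \sum_i u i * F i w).
  by apply: square_integrable_sum => i; exact: square_integrableZ.
have Z0 : CE (fun w => (\sum_i u i * F i w) * (\sum_i u i * F i w)) = 0.
  rewrite Cexpectation_mul_sum// big1// => i _; rewrite big1// => j _.
  by rewrite pK mulr0.
have E := expect_csq_sum u sF cK.
have [iS _] := Cintegrable_mul sS sS.
transitivity (\int[P]_w (2^-1 * (csq (\sum_i u i * F i w) +
    Re ((\sum_i u i * F i w) * (\sum_i u i * F i w))))).
  by apply: eq_Rintegral => w _; case: (\sum_i _) => a b; rewrite /csq /=; field.
rewrite RintegralZl//; last by apply: integrable_EFinD => //; exact: sS.2.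
rewrite RintegralD//; last exact: sS.2.
have -> : \int[P]_w Re ((\sum_i u i * F i w) * (\sum_i u i * F i w)) = 0.
  exact: (congr1 Re Z0).
by rewrite addr0 mulrC /Rintegral E.
Qed.

Definition independent_pair (F G : T -> C) := forall A B, measurable A -> measurable B ->
  P (F @^-1` A `&` G @^-1` B) = (P (F @^-1` A) * P (G @^-1` B))%E.

Lemma Cexpectation_mul_indep F G : square_integrable F -> square_integrable G ->
  independent_pair F G -> CE (fun w => F w * G w) = CE F * CE G.
Proof.
move=> sF sG FG; have [mFr mFi] := (measurable_fun_complexP F).1 sF.1.
have [mGr mGi] := (measurable_fun_complexP G).1 sG.1.
have [rF iF] := (square_integrable_Re sF, square_integrable_Im sF).
have [rG iG] := (square_integrable_Re sG, square_integrable_Im sG).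
have mRe A : measurable A -> measurable (Re @^-1` A).
  by move=> mA; have := measurable_cRe measurableT mA; rewrite setTI.
have mIm A : measurable A -> measurable (Im @^-1` A).
  by move=> mA; have := measurable_cIm measurableT mA; rewrite setTI.
apply/eqP; rewrite eq_complex; apply/andP; split; apply/eqP.
  transitivity (\int[P]_w (Re (F w) * Re (G w) - Im (F w) * Im (G w))).
    by apply: eq_Rintegral => w _; case: (F w) (G w) => ? ? [].
  rewrite RintegralB//; [|exact: integrable_sqr_mul|exact: integrable_sqr_mul].
  rewrite !Rintegral_mul_indep//.
  - by move=> A B mA mB; exact: (FG (Im @^-1` A) (Im @^-1` B) (mIm _ mA) (mIm _ mB)).
  - by move=> A B mA mB; exact: (FG (Re @^-1` A) (Re @^-1` B) (mRe _ mA) (mRe _ mB)).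
transitivity (\int[P]_w (Re (F w) * Im (G w) + Im (F w) * Re (G w))).
  by apply: eq_Rintegral => w _; case: (F w) (G w) => ? ? [].
rewrite RintegralD//; [|exact: integrable_sqr_mul|exact: integrable_sqr_mul].
rewrite !Rintegral_mul_indep//.
- by move=> A B mA mB; exact: (FG (Im @^-1` A) (Re @^-1` B) (mIm _ mA) (mRe _ mB)).
- by move=> A B mA mB; exact: (FG (Re @^-1` A) (Im @^-1` B) (mRe _ mA) (mIm _ mB)).
Qed.

Lemma independent_pair_conj F G : independent_pair F G ->
  independent_pair F (fun w => (G w)^*).
Proof.
move=> FG A B mA mB; have mcB : measurable ((fun z : C => z^*) @^-1` B).
  have mc : measurable_fun setT (fun z : C => z^*).
    apply/measurable_fun_complexP; split.
      by rewrite (_ : (fun w => _) = Re); [exact: measurable_cRe|apply/funext => -[]].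
    rewrite (_ : (fun w => _) = fun w => - Im w); last by apply/funext => -[].
    exact: (measurableT_comp _ measurable_cIm).
  by have := mc measurableT _ mB; rewrite setTI.
exact: (FG A _ mA mcB).
Qed.

End square_integrable.

(** * Moments and transition density of the channel *)

Section sigma_of_facts.
Context d (T : measurableType d) (R : realType) (P : probability T R).
Local Notation C := R[i].

Lemma sigma_of_preimage (T' I : Type) (X : I -> T' -> C) i A :
  measurable A -> sigma_of X (X i @^-1` A).
Proof. by move=> mA; apply: sub_sigma_algebra; exists i => //; exists A => //; rewrite setTI. Qed.

(** Passes from finite subsets of [I] to families indexed by a finite type; injectivity of [h]
    ensures that each event is counted once. Outside the image of [h] the event is [setT]. *)
Lemma mutually_independent_finite (I : choiceType) (F : I -> set (set T)) (K : finType)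
    (h : K -> I) (E : K -> set T) :
  injective h -> mutually_independent P F -> (forall k, F (h k) (E k)) ->
  P [set w | forall k, E k w] = (\prod_k P (E k))%E.
Proof.
move=> hI iF FE; pose J := seq_fset tt (map h (enum K)).
have JP : perm_eq J (map h (enum K)).
  by rewrite (perm_trans (seq_fset_perm _ _))// undup_id// (map_inj_uniq hI) enum_uniq.
pose E' i := if [pick k | h k == i] is Some k then E k else setT.
have EE k : E' (h k) = E k.
  by rewrite /E'; case: pickP => [k' /eqP/hI -> //|/(_ k)]; rewrite eqxx.
have inJ k : h k \in J by rewrite (perm_mem JP) map_f// mem_enum.
have inJP i : i \in J -> exists k, i = h k.
  by rewrite (perm_mem JP) => /mapP[k _ ->]; exists k.
have := iF J E' _; rewrite (perm_big _ JP)/= big_map big_enum/=.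
rewrite (eq_bigr (fun k => P (E k))); last by move=> k _; rewrite EE.
move=> <-; last by move=> i /inJP[k ->]; rewrite EE.
congr (P _); apply/seteqP; split => [w h1 i /= /inJP[k ->]|w h1 k]; first by rewrite EE.
by have := h1 _ (inJ k); rewrite EE.
Qed.

Lemma mutually_independent_pair (I : choiceType) (F : I -> set (set T)) i j A B :
  i != j -> mutually_independent P F -> F i A -> F j B ->
  P (A `&` B) = (P A * P B)%E.
Proof.
move=> ij iF FA FB.
have := @mutually_independent_finite I F bool (fun b => if b then i else j)
  (fun b => if b then A else B).
rewrite big_bool/= => <- //.
- by congr (P _); apply/seteqP; split => [w [? ?] []|w h] //; split; [exact: (h true)|exact: (h false)].
- by move=> [] [] // /eqP; rewrite ?(negbTE ij)// eq_sym (negbTE ij).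
- by case.
Qed.

(* Two coordinates of a path are shifted together, as a pair. *)
Lemma stationary_cov (X : int -> T -> C) : stationary P X ->
  (forall n, measurable_fun setT (X n)) ->
  forall n m, Cexpectation P (fun w => X n w * (X m w)^*) = autocorrelation P X (n - m).
Proof.
move=> sX mX n m.
have law A : measurable A ->
    P ((fun w => (X n w, X m w)) @^-1` A) = P ((fun w => (X (n - m) w, X 0 w)) @^-1` A).
  move=> mA; pose G := \bigcup_k preimage_set_system setT (fun x : int -> C => x k) measurable.
  have mk k : measurable_fun setT (fun x : g_sigma_algebraType G => x k).
    by move=> _ B mB; rewrite setTI; exact: sigma_of_preimage.
  have mp : measurable_fun setT (fun x : g_sigma_algebraType G => (x (n - m), x 0)).
    exact: measurable_fun_pair.
  have := sX m ((fun x => (x (n - m), x 0)) @^-1` A).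
  rewrite /shift_path /= subrK add0r; apply.
  by have := mp measurableT A mA; rewrite setTI.
have m1 : measurable_fun setT (fun w => (X n w, X m w)) by exact: measurable_fun_pair.
have m2 : measurable_fun setT (fun w => (X (n - m) w, X 0 w)) by exact: measurable_fun_pair.
pose Z1 : {mfun T >-> (C * C)%type} := HB.pack (fun w => (X n w, X m w)) (isMeasurableFun.Build _ _ _ _ _ m1).
have mf : measurable_fun setT (fun p : C * C => p.1 * p.2^*).
  by apply: measurable_complexM => //; exact: measurable_conj.
have [mr mi] := (measurable_fun_complexP _).1 mf.
have key (g : C * C -> R) : measurable_fun setT g ->
    \int[P]_w g (X n w, X m w) = \int[P]_w g (X (n - m) w, X 0 w).
  move=> mg; transitivity (\int[distribution P Z1]_p g p).
    by rewrite (@Rintegral_image _ _ _ _ R P (distribution P Z1) Z1).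
  by rewrite (@Rintegral_image _ _ _ _ R P (distribution P Z1) _ m2)// => A mA; exact/esym/law.
apply/eqP; rewrite eq_complex; apply/andP; split; apply/eqP.
  exact: (key _ mr).
exact: (key _ mi).
Qed.

End sigma_of_facts.

(** The process that realises [r] supplies these properties. They cannot be read off the fading,
    which fixes only the products of [r] with the [alpha k], and these may all be zero. *)
Lemma autocorrelation_facts (R : realType) (r : int -> R[i]) : is_autocorrelation r ->
  [/\ forall n, r (- n) = (r n)^*, complex.Im (r 0) = 0 & 0 <= complex.Re (r 0)].
Proof.
move=> [d [T [P [X [sX iX rE]]]]].
have sq n : square_integrable P (X n).
  split=> //; apply/integrableP; split.
    by apply/measurable_EFinP; apply: (measurableT_comp measurable_csq).
  rewrite (le_lt_trans _ (iX n))// le_eqVlt; apply/orP; left; apply/eqP; apply: eq_integral => w _.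
  by rewrite /= ger0_norm ?csq_ge0// normc_sqr.
have rc n m : Cexpectation P (fun w => X n w * (X m w)^*) = r (n - m).
  by rewrite (stationary_cov sX)// => k; exact: measurable_funP.
have rN n : r (- n) = (r n)^*.
  rewrite -sub0r -rc -(subr0 n) -rc -Cexpectation_conj; last first.
    by apply: Cintegrable_mul => //; exact: square_integrable_conj.
  by congr Cexpectation; apply/funext => w; rewrite subr0 rmorphM/= conjCK mulrC.
split=> //.
  have := rN 0; rewrite oppr0 => /(congr1 (@complex.Im R)).
  by case: (r 0) => a b /= h; lra.
have -> : r 0 = Cexpectation P (fun w => X 0 w * (X 0 w)^*) by rewrite rc subr0.
apply: Rintegral_ge0 => // w _.
by rewrite mul_conj/= csq_ge0.
Qed.

Section channel_moments.
Context (R : realType) (NT NR : nat) d (Omega : measurableType d)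
  (P : probability Omega R)
  (H : 'I_NT -> 'I_NR -> int -> {RV P >-> R[i]})
  (W : 'I_NR -> nat -> {RV P >-> R[i]})
  (channel : rayleigh_mimo H W).
Local Notation C := R[i].
Local Notation Re := (@complex.Re R).
Local Notation Im := (@complex.Im R).
Local Notation CE := (Cexpectation P).

Lemma is_normal_Re_Im (V : Omega -> C) : measurable_fun setT V ->
  is_normal P (fun w => Re (V w)) -> is_normal P (fun w => Im (V w)) ->
  square_integrable P V.
Proof.
move=> mV; have [mr mi] := (measurable_fun_complexP V).1 mV.
move=> [m [s nr]] [m' [s' ni]]; split=> //.
have [_ Ir _ _] := normal_law_moments mr nr.
have [_ Ii _ _] := normal_law_moments mi ni.
exact: integrable_EFinD.
Qed.

Lemma fading_square_integrable k l n : square_integrable P (H k l n).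
Proof.
have [nH _] := fading_normal channel.
apply: is_normal_Re_Im => //.
  have := nH [:: (k, l, n)] (fun=> 1) (fun=> 0).
  rewrite (_ : (fun w => _) = (fun w => Re (H k l n w)))//.
  by apply/funext => w; rewrite big_seq1 mul1r mul0r addr0.
have := nH [:: (k, l, n)] (fun=> 0) (fun=> 1).
rewrite (_ : (fun w => _) = (fun w => Im (H k l n w)))//.
by apply/funext => w; rewrite big_seq1 mul1r mul0r add0r.
Qed.

Lemma noise_square_integrable l n : square_integrable P (W l n).
Proof.
have [nH _] := noise_normal channel l n.
apply: is_normal_Re_Im => //.
  have := nH [:: tt] (fun=> 1) (fun=> 0).
  rewrite (_ : (fun w => _) = (fun w => Re (W l n w)))//.
  by apply/funext => w; rewrite big_seq1 mul1r mul0r addr0.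
have := nH [:: tt] (fun=> 0) (fun=> 1).
rewrite (_ : (fun w => _) = (fun w => Im (W l n w)))//.
by apply/funext => w; rewrite big_seq1 mul1r mul0r add0r.
Qed.

Lemma fading_pseudo_cov i j :
  CE (fun w => H i.1.1 i.1.2 i.2 w * H j.1.1 j.1.2 j.2 w) = 0.
Proof.
have [_ /(_ i j)] := fading_normal channel.
rewrite !(fading_mean0 channel) => E; rewrite -[RHS]E.
by congr CE; apply/funext => w; rewrite !subr0.
Qed.

Lemma fading_cov alpha r : transmit_separable H alpha r -> forall i j,
  CE (fun w => H i.1.1 i.1.2 i.2 w * (H j.1.1 j.1.2 j.2 w)^*) =
  if i.1 == j.1 then (alpha i.1.1)%:C%C * r i.1.2 (i.2 - j.2) else 0.
Proof.
move=> [_ _ ac] [kl n] [kl' m] /=; case: eqVneq => [<-|klN].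
  by rewrite -ac -(stationary_cov (fading_stationary channel kl.1 kl.2))// => k; exact: measurable_funP.
rewrite Cexpectation_mul_indep.
- by rewrite (fading_mean0 channel) mul0r.
- exact: fading_square_integrable.
- exact/square_integrable_conj/fading_square_integrable.
- apply: independent_pair_conj => A B mA mB.
  apply: (mutually_independent_pair klN (fading_independent channel)).
    exact: (@sigma_of_preimage R Omega int (fun n => H kl.1 kl.2 n) n A mA).
  exact: (@sigma_of_preimage R Omega int (fun n => H kl'.1 kl'.2 n) m B mB).
Qed.

Lemma noise_cov l n l' n' : CE (fun w => W l n w * (W l' n' w)^*) =
  ((l == l') && (n == n'))%:R.
Proof.
have [/andP[/eqP <- /eqP <-]|ln] := boolP ((l == l') && (n == n')).
  have -> : CE (fun w => W l n w * (W l n w)^*) = (\int[P]_w csq (W l n w))%:C%C.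
    apply/eqP; rewrite eq_complex /=; apply/andP; split; apply/eqP.
      by apply: eq_Rintegral => w _; rewrite mul_conj.
    by rewrite -[RHS](Rintegral_prob_cst P); apply: eq_Rintegral => w _; rewrite mul_conj.
  rewrite /Rintegral; under eq_integral do rewrite -normc_sqr.
  by rewrite (noise_var1 channel).
rewrite Cexpectation_mul_indep.
- by rewrite (noise_mean0 channel) mul0r.
- exact: noise_square_integrable.
- exact/square_integrable_conj/noise_square_integrable.
- apply: independent_pair_conj => A B mA mB.
  have lnN : (l, n) != (l', n') by rewrite xpair_eqE.
  apply: (mutually_independent_pair lnN (noise_independent channel)).
    exact: (@sigma_of_preimage R Omega unit (fun=> W l n) tt A mA).
  exact: (@sigma_of_preimage R Omega unit (fun=> W l' n') tt B mB).
Qed.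

Lemma fading_noise_cov i l n :
  CE (fun w => H i.1.1 i.1.2 i.2 w * (W l n w)^*) = 0.
Proof.
rewrite Cexpectation_mul_indep.
- by rewrite (fading_mean0 channel) mul0r.
- exact: fading_square_integrable.
- exact/square_integrable_conj/noise_square_integrable.
- apply: independent_pair_conj => A B mA mB; apply: (fading_noise_independent channel).
    exact: (@sigma_of_preimage R Omega _ (fun i : 'I_NT * 'I_NR * int => H i.1.1 i.1.2 i.2) i A mA).
  exact: (@sigma_of_preimage R Omega _ (fun ln : 'I_NR * nat => W ln.1 ln.2) (l, n) B mB).
Qed.

Lemma noise_law_std l n A : measurable A -> P (W l n @^-1` A) = std_cnormal A.
Proof.
move=> mA; apply: proper_normal_law => // s t th.
have [nW pW] := noise_normal channel l n.
have sW := noise_square_integrable l n.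
have [mr mi] := (measurable_fun_complexP (W l n)).1 sW.1.
have [m [s0 nV]] := nW [:: tt] (fun=> s) (fun=> t).
pose V w := s * Re (W l n w) + t * Im (W l n w).
have VE : (fun w => \sum_(i <- [:: tt]) (s * Re (W l n w) + t * Im (W l n w))) = V.
  by apply/funext => w; rewrite big_seq1.
rewrite VE in nV.
have mV : measurable_fun setT V by apply: measurable_funD; apply: measurable_funM.
rewrite -[LHS]/(\int[P]_w cos (V w + th)).
(* With this [c], the combination [V] is the real part of [c * W l n], whose second moment follows
   from variance one and properness. *)
pose c : C := (s +i* - t)%C.
have Vc w : V w = Re (\sum_(i < 1) c * W l n w).
  by rewrite big_ord1 /V /c; case: (W l n w) => a b /=; ring.
have E0 : \int[P]_w V w = 0.
  have [Ir Ii] : Cintegrable P (W l n).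
    rewrite (_ : (W l n : Omega -> C) = fun w => 1 * W l n w); last by apply/funext => w; rewrite mul1r.
    apply: (Cintegrable_mul _ sW); split; first exact: measurable_cst.
    exact: integrable_prob_cst.
  rewrite /V RintegralD//; [|exact: integrable_EFinZl|exact: integrable_EFinZl].
  have /eqP := noise_mean0 channel l n; rewrite eq_complex /= => /andP[/eqP r0 /eqP i0].
  by rewrite !RintegralZl// r0 i0 !mulr0 addr0.
have E2 : \int[P]_w (V w ^+ 2) = (s ^+ 2 + t ^+ 2) / 2.
  rewrite (_ : (fun w => V w ^+ 2) = (fun w => Re (\sum_(i < 1) c * W l n w) ^+ 2)); last first.
    by apply/funext => w; rewrite Vc.
  rewrite (@expect_Re_sum_sqr _ _ _ P 'I_1 (fun=> W l n) (fun _ _ => 1) (fun=> c))//.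
  - by rewrite /quad !big_ord1 mulr1 Re_conjM cdotzz /csq /c/= sqrrN.
  - by move=> _ _; rewrite noise_cov !eqxx.
  - move=> _ _; have := pW tt tt; rewrite (noise_mean0 channel) => E; rewrite -[RHS]E.
    by congr CE; apply/funext => w; rewrite !subr0.
have [cf _] := centered_normal_law mV nV E0.
by rewrite cf E2; congr (expR _ * _); field.
Qed.

End channel_moments.

Section signal.
Context (R : realType) (NT NR : nat) d (Omega : measurableType d)
  (P : probability Omega R)
  (H : 'I_NT -> 'I_NR -> int -> {RV P >-> R[i]})
  (W : 'I_NR -> nat -> {RV P >-> R[i]})
  (channel : rayleigh_mimo H W)
  (alpha : 'I_NT -> R) (r : 'I_NR -> int -> R[i])
  (separable : transmit_separable H alpha r) (rho : R).
Hypothesis rho_ge0 : 0 <= rho.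
Local Notation C := R[i].
Local Notation Re := (@complex.Re R).
Local Notation Im := (@complex.Im R).
Local Notation CE := (Cexpectation P).
Local Notation input_block N := (N.-tuple (NT.-tuple R[i])).
Local Notation output_block N := (N.-tuple (NR.-tuple R[i])).

(* The time offset tau is needed for the second of two concatenated blocks. *)
Definition signal (tau N : nat) (z : input_block N) (i : 'I_N * 'I_NR) (w : Omega) : C :=
  \sum_(k < NT) ((Num.sqrt rho)%:C%C * tnth (tnth z i.1) k) * H k i.2 (tau + i.1).+1%:Z w.

Definition received (tau N : nat) (z : input_block N) (i : 'I_N * 'I_NR) (w : Omega) : C :=
  signal tau z i w + W i.2 (tau + i.1).+1 w.

(** Covariance of the signal given the input [z]. Stationarity makes it independent of the offset
    [tau], and separability splits off one weighted inner product of the inputs at the two times. *)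
Definition covariance (N : nat) (z : input_block N) (i j : 'I_N * 'I_NR) : C :=
  if i.2 == j.2 then
    rho%:C%C * r i.2 (i.1%:Z - j.1%:Z) *
      \sum_(k < NT) (alpha k)%:C%C * (tnth (tnth z i.1) k * (tnth (tnth z j.1) k)^*)
  else 0.

Lemma block_received N (z : input_block N) w :
  channel_output H W rho (z, w) = block (received 0 z ^~ w).
Proof.
rewrite /channel_output /block; apply: eq_from_tnth => n; rewrite !tnth_mktuple.
apply: eq_from_tnth => l; rewrite !tnth_mktuple /received /signal add0n /=.
by rewrite mulr_sumr; congr (_ + _); apply: eq_bigr => k _; ring.
Qed.

Section block.
Variables (tau N : nat) (z : input_block N).
Local Notation I := ('I_N * 'I_NR)%type.

Lemma signal_square_integrable i : square_integrable P (signal tau z i).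
Proof.
apply: square_integrable_sum => k; apply: square_integrableZ.
exact: fading_square_integrable channel _ _ _.
Qed.

Lemma signal_pseudo_cov i j : CE (fun w => signal tau z i w * signal tau z j w) = 0.
Proof.
rewrite Cexpectation_mul_sum; last 2 first.
- by move=> k; exact: fading_square_integrable channel _ _ _.
- by move=> k; exact: fading_square_integrable channel _ _ _.
rewrite big1// => k _; rewrite big1// => k' _.
by rewrite (fading_pseudo_cov channel (k, i.2, (tau + i.1).+1%:Z) (k', j.2, (tau + j.1).+1%:Z)) mulr0.
Qed.

Lemma signal_cov i j : CE (fun w => signal tau z i w * (signal tau z j w)^*) = covariance z i j.
Proof.
have conjE w : (signal tau z j w)^* =
    \sum_k ((Num.sqrt rho)%:C%C * tnth (tnth z j.1) k)^* * (H k j.2 (tau + j.1).+1%:Z w)^*.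
  by rewrite rmorph_sum; apply: eq_bigr => k _; rewrite rmorphM.
rewrite (_ : (fun w => _) = fun w => signal tau z i w *
    \sum_k ((Num.sqrt rho)%:C%C * tnth (tnth z j.1) k)^* * (H k j.2 (tau + j.1).+1%:Z w)^*); last first.
  by apply/funext => w; rewrite conjE.
rewrite Cexpectation_mul_sum; last 2 first.
- by move=> k; exact: fading_square_integrable channel _ _ _.
- by move=> k; exact/square_integrable_conj/(fading_square_integrable channel).
have cov k k' := fading_cov channel separable (k, i.2, (tau + i.1).+1%:Z) (k', j.2, (tau + j.1).+1%:Z).
have rhoC : (Num.sqrt rho)%:C%C * ((Num.sqrt rho)%:C%C)^* = rho%:C%C :> C.
  by rewrite mul_conj /csq /= expr0n addr0 sqr_sqrtr.
have tauE : (tau + i.1).+1%:Z - (tau + j.1).+1%:Z = i.1%:Z - j.1%:Z.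
  by rewrite -!addSn !PoszD; ring.
rewrite /covariance; case: eqP => ij; last first.
  rewrite big1// => k _; rewrite big1// => k' _; rewrite cov/=.
  by case: eqP => [[_ /ij]|]//; rewrite mulr0.
rewrite mulr_sumr; apply: eq_bigr => k _; rewrite (bigD1 k)//= big1 ?addr0.
  rewrite cov/= ij eqxx tauE rmorphM/= -rhoC; ring.
move=> k' k'k; rewrite cov/=; case: eqP => [[kk' _]|]; last by rewrite mulr0.
by rewrite kk' eqxx in k'k.
Qed.

Lemma covariance_herm i j : covariance z j i = (covariance z i j)^*.
Proof.
rewrite -!signal_cov -Cexpectation_conj.
  by congr CE; apply/funext => w; rewrite rmorphM/= conjCK mulrC.
apply: Cintegrable_mul; first exact: signal_square_integrable.
exact/square_integrable_conj/signal_square_integrable.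
Qed.

Lemma covariance_psd c : 0 <= quad (covariance z) c.
Proof.
rewrite -lee_fin -(expect_csq_sum c signal_square_integrable signal_cov).
by apply: integral_ge0 => w _; rewrite lee_fin csq_ge0.
Qed.

Lemma measurable_signal i : measurable_fun setT (signal tau z i).
Proof. by have [] := signal_square_integrable i. Qed.

Lemma signal_gaussian : gaussian_vector P (covariance z) (signal tau z).
Proof.
move=> c th.
pose F := (I * 'I_NT)%type.
pose idx (f : F) : 'I_NT * 'I_NR * int := (f.2, f.1.2, (tau + f.1.1).+1%:Z).
have idx_inj : injective idx.
  move=> [[n l] k] [[n' l'] k'] [-> -> /addnI nn].
  by congr (_, _, _); exact: val_inj.
pose g (f : F) : C := c f.1 * ((Num.sqrt rho)%:C%C * tnth (tnth z f.1.1) f.2).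
pose V w := Re (\sum_i c i * signal tau z i w).
have VE w : V w = \sum_(f : F) (Re (g f) * Re (H f.2 f.1.2 (tau + f.1.1).+1%:Z w) -
                       Im (g f) * Im (H f.2 f.1.2 (tau + f.1.1).+1%:Z w)).
  transitivity (Re (\sum_i \sum_k g (i, k) * H k i.2 (tau + i.1).+1%:Z w)).
    congr Re; apply: eq_bigr => i _; rewrite mulr_sumr; apply: eq_bigr => k _.
    by rewrite /g mulrA.
  rewrite pair_bigA Re_sum; apply: eq_bigr => -[i k] _ /=.
  by case: (g _) (H _ _ _ _) => a b [a' b'].
have [nH _] := fading_normal channel.
(* Joint normality takes its coefficients on the whole index set. As [idx] is injective, these sums
   have a single term on the image of [idx]. *)
pose a ka := \sum_(f | idx f == ka) Re (g f).
pose b ka := - \sum_(f | idx f == ka) Im (g f).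
have pickE (G : F -> R) f : \sum_(f' | idx f' == idx f) G f' = G f.
  by rewrite (big_pred1 f)// => f' /=; rewrite (inj_eq idx_inj).
have := nH (map idx (enum {: F})) a b.
rewrite (_ : (fun w => _) = V); last first.
  apply/funext => w; rewrite VE big_map big_enum/=; apply: eq_bigr => f _.
  by rewrite /a /b !pickE mulNr.
move=> [m [s nV]].
have mV : measurable_fun setT V.
  apply: (measurableT_comp measurable_cRe); apply: measurable_complex_sum => i.
  by apply: measurable_complexM; [exact: measurable_cst|exact: measurable_signal].
have iH k l n : Cintegrable P (H k l n).
  rewrite (_ : (H k l n : Omega -> C) = fun w => 1 * H k l n w); last by apply/funext => w; rewrite mul1r.
  apply: (Cintegrable_mul _ (fading_square_integrable channel k l n)).
  by split; [exact: measurable_cst|exact: integrable_prob_cst].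
have iS i : Cintegrable P (signal tau z i).
  by apply: Cintegrable_sum => k; exact: CintegrableZ.
have E0 : \int[P]_w V w = 0.
  have : CE (fun w => \sum_i c i * signal tau z i w) = 0.
    rewrite Cexpectation_sum; last by move=> i; exact: CintegrableZ.
    rewrite big1// => i _; rewrite CexpectationZ// Cexpectation_sum; last by move=> k; exact: CintegrableZ.
    rewrite big1 ?mulr0// => k _; rewrite CexpectationZ//.
    by rewrite (fading_mean0 channel) mulr0.
  exact: (congr1 Re).
have E2 := expect_Re_sum_sqr c signal_square_integrable signal_cov signal_pseudo_cov.
have [cf _] := centered_normal_law mV nV E0.
by rewrite cf [X in X / 2]E2; congr (expR _ * _); field.
Qed.

Lemma received_square_integrable i : square_integrable P (received tau z i).
Proof.
apply: square_integrableD; first exact: signal_square_integrable.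
exact: (noise_square_integrable channel).
Qed.

Lemma received_cov i j :
  CE (fun w => received tau z i w * (received tau z j w)^*) = covariance z i j + (i == j)%:R.
Proof.
have sS := signal_square_integrable; have sW := noise_square_integrable channel.
have sSc k := square_integrable_conj (sS k); have sWc l n := square_integrable_conj (sW l n).
pose Wi (k : I) := W k.2 (tau + k.1).+1.
have cross k m : CE (fun w => signal tau z k w * (Wi m w)^*) = 0.
  transitivity (CE (fun w => (signal tau z k w) * \sum_(i < 1) 1 * (Wi m w)^*)).
    by congr CE; apply/funext => w; rewrite big_ord1 mul1r.
  rewrite (Cexpectation_mul_sum (J := 'I_1) (G := fun _ w => (Wi m w)^*) _ (fun=> 1)); last 2 first.
  - by move=> k'; exact: (fading_square_integrable channel).
  - by move=> _; exact: sWc.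
  rewrite big1// => k' _; rewrite big_ord1.
  by rewrite (fading_noise_cov channel (k', k.2, (tau + k.1).+1%:Z)) mulr0.
transitivity (CE (fun w => ((signal tau z i w * (signal tau z j w)^*) + (signal tau z i w * (Wi j w)^*)) +
    ((Wi i w * (signal tau z j w)^*) + Wi i w * (Wi j w)^*))).
  by congr CE; apply/funext => w; rewrite /received -/(Wi i) -/(Wi j) rmorphD/= mulrDl !mulrDr.
have i1 := Cintegrable_mul (sS i) (sSc j).
have i2 := Cintegrable_mul (sS i) (sWc j.2 (tau + j.1).+1).
have i3 := Cintegrable_mul (sW i.2 (tau + i.1).+1) (sSc j).
have i4 := Cintegrable_mul (sW i.2 (tau + i.1).+1) (sWc j.2 (tau + j.1).+1).
rewrite CexpectationD; [|exact: CintegrableD|exact: CintegrableD].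
rewrite !CexpectationD// signal_cov cross addr0.
have -> : CE (fun w => Wi i w * (signal tau z j w)^*) = 0.
  rewrite -[RHS]conjC0 -(cross j i) -Cexpectation_conj; last exact: (Cintegrable_mul (sS j) (sWc _ _)).
  by congr CE; apply/funext => w; rewrite rmorphM/= conjCK mulrC.
rewrite add0r (noise_cov channel) eqSS eqn_add2l; congr (_ + _%:R).
by case: i j {i1 i2 i3 i4} => n l [n' l'] /=; rewrite xpair_eqE andbC.
Qed.

Lemma expect_received u :
  (\int[P]_w (csq (\sum_i u i * received tau z i w))%:E =
   (quad (covariance z) u + \sum_i csq (u i))%:E)%E.
Proof.
rewrite (expect_csq_sum u received_square_integrable received_cov); congr _%:E.
rewrite /quad; transitivity (Re (\sum_i ((\sum_j u i * covariance z i j * (u j)^*) + u i * (u i)^*))).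
  congr Re; apply: eq_bigr => i _.
  under eq_bigr do rewrite mulrDr mulrDl.
  rewrite big_split/=; congr (_ + _); rewrite (bigD1 i)//= eqxx mulr1 big1 ?addr0// => j ji.
  by rewrite eq_sym (negbTE ji) mulr0 mul0r.
rewrite big_split/=; have ReD (x y : C) : Re (x + y) = Re x + Re y by case: x y => ? ? [].
by rewrite ReD; congr (_ + _); rewrite Re_sum; apply: eq_bigr => i _; rewrite Re_conjM cdotzz.
Qed.

End block.
End signal.

Section channel_density.
Context (R : realType) (NT NR : nat) d (Omega : measurableType d)
  (P : probability Omega R)
  (H : 'I_NT -> 'I_NR -> int -> {RV P >-> R[i]})
  (W : 'I_NR -> nat -> {RV P >-> R[i]})
  (channel : rayleigh_mimo H W)
  (alpha : 'I_NT -> R) (r : 'I_NR -> int -> R[i])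
  (separable : transmit_separable H alpha r) (rho : R).
Hypothesis rho_ge0 : 0 <= rho.
Local Notation C := R[i].
Local Notation input_block N := (N.-tuple (NT.-tuple R[i])).
Local Notation output_block N := (N.-tuple (NR.-tuple R[i])).
Local Notation signal := (signal H rho).
Local Notation received := (received H W rho).

Definition density N (z : input_block N) (y : output_block N) : R :=
  likelihood P (signal 0 z) (coord y).

Lemma measurable_coord_input N n k : measurable_fun setT (fun z : input_block N => tnth (tnth z n) k).
Proof. exact: (measurableT_comp (measurable_tnth k) (measurable_tnth n)). Qed.

Lemma measurable_signal2 tau N i :
  measurable_fun setT (fun p : input_block N * Omega => signal tau p.1 i p.2).
Proof.
apply: measurable_complex_sum => k; apply: measurable_complexM; last first.
  exact: measurableT_comp.
apply: measurable_complexM; first exact: measurable_cst.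
exact: (measurableT_comp (measurable_coord_input i.1 k)).
Qed.

Lemma measurable_density N :
  measurable_fun setT (fun p : input_block N * output_block N => density p.1 p.2).
Proof.
apply: (measurableT_comp (fine_measurable measurableT)).
pose f (q : (input_block N * output_block N) * Omega) : \bar R :=
  (expR (\sum_i (2 * cdot (signal 0 q.1.1 i q.2) (coord q.1.2 i) - csq (signal 0 q.1.1 i q.2))))%:E.
apply: (@measurable_fun_fubini_tonelli_F _ _ _ _ R P f) => [|q]; last by rewrite lee_fin expR_ge0.
apply/measurable_EFinP; apply: measurable_likelihood_exponent => i.
  apply: (measurableT_comp (@measurable_signal2 0 N i) (g := fun q => (q.1.1, q.2))).
  by apply: measurable_fun_pair => //; exact: measurableT_comp.
exact: (measurableT_comp (measurable_coord i) (measurableT_comp _ _)).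
Qed.

Lemma measurable_density_l N (y : output_block N) : measurable_fun setT (fun z : input_block N => density z y).
Proof. exact: (measurableT_comp (@measurable_density N) (pair2_measurable y)). Qed.

Lemma density_gt0 N (z : input_block N) y : 0 < density z y.
Proof.
apply: (likelihood_gt0 (covariance_herm channel separable rho_ge0 0 z)
  (covariance_psd channel separable rho_ge0 0 z)).
  by move=> i; exact: (measurable_signal channel).
exact: (signal_gaussian channel separable rho_ge0).
Qed.

Lemma density_le N (z : input_block N) y : density z y <= expR (\sum_i csq (coord y i)).
Proof. by apply: likelihood_le => i; exact: (measurable_signal channel). Qed.

Lemma density_ge N (z : input_block N) y :
  expR (- \sum_i complex.Re (covariance alpha r rho z i i)) <= density z y.
Proof.
apply: (likelihood_ge (covariance_herm channel separable rho_ge0 0 z)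
  (covariance_psd channel separable rho_ge0 0 z)).
  by move=> i; exact: (measurable_signal channel).
exact: (signal_gaussian channel separable rho_ge0).
Qed.

Section fixed_input.
Variables (tau N : nat) (z : input_block N).
Local Notation I := ('I_N * 'I_NR)%type.

Let noise (i : I) : Omega -> C := W i.2 (tau + i.1).+1.

Lemma noise_block_law A : measurable A ->
  P ((fun w => block (noise ^~ w)) @^-1` A) = noise_law A.
Proof.
apply: noise_law_unique.
- by move=> i; exact: measurable_funP.
- by move=> i B mB; exact: (noise_law_std channel).
- move=> B mB; pose h (i : I) : 'I_NR * nat := (i.2, (tau + i.1).+1).
  apply: (@mutually_independent_finite _ _ R P _ _ I h (fun i => noise i @^-1` B i) _ (noise_independent channel)).
    by move=> [n l] [n' l'] [-> /addnI nn]; congr (_, _); exact: val_inj.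
  by move=> i; exact: (@sigma_of_preimage R Omega unit (fun=> noise i) tt _ (mB i)).
Qed.

Let X w := block (signal tau z ^~ w).
Let V w := block (noise ^~ w).

Let mX : measurable_fun setT X.
Proof. by apply: measurable_block => i; exact: (measurable_signal channel). Qed.

Let mV : measurable_fun setT V.
Proof. by apply: measurable_block => i; exact: measurable_funP. Qed.

(** Independence is assumed for generated sigma-algebras, so measurability of the signal and of the
    noise block is checked again with respect to these, through [g_sigma_algebraType]. *)
Let XV A B : measurable A -> measurable B ->
  P (X @^-1` A `&` V @^-1` B) = (P (X @^-1` A) * P (V @^-1` B))%E.
Proof.
move=> mA mB; apply: (fading_noise_independent channel).
  pose F (i : 'I_NT * 'I_NR * int) : Omega -> C := H i.1.1 i.1.2 i.2.
  pose G := \bigcup_i preimage_set_system setT (F i) measurable.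
  have mF k l n : measurable_fun setT (H k l n : g_sigma_algebraType G -> C).
    by move=> _ E mE; rewrite setTI; exact: (@sigma_of_preimage R Omega _ F (k, l, n) E mE).
  have mXG : measurable_fun setT (X : g_sigma_algebraType G -> output_block N).
    apply: measurable_block => i; apply: measurable_complex_sum => k.
    by apply: measurable_complexM; [exact: measurable_cst|exact: mF].
  by have := mXG measurableT A mA; rewrite setTI.
pose F (i : 'I_NR * nat) : Omega -> C := W i.1 i.2.
pose G := \bigcup_i preimage_set_system setT (F i) measurable.
have mF l n : measurable_fun setT (W l n : g_sigma_algebraType G -> C).
  by move=> _ E mE; rewrite setTI; exact: (@sigma_of_preimage R Omega _ F (l, n) E mE).
have mVG : measurable_fun setT (V : g_sigma_algebraType G -> output_block N).
  by apply: measurable_block => i; exact: mF.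
by have := mVG measurableT B mB; rewrite setTI.
Qed.

(** Given the signal, the output is a shifted noise block, with the Cameron-Martin factor as
    density; Fubini averages it over the fading. The density on the right is the one at offset 0 for
    every [tau], because the covariance does not depend on [tau]. *)
Lemma expect_received_density (f : output_block N -> \bar R) :
  measurable_fun setT f -> (forall y, (0 <= f y)%E) ->
  (\int[P]_w f (block (received tau z ^~ w)) =
   \int[noise_law]_y (f y * (density z y)%:E))%E.
Proof.
move=> mf f0.
pose add (p : output_block N * output_block N) : output_block N :=
  block (fun i => coord p.2 i + coord p.1 i).
have madd : measurable_fun setT add.
  apply: (measurable_block (f := fun i (p : output_block N * output_block N) => coord p.2 i + coord p.1 i)) => i.
  by apply: measurable_complexD; apply: (measurableT_comp (measurable_coord i)).
have mfadd : measurable_fun setT (f \o add) by exact: measurableT_comp.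
transitivity (\int[P]_w (f \o add) (X w, V w))%E.
  apply: eq_integral => w _; rewrite /=/add/=; congr f.
  by congr block; apply/funext => i; rewrite !coord_block addrC.
rewrite (ge0_integral_indep mX mV XV)//; last by move=> p; exact: f0.
pose g (p : Omega * output_block N) : \bar R := (f p.2 *
  (expR (\sum_i (2 * cdot (signal tau z i p.1) (coord p.2 i) - csq (signal tau z i p.1))))%R%:E)%E.
have mexp : measurable_fun setT (fun p : Omega * output_block N =>
    expR (\sum_i (2 * cdot (signal tau z i p.1) (coord p.2 i) - csq (signal tau z i p.1)))).
  apply: measurable_likelihood_exponent => i.
    exact: (measurableT_comp (measurable_signal channel rho tau z i)).
  exact: (measurableT_comp (measurable_coord i)).
have mg : measurable_fun setT g.
  apply: emeasurable_funM; first exact: (measurableT_comp mf).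
  exact/measurable_EFinP.
have g0 p : (0 <= g p)%E by rewrite mule_ge0// lee_fin expR_ge0.
transitivity (\int[P]_w \int[noise_law]_y g (w, y))%E.
  apply: eq_integral => w _.
  rewrite -(@ge0_integral_image _ _ _ _ R P noise_law V mV noise_block_law (fun v => f (add (X w, v))))//; last first.
    exact: (measurableT_comp mfadd (pair1_measurable _)).
  rewrite -(noise_law_shift (fun i => signal tau z i w) mf f0).
  apply: eq_integral => y _; rewrite /add/=; congr f; congr block; apply/funext => i.
  by rewrite coord_block.
rewrite (@fubini_tonelli _ _ _ _ _ _ _ g)//; apply: eq_integral => y _.
rewrite /g/= ge0_integralZl//; last first.
  by apply/measurable_EFinP; exact: (measurableT_comp mexp (pair2_measurable y)).
congr (_ * _)%E; rewrite /density.
have gs t := @signal_gaussian _ _ _ _ _ _ _ _ channel _ _ separable _ rho_ge0 t N z.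
have ms t := @measurable_signal _ _ _ _ _ _ _ _ channel rho t N z.
rewrite (likelihood_unique (covariance_herm channel separable rho_ge0 0 z)
  (covariance_psd channel separable rho_ge0 0 z) (ms 0) (gs 0) (ms tau) (gs tau)).
by rewrite EFin_likelihood.
Qed.

End fixed_input.

Lemma density_int1 N (z : input_block N) : (\int[noise_law]_y (density z y)%:E = 1)%E.
Proof.
rewrite -(integral_prob_cst P 1).
rewrite (@expect_received_density 0 N z (cst 1%E))//.
by apply: eq_integral => y _; rewrite mul1e.
Qed.

End channel_density.

(** * Mutual information through densities *)

Section divergence.
Context d (T : measurableType d) (R : realType) (P Q : probability T R).
Variable h : T -> R.
Hypothesis mh : measurable_fun setT h.
Hypothesis PE : forall A, measurable A -> P A = (\int[Q]_(x in A) (h x)%:E)%E.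

(** [KL] uses a version of the Radon-Nikodym derivative that equals [h] only up to a [Q]-null set;
    absolute continuity makes this set [P]-null, so the integral does not change. *)
Lemma KL_density : KL P Q = (\int[P]_x (ln (h x))%:E)%E.
Proof.
have PQ : P `<< Q.
  apply/null_content_dominatesP => A mA QA.
  rewrite PE//; apply: null_set_integral => //.
  by apply/measurable_EFinP; exact: measurable_funS mh.
rewrite /KL; case: asboolP => [_|/(_ PQ)//].
set f := Radon_Nikodym _ _.
have If : Q.-integrable setT f by exact: Radon_Nikodym_integrable.
have mf : measurable_fun setT f := measurable_int _ If.
have fh : ae_eq Q setT f (EFin \o h).
  apply: integral_ae_eq => //; first exact/measurable_EFinP.
  move=> E _ mE; rewrite -PE// -Radon_Nikodym_integral//.
apply: ae_eq_integral => //.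
- apply/measurable_EFinP; apply: (measurableT_comp (@measurable_ln R)).
  exact: (measurableT_comp (fine_measurable measurableT)).
- by apply/measurable_EFinP; exact: (measurableT_comp (@measurable_ln R)).
- have [N [mN N0 fN]] := fh.
  exists N; split => //; first by move/null_content_dominatesP : PQ; exact.
  move=> x /= nx; apply: fN => /= E; apply: nx => _.
  by rewrite E.
Qed.

(** Gibbs' inequality from [1 + x <= expR x]. Both variational bounds on the mutual information are
    instances. *)
Lemma Rintegral_gibbs (a b : T -> R) :
  P.-integrable setT (EFin \o a) -> P.-integrable setT (EFin \o b) ->
  (\int[P]_x (expR (b x - a x))%:E <= 1)%E ->
  \int[P]_x b x <= \int[P]_x a x.
Proof.
move=> Ia Ib ab; rewrite -subr_ge0 -RintegralB//.
have ma : measurable_fun setT a by apply/measurable_EFinP; exact: measurable_int Ia.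
have mb : measurable_fun setT b by apply/measurable_EFinP; exact: measurable_int Ib.
have mab : measurable_fun setT (fun x => expR (b x - a x)).
  by apply: measurableT_comp => //; exact: measurable_funB.
have Iab : P.-integrable setT (EFin \o (fun x => expR (b x - a x))).
  by apply: (ge0_Rintegrable_le mab _ ab) => x; exact: expR_ge0.
have : \int[P]_x (1 - expR (b x - a x)) <= \int[P]_x (a x - b x).
  apply: le_Rintegral => //.
  - by apply: integrable_EFinB => //; exact: integrable_prob_cst.
  - exact: integrable_EFinB.
  - by move=> x _; have := expR_ge1Dx (b x - a x); lra.
apply: le_trans; rewrite RintegralB//; last exact: integrable_prob_cst.
rewrite Rintegral_prob_cst subr_ge0 -lee_fin EFin_Rintegral//.
Qed.

End divergence.

Section channel_information.
Context d1 d2 d3 (T1 : measurableType d1) (T2 : measurableType d2) (O : measurableType d3)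
  (R : realType) (mu : probability T1 R) (P : probability O R) (gamma : probability T2 R).
Variables (X : {mfun (T1 * O)%type >-> T1}) (Y : {mfun (T1 * O)%type >-> T2}).
Hypothesis XE : forall s, X s = s.1.
Variable L : T1 * T2 -> R.
Hypothesis mL : measurable_fun setT L.
Hypothesis L_gt0 : forall p, 0 < L p.
Hypothesis YL : forall z f, measurable_fun setT f -> (forall y, 0 <= f y)%E ->
  (\int[P]_w f (Y (z, w)) = \int[gamma]_y (f y * (L (z, y))%:E))%E.
Variables (B : T2 -> R) (c : R).
Hypothesis L_le : forall z y, L (z, y) <= B y.
Hypothesis c_gt0 : 0 < c.
Hypothesis L_ge : forall y, {ae mu, forall z, c <= L (z, y)}.
Hypothesis ln_B : (mu \x P)%E.-integrable setT (EFin \o (fun s => ln (B (Y s)))).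

Definition marginal y : R := \int[mu]_z L (z, y).

Lemma integrable_channel_density y : mu.-integrable setT (EFin \o (fun z => L (z, y))).
Proof.
apply: (@le_EFin_integrable _ _ _ mu setT measurableT _ (fun=> B y)).
- exact: (measurableT_comp mL (pair2_measurable y)).
- by move=> z _; rewrite ger0_norm ?(ltW (L_gt0 _)).
- exact: integrable_prob_cst.
Qed.

Lemma EFin_marginal y : ((marginal y)%:E = \int[mu]_z (L (z, y))%:E)%E.
Proof. by rewrite EFin_Rintegral//; exact: integrable_channel_density. Qed.

Lemma marginal_le y : marginal y <= B y.
Proof.
rewrite -[leRHS](Rintegral_prob_cst mu); apply: le_Rintegral => //.
- exact: integrable_channel_density.
- exact: integrable_prob_cst.
Qed.

(** The floor on [L] holds only for almost all inputs, as the peak constraint does, but after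
    averaging it holds at every output, so the logarithm of [marginal] is under control
    everywhere. *)
Lemma marginal_ge y : c <= marginal y.
Proof.
rewrite -lee_fin EFin_marginal -(integral_prob_cst mu c).
apply: ae_ge0_le_integral => //.
- by move=> z _; rewrite lee_fin ltW.
- by move=> z _; rewrite lee_fin ltW.
- by apply/measurable_EFinP; exact: (measurableT_comp mL (pair2_measurable y)).
- by apply: filterS (L_ge y) => z h _; rewrite lee_fin.
Qed.

Lemma marginal_gt0 y : 0 < marginal y.
Proof. exact: lt_le_trans c_gt0 (marginal_ge y). Qed.

Lemma measurable_marginal : measurable_fun setT marginal.
Proof.
apply: (measurableT_comp (fine_measurable measurableT)).
apply: (@measurable_fun_fubini_tonelli_G _ _ _ _ R mu (fun p => (L p)%:E)) => [|p].
  exact/measurable_EFinP.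
by rewrite lee_fin ltW.
Qed.

Lemma ge0_integral_joint (f : T1 * T2 -> \bar R) :
  measurable_fun setT f -> (forall p, 0 <= f p)%E ->
  (\int[mu \x P]_s f (s.1, Y s) =
   \int[mu]_z \int[gamma]_y (f (z, y) * (L (z, y))%:E))%E.
Proof.
move=> mf f0; rewrite fubini_tonelli1//.
  apply: eq_integral => z _; rewrite /fubini_F/= (YL z (f := fun y => f (z, y)))//.
  exact: (measurableT_comp mf (pair1_measurable z)).
apply: (measurableT_comp mf); exact: measurable_fun_pair.
Qed.

Lemma ge0_integral_output (g : T2 -> \bar R) :
  measurable_fun setT g -> (forall y, 0 <= g y)%E ->
  (\int[mu \x P]_s g (Y s) = \int[gamma]_y (g y * (marginal y)%:E))%E.
Proof.
move=> mg g0.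
have mgL : measurable_fun setT (fun p : T1 * T2 => (g p.2 * (L p)%:E)%E).
  by apply: emeasurable_funM; [exact: (measurableT_comp mg)|exact/measurable_EFinP].
rewrite (ge0_integral_joint (f := fun p => g p.2))//; last exact: (measurableT_comp mg).
rewrite (@fubini_tonelli _ _ _ _ _ _ _ (fun p : T1 * T2 => (g p.2 * (L p)%:E)%E))//; last first.
  by move=> p; rewrite mule_ge0// lee_fin ltW.
apply: eq_integral => y _; rewrite /= ge0_integralZl// -?EFin_marginal//.
- by apply/measurable_EFinP; exact: (measurableT_comp mL (pair2_measurable y)).
- by move=> z _; rewrite lee_fin ltW.
Qed.

Definition info_density (p : T1 * T2) : R := ln (L p) - ln (marginal p.2).

Lemma measurable_info_density : measurable_fun setT info_density.
Proof.
apply: measurable_funB; apply: (measurableT_comp (@measurable_ln R)) => //.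
exact: (measurableT_comp measurable_marginal).
Qed.

Lemma expR_info_density p : expR (info_density p) * marginal p.2 = L p.
Proof. by rewrite expRD expRN !lnK ?posrE ?marginal_gt0// divfK ?gt_eqF ?marginal_gt0. Qed.

(** The output law has density [marginal] with respect to [gamma], so the exponential of
    [info_density] is the density of the joint law with respect to the product of its marginals. *)
Lemma mutual_information_density : mutual_information (mu \x P)%E X Y =
  (\int[mu \x P]_s (info_density (s.1, Y s))%:E)%E.
Proof.
have mXY : measurable_fun setT (pair_fun X Y) by exact: measurable_fun_pair.
have mi := measurable_info_density.
have mei : measurable_fun setT (fun p => expR (info_density p)) by exact: measurableT_comp.
rewrite /mutual_information (KL_density mei).
  rewrite (@integral_image _ _ _ _ R (mu \x P)%E (distribution (mu \x P)%E (pair_fun X Y)) (pair_fun X Y))//; last first.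
    by apply/measurable_EFinP; apply: (measurableT_comp (@measurable_ln R)).
  by apply: eq_integral => s _; rewrite expRK /pair_fun XE.
move=> A mA.
have mL' : measurable_fun setT (fun p => (L p)%:E) by exact/measurable_EFinP.
have mei' : measurable_fun setT (fun p => (expR (info_density p))%:E) by exact/measurable_EFinP.
have mIA : measurable_fun setT (fun p : T1 * T2 => (\1_A p)%:E : \bar R).
  by apply/measurable_EFinP; exact: measurable_indic.
have IA0 p : (0 <= (\1_A p)%:E :> \bar R)%E by rewrite lee_fin indicE.
transitivity (\int[mu]_z \int[gamma]_y ((\1_A (z, y))%:E * (L (z, y))%:E))%E.
  rewrite -(ge0_integral_joint mIA IA0).
  transitivity (\int[mu \x P]_s (\1_(pair_fun X Y @^-1` A) s)%:E)%E.
    rewrite integral_indic ?setIT//.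
    by have := mXY measurableT A mA; rewrite setTI.
  by apply: eq_integral => s _; rewrite -XE -[(X s, Y s)]/(pair_fun X Y s).
rewrite [RHS]integral_mkcond.
transitivity (\int[(distribution (mu \x P) X \x distribution (mu \x P) Y)]_p
    ((\1_A p)%:E * (expR (info_density p))%:E))%E; last first.
  apply: eq_integral => p _; rewrite patchE indicE.
  by case: (p \in A); rewrite ?mul1e ?mul0e.
have mF : measurable_fun setT (fun p => (\1_A p)%:E * (expR (info_density p))%:E)%E.
  exact: emeasurable_funM.
have F0 p : (0 <= (\1_A p)%:E * (expR (info_density p))%:E)%E.
  by rewrite mule_ge0// lee_fin expR_ge0.
rewrite fubini_tonelli1//.
have mG : measurable_fun setT (fubini_F (distribution (mu \x P)%E Y)
    (fun p => (\1_A p)%:E * (expR (info_density p))%:E)%E).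
  exact: measurable_fun_fubini_tonelli_F.
rewrite (@ge0_integral_image _ _ _ _ R (mu \x P)%E (distribution (mu \x P)%E X) X)//; last first.
  by move=> z; apply: integral_ge0 => y _; exact: F0.
rewrite fubini_tonelli1//; last 2 first.
- exact: (measurableT_comp mG).
- by move=> s; apply: integral_ge0 => y _; exact: F0.
apply: eq_integral => z _; rewrite /fubini_F/=.
transitivity (\int[P]_w \int[gamma]_y ((\1_A (z, y))%:E * (L (z, y))%:E))%E.
  rewrite integral_cst// -[LHS]mule1; congr (_ * _)%E; exact/esym/(@probability_setT _ _ _ P).
apply: eq_integral => w _; rewrite XE/=.
rewrite (@ge0_integral_image _ _ _ _ R (mu \x P)%E (distribution (mu \x P)%E Y) Y)//; last first.
  exact: (measurableT_comp mF (pair1_measurable z)).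
rewrite (ge0_integral_output (g := fun y => (\1_A (z, y))%:E * (expR (info_density (z, y)))%:E))%E//; last first.
  exact: (measurableT_comp mF (pair1_measurable z)).
apply: eq_integral => y _; rewrite -muleA -!EFinM.
by congr (_ * _)%:E; exact: (esym (expR_info_density (z, y))).
Qed.

Hypothesis ln_L : (mu \x P)%E.-integrable setT (EFin \o (fun s => ln (L (s.1, Y s)))).

Lemma integrable_ln_marginal :
  (mu \x P)%E.-integrable setT (EFin \o (fun s => ln (marginal (Y s)))).
Proof.
apply: (@le_EFin_integrable _ _ _ (mu \x P)%E setT measurableT _
  (fun s => `|ln (B (Y s))| + `|ln c|)).
- apply: (measurableT_comp (@measurable_ln R)).
  exact: (measurableT_comp measurable_marginal).
- move=> s _; have c1 : ln c <= ln (marginal (Y s)).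
    by rewrite ler_ln ?posrE ?marginal_gt0// marginal_ge.
  have c2 : ln (marginal (Y s)) <= ln (B (Y s)).
    by rewrite ler_ln ?posrE ?marginal_gt0 ?marginal_le// (lt_le_trans (marginal_gt0 (Y s)))// marginal_le.
  by rewrite ler_norml; have := ler_norm (ln (B (Y s))); have := ler_norm (- ln c);
    have := normr_ge0 (ln c); have := normr_ge0 (ln (B (Y s))); rewrite normrN; lra.
- apply: integrable_EFinD => //; last exact: integrable_prob_cst.
  exact: (integrable_abse ln_B).
Qed.

Lemma integrable_info_density :
  (mu \x P)%E.-integrable setT (EFin \o (fun s => info_density (s.1, Y s))).
Proof. by apply: integrable_EFinB => //; exact: integrable_ln_marginal. Qed.

Lemma mutual_information_real : mutual_information (mu \x P)%E X Y =
  (\int[(mu \x P)%E]_s info_density (s.1, Y s))%:E.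
Proof. by rewrite mutual_information_density EFin_Rintegral//; exact: integrable_info_density. Qed.

(** Gibbs' inequality for the ratio [q y / marginal y], whose integral against the output law is the
    integral of [q]. *)
Lemma mutual_information_le (q : T2 -> R) :
  measurable_fun setT q -> (forall y, 0 < q y) ->
  (\int[gamma]_y (q y)%:E <= 1)%E ->
  (mu \x P)%E.-integrable setT (EFin \o (fun s => ln (q (Y s)))) ->
  (mutual_information (mu \x P)%E X Y <=
   (\int[(mu \x P)%E]_s (ln (L (s.1, Y s)) - ln (q (Y s))))%R%:E)%E.
Proof.
move=> mq q0 q1 Iq; rewrite mutual_information_real lee_fin.
apply: Rintegral_gibbs; first exact: integrable_EFinB.
  exact: integrable_info_density.
apply: le_trans q1.
have mqm : measurable_fun setT (fun y => expR (ln (q y) - ln (marginal y))).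
  apply: measurableT_comp => //; apply: measurable_funB; apply: (measurableT_comp (@measurable_ln R)) => //.
  exact: measurable_marginal.
apply: (@le_trans _ _ (\int[mu \x P]_s (fun y => (expR (ln (q y) - ln (marginal y)))%:E) (Y s))%E).
  by rewrite le_eqVlt; apply/orP; left; apply/eqP; apply: eq_integral => s _; congr (expR _)%:E; rewrite /info_density/=; ring.
rewrite (ge0_integral_output (g := fun y => (expR (ln (q y) - ln (marginal y)))%:E)); last 2 first.
- exact/measurable_EFinP.
- by move=> y; rewrite lee_fin expR_ge0.
rewrite le_eqVlt; apply/orP; left; apply/eqP; apply: eq_integral => y _; rewrite -EFinM; congr _%:E.
by rewrite expRD expRN !lnK ?posrE ?marginal_gt0// divfK// gt_eqF// marginal_gt0.
Qed.

(** Gibbs' inequality again: against the joint law, [g] divided by the exponential of [info_density]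
    integrates to the integral of [g] times [marginal]. A constant multiple of L / q for [g] yields
    achievable rates, a product of posterior densities yields superadditivity, and [g = 1]
    nonnegativity. *)
Lemma mutual_information_ge (g : T1 * T2 -> R) :
  measurable_fun setT g -> (forall p, 0 < g p) ->
  (\int[mu]_z \int[gamma]_y (g (z, y) * marginal y)%:E <= 1)%E ->
  (mu \x P)%E.-integrable setT (EFin \o (fun s => ln (g (s.1, Y s)))) ->
  ((\int[(mu \x P)%E]_s ln (g (s.1, Y s)))%R%:E <= mutual_information (mu \x P)%E X Y)%E.
Proof.
move=> mg g0 g1 Ig; rewrite mutual_information_real lee_fin.
apply: Rintegral_gibbs => //; first exact: integrable_info_density.
apply: le_trans g1.
have mqm : measurable_fun setT (fun p => expR (ln (g p) - info_density p)).
  apply: measurableT_comp => //; apply: measurable_funB; first exact: (measurableT_comp (@measurable_ln R)).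
  exact: measurable_info_density.
rewrite (ge0_integral_joint (f := fun p => (expR (ln (g p) - info_density p))%:E)); last 2 first.
- exact/measurable_EFinP.
- by move=> y; rewrite lee_fin expR_ge0.
rewrite le_eqVlt; apply/orP; left; apply/eqP; apply: eq_integral => z _.
apply: eq_integral => y _; rewrite -EFinM; congr _%:E.
rewrite expRD expRN lnK ?posrE// -mulrA; congr (_ * _).
by rewrite -[X in _ * X]expR_info_density mulrA mulVf ?gt_eqF ?expR_gt0// mul1r.
Qed.

End channel_information.

Section ae_Rintegral.
Context d (T : measurableType d) (R : realType) (P : probability T R).

Lemma ae_le_Rintegral (f g : T -> R) :
  P.-integrable setT (EFin \o f) -> P.-integrable setT (EFin \o g) ->
  {ae P, forall x, f x <= g x} -> \int[P]_x f x <= \int[P]_x g x.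
Proof.
move=> If Ig fg.
have mf : measurable_fun setT f by apply/measurable_EFinP; exact: measurable_int If.
have mg : measurable_fun setT g by apply/measurable_EFinP; exact: measurable_int Ig.
(* The minimum is below [g] everywhere and equals [f] almost everywhere. *)
pose h x := Num.min (f x) (g x).
have mh : measurable_fun setT h by exact: measurable_minr.
have Ih : P.-integrable setT (EFin \o h).
  apply: (@le_EFin_integrable _ _ _ P setT measurableT _ (fun x => `|f x| + `|g x|)) => //.
    by move=> x _; have := normr_ge0 (f x); have := normr_ge0 (g x); rewrite /h /Order.min; case: ifP => _; lra.
  by apply: integrable_EFinD => //; apply: (integrable_abse (f := EFin \o _)).
have -> : \int[P]_x f x = \int[P]_x h x.
  congr fine; apply: ae_eq_integral => //; [exact/measurable_EFinP|exact/measurable_EFinP|].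
  by apply: filterS fg => x fgx _; rewrite /h min_l.
by apply: le_Rintegral => // x _; rewrite /h ge_min lexx orbT.
Qed.

End ae_Rintegral.

Section weighted_cauchy_schwarz.
Context (R : realType) (K : finType).
Local Notation C := R[i].

Lemma csq_sum (w : K -> C) : csq (\sum_k w k) = \sum_k \sum_l cdot (w k) (w l).
Proof.
rewrite /csq Re_sum Im_sum !expr2 !big_distrlr/= -big_split/=.
by apply: eq_bigr => k _; rewrite -big_split.
Qed.

(* Lagrange's identity: the difference is a sum of terms csq (x k * y l - x l * y k). *)
Lemma csq_sum_le (a : K -> R) (x y : K -> C) : (forall k, 0 <= a k) ->
  csq (\sum_k (a k)%:C%C * (x k * (y k)^*)) <=
  (\sum_k a k * csq (x k)) * (\sum_k a k * csq (y k)).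
Proof.
move=> a0; rewrite csq_sum.
have E : (\sum_k a k * csq (x k)) * (\sum_k a k * csq (y k)) =
    \sum_k \sum_l (a k * a l * (csq (x k * y l) + csq (x l * y k)) / 2).
  under [RHS]eq_bigr do under eq_bigr do rewrite mulrDr mulrDl.
  under [RHS]eq_bigr do rewrite big_split/=.
  rewrite big_split/= [X in _ = _ + X]exchange_big/= -big_split/=.
  rewrite big_distrlr/=; apply: eq_bigr => k _; rewrite -big_split/=; apply: eq_bigr => l _.
  by case: (x k) (y l) => x1 x2 [y1 y2]; rewrite /csq /=; field.
rewrite E; apply: ler_sum => k _; apply: ler_sum => l _.
have -> : cdot ((a k)%:C%C * (x k * (y k)^*)) ((a l)%:C%C * (x l * (y l)^*)) =
    a k * a l * cdot (x k * y l) (x l * y k).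
  case: (x k) (y k) (x l) (y l) => x1 x2 [y1 y2] [x3 x4] [y3 y4].
  by rewrite /cdot /=; ring.
rewrite -[leRHS]mulrA ler_wpM2l ?mulr_ge0//.
by have := csq_ge0 (x k * y l - x l * y k); rewrite csqB; lra.
Qed.

End weighted_cauchy_schwarz.

(** * Power of the input and size of the covariance *)

Section power_bound.
Context (R : realType) (NT NR : nat) d (Omega : measurableType d)
  (P : probability Omega R)
  (H : 'I_NT -> 'I_NR -> int -> {RV P >-> R[i]})
  (W : 'I_NR -> nat -> {RV P >-> R[i]})
  (channel : rayleigh_mimo H W)
  (alpha : 'I_NT -> R) (r : 'I_NR -> int -> R[i])
  (separable : transmit_separable H alpha r) (rho : R).
Hypothesis rho_ge0 : 0 <= rho.
Local Notation C := R[i].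
Local Notation Re := (@complex.Re R).
Local Notation input_block N := (N.-tuple (NT.-tuple R[i])).
Local Notation output_block N := (N.-tuple (NR.-tuple R[i])).
Local Notation cov := (covariance alpha r rho).

Let alpha_ge0 k : 0 <= alpha k. Proof. by case: separable. Qed.

(** Given the input, the variance of an output at time [n] depends on [z] only through this
    combination. *)
Definition weighted_power N (z : input_block N) (n : 'I_N) : R :=
  \sum_k alpha k * csq (tnth (tnth z n) k).

Definition signal_energy N (z : input_block N) : R := \sum_i Re (cov z i i).

Definition cov_energy N (z : input_block N) : R := \sum_i \sum_j csq (cov z i j).

Lemma weighted_power_ge0 N (z : input_block N) n : 0 <= weighted_power z n.
Proof. by apply: sumr_ge0 => k _; rewrite mulr_ge0 ?csq_ge0. Qed.

Lemma measurable_weighted_power N n :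
  measurable_fun setT (fun z : input_block N => weighted_power z n).
Proof.
apply: measurable_sum => k; apply: measurable_funM => //.
exact: (measurableT_comp measurable_csq (measurable_coord_input n k)).
Qed.

Lemma sum_conj N (z : input_block N) n :
  \sum_k (alpha k)%:C%C * (tnth (tnth z n) k * (tnth (tnth z n) k)^*) = (weighted_power z n)%:C%C.
Proof.
rewrite /weighted_power rmorph_sum; apply: eq_bigr => k _ /=.
by rewrite mul_conj -rmorphM.
Qed.

Lemma cov_diag N (z : input_block N) i :
  Re (cov z i i) = rho * Re (r i.2 0) * weighted_power z i.1.
Proof.
by rewrite /covariance eqxx subrr sum_conj; case: (r i.2 0) => a b /=; ring.
Qed.

(** Separability enters here: the covariance is [r] times an inner product weighted by [alpha], to
    which Cauchy-Schwarz applies. Equality holds when all antennas send the same symbol. *)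
Lemma cov_offdiag N (z : input_block N) i j : csq (cov z i j) <=
  if i.2 == j.2 then rho ^+ 2 * csq (r i.2 (i.1%:Z - j.1%:Z)) *
    (weighted_power z i.1 * weighted_power z j.1) else 0.
Proof.
rewrite /covariance; case: eqP => _; last by rewrite /csq /= expr0n /= addr0.
have csqM (u v : C) : csq (u * v) = csq u * csq v.
  by case: u v => u1 u2 [v1 v2]; rewrite /csq /=; ring.
rewrite !csqM (_ : csq rho%:C%C = rho ^+ 2); last by rewrite /csq /= expr0n /= addr0.
by rewrite ler_wpM2l ?mulr_ge0 ?sqr_ge0 ?csq_ge0// csq_sum_le.
Qed.

Definition total_gain : R := \sum_k alpha k.

Lemma total_gain_ge0 : 0 <= total_gain. Proof. exact: sumr_ge0. Qed.

End power_bound.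

Section product_fst.
Context d1 d2 (T1 : measurableType d1) (T2 : measurableType d2) (R : realType)
  (mu : probability T1 R) (P : probability T2 R).

Lemma law_fst A : measurable A -> (mu \x P)%E (fst @^-1` A) = mu A.
Proof.
move=> mA; rewrite (_ : fst @^-1` A = A `*` setT); last first.
  by apply/seteqP; split => [[a b] //=|[a b] []].
by rewrite product_measure1E// -[RHS]mule1; congr (_ * _)%E; exact: (@probability_setT _ _ _ P).
Qed.

Lemma integrable_fst (f : T1 -> R) : mu.-integrable setT (EFin \o f) ->
  (mu \x P)%E.-integrable setT (EFin \o (fun s => f s.1)).
Proof.
move=> If; have mf := measurable_int _ If.
exact: (integrable_image (m1 := (mu \x P)%E) measurable_fst law_fst mf).1.
Qed.

(* Without integrability of f the two sides can differ, since fine +oo = 0. *)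
Lemma Rintegral_Fubini (f : T1 * T2 -> R) :
  (mu \x P)%E.-integrable setT (EFin \o f) ->
  mu.-integrable setT (fun z => \int[P]_w (f (z, w))%:E)%E /\
  (\int[(mu \x P)%E]_s f s)%:E = (\int[mu]_z \int[P]_w (f (z, w))%:E)%E.
Proof.
move=> If; split; first exact: (integrable_fubini_F If).
by rewrite EFin_Rintegral// -integral12_prod_meas1.
Qed.

End product_fst.

Section information_bounds.
Context (R : realType) (NT NR : nat) d (Omega : measurableType d)
  (P : probability Omega R)
  (H : 'I_NT -> 'I_NR -> int -> {RV P >-> R[i]})
  (W : 'I_NR -> nat -> {RV P >-> R[i]})
  (channel : rayleigh_mimo H W)
  (alpha : 'I_NT -> R) (r : 'I_NR -> int -> R[i])
  (separable : transmit_separable H alpha r) (rho beta : R).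
Hypothesis rho_ge0 : 0 <= rho.
Hypothesis beta_ge1 : 1 <= beta.
Local Notation C := R[i].
Local Notation Re := (@complex.Re R).
Local Notation input_block N := (N.-tuple (NT.-tuple R[i])).
Local Notation output_block N := (N.-tuple (NR.-tuple R[i])).
Local Notation cov := (covariance alpha r rho).
Local Notation power z n := (weighted_power alpha z n).

Let alpha_ge0 k : 0 <= alpha k. Proof. by case: separable. Qed.

Let r0_ge0 l : 0 <= Re (r l 0).
Proof. by case: separable => _ /(_ l) /autocorrelation_facts[]. Qed.

Variables (N : nat) (mu : probability (input_block N) R).
Hypothesis mu_power : power_constraints beta mu.
Local Notation I := ('I_N * 'I_NR)%type.
Local Notation base := (mu \x P)%E.
Local Notation out := (@channel_output R NT NR d Omega P H W rho N).

Lemma peak_power : {ae mu, forall z, forall n, power z n <= total_gain alpha}.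
Proof.
have : {ae mu, forall z, forall kn : 'I_NT * 'I_N, Normc.normc (tnth (tnth z kn.2) kn.1) ^+ 2 <= 1}.
  by apply: filter_forall => kn; case: (mu_power kn.1 kn.2).
apply: filterS => z hz n; apply: ler_sum => k _.
by rewrite -[leRHS]mulr1 ler_wpM2l// -normc_sqr; exact: (hz (k, n)).
Qed.

Definition mean_power (n : 'I_N) : R := \int[mu]_z power z n.

Lemma integrable_csq_input k n : mu.-integrable setT (EFin \o (fun z => csq (tnth (tnth z n) k))).
Proof.
have [_] := mu_power k n; under eq_integral do rewrite normc_sqr.
apply: ge0_Rintegrable_le => [|z]; last exact: csq_ge0.
exact: (measurableT_comp measurable_csq (measurable_coord_input n k)).
Qed.

Lemma integrable_power n : mu.-integrable setT (EFin \o (fun z => power z n)).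
Proof.
apply: (integrable_EFin_sum measurableT) => k.
exact: (integrable_EFinZl measurableT _ (integrable_csq_input k n)).
Qed.

Lemma mean_power_ge0 n : 0 <= mean_power n.
Proof. by apply: Rintegral_ge0 => // z _; exact: (weighted_power_ge0 separable). Qed.

Lemma mean_power_le n : mean_power n <= total_gain alpha / beta.
Proof.
rewrite /mean_power /weighted_power Rintegral_sum//; last first.
  by move=> k; exact: (integrable_EFinZl measurableT _ (integrable_csq_input k n)).
rewrite /total_gain mulr_suml; apply: ler_sum => k _.
rewrite RintegralZl//; last exact: integrable_csq_input.
rewrite ler_wpM2l// -lee_fin EFin_Rintegral//; last exact: integrable_csq_input.
have [_] := mu_power k n; apply: le_trans; rewrite le_eqVlt; apply/orP; left; apply/eqP.
by apply: eq_integral => z _; rewrite normc_sqr.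
Qed.

Lemma coord_out (z : input_block N) w i : coord (out (z, w)) i = received H W rho 0 z i w.
Proof. by rewrite block_received coord_block. Qed.

Lemma out_received (z : input_block N) w : out (z, w) = block (received H W rho 0 z ^~ w).
Proof. exact: block_received. Qed.

Lemma measurable_csq_out i : measurable_fun setT (fun s => csq (coord (out s) i)).
Proof.
apply: (measurableT_comp measurable_csq).
exact: (measurableT_comp (measurable_coord i)).
Qed.

Lemma expect_csq_out i : (\int[base]_s (csq (coord (out s) i))%:E =
  (1 + rho * Re (r i.2 0) * mean_power i.1)%:E)%E.
Proof.
rewrite fubini_tonelli1//; last 2 first.
- by apply/measurable_EFinP; exact: measurable_csq_out.
- by move=> s; rewrite lee_fin csq_ge0.
transitivity (\int[mu]_z (1 + rho * Re (r i.2 0) * power z i.1)%:E)%E.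
  apply: eq_integral => z _; rewrite /fubini_F.
  (* Indicator coefficients bring one coordinate to the form of [expect_received]. *)
  transitivity (\int[P]_w (csq (\sum_j (j == i)%:R * received H W rho 0 z j w))%:E)%E.
    apply: eq_integral => w _; rewrite coord_out (bigD1 i)//= eqxx mul1r big1 ?addr0//.
    by move=> j /negbTE ->; rewrite mul0r.
  rewrite (expect_received channel separable rho_ge0); congr _%:E.
  rewrite /quad addrC; congr (_ + _).
    rewrite (bigD1 i)//= eqxx big1 ?addr0; first by rewrite /csq /=; ring.
    by move=> j /negbTE ->; rewrite /csq /=; ring.
  rewrite -cov_diag; congr Re.
  rewrite (bigD1 i)//= [X in _ + X]big1 ?addr0; last first.
    by move=> j /negbTE ->; rewrite big1// => k _; rewrite !mul0r.
  rewrite (bigD1 i)//= eqxx [X in _ + X]big1 ?addr0; last first.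
    by move=> j /negbTE ->; rewrite conjC0 mulr0.
  by rewrite mul1r conjC1 mulr1.
have I1 : mu.-integrable setT (EFin \o (fun z => rho * Re (r i.2 0) * power z i.1)).
  exact: (integrable_EFinZl measurableT _ (integrable_power _)).
rewrite -EFin_Rintegral//; last first.
  by apply: (integrable_EFinD measurableT) => //; exact: integrable_prob_cst.
rewrite RintegralD//; last exact: integrable_prob_cst.
by rewrite Rintegral_prob_cst RintegralZl//; exact: integrable_power.
Qed.

Lemma integrable_csq_out i : base.-integrable setT (EFin \o (fun s => csq (coord (out s) i))).
Proof.
apply: (ge0_Rintegrable (measurable_csq_out i) _ (expect_csq_out i)) => s.
exact: csq_ge0.
Qed.

Lemma Rexpect_csq_out i :
  \int[base]_s csq (coord (out s) i) = 1 + rho * Re (r i.2 0) * mean_power i.1.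
Proof. by rewrite /Rintegral expect_csq_out. Qed.

Lemma integrable_sum_csq_out :
  base.-integrable setT (EFin \o (fun s => \sum_i csq (coord (out s) i))).
Proof. by apply: (integrable_EFin_sum measurableT) => i; exact: integrable_csq_out. Qed.

Lemma integrable_signal_energy :
  mu.-integrable setT (EFin \o (fun z => signal_energy alpha r rho z)).
Proof.
apply: (integrable_EFin_sum measurableT) => i.
rewrite (_ : EFin \o _ = EFin \o (fun z => rho * Re (r i.2 0) * power z i.1)).
  exact: (integrable_EFinZl measurableT _ (integrable_power _)).
by apply/funext => z /=; rewrite cov_diag.
Qed.

Definition chan_density (p : input_block N * output_block N) : R := density H rho p.1 p.2.

Lemma measurable_chan_density : measurable_fun setT chan_density.
Proof. exact: measurable_density. Qed.

Lemma chan_density_gt0 p : 0 < chan_density p.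
Proof. exact: (density_gt0 channel separable rho_ge0). Qed.

Lemma chan_kernel z f : measurable_fun setT f -> (forall y, (0 <= f y)%E) ->
  (\int[P]_w f (out (z, w)) = \int[noise_law]_y (f y * (chan_density (z, y))%:E))%E.
Proof.
move=> mf f0; rewrite -(expect_received_density channel separable rho_ge0 0)//.
by apply: eq_integral => w _; rewrite out_received.
Qed.

Definition energy_bound (y : output_block N) : R := expR (\sum_i csq (coord y i)).

Lemma chan_density_le z y : chan_density (z, y) <= energy_bound y.
Proof. exact: (density_le channel). Qed.

(** The bound of [density_ge] at the largest signal energy that the peak constraint allows. *)
Definition density_floor : R := expR (- \sum_(i : I) rho * Re (r i.2 0) * total_gain alpha).

Lemma density_floor_gt0 : 0 < density_floor. Proof. exact: expR_gt0. Qed.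

Lemma chan_density_ge y : {ae mu, forall z, density_floor <= chan_density (z, y)}.
Proof.
apply: filterS peak_power => z hz.
apply: le_trans (density_ge channel separable rho_ge0 z y).
rewrite ler_expR lerN2; apply: ler_sum => i _; rewrite cov_diag.
by rewrite ler_wpM2l// mulr_ge0.
Qed.

Lemma ln_energy_bound : base.-integrable setT (EFin \o (fun s => ln (energy_bound (out s)))).
Proof.
rewrite (_ : EFin \o _ = EFin \o (fun s => \sum_i csq (coord (out s) i))).
  exact: integrable_sum_csq_out.
by apply/funext => s /=; rewrite expRK.
Qed.

(** The logarithm lies between minus the signal energy and the energy of the output, both of finite
    mean. *)
Lemma integrable_ln_density :
  base.-integrable setT (EFin \o (fun s => ln (chan_density (s.1, out s)))).
Proof.
apply: (@le_EFin_integrable _ _ _ base setT measurableT _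
  (fun s => \sum_i csq (coord (out s) i) + signal_energy alpha r rho s.1)).
- apply: (measurableT_comp (@measurable_ln R)); apply: (measurableT_comp measurable_chan_density).
  exact: measurable_fun_pair.
- move=> s _.
  have t0 : 0 <= signal_energy alpha r rho s.1.
    by apply: sumr_ge0 => i _; rewrite cov_diag mulr_ge0 ?mulr_ge0// (weighted_power_ge0 separable).
  have y0 : 0 <= \sum_i csq (coord (out s) i) by apply: sumr_ge0 => i _; exact: csq_ge0.
  have h1 : ln (chan_density (s.1, out s)) <= \sum_i csq (coord (out s) i).
    by rewrite -[leRHS]expRK ler_ln ?posrE ?expR_gt0 ?chan_density_gt0// chan_density_le.
  have h2 : - signal_energy alpha r rho s.1 <= ln (chan_density (s.1, out s)).
    rewrite -[leLHS]expRK ler_ln ?posrE ?expR_gt0 ?chan_density_gt0//.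
    exact: (density_ge channel separable rho_ge0).
  by rewrite ler_norml; apply/andP; split; lra.
- apply: (integrable_EFinD measurableT); first exact: integrable_sum_csq_out.
  exact: (integrable_fst P integrable_signal_energy).
Qed.

Definition output_density (y : output_block N) : R := marginal mu chan_density y.

Let bXE (s : input_block N * Omega) : block_input s = s.1. Proof. by []. Qed.

Lemma block_information_real :
  block_information H W rho mu =
  (\int[base]_s info_density mu chan_density (s.1, out s))%:E.
Proof.
exact: (mutual_information_real bXE measurable_chan_density chan_density_gt0 chan_kernel
  chan_density_le density_floor_gt0 chan_density_ge ln_energy_bound integrable_ln_density).
Qed.

Lemma block_information_le (q : output_block N -> R) :
  measurable_fun setT q -> (forall y, 0 < q y) ->
  (\int[noise_law]_y (q y)%:E <= 1)%E ->
  base.-integrable setT (EFin \o (fun s => ln (q (out s)))) ->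
  (block_information H W rho mu <=
   (\int[base]_s (ln (chan_density (s.1, out s)) - ln (q (out s))))%R%:E)%E.
Proof.
exact: (mutual_information_le bXE measurable_chan_density chan_density_gt0 chan_kernel
  chan_density_le density_floor_gt0 chan_density_ge ln_energy_bound integrable_ln_density).
Qed.

Lemma block_information_ge (g : input_block N * output_block N -> R) :
  measurable_fun setT g -> (forall p, 0 < g p) ->
  (\int[mu]_z \int[noise_law]_y (g (z, y) * output_density y)%:E <= 1)%E ->
  base.-integrable setT (EFin \o (fun s => ln (g (s.1, out s)))) ->
  ((\int[base]_s ln (g (s.1, out s)))%R%:E <= block_information H W rho mu)%E.
Proof.
exact: (mutual_information_ge bXE measurable_chan_density chan_density_gt0 chan_kernel
  chan_density_le density_floor_gt0 chan_density_ge ln_energy_bound integrable_ln_density).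
Qed.

End information_bounds.

(** * Upper bound *)

Section autocorrelation_sums.
Context (R : realType) (r : int -> R[i]).
Local Notation C := R[i].
Hypothesis r_conj : forall n, r (- n) = (r n)^*.
Hypothesis r0_real : complex.Im (r 0) = 0.
Hypothesis phi_fin : (phi r < +oo)%E.

Definition partial_phi (m : nat) : R := \sum_(1 <= k < m) csq (r k%:Z).

Lemma partial_phiE m : (\sum_(1 <= k < m) (Normc.normc (r k%:Z) ^+ 2)%:E)%E = (partial_phi m)%:E.
Proof. by rewrite /partial_phi -sumEFin; apply: eq_bigr => k _; rewrite normc_sqr. Qed.

Let phi_num : phi r \is a fin_num.
Proof.
rewrite ge0_fin_numE//; apply: nneseries_ge0 => k _ _.
by rewrite lee_fin normc_sqr csq_ge0.
Qed.

Lemma partial_phi_le m : partial_phi m <= fine (phi r).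
Proof.
rewrite -lee_fin fineK// -partial_phiE; apply: nneseries_lim_ge => k _.
by rewrite lee_fin normc_sqr csq_ge0.
Qed.

Lemma partial_phi_cvg e : 0 < e -> exists K, forall m, (K <= m)%N ->
  fine (phi r) - e <= partial_phi m.
Proof.
move=> e0.
have cv : (\sum_(1 <= k < m) (Normc.normc (r k%:Z) ^+ 2)%:E)%E @[m --> \oo] --> phi r.
  apply: is_cvg_nneseries => k _ _.
  by rewrite lee_fin normc_sqr csq_ge0.
have {}cv : partial_phi m @[m --> \oo] --> fine (phi r).
  apply: (@fine_cvg R nat \oo _ (fun m => (partial_phi m)%:E)).
  by rewrite fineK//; under eq_fun do rewrite -partial_phiE.
have /cvgrPdist_lt /(_ _ e0) [K _ hK] := cv.
exists K => m Km; have := hK m Km; rewrite /= ltr_norml => /andP[_ h].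
lra.
Qed.

(** Row [n] of the Toeplitz matrix meets lags 1 to [n] on one side and 1 to [N - n - 1] on the
    other; [partial_phi m] stops before [m], hence the arguments [n.+1] and [N - n]. *)
Lemma row_sum N (n : 'I_N) : \sum_(m < N) csq (r (n%:Z - m%:Z)) =
  complex.Re (r 0) ^+ 2 + partial_phi n.+1 + partial_phi (N - n).
Proof.
have nN : (n < N)%N by [].
rewrite -(big_mkord xpredT (fun m => csq (r (n%:Z - m%:Z)))).
rewrite (@big_cat_nat _ _ _ n)//=; last exact: ltnW.
rewrite [RHS]addrAC [RHS]addrC; congr (_ + _).
  rewrite big_nat_rev/= /partial_phi big_add1/=.
  rewrite !big_mkord; apply: eq_bigr => i _; congr (csq (r _)).
  by rewrite add0n -subzn// opprB addrC subrK.
rewrite big_ltn// subrr; congr (_ + _); first by rewrite /csq r0_real expr0n addr0.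
have -> : n.+1 = (1 + n)%N by [].
rewrite big_addn /partial_phi; apply: eq_bigr => k _.
by rewrite PoszD opprD addrCA subrr addr0 r_conj; case: (r k) => a b; rewrite /csq /= sqrrN.
Qed.

Lemma row_sum_le N (n : 'I_N) : \sum_(m < N) csq (r (n%:Z - m%:Z)) <= lambda r.
Proof.
rewrite row_sum /lambda; have := partial_phi_le n.+1; have := partial_phi_le (N - n).
lra.
Qed.

Let sum_lt (N K : nat) : (\sum_(n < N) (n < K) <= K)%N.
Proof.
suff -> : (\sum_(n < N) (n < K) = minn N K)%N by rewrite geq_minr.
elim: N => [|N ih]; first by rewrite big_ord0 min0n.
rewrite big_ord_recr/= ih; case: (ltnP N K) => NK.
  by rewrite addn1 (minn_idPl NK).
by rewrite addn0 (minn_idPr (leqW NK)).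
Qed.

Lemma double_sum_ge e : 0 < e -> exists K : nat, forall N,
  N%:R * (lambda r - 2 * e) - 2 * K%:R * lambda r <=
  \sum_(n < N) \sum_(m < N) csq (r (n%:Z - m%:Z)).
Proof.
move=> e0; have [K hK] := partial_phi_cvg e0; exists K => N.
have f0 : 0 <= fine (phi r).
  by have := partial_phi_le 0; rewrite /partial_phi big_geq.
have l0 : 0 <= lambda r by rewrite addr_ge0 ?sqr_ge0// mulr_ge0.
apply: (@le_trans _ _ (\sum_(n < N) (lambda r - 2 * e - lambda r * (n < K)%N%:R
    - lambda r * (N - n < K)%N%:R))).
  rewrite !sumrB -!mulr_sumr !sumr_const card_ord -!natr_sum.
  have h1 : (\sum_(n < N) (n < K))%:R <= K%:R :> R by rewrite ler_nat sum_lt.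
  have h2 : (\sum_(n < N) (N - n < K))%:R <= K%:R :> R.
    rewrite ler_nat (leq_trans _ (sum_lt N K))// (reindex_inj rev_ord_inj)/=.
    apply: leq_sum => n _; rewrite subKn//; case: (ltnP n.+1 K) => // h.
    by rewrite (ltn_trans _ h).
  have := ler_wpM2l l0 h1; have := ler_wpM2l l0 h2.
  rewrite -[lambda r *+ N]mulr_natl -[e *+ N]mulr_natl; lra.
apply: ler_sum => n _.
have row0 : 0 <= \sum_(m < N) csq (r (n%:Z - m%:Z)) by apply: sumr_ge0 => m _; exact: csq_ge0.
case: (ltnP n K) => nK; first by case: (ltnP (N - n) K) => _ /=; lra.
case: (ltnP (N - n) K) => NK /=; first by lra.
rewrite row_sum; have := hK _ NK; have := hK n.+1 (leqW nK); rewrite /lambda; lra.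
Qed.

End autocorrelation_sums.

Section product_reference.
Context (R : realType) (N NR : nat).
Local Notation I := ('I_N * 'I_NR)%type.
Local Notation output_block := (N.-tuple (NR.-tuple R[i])).
Variable v : I -> R.
Hypothesis v_ge0 : forall i, 0 <= v i.

(* Law of independent proper complex normals of variances 1 + v i, with respect to the noise law. *)
Definition product_reference (y : output_block) : R :=
  \prod_i ((1 + v i)^-1 * expR (csq (coord y i) * (v i / (1 + v i)))).

Let v1 i : 0 < 1 + v i. Proof. by rewrite ltr_pwDl. Qed.

Lemma product_reference_gt0 y : 0 < product_reference y.
Proof. by apply: prodr_gt0 => i _; rewrite mulr_gt0 ?expR_gt0// invr_gt0. Qed.

Lemma measurable_product_reference : measurable_fun setT product_reference.
Proof.
apply: measurable_prod => i _; apply: measurable_funM => //.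
apply: measurableT_comp => //; apply: measurable_funM => //.
exact: (measurableT_comp measurable_csq (measurable_coord i)).
Qed.

Lemma ln_product_reference y : ln (product_reference y) =
  \sum_i (csq (coord y i) * (v i / (1 + v i)) - ln (1 + v i)).
Proof.
rewrite -[RHS]expRK expR_sum; congr ln; apply: eq_bigr => i _.
by rewrite expRD expRN lnK ?posrE// mulrC.
Qed.

Lemma product_reference_int1 : (\int[noise_law]_y (product_reference y)%:E = 1)%E.
Proof.
rewrite (integral_noise_law_prod
  (f := fun i z => (1 + v i)^-1 * expR (csq z * (v i / (1 + v i)))) (c := fun=> 1)).
- by rewrite big1.
- move=> i; apply: measurable_funM => //; apply: measurableT_comp => //.
  by apply: measurable_funM => //; exact: measurable_csq.
- by move=> i z; rewrite mulr_ge0 ?expR_ge0// invr_ge0 ltW.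
- move=> i; have b1 : -1 < - (v i / (1 + v i)) by rewrite ltrN2 ltr_pdivrMr// mul1r ltrDr.
  transitivity (((1 + v i)^-1)%:E * \int[std_cnormal]_z
      (expR (2 * cdot 0 z - (- (v i / (1 + v i))) * csq z))%:E)%E.
    rewrite -ge0_integralZl//.
    + by apply: eq_integral => z _; rewrite -EFinM /cdot/= !mul0r addr0 mulr0 add0r mulNr opprK [csq z * _]mulrC.
    + apply/measurable_EFinP; apply: measurableT_comp => //; apply: measurable_funB.
        by apply: measurable_funM => //; apply: measurable_cdot => //; exact: measurable_cst.
      by apply: measurable_funM => //; exact: measurable_csq.
    + apply: ltW; rewrite lte_fin invr_gt0; exact: v1.
  rewrite std_cnormal_exp// -EFinM; congr _%:E.
  rewrite /csq /= expr0n addr0 mul0r expR0 mulr1 -invfM.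
  rewrite (_ : (1 + v i) * _ = 1) ?invr1//; field; exact: lt0r_neq0.
Qed.

End product_reference.

Section upper_bound.
Context (R : realType) (NT NR : nat) d (Omega : measurableType d)
  (P : probability Omega R)
  (H : 'I_NT -> 'I_NR -> int -> {RV P >-> R[i]})
  (W : 'I_NR -> nat -> {RV P >-> R[i]})
  (channel : rayleigh_mimo H W)
  (alpha : 'I_NT -> R) (r : 'I_NR -> int -> R[i])
  (separable : transmit_separable H alpha r) (rho beta : R).
Hypothesis rho_ge0 : 0 <= rho.
Local Notation C := R[i].
Local Notation Re := (@complex.Re R).
Local Notation input_block N := (N.-tuple (NT.-tuple R[i])).
Local Notation output_block N := (N.-tuple (NR.-tuple R[i])).
Local Notation power z n := (weighted_power alpha z n).

Let alpha_ge0 k : 0 <= alpha k. Proof. by case: separable. Qed.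

Let r0_ge0 l : 0 <= Re (r l 0).
Proof. by case: separable => _ /(_ l) /autocorrelation_facts[]. Qed.

Variable N : nat.
Local Notation I := ('I_N * 'I_NR)%type.
Local Notation out := (@channel_output R NT NR d Omega P H W rho N).
Local Notation dens := (@chan_density R NT NR d Omega P H rho N).

(** Divergence of the output law given [z] from the noise law. *)
Definition ln_density_mean (z : input_block N) : R := \int[P]_w ln (dens (z, out (z, w))).

Lemma ln_density_mean_bounds z :
  [/\ P.-integrable setT (EFin \o (fun w => ln (dens (z, out (z, w))))),
      ln_density_mean z <= cov_energy alpha r rho z / 2 &
      cov_energy alpha r rho z / 2 - signal_energy alpha r rho z * cov_energy alpha r rho z / 3
        <= ln_density_mean z].
Proof.
have := expect_ln_likelihood (covariance_herm channel separable rho_ge0 0 z)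
  (covariance_psd channel separable rho_ge0 0 z)
  (measurable_signal channel rho 0 z) (signal_gaussian channel separable rho_ge0 0 z)
  (P' := P) (Y := received H W rho 0 z) _ (expect_received channel separable rho_ge0 0 z).
have E w : ln (dens (z, out (z, w))) = ln (likelihood P (signal H rho 0 z) (received H W rho 0 z ^~ w)).
  rewrite /chan_density /density/=; congr (ln (likelihood _ _ _)).
  by apply/funext => i; rewrite coord_out.
have EE : (fun w => ln (dens (z, out (z, w)))) =
  (fun w => ln (likelihood P (signal H rho 0 z) (received H W rho 0 z ^~ w))) by exact/funext/E.
have transfer (f g : Omega -> R) (a b : R) : f = g ->
    [/\ P.-integrable setT (EFin \o g), \int[P]_w g w <= a & b <= \int[P]_w g w] ->
    [/\ P.-integrable setT (EFin \o f), \int[P]_w f w <= a & b <= \int[P]_w f w].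
  by move=> ->.
move=> /(_ (fun i => (received_square_integrable channel rho 0 z i).1)).
exact: (transfer _ _ _ _ EE).
Qed.

Section with_input.
Variable mu : probability (input_block N) R.
Hypothesis mu_power : power_constraints beta mu.
Local Notation base := (mu \x P)%E.
Local Notation mean_power := (mean_power alpha mu).

Lemma integrable_ln_density_mean :
  mu.-integrable setT (EFin \o ln_density_mean) /\
  \int[base]_s ln (dens (s.1, out s)) = \int[mu]_z ln_density_mean z.
Proof.
have [I1 E1] := Rintegral_Fubini (integrable_ln_density channel separable rho_ge0 mu_power).
have inner z : (\int[P]_w (ln (dens (z, out (z, w))))%:E)%E = (ln_density_mean z)%:E.
  by rewrite EFin_Rintegral//; case: (ln_density_mean_bounds z).
have I2 : mu.-integrable setT (EFin \o ln_density_mean).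
  by move: I1; rewrite (_ : (fun z => _) = EFin \o ln_density_mean)//; apply/funext => z; exact: inner.
split=> //; apply/eqP; rewrite -eqe; apply/eqP.
rewrite [LHS]E1 EFin_Rintegral//; apply: eq_integral => z _; exact: inner.
Qed.

Let v (i : I) : R := rho * Re (r i.2 0) * mean_power i.1.

Let v_ge0 i : 0 <= v i.
Proof. by rewrite !mulr_ge0// (mean_power_ge0 separable). Qed.

(** The reference has the second moments of the output, so the coordinate [i] contributes exactly
    [v i - ln (1 + v i)]: apart from the mean powers, the law of the input does not matter. *)
Lemma integrable_ln_reference :
  base.-integrable setT (EFin \o (fun s => ln (product_reference v (out s)))) /\
  \int[base]_s ln (product_reference v (out s)) = \sum_i (v i - ln (1 + v i)).
Proof.
have I1 i : base.-integrable setT (EFin \o (fun s => csq (coord (out s) i) * (v i / (1 + v i)) - ln (1 + v i))).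
  apply: (integrable_EFinB measurableT); last exact: integrable_prob_cst.
  exact: (integrable_EFinZr measurableT _ (integrable_csq_out channel separable rho_ge0 mu_power i)).
rewrite (_ : (fun s => ln _) = fun s => \sum_i (csq (coord (out s) i) * (v i / (1 + v i)) - ln (1 + v i))); last first.
  by apply/funext => s; exact: ln_product_reference.
split; first exact: (integrable_EFin_sum measurableT).
rewrite Rintegral_sum//; apply: eq_bigr => i _.
have I2 := integrable_csq_out channel separable rho_ge0 mu_power i.
rewrite RintegralB//; [|exact: (integrable_EFinZr measurableT)|exact: integrable_prob_cst].
rewrite RintegralZr// Rintegral_prob_cst (Rexpect_csq_out channel separable rho_ge0 mu_power).
by rewrite -/(v i); congr (_ - _); field; rewrite gt_eqF// ltr_pwDl.
Qed.

Lemma sum_block (F : 'I_N -> 'I_NR -> R) : \sum_(i : I) F i.1 i.2 = \sum_n \sum_l F n l.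
Proof. by rewrite pair_bigA. Qed.

(** Of the two power factors in [cov_offdiag] one is bounded by its peak value and the other is
    kept, so that the bound is linear in the power and its expectation only involves mean powers. *)
Lemma cov_energy_le (z : input_block N) : (forall l, (phi (r l) < +oo)%E) ->
  (forall n, power z n <= total_gain alpha) ->
  cov_energy alpha r rho z <=
  rho ^+ 2 * total_gain alpha * (\sum_l lambda (r l)) * \sum_n power z n.
Proof.
move=> phi_fin hz.
have S0 : 0 <= total_gain alpha := total_gain_ge0 separable.
have p0 n : 0 <= power z n := weighted_power_ge0 separable z n.
apply: (@le_trans _ _ (\sum_(i : I) rho ^+ 2 * total_gain alpha * lambda (r i.2) * power z i.1)); last first.
  rewrite (sum_block (fun n l => rho ^+ 2 * total_gain alpha * lambda (r l) * power z n)).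
  rewrite [leRHS]mulr_sumr; apply: ler_sum => n _.
  rewrite -mulr_suml -mulr_sumr//.
apply: ler_sum => i _.
apply: (@le_trans _ _ (\sum_(m < N) rho ^+ 2 * csq (r i.2 (i.1%:Z - m%:Z)) * (power z i.1 * total_gain alpha))).
  apply: (@le_trans _ _ (\sum_(j : I) if i.2 == j.2 then
      rho ^+ 2 * csq (r i.2 (i.1%:Z - j.1%:Z)) * (power z i.1 * total_gain alpha) else 0)).
    apply: ler_sum => j _; apply: le_trans (cov_offdiag separable rho_ge0 z i j) _.
    case: eqP => // _; apply: ler_wpM2l; first by rewrite mulr_ge0 ?sqr_ge0 ?csq_ge0.
    exact: ler_wpM2l.
  rewrite (sum_block (fun m l' => if i.2 == l' then
    rho ^+ 2 * csq (r i.2 (i.1%:Z - m%:Z)) * (power z i.1 * total_gain alpha) else 0)).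
  apply: ler_sum => m _; rewrite (bigD1 i.2)//= eqxx big1 ?addr0// => l' l'i.
  by rewrite eq_sym (negbTE l'i).
rewrite -mulr_suml -mulr_sumr.
have [_ /(_ i.2) /autocorrelation_facts[rN r0 _] _] := separable.
have h := row_sum_le rN r0 (phi_fin i.2) i.1.
rewrite [leRHS](_ : _ = rho ^+ 2 * lambda (r i.2) * (power z i.1 * total_gain alpha)); last by ring.
by rewrite ler_wpM2r ?mulr_ge0// ler_wpM2l ?sqr_ge0.
Qed.

(** The gain is linear in the mean powers and the subtracted term quadratic, because the variances
    of the reference are themselves averages over the input. The cubic term is the error of
    [ln1D_le] for the reference. *)
Lemma information_upper : (forall l, (phi (r l) < +oo)%E) ->
  (block_information H W rho mu <=
   (rho ^+ 2 / 2 * (total_gain alpha * (\sum_l lambda (r l)) * (\sum_n mean_power n)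
      - (\sum_l Re (r l 0) ^+ 2) * (\sum_n mean_power n ^+ 2))
    + rho ^+ 3 / 3 * ((\sum_l Re (r l 0) ^+ 3) * (\sum_n mean_power n ^+ 3)))%R%:E)%E.
Proof.
move=> phi_fin.
have [Iq Eq] := integrable_ln_reference.
have [ID ED] := integrable_ln_density_mean.
have Iln := integrable_ln_density channel separable rho_ge0 mu_power.
apply: le_trans (block_information_le channel separable rho_ge0 mu_power
  (measurable_product_reference v) (product_reference_gt0 v_ge0) _ Iq) _.
  by rewrite (product_reference_int1 v_ge0).
rewrite lee_fin RintegralB// Eq ED.
have hD : \int[mu]_z ln_density_mean z <=
    rho ^+ 2 / 2 * (total_gain alpha * (\sum_l lambda (r l)) * (\sum_n mean_power n)).
  have Ip : mu.-integrable setT (EFin \o (fun z => \sum_n power z n)).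
    by apply: (integrable_EFin_sum measurableT) => n; exact: (integrable_power alpha mu_power n).
  apply: (@le_trans _ _ (\int[mu]_z ((rho ^+ 2 / 2 * (total_gain alpha * \sum_l lambda (r l))) * \sum_n power z n))).
    apply: ae_le_Rintegral => //; first exact: (integrable_EFinZl measurableT).
    apply: filterS (peak_power separable mu_power) => z hz.
    have [_ h _] := ln_density_mean_bounds z; apply: le_trans h _.
    by have := cov_energy_le phi_fin hz; lra.
  rewrite RintegralZl// Rintegral_sum//; last by move=> n; exact: (integrable_power alpha mu_power n).
  by rewrite /mean_power; lra.
have hv : \sum_i (v i ^+ 2 / 2 - v i ^+ 3 / 3) <= \sum_i (v i - ln (1 + v i)).
  by apply: ler_sum => i _; exact: ln1D_le.
have E2 : \sum_i v i ^+ 2 = rho ^+ 2 * ((\sum_l Re (r l 0) ^+ 2) * (\sum_n mean_power n ^+ 2)).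
  rewrite (sum_block (fun n l => (rho * Re (r l 0) * mean_power n) ^+ 2)).
  rewrite mulr_suml mulr_sumr exchange_big/=; apply: eq_bigr => l _.
  by rewrite mulr_sumr mulr_sumr; apply: eq_bigr => n _; ring.
have E3 : \sum_i v i ^+ 3 = rho ^+ 3 * ((\sum_l Re (r l 0) ^+ 3) * (\sum_n mean_power n ^+ 3)).
  rewrite (sum_block (fun n l => (rho * Re (r l 0) * mean_power n) ^+ 3)).
  rewrite mulr_suml mulr_sumr exchange_big/=; apply: eq_bigr => l _.
  by rewrite mulr_sumr mulr_sumr; apply: eq_bigr => n _; ring.
move: hv; rewrite sumrB -!mulr_suml E2 E3; lra.
Qed.

End with_input.
End upper_bound.

(** * On-off signalling with random signs *)

Section chi_square_pointwise.
Context (R : realType) (I : finType).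
Local Notation C := R[i].
Variables (v : I -> R) (M rho : R).
Hypothesis v_ge0 : forall i, 0 <= v i.
Hypothesis v_le : forall i, v i <= M.
Hypothesis M0 : 0 <= M.
Hypothesis rho_gt0 : 0 < rho.
Hypothesis rho_le1 : rho <= 1.
Variables (x u : I -> C).

(** This is [overlap] for signals [x] and [u] scaled by the square root of [rho] and powers [v]
    scaled by [rho]. To second order it is [rho * chi_linear - rho ^+ 2 * chi_quadratic]. *)
Definition chi_exponent : R := \sum_i (2 * rho * cdot (x i) (u i) -
  rho ^+ 2 * ((csq (x i + u i) - v i) * v i) / (1 + 2 * rho * v i)).

Definition chi_linear : R := \sum_i (2 * cdot (x i) (u i)).

Definition chi_quadratic : R := \sum_i ((csq (x i + u i) - v i) * v i).

(** Large enough for [chi_bound] to dominate the modulus of [chi_linear] plus the sum of the moduli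
    of the terms of [chi_quadratic]. *)
Definition chi_size : R := 1 + 2 * M + #|I|%:R * M ^+ 2.

Definition chi_bound : R := chi_size * (1 + \sum_i csq (x i) + \sum_i csq (u i)).

(** [expR_le_taylor2] at [chi_exponent]. The three cubic errors come from replacing the denominators
    [1 + 2 * rho * v i] by 1, from replacing the square of the exponent by that of its linear part,
    and from the Taylor remainder. *)
Lemma chi_pointwise : expR chi_exponent <=
  1 + rho * chi_linear - rho ^+ 2 * chi_quadratic + rho ^+ 2 * chi_linear ^+ 2 / 2 +
  rho ^+ 3 * (2 * M * chi_bound + chi_bound ^+ 2 + chi_bound ^+ 3 * expR (rho * chi_bound)).
Proof.
set e := chi_exponent; set t := chi_linear; set G := chi_bound.
pose y i := (csq (x i + u i) - v i) * v i.
pose Y := \sum_i `|y i|.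
set Z := \sum_i csq (x i); set U := \sum_i csq (u i).
have Z0 : 0 <= Z by apply: sumr_ge0 => i _; exact: csq_ge0.
have U0 : 0 <= U by apply: sumr_ge0 => i _; exact: csq_ge0.
have Y0 : 0 <= Y by apply: sumr_ge0.
have tZU : `|t| <= Z + U.
  apply: le_trans (ler_norm_sum _ _ _) _; rewrite -big_split; apply: ler_sum => i _ /=.
  have := csq_ge0 (x i + u i); have := csq_ge0 (x i - u i); rewrite csqB csqD => h1 h2.
  by rewrite ler_norml; apply/andP; split; lra.
pose c : R := #|I|%:R * M ^+ 2.
have c0 : 0 <= c by rewrite mulr_ge0 ?sqr_ge0.
have Ec : chi_size = 1 + 2 * M + c by [].
have YZU : Y <= 2 * M * (Z + U) + c.
  rewrite /c -big_split/= mulr_sumr -sum1_card natr_sum mulr_suml -big_split/=.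
  apply: ler_sum => i _; rewrite /y normrM (ger0_norm (v_ge0 i)).
  have h1 : `|csq (x i + u i) - v i| <= 2 * (csq (x i) + csq (u i)) + M.
    have := csq_ge0 (x i + u i); have := csq_ge0 (x i - u i); rewrite csqB csqD => h1 h2.
    have := v_ge0 i; have := v_le i; have := csq_ge0 (x i); have := csq_ge0 (u i).
    by rewrite ler_norml => *; apply/andP; split; lra.
  apply: le_trans (ler_pM _ _ h1 (v_le i)) _ => //.
  by rewrite le_eqVlt; apply/orP; left; apply/eqP; ring.
have tYG : `|t| + Y <= G.
  rewrite /G /chi_bound -/Z -/U Ec.
  have h2 : 0 <= c * (Z + U) by rewrite mulr_ge0// addr_ge0.
  have -> : (1 + 2 * M + c) * (1 + Z + U) =
      1 + 2 * M + c + (Z + U) + 2 * M * (Z + U) + c * (Z + U) by ring.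
  apply: le_trans (lerD tZU YZU) _; rewrite -subr_ge0.
  rewrite (_ : _ - _ = 1 + 2 * M + c * (Z + U)); last by ring.
  by rewrite !addr_ge0// mulr_ge0.
have t0 := normr_ge0 t.
have G0 : 0 <= G by lra.
have d0 i : 0 < 1 + 2 * rho * v i by rewrite ltr_pwDl// !mulr_ge0// ltW.
have eE : e - (rho * t - rho ^+ 2 * chi_quadratic) =
    rho ^+ 3 * \sum_i (y i * (2 * v i / (1 + 2 * rho * v i))).
  rewrite /e /chi_exponent /t /chi_linear /chi_quadratic !mulr_sumr -!sumrB.
  by apply: eq_bigr => i _; rewrite -/(y i); field; rewrite gt_eqF.
have eD : `|e - (rho * t - rho ^+ 2 * chi_quadratic)| <= rho ^+ 3 * (2 * M * G).
  rewrite eE normrM (ger0_norm (exprn_ge0 _ (ltW rho_gt0))) ler_pM2l ?exprn_gt0//.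
  apply: (@le_trans _ _ (2 * M * Y)); last by rewrite ler_wpM2l ?mulr_ge0//; lra.
  apply: le_trans (ler_norm_sum _ _ _) _; rewrite mulr_sumr; apply: ler_sum => i _.
  rewrite normrM [leRHS]mulrC ler_wpM2l// ger0_norm ?divr_ge0 ?mulr_ge0 ?(ltW (d0 i))//.
  rewrite ler_pdivrMr// (@le_trans _ _ (2 * M))//; first by rewrite ler_pM2l.
  by rewrite ler_peMr ?mulr_ge0// lerDl !mulr_ge0// ltW.
have et : `|e - rho * t| <= rho ^+ 2 * Y.
  have -> : e - rho * t = - \sum_i (rho ^+ 2 * y i / (1 + 2 * rho * v i)).
    rewrite /e /chi_exponent sumrB /t /chi_linear mulr_sumr.
    rewrite (eq_bigr (fun i => rho * (2 * cdot (x i) (u i)))); first by rewrite addrAC subrr sub0r.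
    by move=> i _; ring.
  rewrite normrN; apply: le_trans (ler_norm_sum _ _ _) _; rewrite mulr_sumr; apply: ler_sum => i _.
  rewrite -mulrA normrM (ger0_norm (sqr_ge0 _)) ler_wpM2l ?sqr_ge0// normrM [X in _ * X]ger0_norm ?invr_ge0 ?(ltW (d0 i))//.
  by rewrite ler_piMr// invf_le1// lerDl !mulr_ge0// ltW.
have rho2 : rho ^+ 2 <= rho by rewrite expr2 ler_piMr// ltW.
have rho20 : 0 <= rho ^+ 2 := sqr_ge0 rho.
have etY : rho ^+ 2 * Y <= rho * Y by rewrite ler_wpM2r.
have eG : `|e| <= rho * G.
  apply: (@le_trans _ _ (`|e - rho * t| + `|rho * t|)); first by rewrite -{1}[e](subrK (rho * t)) ler_normD.
  rewrite normrM (ger0_norm (ltW rho_gt0)).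
  apply: (@le_trans _ _ (rho * (`|t| + Y))); last by rewrite ler_pM2l.
  lra.
have e2 : e ^+ 2 <= rho ^+ 2 * t ^+ 2 + 2 * rho ^+ 3 * G ^+ 2.
  have -> : e ^+ 2 = rho ^+ 2 * t ^+ 2 + (e - rho * t) * (e + rho * t) by ring.
  rewrite lerD2l (le_trans (ler_norm _))// normrM.
  rewrite (_ : 2 * rho ^+ 3 * G ^+ 2 = (rho ^+ 2 * G) * (2 * (rho * G))); last by ring.
  apply: ler_pM => //.
    by apply: le_trans et _; rewrite ler_wpM2l//; lra.
  apply: (@le_trans _ _ (`|e| + `|rho * t|)); first exact: ler_normD.
  rewrite normrM (ger0_norm (ltW rho_gt0)).
  have : rho * `|t| <= rho * G by rewrite ler_pM2l//; lra.
  lra.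
have e3 : `|e| ^+ 3 * expR `|e| <= rho ^+ 3 * (G ^+ 3 * expR (rho * G)).
  rewrite mulrA -exprMn; apply: ler_pM; rewrite ?exprn_ge0 ?expR_ge0//.
    by rewrite lerXn2r ?nnegrE// mulr_ge0// ltW.
  by rewrite ler_expR.
apply: le_trans (expR_le_taylor2 e) _.
have : e - (rho * t - rho ^+ 2 * chi_quadratic) <= rho ^+ 3 * (2 * M * G).
  exact: le_trans (ler_norm _) eD.
rewrite !mulrDr; lra.
Qed.

Lemma chi_bound_ge0 : 0 <= chi_bound.
Proof.
rewrite /chi_bound /chi_size mulr_ge0//.
  by rewrite !addr_ge0// ?mulr_ge0// ?sqr_ge0.
by rewrite !addr_ge0//; apply: sumr_ge0 => i _; exact: csq_ge0.
Qed.

(** With [h = delta / (2 * chi_size)] the weight [expR (delta * S)] is the square of [expR (h * G)].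
    One factor pays for [expR (rho * G)], since [rho <= h], the other for the powers of [G] through
    [G <= k / h * expR (h * G / k)]. Taking [k] = 1, 2, 3 gives the coefficients 2, 4 and 6. *)
Lemma chi_pointwise_exp (delta : R) : 0 < delta -> rho * (2 * chi_size) <= delta ->
  expR chi_exponent <=
  1 + rho * chi_linear - rho ^+ 2 * chi_quadratic + rho ^+ 2 * chi_linear ^+ 2 / 2 +
  rho ^+ 3 * ((2 * M * (2 * chi_size / delta) + (4 * chi_size / delta) ^+ 2 +
    (6 * chi_size / delta) ^+ 3) *
    expR (delta * (1 + \sum_i csq (x i) + \sum_i csq (u i)))).
Proof.
move=> delta0 rd; apply: le_trans chi_pointwise _; rewrite lerD2l ler_pM2l ?exprn_gt0//.
set G := chi_bound; set S := 1 + _ + _.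
have G0 : 0 <= G := chi_bound_ge0.
have S0 : 0 <= S by rewrite !addr_ge0//; apply: sumr_ge0 => i _; exact: csq_ge0.
have A0 : 0 < chi_size.
  by rewrite /chi_size -addrA ltr_pwDl// addr_ge0// mulr_ge0// ?mulr_ge0// sqr_ge0.
pose h := delta / (2 * chi_size).
have h0 : 0 < h by rewrite divr_gt0// mulr_gt0.
have hG : 2 * (h * G) = delta * S by rewrite /h /G /chi_bound -/S; field; rewrite gt_eqF.
have hE : expR (delta * S) = expR (h * G) * expR (h * G) by rewrite -expRD -hG; congr expR; ring.
have e1 : 1 <= expR (h * G) by rewrite -[leLHS]expR0 ler_expR mulr_ge0// ltW.
have lin (k : R) : 0 < k -> G <= k / h * expR (h * G / k).
  move=> k0; have := expR_ge1Dx (h * G / k) => h1.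
  have {1}-> : G = k / h * (h * G / k) by field; rewrite !gt_eqF.
  apply: ler_wpM2l; first by rewrite divr_ge0// ltW.
  by apply: (le_trans _ h1); rewrite lerDr.
have rG : expR (rho * G) <= expR (h * G).
  by rewrite ler_expR ler_wpM2r// /h ler_pdivlMr// mulr_gt0.
have p1 : G <= h^-1 * expR (h * G).
  by have := lin 1 ltr01; rewrite divr1 mul1r.
have p2 : G ^+ 2 <= (2 / h) ^+ 2 * expR (h * G).
  have := lin 2 (ltr0Sn _ 1) => l2; have : G ^+ 2 <= (2 / h * expR (h * G / 2)) ^+ 2.
    by rewrite lerXn2r ?nnegrE// mulr_ge0 ?expR_ge0// divr_ge0// ltW.
  have -> : expR (h * G) = expR (h * G / 2) ^+ 2 by rewrite expr2 -expRD; congr expR; field.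
  by rewrite -exprMn.
have p3 : G ^+ 3 <= (3 / h) ^+ 3 * expR (h * G).
  have := lin 3 (ltr0Sn _ 2) => l3; have : G ^+ 3 <= (3 / h * expR (h * G / 3)) ^+ 3.
    by rewrite lerXn2r ?nnegrE// mulr_ge0 ?expR_ge0// divr_ge0// ltW.
  have -> : expR (h * G) = expR (h * G / 3) ^+ 3 by rewrite !exprS expr0 mulr1 -!expRD; congr expR; field.
  by rewrite -exprMn.
have E : expR (h * G) <= expR (delta * S).
  by rewrite hE ler_peMr// expR_ge0.
set a := 2 * M * (2 * chi_size / delta); set b := (4 * _ / _) ^+ 2; set c := (6 * _ / _) ^+ 3.
rewrite (_ : (a + b + c) * _ = a * expR (delta * S) + b * expR (delta * S) + c * expR (delta * S)); last by ring.
rewrite {}/a {}/b {}/c; apply: lerD; first apply: lerD.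
- rewrite -[leRHS]mulrA ler_wpM2l ?mulr_ge0//.
  rewrite (_ : 2 * chi_size / delta = h^-1); last by rewrite /h; field; rewrite !gt_eqF.
  by apply: le_trans p1 _; rewrite ler_wpM2l// invr_ge0 ltW.
- rewrite (_ : 4 * chi_size / delta = 2 / h); last by rewrite /h; field; rewrite !gt_eqF.
  by apply: le_trans p2 _; rewrite ler_wpM2l// sqr_ge0.
- rewrite (_ : 6 * chi_size / delta = 3 / h); last by rewrite /h; field; rewrite !gt_eqF.
  rewrite hE [leRHS]mulrA; apply: ler_pM => //; rewrite ?exprn_ge0 ?expR_ge0//.
Qed.

End chi_square_pointwise.

Section chi_square_integral.
Context d (T : measurableType d) (R : realType) (Q : probability T R) (I : finType).
Local Notation C := R[i].
Local Notation Re := (@complex.Re R).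
Local Notation Im := (@complex.Im R).
Local Notation CE := (Cexpectation Q).
Variables (X : I -> T -> C) (v : I -> R) (M delta : R).
Hypothesis v_ge0 : forall i, 0 <= v i.
Hypothesis v_le : forall i, v i <= M.
Hypothesis M_ge0 : 0 <= M.
Hypothesis sX : forall i, square_integrable Q (X i).
Hypothesis X_mean0 : forall i, CE (X i) = 0.
Hypothesis X_cov : forall i j, CE (fun w => X i w * (X j w)^*) = if i == j then (v i)%:C%C else 0.
Hypothesis X_pcov : forall i j, CE (fun w => X i w * X j w) = 0.
Hypothesis delta_gt0 : 0 < delta.
Hypothesis X_exp : Q.-integrable setT (EFin \o (fun w => expR (delta * \sum_i csq (X i w)))).

Lemma square_integrable_Cintegrable F : square_integrable Q F -> Cintegrable Q F.
Proof.
move=> sF; rewrite (_ : F = fun w => 1 * F w); last by apply/funext => w; rewrite mul1r.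
by apply: (Cintegrable_mul _ sF); split; [exact: measurable_cst|exact: integrable_prob_cst].
Qed.

Lemma integrable_cdot_cst i u : Q.-integrable setT (EFin \o (fun w => cdot (X i w) u)).
Proof.
have [rX iX] := square_integrable_Cintegrable (sX i).
by apply: (integrable_EFinD measurableT); exact: (integrable_EFinZr measurableT).
Qed.

Lemma Rintegral_cdot_cst i u : \int[Q]_w cdot (X i w) u = 0.
Proof.
have [rX iX] := square_integrable_Cintegrable (sX i).
have /eqP := X_mean0 i; rewrite eq_complex /= => /andP[/eqP r0 /eqP i0].
rewrite RintegralD//; [|exact: (integrable_EFinZr measurableT)|exact: (integrable_EFinZr measurableT)].
by rewrite !RintegralZr// [X in X * _]r0 [X in _ + X * _]i0 !mul0r addr0.
Qed.

Lemma Rintegral_csq i : \int[Q]_w csq (X i w) = v i.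
Proof.
have := congr1 Re (X_cov i i); rewrite eqxx/= => <-.
by apply: eq_Rintegral => w _; rewrite Re_conjM cdotzz.
Qed.

Definition chi_coef : R := 2 * M * (2 * chi_size I M / delta) +
  (4 * chi_size I M / delta) ^+ 2 + (6 * chi_size I M / delta) ^+ 3.

Definition chi_moment : R := \int[Q]_w expR (delta * \sum_i csq (X i w)).

Definition chi_constant : R := chi_coef * expR delta * chi_moment.

Section fixed_u.
Variables (rho : R) (u : I -> C).
Hypothesis rho_gt0 : 0 < rho.
Hypothesis rho_le1 : rho <= 1.
Hypothesis rho_small : rho * (2 * chi_size I M) <= delta.

Let t w := chi_linear (X ^~ w) u.
Let s w := chi_quadratic v (X ^~ w) u.

Let It : Q.-integrable setT (EFin \o t).
Proof.
by apply: (integrable_EFin_sum measurableT) => i; exact: (integrable_EFinZl measurableT _ (integrable_cdot_cst i (u i))).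
Qed.

Let Et : \int[Q]_w t w = 0.
Proof.
rewrite Rintegral_sum//; last by move=> i; exact: (integrable_EFinZl measurableT _ (integrable_cdot_cst i (u i))).
rewrite big1// => i _; rewrite RintegralZl//; last exact: integrable_cdot_cst.
by rewrite Rintegral_cdot_cst mulr0.
Qed.

Let sE i w : (csq (X i w + u i) - v i) * v i =
  v i * csq (X i w) + (v i * (csq (u i) - v i) + 2 * v i * cdot (X i w) (u i)).
Proof. by rewrite csqD; ring. Qed.

Let Isi i : Q.-integrable setT (EFin \o (fun w => v i * csq (X i w) +
  (v i * (csq (u i) - v i) + 2 * v i * cdot (X i w) (u i)))).
Proof.
apply: (integrable_EFinD measurableT); first exact: (integrable_EFinZl measurableT _ (sX i).2).
apply: (integrable_EFinD measurableT); first exact: integrable_prob_cst.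
exact: (integrable_EFinZl measurableT _ (integrable_cdot_cst i (u i))).
Qed.

Let sEE : s = fun w => \sum_i (v i * csq (X i w) +
  (v i * (csq (u i) - v i) + 2 * v i * cdot (X i w) (u i))).
Proof. by apply/funext => w; apply: eq_bigr => i _; rewrite sE. Qed.

Let Is : Q.-integrable setT (EFin \o s).
Proof. by rewrite sEE; exact: (integrable_EFin_sum measurableT). Qed.

Let Es : \int[Q]_w s w = \sum_i v i * csq (u i).
Proof.
rewrite sEE Rintegral_sum//; apply: eq_bigr => i _.
have I1 := integrable_EFinZl measurableT (2 * v i) (integrable_cdot_cst i (u i)).
rewrite RintegralD//; first last.
- by apply: (integrable_EFinD measurableT) => //; exact: integrable_prob_cst.
- exact: (integrable_EFinZl measurableT _ (sX i).2).
rewrite RintegralD//; last exact: integrable_prob_cst.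
rewrite RintegralZl//; last exact: (sX i).2.
rewrite Rintegral_csq Rintegral_prob_cst RintegralZl//; last exact: integrable_cdot_cst.
by rewrite Rintegral_cdot_cst; ring.
Qed.

Let tE w : t w ^+ 2 = 4 * Re (\sum_i (u i)^* * X i w) ^+ 2.
Proof.
rewrite /t /chi_linear (_ : \sum_i _ = 2 * Re (\sum_i (u i)^* * X i w)); first by ring.
by rewrite Re_sum mulr_sumr; apply: eq_bigr => i _; rewrite -(Re_conjM (X i w)) [X i w * _]mulrC.
Qed.

Let sS : square_integrable Q (fun w => \sum_i (u i)^* * X i w).
Proof. by apply: square_integrable_sum => i; exact: square_integrableZ. Qed.

Let It2 : Q.-integrable setT (EFin \o (fun w => t w ^+ 2)).
Proof.
rewrite (_ : EFin \o _ = EFin \o (fun w => 4 * Re (\sum_i (u i)^* * X i w) ^+ 2)).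
  exact: (integrable_EFinZl measurableT _ (square_integrable_Re sS)).
by apply/funext => w /=; rewrite tE.
Qed.

Let Et2 : \int[Q]_w (t w ^+ 2) = 2 * \sum_i v i * csq (u i).
Proof.
rewrite (_ : (fun w => t w ^+ 2) = fun w => 4 * Re (\sum_i (u i)^* * X i w) ^+ 2); last exact/funext/tE.
rewrite RintegralZl//; last exact: (square_integrable_Re sS).
rewrite (expect_Re_sum_sqr _ sX X_cov X_pcov) /quad.
have -> : Re (\sum_i \sum_j (u i)^* * (if i == j then (v i)%:C%C else 0) * ((u j)^*)^*) =
    \sum_i v i * csq (u i).
  rewrite Re_sum; apply: eq_bigr => i _; rewrite (bigD1 i)//= eqxx big1 ?addr0.
    by rewrite conjCK mulrAC [_^* * _]mulrC mul_conj /=; ring.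
  by move=> j ji; rewrite eq_sym (negbTE ji) mulr0 mul0r.
by field.
Qed.

(** [Et] removes the linear term. By [Es] and [Et2], the quadratic part and half of the squared
    linear part have the same mean [\sum_i v i * csq (u i)] and enter with opposite signs, so order
    [rho ^+ 2] cancels: this is why the reference is given the powers [v]. *)
Lemma chi_square_fixed :
  (\int[Q]_w (expR (chi_exponent v rho (X ^~ w) u))%:E <=
   (1 + rho ^+ 3 * (chi_constant * expR (delta * \sum_i csq (u i))))%:E)%E.
Proof.
pose K := chi_coef.
have IK : Q.-integrable setT (EFin \o (fun w => rho ^+ 3 * (K *
    expR (delta * (1 + \sum_i csq (X i w) + \sum_i csq (u i)))))).
  do 2 apply: (integrable_EFinZl measurableT).
  rewrite (_ : EFin \o _ = EFin \o (fun w => (expR delta * expR (delta * \sum_i csq (u i))) *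
      expR (delta * \sum_i csq (X i w)))).
    exact: (integrable_EFinZl measurableT).
  by apply/funext => w /=; rewrite -!expRD; congr (expR _)%:E; ring.
have I1 : Q.-integrable setT (EFin \o (fun w => 1 + rho * t w)).
  by apply: (integrable_EFinD measurableT); [exact: integrable_prob_cst|exact: (integrable_EFinZl measurableT)].
have I2 : Q.-integrable setT (EFin \o (fun w => rho ^+ 2 * s w)).
  exact: (integrable_EFinZl measurableT).
have I3 : Q.-integrable setT (EFin \o (fun w => rho ^+ 2 * t w ^+ 2 / 2)).
  by apply: (integrable_EFinZr measurableT); exact: (integrable_EFinZl measurableT).
have I12 := integrable_EFinB measurableT I1 I2.
have I123 := integrable_EFinD measurableT I12 I3.
have Iall := integrable_EFinD measurableT I123 IK.
apply: (@le_trans _ _ (\int[Q]_w (1 + rho * t w - rho ^+ 2 * s w + rho ^+ 2 * t w ^+ 2 / 2 +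
    rho ^+ 3 * (K * expR (delta * (1 + \sum_i csq (X i w) + \sum_i csq (u i)))))%:E)%E).
  apply: ge0_le_integral => //.
  - apply/measurable_EFinP; apply: measurableT_comp => //; apply: measurable_sum => i.
    have mXu : measurable_fun setT (fun w => csq (X i w + u i)).
      apply: (measurableT_comp measurable_csq); apply: measurable_complexD; first exact: (sX i).1.
      exact: measurable_cst.
    apply: measurable_funB.
      apply: measurable_funM => //; apply: measurable_cdot; first exact: (sX i).1.
      exact: measurable_cst.
    by apply: measurable_funM => //; apply: measurable_funM => //; apply: measurable_funM => //; apply: measurable_funB.
  - exact: measurable_int Iall.
  - by move=> w _; rewrite lee_fin; exact: chi_pointwise_exp.
rewrite -EFin_Rintegral// lee_fin RintegralD// RintegralD// RintegralB// RintegralD//; first last.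
- exact: (integrable_EFinZl measurableT).
- exact: integrable_prob_cst.
rewrite Rintegral_prob_cst RintegralZl// RintegralZl// RintegralZr//; last exact: (integrable_EFinZl measurableT).
rewrite RintegralZl// Et Es Et2.
have -> : \int[Q]_w (rho ^+ 3 * (K * expR (delta * (1 + \sum_i csq (X i w) + \sum_i csq (u i))))) =
    rho ^+ 3 * (chi_constant * expR (delta * \sum_i csq (u i))).
  rewrite (_ : (fun w => _) = (fun w => (rho ^+ 3 * K * expR delta * expR (delta * \sum_i csq (u i))) *
      expR (delta * \sum_i csq (X i w)))).
    by rewrite RintegralZl// /chi_constant -/chi_moment -/K; ring.
  apply/funext => w; rewrite (_ : delta * (1 + _ + _) =
    delta + delta * (\sum_i csq (X i w)) + delta * (\sum_i csq (u i))); last by ring.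
  by rewrite !expRD; ring.
by rewrite le_eqVlt; apply/orP; left; apply/eqP; field.
Qed.

End fixed_u.

Lemma chi_square_double (rho : R) : 0 < rho -> rho <= 1 -> rho * (2 * chi_size I M) <= delta ->
  (\int[Q]_w' \int[Q]_w (expR (chi_exponent v rho (X ^~ w) (X ^~ w')))%:E <=
   (1 + rho ^+ 3 * (chi_constant * chi_moment))%:E)%E.
Proof.
move=> r0 r1 rs.
have IK : Q.-integrable setT (EFin \o (fun w => 1 + rho ^+ 3 * (chi_constant *
    expR (delta * \sum_i csq (X i w))))).
  apply: (integrable_EFinD measurableT); first exact: integrable_prob_cst.
  by do 2 apply: (integrable_EFinZl measurableT).
have mX2 : measurable_fun setT (fun p : T * T => expR (chi_exponent v rho (X ^~ p.2) (X ^~ p.1))).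
  apply: measurableT_comp => //; apply: measurable_sum => i.
  have mX1 : measurable_fun setT (fun p : T * T => X i p.1) by exact: (measurableT_comp (sX i).1).
  have mX2 : measurable_fun setT (fun p : T * T => X i p.2) by exact: (measurableT_comp (sX i).1).
  have mXu : measurable_fun setT (fun p : T * T => csq (X i p.2 + X i p.1)).
    by apply: (measurableT_comp measurable_csq); exact: measurable_complexD.
  apply: measurable_funB.
    by apply: measurable_funM => //; exact: measurable_cdot.
  by apply: measurable_funM => //; apply: measurable_funM => //; apply: measurable_funM => //; apply: measurable_funB.
apply: (@le_trans _ _ (\int[Q]_w (1 + rho ^+ 3 * (chi_constant *
    expR (delta * \sum_i csq (X i w))))%:E)%E).
  apply: ge0_le_integral => //.
  - by move=> w _; apply: integral_ge0 => w' _; rewrite lee_fin expR_ge0.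
  - apply: (@measurable_fun_fubini_tonelli_F _ _ _ _ R Q
      (fun p => (expR (chi_exponent v rho (X ^~ p.2) (X ^~ p.1)))%:E)) => [|p].
      exact/measurable_EFinP.
    by rewrite lee_fin expR_ge0.
  - exact: measurable_int IK.
  - by move=> w _; exact: chi_square_fixed.
rewrite -EFin_Rintegral// lee_fin RintegralD//; first last.
- by do 2 apply: (integrable_EFinZl measurableT).
- exact: integrable_prob_cst.
by rewrite Rintegral_prob_cst RintegralZl ?RintegralZl//; exact: (integrable_EFinZl measurableT).
Qed.

End chi_square_integral.

(** * Finitely supported inputs *)

Section finite_mixture.
Context d (T : measurableType d) (R : realType) (K : finType) (k0 : K).
Variables (p : K -> R) (z : K -> T).
Hypothesis p_ge0 : forall k, 0 <= p k.
Hypothesis p_sum : \sum_k p k = 1.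

(** [msum] takes measures indexed by natural numbers, so [K] is enumerated; [k0] is only the default
    value of [nth]. *)
Let component (i : nat) : {measure set T -> \bar R} :=
  mscale (NngNum (p_ge0 (nth k0 (enum K) i))) (\d_(z (nth k0 (enum K) i))).

Definition mixture_measure : set T -> \bar R := msum component #|K|.

HB.instance Definition _ := Measure.copy mixture_measure (msum component #|K|).

Lemma sum_nth_enum (F : K -> \bar R) :
  (\sum_(i < #|K|) F (nth k0 (enum K) i) = \sum_k F k)%E.
Proof. by rewrite -[RHS]big_enum (big_nth k0) -cardE big_mkord. Qed.

Lemma ge0_integral_mixture_measure (f : T -> \bar R) :
  measurable_fun setT f -> (forall x, (0 <= f x)%E) ->
  (\int[mixture_measure]_x f x = \sum_k (p k)%:E * f (z k))%E.
Proof.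
move=> mf f0; rewrite /mixture_measure ge0_integral_measure_sum// -sum_nth_enum.
apply: eq_bigr => i _; rewrite ge0_integral_mscale// integral_dirac//.
by rewrite diracT mul1e.
Qed.

Lemma mixture_setT : mixture_measure setT = 1%E.
Proof.
rewrite -[LHS]mul1e -integral_cst// (ge0_integral_mixture_measure (f := cst 1%E))//.
by rewrite -(eq_bigr _ (fun k _ => esym (mule1 (p k)%:E))) sumEFin p_sum.
Qed.

HB.instance Definition _ := Measure_isProbability.Build _ _ _ mixture_measure mixture_setT.

Definition mixture : probability T R := mixture_measure.

Lemma ge0_integral_mixture (f : T -> \bar R) :
  measurable_fun setT f -> (forall x, (0 <= f x)%E) ->
  (\int[mixture]_x f x = \sum_k (p k)%:E * f (z k))%E.
Proof. exact: ge0_integral_mixture_measure. Qed.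

Lemma ge0_mixture_integrable (f : T -> R) : measurable_fun setT f ->
  (forall x, 0 <= f x) -> mixture.-integrable setT (EFin \o f).
Proof.
move=> mf f0; apply: (@ge0_Rintegrable _ _ _ mixture f (\sum_k p k * f (z k))) => //.
rewrite ge0_integral_mixture//; first by rewrite -sumEFin.
exact/measurable_EFinP.
Qed.

Lemma ge0_Rintegral_mixture (f : T -> R) : measurable_fun setT f ->
  (forall x, 0 <= f x) -> \int[mixture]_x f x = \sum_k p k * f (z k).
Proof.
move=> mf f0; rewrite /Rintegral ge0_integral_mixture//; first by rewrite -[RHS]/(fine _%:E) -sumEFin.
exact/measurable_EFinP.
Qed.

Lemma Rintegral_mixture (f : T -> R) : measurable_fun setT f ->
  mixture.-integrable setT (EFin \o f) /\ \int[mixture]_x f x = \sum_k p k * f (z k).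
Proof.
move=> mf.
have mp : measurable_fun setT (fun x => Num.max (f x) 0) by exact: measurable_maxr.
have mn : measurable_fun setT (fun x => Num.max (- f x) 0) by apply: measurable_maxr => //; exact: measurableT_comp.
have p0 x : 0 <= Num.max (f x) 0 by rewrite le_max lexx orbT.
have n0 x : 0 <= Num.max (- f x) 0 by rewrite le_max lexx orbT.
have fE x : f x = Num.max (f x) 0 - Num.max (- f x) 0.
  by rewrite /Order.max; case: ifPn; case: ifPn; rewrite -?leNgt; lra.
have I1 := ge0_mixture_integrable mp p0; have I2 := ge0_mixture_integrable mn n0.
have E : f = fun x => Num.max (f x) 0 - Num.max (- f x) 0 by exact/funext.
split; first by rewrite E; exact: (integrable_EFinB measurableT).
rewrite [in LHS]E RintegralB// !ge0_Rintegral_mixture// -sumrB.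
by apply: eq_bigr => k _; rewrite [in RHS]fE mulrBr.
Qed.

Lemma ae_mixture (Q : T -> Prop) : measurable [set x | Q x] -> (forall k, Q (z k)) ->
  {ae mixture, forall x, Q x}.
Proof.
move=> mQ Qz; exists (~` [set x | Q x]); split => //; first exact: measurableC.
rewrite -[LHS]mul1e -integral_cst ?(measurableC mQ)//.
rewrite integral_mkcond ge0_integral_mixture//.
- rewrite big1// => k _; rewrite patchE memNset ?mule0// => h; exact: (h (Qz k)).
- by apply/(measurable_restrictT _ (measurableC mQ)).
- by move=> x; rewrite patchE; case: ifP.
- exact: measurableC.
Qed.

Lemma ge0_integral_mixture_prod d' (O : measurableType d') (P : probability O R)
    (f : T * O -> \bar R) : measurable_fun setT f -> (forall x, (0 <= f x)%E) ->
  (\int[mixture \x P]_s f s = \sum_k (p k)%:E * \int[P]_w f (z k, w))%E.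
Proof.
move=> mf f0; rewrite fubini_tonelli1// ge0_integral_mixture//.
  exact: measurable_fun_fubini_tonelli_F.
by move=> x; apply: integral_ge0.
Qed.

Lemma Rintegral_mixture_prod d' (O : measurableType d') (P : probability O R)
    (f : T * O -> R) : measurable_fun setT f ->
  (forall k, P.-integrable setT (EFin \o (fun w => f (z k, w)))) ->
  (mixture \x P)%E.-integrable setT (EFin \o f) /\
  \int[(mixture \x P)%E]_s f s = \sum_k p k * \int[P]_w f (z k, w).
Proof.
move=> mf If.
have ge0_case (g : T * O -> R) : measurable_fun setT g -> (forall s, 0 <= g s) ->
    (forall k, P.-integrable setT (EFin \o (fun w => g (z k, w)))) ->
    (\int[mixture \x P]_s (g s)%:E = (\sum_k p k * \int[P]_w g (z k, w))%R%:E)%E.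
  move=> mg g0 Ig; rewrite (ge0_integral_mixture_prod P (f := fun s => (g s)%:E)); last 2 first.
  - exact/measurable_EFinP.
  - by move=> s; rewrite lee_fin.
  by rewrite -sumEFin; apply: eq_bigr => k _; rewrite EFinM EFin_Rintegral.
have mp : measurable_fun setT (fun x => Num.max (f x) 0) by exact: measurable_maxr.
have mn : measurable_fun setT (fun x => Num.max (- f x) 0) by apply: measurable_maxr => //; exact: measurableT_comp.
have p0 x : 0 <= Num.max (f x) 0 by rewrite le_max lexx orbT.
have n0 x : 0 <= Num.max (- f x) 0 by rewrite le_max lexx orbT.
have fE x : f x = Num.max (f x) 0 - Num.max (- f x) 0.
  by rewrite /Order.max; case: ifPn; case: ifPn; rewrite -?leNgt; lra.
have bound (g : T * O -> R) : measurable_fun setT g -> (forall s, `|g s| <= `|f s|) ->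
    forall k, P.-integrable setT (EFin \o (fun w => g (z k, w))).
  move=> mg gf k.
  apply: (@le_EFin_integrable _ _ _ P setT measurableT _ (fun w => `|f (z k, w)|)) => //.
  - exact: (measurableT_comp mg (pair1_measurable (z k))).
  - exact: (integrable_abse (If k)).
have Ip k : P.-integrable setT (EFin \o (fun w => Num.max (f (z k, w)) 0)).
  apply: (bound (fun s => Num.max (f s) 0)) => // s.
  by rewrite ger0_norm// ge_max ler_norm normr_ge0.
have In k : P.-integrable setT (EFin \o (fun w => Num.max (- f (z k, w)) 0)).
  apply: (bound (fun s => Num.max (- f s) 0)) => // s.
  by rewrite ger0_norm// ge_max normr_ge0 -normrN ler_norm.
have Ep := ge0_case _ mp p0 Ip; have En := ge0_case _ mn n0 In.
have I1 := ge0_Rintegrable mp p0 Ep; have I2 := ge0_Rintegrable mn n0 En.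
have E : f = fun x => Num.max (f x) 0 - Num.max (- f x) 0 by exact/funext.
split; first by rewrite E; exact: (integrable_EFinB measurableT).
rewrite [in LHS]E RintegralB// [X in X - _](congr1 fine Ep) [X in _ - X](congr1 fine En) /= -sumrB.
apply: eq_bigr => k _; rewrite -mulrBr -RintegralB//; congr (_ * _).
by apply: eq_Rintegral => w _; rewrite [RHS]fE.
Qed.

End finite_mixture.

(** * Exponential moments of the fading *)

Section exponential_moments.
Context d (T : measurableType d) (R : realType) (P : probability T R).

(** Every term is replaced by the largest one. The summand 1 covers the empty family. *)
Lemma expR_sum_le (J : finType) (c : J -> R) : (forall j, 0 <= c j) ->
  expR (\sum_j c j) <= 1 + \sum_j expR (#|J|%:R * c j).
Proof.
move=> c0; have e0 j : 0 <= expR (#|J|%:R * c j) by exact: expR_ge0.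
case: (pickP (fun _ : J => true)) => [j0 _|J0]; last first.
  by rewrite !big_pred0// expR0 addr0.
pose m := [arg max_(j > j0) c j]%O.
have mP j : c j <= c m by rewrite /m; case: arg_maxP => // i _; apply.
apply: (@le_trans _ _ (expR (#|J|%:R * c m))); last first.
  by rewrite (bigD1 m)//= addrA ler_wpDr ?sumr_ge0// lerDr.
rewrite ler_expR (le_trans (ler_sum _ (fun j _ => mP j)))//.
by rewrite sumr_const mulr_natl.
Qed.

(** The coordinates may be dependent. [D] is chosen so that [#|J|%:R / D] is at most every [e j]; a
    sum of inverses replaces a minimum, which would require [J] to be nonempty. *)
Lemma joint_exponential_moment (J : finType) (V : J -> T -> R) :
  (forall j, measurable_fun setT (V j)) ->
  (forall j, exists2 e, 0 < e & P.-integrable setT (EFin \o (fun w => expR (e * V j w ^+ 2)))) ->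
  exists2 e, 0 < e & P.-integrable setT (EFin \o (fun w => expR (e * \sum_j V j w ^+ 2))).
Proof.
move=> mV hV.
have /boolp.choice[e he] : forall j, exists e, 0 < e /\
    P.-integrable setT (EFin \o (fun w => expR (e * V j w ^+ 2))).
  by move=> j; have [e] := hV j; exists e.
have e_gt0 j : 0 < e j by have [] := he j.
pose m : R := #|J|%:R; pose D := 1 + m * \sum_j (e j)^-1.
have m0 : 0 <= m by exact: ler0n.
have i0 j : 0 <= (e j)^-1 by rewrite invr_ge0 ltW.
have D0 : 0 < D by rewrite ltr_wpDr// mulr_ge0// sumr_ge0.
exists D^-1; first by rewrite invr_gt0.
have De j : m * D^-1 <= e j.
  rewrite ler_pdivrMr// /D mulrDr mulr1 (bigD1 j)//= !mulrDr.
  have -> : e j * (m * (e j)^-1) = m by field; rewrite gt_eqF.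
  have h2 : 0 <= e j * (m * \sum_(i | i != j) (e i)^-1).
    by rewrite !mulr_ge0 ?sumr_ge0// ltW.
  by have := e_gt0 j; lra.
apply: (@le_EFin_integrable _ _ _ P setT measurableT _
  (fun w => 1 + \sum_j expR (e j * V j w ^+ 2))).
- apply: measurableT_comp => //; apply: measurable_funM => //.
  by apply: measurable_sum => j; exact: measurable_funX.
- move=> w _; rewrite ger0_norm ?expR_ge0// mulr_sumr.
  apply: (le_trans (expR_sum_le _)) => [j|].
    by rewrite mulr_ge0 ?sqr_ge0// invr_ge0 ltW.
  rewrite lerD2l; apply: ler_sum => j _; rewrite ler_expR mulrA.
  by rewrite ler_wpM2r ?sqr_ge0.
- apply: integrable_EFinD => //; first exact: integrable_prob_cst.
  by apply: integrable_EFin_sum => // j; have [] := he j.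
Qed.

End exponential_moments.

Section fading_exponential_moment.
Context (R : realType) (NT NR : nat) d (Omega : measurableType d)
  (P : probability Omega R)
  (H : 'I_NT -> 'I_NR -> int -> {RV P >-> R[i]})
  (W : 'I_NR -> nat -> {RV P >-> R[i]})
  (channel : rayleigh_mimo H W).
Local Notation Re := (@complex.Re R).
Local Notation Im := (@complex.Im R).

Lemma fading_exponential_moment (J : finType) (i : J -> 'I_NT * 'I_NR * int) :
  exists2 e, 0 < e & P.-integrable setT (EFin \o (fun w =>
    expR (e * \sum_j csq (H (i j).1.1 (i j).1.2 (i j).2 w)))).
Proof.
pose X j w := H (i j).1.1 (i j).1.2 (i j).2 w.
have mX j : measurable_fun setT (X j) by exact: measurable_funPT.
have mR j : measurable_fun setT (fun w => Re (X j w)).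
  exact: (measurableT_comp measurable_cRe).
have mI j : measurable_fun setT (fun w => Im (X j w)).
  exact: (measurableT_comp measurable_cIm).
pose V (jb : J * bool) w := if jb.2 then Re (X jb.1 w) else Im (X jb.1 w).
have mV jb : measurable_fun setT (V jb) by rewrite /V; case: jb.2.
have hV jb : exists2 e, 0 < e & P.-integrable setT (EFin \o (fun w => expR (e * V jb w ^+ 2))).
  have [nH _] := fading_normal channel.
  (* The boolean, read as 0 or 1, selects the real or the imaginary part. *)
  have := nH [:: i jb.1] (fun=> (jb.2 : nat)%:R) (fun=> (~~ jb.2 : nat)%:R).
  rewrite (_ : (fun w => _) = V jb); last first.
    apply/funext => w; rewrite big_seq1 /V /X; case: jb.2 => /=; ring.
  move=> [m [s Vs]].
  have V0 : \int[P]_w V jb w = 0; last by have [_] := centered_normal_law (mV jb) Vs V0.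
  have := fading_mean0 channel (i jb.1).1.1 (i jb.1).1.2 (i jb.1).2.
  rewrite /Cexpectation /Cintegral => -[hr hi].
  by rewrite /V; case: jb.2.
have [e e0 Ie] := joint_exponential_moment mV hV.
exists e => //; rewrite (_ : (fun w => _) = (fun w => expR (e * \sum_j V j w ^+ 2))) //.
apply/funext => w; congr (expR (e * _)).
rewrite -(pair_bigA _ (fun j b => V (j, b) w ^+ 2)) /=.
by apply: eq_bigr => j _; rewrite big_bool /V /= /csq.
Qed.

End fading_exponential_moment.

Section mixture_complex.
Context d (T : measurableType d) (R : realType) (K : finType) (k0 : K).
Context d' (O : measurableType d') (P : probability O R).
Variables (p : K -> R) (z : K -> T).
Hypothesis p_ge0 : forall k, 0 <= p k.
Hypothesis p_sum : \sum_k p k = 1.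
Local Notation S := (mixture k0 z p_ge0 p_sum \x P)%E.

Lemma Cexpectation_mixture_prod (F : T * O -> R[i]) : measurable_fun setT F ->
  (forall k, Cintegrable P (fun w => F (z k, w))) ->
  Cexpectation S F = \sum_k (p k)%:C%C * Cexpectation P (fun w => F (z k, w)).
Proof.
move=> /measurable_fun_complexP[mr mi] IF.
have [_ Er] := Rintegral_mixture_prod k0 p_ge0 p_sum mr (fun k => (IF k).1).
have [_ Ei] := Rintegral_mixture_prod k0 p_ge0 p_sum mi (fun k => (IF k).2).
rewrite /Cexpectation /Cintegral Er Ei; apply/eqP; rewrite eq_complex Re_sum Im_sum /=.
by apply/andP; split; apply/eqP; apply: eq_bigr => k _; rewrite mul0r ?subr0 ?addr0.
Qed.

Lemma square_integrable_mixture_prod (F : T * O -> R[i]) : measurable_fun setT F ->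
  (forall k, square_integrable P (fun w => F (z k, w))) -> square_integrable S F.
Proof.
move=> mF sF; split=> //.
have mc : measurable_fun setT (csq \o F) by exact: (measurableT_comp measurable_csq).
by have [] := Rintegral_mixture_prod k0 p_ge0 p_sum mc (fun k => (sF k).2).
Qed.

End mixture_complex.

Section random_signs.
Context (R : realType) (N : nat) (a : R).
Local Notation K := (option {ffun 'I_N -> bool}).

(* [None] is the silent block; the random signs make distinct times uncorrelated even
   though a whole block is either on or off. *)
Definition codeword_amplitude (x : K) (n : 'I_N) : R :=
  if x is Some s then (-1) ^+ s n else 0.

Definition codeword_weight (x : K) : R := if x is Some _ then a / 2 ^+ N else 1 - a.

Lemma sum_option (V : zmodType) (F : K -> V) : \sum_x F x = F None + \sum_s F (Some s).
Proof.
rewrite (bigD1 None)//=; congr (_ + _).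
rewrite (reindex_omap (@Some {ffun 'I_N -> bool}) id) /=; last by case.
by apply: eq_bigl => s; rewrite eqxx.
Qed.

Lemma codeword_weight_sum : \sum_x codeword_weight x = 1.
Proof.
rewrite sum_option /= sumr_const card_ffun card_bool card_ord -[_ *+ (2 ^ N)]mulr_natr natrX mulfVK; first by ring.
by rewrite expf_neq0// pnatr_eq0.
Qed.

Lemma codeword_weight_ge0 : 0 <= a <= 1 -> forall x, 0 <= codeword_weight x.
Proof.
move=> /andP[a0 a1] [s|] /=; last by rewrite subr_ge0.
by rewrite divr_ge0// exprn_ge0.
Qed.

(** Flipping the sign at [n] is an involution that negates the sum if [n != m]. *)
Lemma sum_signs n m : \sum_(s : {ffun 'I_N -> bool}) (-1) ^+ s n * (-1) ^+ s m =
  if n == m then (2 ^+ N : R) else 0.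
Proof.
case: eqP => [->|/eqP nm].
  rewrite (eq_bigr (fun=> 1)); last by move=> s _; rewrite -expr2 sqrr_sign.
  by rewrite sumr_const card_ffun card_bool card_ord -natrX.
pose flip (s : {ffun 'I_N -> bool}) : {ffun 'I_N -> bool} :=
  [ffun i => if i == n then ~~ s i else s i].
have flipK : involutive flip.
  by move=> s; apply/ffunP => i; rewrite !ffunE; case: eqP => // _; rewrite negbK.
set T := LHS; have : T = - T.
  rewrite {1}/T (reindex_inj (inv_inj flipK)) /= -sumrN; apply: eq_bigr => s _.
  rewrite !ffunE eqxx eq_sym (negbTE nm) signrN; ring.
by move=> h; lra.
Qed.

Lemma codeword_correlation n m :
  \sum_x codeword_weight x * (codeword_amplitude x n * codeword_amplitude x m) =
  if n == m then a else 0.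
Proof.
rewrite sum_option /= mul0r mulr0 add0r -mulr_sumr sum_signs.
case: eqP => _; last by rewrite mulr0.
by rewrite mulfVK// expf_neq0// pnatr_eq0.
Qed.

Lemma codeword_amplitude_sqr x n : codeword_amplitude x n ^+ 2 = (x != None)%:R.
Proof. by case: x => [s|] /=; rewrite ?sqrr_sign// expr0n. Qed.

End random_signs.

Section codewords.
Context (R : realType) (NT NR : nat) d (Omega : measurableType d)
  (P : probability Omega R)
  (H : 'I_NT -> 'I_NR -> int -> {RV P >-> R[i]})
  (W : 'I_NR -> nat -> {RV P >-> R[i]})
  (channel : rayleigh_mimo H W)
  (alpha : 'I_NT -> R) (r : 'I_NR -> int -> R[i])
  (separable : transmit_separable H alpha r).
Local Notation C := R[i].
Local Notation Re := (@complex.Re R).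
Local Notation Im := (@complex.Im R).
Local Notation input_block N := (N.-tuple (NT.-tuple R[i])).
Let alpha_ge0 k : 0 <= alpha k. Proof. by have [+ _ _] := separable. Qed.
Let r0_ge0 l : 0 <= Re (r l 0).
Proof. by have [_ + _] := separable => /(_ l)/autocorrelation_facts[]. Qed.

Variables (N : nat) (a : R).
Hypothesis a01 : 0 <= a <= 1.
Local Notation K := (option {ffun 'I_N -> bool}).
Local Notation I := ('I_N * 'I_NR)%type.

(** Equal symbols on all antennas give equality in the Cauchy-Schwarz bound on the covariance, so
    the full [total_gain] is used. *)
Definition codeword (x : K) : input_block N :=
  [tuple [tuple (codeword_amplitude R x n)%:C%C | k < NT] | n < N].

Lemma tnth_codeword x n k : tnth (tnth (codeword x) n) k = (codeword_amplitude R x n)%:C%C.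
Proof. by rewrite /codeword !tnth_mktuple. Qed.

Lemma csq_codeword x n k : csq (tnth (tnth (codeword x) n) k) = (x != None)%:R.
Proof. by rewrite tnth_codeword /csq /= expr0n addr0 codeword_amplitude_sqr. Qed.

Definition random_codeword : probability (input_block N) R :=
  mixture None codeword (codeword_weight_ge0 a01) (codeword_weight_sum N a).
Local Notation mu := random_codeword.
Local Notation S := (mu \x P)%E.

Lemma codeword_weight_active : \sum_x codeword_weight a x * (x != None :> K)%:R = a.
Proof.
rewrite sum_option /= mulr0 add0r.
have := codeword_weight_sum N a; rewrite sum_option /= => h.
rewrite (eq_bigr (fun=> a / 2 ^+ N)); last by move=> *; rewrite mulr1.
by move: h; lra.
Qed.

Lemma random_codeword_power beta : 1 <= beta -> a <= beta^-1 -> power_constraints beta mu.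
Proof.
move=> b1 ab k n.
have mc : measurable_fun setT (fun z : input_block N => csq (tnth (tnth z n) k)).
  exact: (measurableT_comp measurable_csq (measurable_coord_input n k)).
split.
  apply: (@ae_mixture _ _ _ _ _ _ _ _ _ (fun z => Normc.normc (tnth (tnth z n) k) ^+ 2 <= 1)).
    rewrite (_ : [set x | _] = (fun z => csq (tnth (tnth z n) k)) @^-1` `]-oo, 1]).
      by rewrite -[X in measurable X]setTI; apply: mc.
    by apply/seteqP; split => z /=; rewrite in_itv /= normc_sqr.
  by move=> x; rewrite normc_sqr csq_codeword; case: x.
under eq_integral do rewrite normc_sqr.
rewrite ge0_integral_mixture; last 2 first.
- exact/measurable_EFinP.
- by move=> z; rewrite lee_fin csq_ge0.
under eq_bigr do rewrite csq_codeword -EFinM.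
by rewrite sumEFin codeword_weight_active lee_fin.
Qed.

Lemma codeword_mean_power n : mean_power alpha mu n = a * total_gain alpha.
Proof.
rewrite /mean_power ge0_Rintegral_mixture; last 2 first.
- exact: measurable_weighted_power.
- by move=> z; exact: (weighted_power_ge0 separable).
rewrite -[in RHS]codeword_weight_active mulr_suml; apply: eq_bigr => x _.
rewrite -mulrA; congr (codeword_weight a x * _).
rewrite /weighted_power /total_gain mulr_sumr.
by apply: eq_bigr => k _; rewrite csq_codeword mulrC.
Qed.

(** The signal at [rho = 1]. The square root of [rho] is taken out, so that the moments and
    constants below do not depend on [rho]. *)
Definition fading_signal (i : I) (s : input_block N * Omega) : C := signal H 1 0 s.1 i s.2.

Lemma measurable_fading_signal i : measurable_fun setT (fading_signal i).
Proof. exact: measurable_signal2. Qed.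

Lemma fading_signal_square_integrable i : square_integrable S (fading_signal i).
Proof.
apply: square_integrable_mixture_prod; first exact: measurable_fading_signal.
by move=> x; exact: (signal_square_integrable channel).
Qed.

Lemma fading_signal_mean i : Cexpectation S (fading_signal i) = 0.
Proof.
have sH k l n : Cintegrable P (H k l n).
  exact/square_integrable_Cintegrable/(fading_square_integrable channel).
rewrite Cexpectation_mixture_prod; last 2 first.
- exact: measurable_fading_signal.
- move=> x; apply/square_integrable_Cintegrable.
  exact: (signal_square_integrable channel).
rewrite big1// => x _; rewrite /fading_signal /signal Cexpectation_sum.
  rewrite big1 ?mulr0// => k _.
  apply: (etrans (CexpectationZ ((Num.sqrt 1)%:C%C * tnth (tnth (codeword x) i.1) k)
    (sH k i.2 (0 + i.1).+1%:Z))).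
  by rewrite (fading_mean0 channel) mulr0.
by move=> k; exact: (CintegrableZ ((Num.sqrt 1)%:C%C * tnth (tnth (codeword x) i.1) k) (sH k i.2 (0 + i.1).+1%:Z)).
Qed.

Lemma fading_signal_pcov i j :
  Cexpectation S (fun s => fading_signal i s * fading_signal j s) = 0.
Proof.
rewrite Cexpectation_mixture_prod; last 2 first.
- by apply: measurable_complexM; exact: measurable_fading_signal.
- by move=> x; apply: Cintegrable_mul; exact: (signal_square_integrable channel).
by rewrite big1// => x _; rewrite (signal_pseudo_cov channel) mulr0.
Qed.

Definition signal_power (i : I) : R := Re (r i.2 0) * (a * total_gain alpha).

(** Distinct times are uncorrelated by the random signs, distinct receive antennas by the
    independence of the fading. This is what makes a product reference accurate. *)
Lemma fading_signal_cov i j :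
  Cexpectation S (fun s => fading_signal i s * (fading_signal j s)^*) =
  if i == j then (signal_power i)%:C%C else 0.
Proof.
rewrite Cexpectation_mixture_prod; last 2 first.
- apply: measurable_complexM; first exact: measurable_fading_signal.
  by apply: measurable_conj; exact: measurable_fading_signal.
- move=> x; apply: Cintegrable_mul; first exact: (signal_square_integrable channel).
  by apply: square_integrable_conj; exact: (signal_square_integrable channel).
under eq_bigr => x _ do rewrite (signal_cov channel separable ler01).
rewrite /covariance.
case: (i.2 =P j.2) => [ij|ij]; last first.
  rewrite big1; last by move=> x _; rewrite mulr0.
  by case: eqP => // ij'; case: ij; rewrite ij'.
have E x : (codeword_weight a x)%:C%C * (1%:C%C * r i.2 (i.1%:Z - j.1%:Z) *
    \sum_k (alpha k)%:C%C * (tnth (tnth (codeword x) i.1) k * (tnth (tnth (codeword x) j.1) k)^*)) =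
  (codeword_weight a x * (codeword_amplitude R x i.1 * codeword_amplitude R x j.1))%:C%C *
    (r i.2 (i.1%:Z - j.1%:Z) * (total_gain alpha)%:C%C).
  rewrite (eq_bigr (fun k => (alpha k)%:C%C *
     (codeword_amplitude R x i.1 * codeword_amplitude R x j.1)%:C%C)); last first.
    move=> k _; rewrite !tnth_codeword conj_Creal ?complex_real//.
    by rewrite -rmorphM.
  rewrite -mulr_suml /total_gain rmorph_sum /= rmorphM /=; ring.
rewrite (eq_bigr _ (fun x _ => E x)) -mulr_suml -rmorph_sum codeword_correlation.
case: (i.1 =P j.1) => [ij1|ij1]; last first.
  by rewrite mul0r; case: eqP => // ij'; case: ij1; rewrite ij'.
rewrite (_ : i == j); last by rewrite -pair_eqE /= ij ij1 !eqxx.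
rewrite ij1 subrr.
have [_ + _] := separable => /(_ i.2)/autocorrelation_facts[_ im0 _].
have -> : r i.2 0 = (Re (r i.2 0))%:C%C by case: (r i.2 0) im0 => x y /= ->.
by rewrite -!rmorphM /= /signal_power; congr (_%:C%C); ring.
Qed.

Lemma signal_power_ge0 i : 0 <= signal_power i.
Proof.
rewrite mulr_ge0// mulr_ge0//; first by case/andP: a01.
exact: (total_gain_ge0 separable).
Qed.

(** Symbols have modulus at most 1, so by Cauchy-Schwarz a signal coordinate has squared modulus at
    most [NT] times the sum of the squared fading coefficients. Dividing by [NT%:R + 1] instead of
    [NT%:R] avoids a zero denominator. *)
Lemma fading_signal_exp : exists2 e, 0 < e &
  S.-integrable setT (EFin \o (fun s => expR (e * \sum_i csq (fading_signal i s)))).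
Proof.
pose idx (j : I * 'I_NT) : 'I_NT * 'I_NR * int := (j.2, j.1.2, (0 + j.1.1).+1%:Z).
have [e e0 Ie] := fading_exponential_moment channel idx.
have T0 : 0 < NT%:R + 1 :> R by rewrite ltr_wpDl.
exists (e / (NT%:R + 1)); first by rewrite divr_gt0.
have mF : measurable_fun setT (fun s => expR (e / (NT%:R + 1) * \sum_i csq (fading_signal i s))).
  apply: measurableT_comp => //; apply: measurable_funM => //.
  apply: measurable_sum => i; apply: (measurableT_comp measurable_csq).
  exact: measurable_fading_signal.
suff Ik x : P.-integrable setT (EFin \o
    (fun w => expR (e / (NT%:R + 1) * \sum_i csq (fading_signal i (codeword x, w))))).
  by have [] := Rintegral_mixture_prod None (codeword_weight_ge0 a01) (codeword_weight_sum N a) mF Ik.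
apply: (@le_EFin_integrable _ _ _ P setT measurableT _
  (fun w => expR (e * \sum_j csq (H (idx j).1.1 (idx j).1.2 (idx j).2 w)))) => //.
  exact: (measurableT_comp mF (pair1_measurable (codeword x))).
move=> w _; rewrite ger0_norm ?expR_ge0// ler_expR -mulrA ler_pM2l//.
have -> : \sum_j csq (H (idx j).1.1 (idx j).1.2 (idx j).2 w) =
    \sum_(i : I) \sum_k csq (H k i.2 (0 + i.1).+1%:Z w) by rewrite pair_bigA.
rewrite ler_pdivrMl// mulr_sumr.
apply: ler_sum => i _; rewrite /fading_signal /signal /=.
pose A k := tnth (tnth (codeword x) i.1) k.
(* Unit weights and a double conjugation bring the sum to the form of [csq_sum_le]. *)
rewrite (eq_bigr (fun k => 1%:C%C * (H k i.2 (0 + i.1).+1%:Z w * ((A k)^*)^*))); last first.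
  by move=> k _; rewrite sqrtr1 conjCK !mul1r mulrC.
apply: (le_trans (csq_sum_le _ _ _)) => [//|].
rewrite [X in X * _](eq_bigr (fun k => csq (H k i.2 (0 + i.1).+1%:Z w))); last first.
  by move=> k _; rewrite mul1r.
rewrite mulrC; apply: ler_wpM2r; first by apply: sumr_ge0 => k _; exact: csq_ge0.
apply: (@le_trans _ _ (\sum_(k < NT) 1)); last by rewrite sumr_const card_ord lerDl.
apply: ler_sum => k _; rewrite mul1r.
have -> : csq (A k)^* = csq (A k) by rewrite /csq; case: (A k) => ? ? /=; rewrite sqrrN.
by rewrite csq_codeword; case: (x).
Qed.

End codewords.

(** * Second moment of the output density *)

Section second_moment.
Context d (T : measurableType d) (R : realType) (S : probability T R) (N NR : nat).
Local Notation I := ('I_N * 'I_NR)%type.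
Local Notation B := (N.-tuple (NR.-tuple R[i])).
Variables (X : I -> T -> R[i]) (v : I -> R).
Hypothesis mX : forall i, measurable_fun setT (X i).
Hypothesis v_ge0 : forall i, 0 <= v i.
Let v1 i : 0 < 1 + v i. Proof. by rewrite ltr_wpDr. Qed.

Let b i : R := v i / (1 + v i).
Let e (s : T) (y : B) : R := expR (\sum_i (2 * cdot (X i s) (coord y i) - csq (X i s))).
Let c (y : B) : R := (\prod_i (1 + v i)) * expR (- \sum_i csq (coord y i) * b i).
Let G (q : B * (T * T)) : R := c q.1 * e q.2.1 q.1 * e q.2.2 q.1.

Lemma product_referenceV y : (product_reference v y)^-1 = c y.
Proof.
rewrite /product_reference /c expRN expR_sum -!prodfV -big_split /=.
by apply: eq_bigr => i _; rewrite invfM invrK.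
Qed.

Let c_ge0 y : 0 <= c y.
Proof. by rewrite mulr_ge0 ?expR_ge0// prodr_ge0// => i _; rewrite ltW. Qed.

Let G_ge0 q : 0 <= G q.
Proof. by apply: mulr_ge0; first apply: mulr_ge0; rewrite ?expR_ge0. Qed.

Let mG : measurable_fun setT G.
Proof.
apply: measurable_funM; first apply: measurable_funM.
- apply: measurable_funM => //; apply: measurableT_comp => //.
  apply: measurableT_comp => //; apply: measurable_sum => i.
  apply: measurable_funM => //; apply: (measurableT_comp measurable_csq).
  exact: (measurableT_comp (measurable_coord i)).
- apply: measurable_likelihood_exponent => i.
    exact: (measurableT_comp (mX i) (measurableT_comp measurable_fst measurable_snd)).
  exact: (measurableT_comp (measurable_coord i) measurable_fst).
- apply: measurable_likelihood_exponent => i.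
    exact: (measurableT_comp (mX i) (measurableT_comp measurable_snd measurable_snd)).
  exact: (measurableT_comp (measurable_coord i) measurable_fst).
Qed.

(* What remains of the second moment once the output is integrated out, using
   (1 + v)^2 / (1 + 2 v) <= exp (v^2 / (1 + 2 v)). *)
Definition overlap (x u : I -> R[i]) : R :=
  \sum_i (2 * cdot (x i) (u i) - ((csq (x i + u i) - v i) * v i) / (1 + 2 * v i)).

Lemma overlap_integral (s s' : T) :
  (\int[noise_law]_y (G (y, (s', s)))%:E <= (expR (overlap (X ^~ s) (X ^~ s')))%:E)%E.
Proof.
pose f i (z : R[i]) := (1 + v i) * expR (- (csq (X i s) + csq (X i s'))) *
  expR (2 * cdot (X i s + X i s') z - b i * csq z).
have b1 i : -1 < b i by rewrite (@lt_le_trans _ _ 0) ?ltrN10// divr_ge0// ltW.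
have GE y : G (y, (s', s)) = \prod_i f i (coord y i).
  rewrite /G /c /e /= /f !big_split /= -!expR_sum -!mulrA; congr (_ * _).
  rewrite -!expRD; congr expR; rewrite -!sumrN -!big_split /=; apply: eq_bigr => i _.
  by rewrite /cdot /=; case: (X i s) (X i s') => ? ? [? ?] /=; ring.
have mf i : measurable_fun setT (f i).
  apply: measurable_funM => //; apply: measurableT_comp => //; apply: measurable_funB.
    by apply: measurable_funM => //; exact: measurable_cdot.
  by apply: measurable_funM => //; exact: measurable_csq.
have f0 i z : 0 <= f i z by rewrite !mulr_ge0 ?expR_ge0// ltW.
under eq_integral do rewrite GE.
rewrite (integral_noise_law_prod (c := fun i => (1 + v i) * expR (- (csq (X i s) + csq (X i s'))) *
  ((1 + b i)^-1 * expR (csq (X i s + X i s') / (1 + b i)))))//; last first.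
  move=> i; rewrite /f; under eq_integral do rewrite EFinM.
  rewrite ge0_integralZl_EFin//; last 2 first.
  - apply/measurable_EFinP; apply: measurableT_comp => //; apply: measurable_funB.
      by apply: measurable_funM => //; exact: measurable_cdot.
    by apply: measurable_funM => //; exact: measurable_csq.
  - by rewrite mulr_ge0 ?expR_ge0// ltW.
  by rewrite std_cnormal_exp// -EFinM.
rewrite lee_fin /overlap expR_sum; apply: ler_prod => i _.
have v2 : 0 < 1 + 2 * v i by rewrite ltr_wpDr// mulr_ge0.
have bE : 1 + b i = (1 + 2 * v i) / (1 + v i) by rewrite /b; field; rewrite gt_eqF.
rewrite bE; apply/andP; split.
  by rewrite !mulr_ge0 ?expR_ge0// ?invr_ge0 ?divr_ge0// ltW.
rewrite [leLHS](_ : _ = (1 + v i ^+ 2 / (1 + 2 * v i)) *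
   (expR (- (csq (X i s) + csq (X i s'))) * expR (csq (X i s + X i s') / ((1 + 2 * v i) / (1 + v i))))); last first.
  by field; rewrite !gt_eqF.
rewrite -expRD; apply: (le_trans (ler_wpM2r (expR_ge0 _) (expR_ge1Dx _))).
rewrite -expRD ler_expR csqD le_eqVlt; apply/orP; left; apply/eqP.
by field; rewrite !gt_eqF.
Qed.

(** The squared likelihood is a double integral over two independent copies of the signal. After the
    integrals are exchanged, the one over the noise factorises over coordinates. *)
Lemma second_moment_le :
  (\int[noise_law]_y ((likelihood S X (coord y)) ^+ 2 / product_reference v y)%:E <=
   \int[S]_s' \int[S]_s (expR (overlap (X ^~ s) (X ^~ s')))%:E)%E.
Proof.
have mE : measurable_fun setT (fun q : B * (T * T) => (G q)%:E) by exact/measurable_EFinP.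
have E0 q : (0 <= (G q)%:E)%E by rewrite lee_fin.
have me y : measurable_fun setT (fun s => (e s y)%:E).
  apply/measurable_EFinP; apply: (measurable_likelihood_exponent mX) => i.
  exact: measurable_cst.
have e0 y s : (0 <= (e s y)%:E)%E by rewrite lee_fin expR_ge0.
have step y : (((likelihood S X (coord y)) ^+ 2 / product_reference v y)%:E =
    \int[S \x S]_p (G (y, p))%:E)%E.
  rewrite (@fubini_tonelli1 _ _ _ _ _ S S (fun p => (G (y, p))%:E))//; last first.
    exact: (measurableT_comp mE (pair1_measurable y)).
  under eq_integral => s' _.
    rewrite /fubini_F /=.
    under eq_integral do rewrite /G /= EFinM.
    rewrite ge0_integralZl_EFin//; last by rewrite mulr_ge0 ?expR_ge0.
    rewrite -(EFin_likelihood S mX) -EFinM mulrAC EFinM.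
  over.
  rewrite ge0_integralZl_EFin//; last first.
    by rewrite mulr_ge0// -lee_fin (EFin_likelihood S mX) integral_ge0.
  by rewrite -(EFin_likelihood S mX) -EFinM product_referenceV; congr _%:E; ring.
under eq_integral do rewrite step.
rewrite (@fubini_tonelli _ _ _ _ _ noise_law ((S \x S)%E : probability (T * T)%type R) (fun q => (G q)%:E))//.
rewrite (@fubini_tonelli1 _ _ _ _ _ S S (fun p => \int[noise_law]_y (G (y, p))%:E)%E)//; last 2 first.
- exact: (@measurable_fun_fubini_tonelli_G _ _ _ _ R noise_law (fun q => (G q)%:E)).
- by move=> p; apply: integral_ge0.
have mO : measurable_fun setT (fun p : T * T => (expR (overlap (X ^~ p.2) (X ^~ p.1)))%:E).
  apply/measurable_EFinP; apply: measurableT_comp => //; apply: measurable_sum => i.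
  have m2 : measurable_fun setT (fun p : T * T => X i p.2) by exact: (measurableT_comp (mX i)).
  have m1 : measurable_fun setT (fun p : T * T => X i p.1) by exact: (measurableT_comp (mX i)).
  apply: measurable_funB; first by apply: measurable_funM => //; exact: measurable_cdot.
  apply: measurable_funM => //; apply: measurable_funM => //; apply: measurable_funB => //.
  by apply: (measurableT_comp measurable_csq); exact: measurable_complexD.
have mGp : measurable_fun setT (fun p => \int[noise_law]_y (G (y, p))%:E)%E.
  exact: (@measurable_fun_fubini_tonelli_G _ _ _ _ R noise_law (fun q => (G q)%:E)).
apply: ge0_le_integral => //.
- by move=> s _; apply: integral_ge0 => s' _; apply: integral_ge0.
- apply: (@measurable_fun_fubini_tonelli_F _ _ _ _ R S (fun p => \int[noise_law]_y (G (y, p))%:E)%E) => //.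
  by move=> p; apply: integral_ge0.
- apply: (@measurable_fun_fubini_tonelli_F _ _ _ _ R S _ mO) => //.
move=> s' _; apply: ge0_le_integral => //.
- by move=> s _; apply: integral_ge0.
- exact: (measurableT_comp mGp (pair1_measurable s')).
- exact: (measurableT_comp mO (pair1_measurable s')).
- by move=> s _; exact: overlap_integral.
Qed.

End second_moment.

Section codeword_information.
Context (R : realType) (NT NR : nat) d (Omega : measurableType d)
  (P : probability Omega R)
  (H : 'I_NT -> 'I_NR -> int -> {RV P >-> R[i]})
  (W : 'I_NR -> nat -> {RV P >-> R[i]})
  (channel : rayleigh_mimo H W)
  (alpha : 'I_NT -> R) (r : 'I_NR -> int -> R[i])
  (separable : transmit_separable H alpha r).
Local Notation C := R[i].
Local Notation Re := (@complex.Re R).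
Local Notation Im := (@complex.Im R).
Local Notation input_block N := (N.-tuple (NT.-tuple R[i])).
Local Notation output_block N := (N.-tuple (NR.-tuple R[i])).
Let alpha_ge0 k : 0 <= alpha k. Proof. by have [+ _ _] := separable. Qed.
Let r0_ge0 l : 0 <= Re (r l 0).
Proof. by have [_ + _] := separable => /(_ l)/autocorrelation_facts[]. Qed.

Lemma EFin_output_density rho N (mu : probability (input_block N) R) y :
  ((output_density H rho mu y)%:E = \int[mu]_z (chan_density H rho (z, y))%:E)%E.
Proof.
have dens0 z : (0 <= (density H rho z y)%:E)%E.
  by rewrite lee_fin; apply: Rintegral_ge0 => // w _; exact: expR_ge0.
rewrite /output_density /marginal /Rintegral fineK// ge0_fin_numE; last first.
  by apply: integral_ge0 => z _; exact: dens0.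
apply: (@le_lt_trans _ _ (\int[mu]_z (expR (\sum_i csq (coord y i)))%:E)%E).
  apply: ge0_le_integral => //.
  - by move=> z _; exact: dens0.
  - by apply/measurable_EFinP; exact: (measurable_density_l H rho y).
  - by move=> z _; rewrite lee_fin; exact: (density_le channel).
by rewrite integral_prob_cst ltry.
Qed.

Lemma output_density_ge0 rho N (mu : probability (input_block N) R) y :
  0 <= output_density H rho mu y.
Proof. by do 2! (apply: Rintegral_ge0 => // ? _); exact: expR_ge0. Qed.

Lemma measurable_output_density rho N (mu : probability (input_block N) R) :
  measurable_fun setT (output_density H rho mu).
Proof.
apply: (measurableT_comp (fine_measurable measurableT)).
apply: (@measurable_fun_fubini_tonelli_G _ _ _ _ R mu
  (fun p : input_block N * output_block N => (chan_density H rho p)%:E)) => [|p].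
  by apply/measurable_EFinP; exact: measurable_chan_density.
by rewrite lee_fin; apply: Rintegral_ge0 => // w _; exact: expR_ge0.
Qed.

Lemma output_density_likelihood rho N (mu : probability (input_block N) R) y :
  output_density H rho mu y =
  likelihood (mu \x P)%E (fun i s => signal H rho 0 s.1 i s.2) (coord y).
Proof.
have m2 i : measurable_fun setT (fun s : input_block N * Omega => signal H rho 0 s.1 i s.2).
  exact: measurable_signal2.
have [_ E] := Rintegral_Fubini (integrable_likelihood (mu \x P)%E m2 (coord y)).
apply/EFin_inj; rewrite [RHS]E EFin_output_density.
apply: eq_integral => z _; rewrite /chan_density /density EFin_likelihood// => i.
exact: (measurable_signal channel).
Qed.

Lemma signal_scale rho tau N (z : input_block N) i w :
  signal H rho tau z i w = (Num.sqrt rho)%:C%C * signal H 1 tau z i w.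
Proof.
rewrite /signal mulr_sumr; apply: eq_bigr => k _.
by rewrite sqrtr1 mul1r mulrA.
Qed.

Lemma overlap_chi rho N (m : 'I_N * 'I_NR -> R) (x u : 'I_N * 'I_NR -> C) : 0 <= rho ->
  overlap (fun i => rho * m i) (fun i => (Num.sqrt rho)%:C%C * x i)
    (fun i => (Num.sqrt rho)%:C%C * u i) = chi_exponent m rho x u.
Proof.
move=> rho0; apply: eq_bigr => i _; have := sqr_sqrtr rho0; set c := Num.sqrt rho => cE.
have -> : cdot (c%:C%C * x i) (c%:C%C * u i) = c ^+ 2 * cdot (x i) (u i).
  by rewrite /cdot; case: (x i) (u i) => ? ? [? ?] /=; ring.
have -> : csq (c%:C%C * x i + c%:C%C * u i) = c ^+ 2 * csq (x i + u i).
  by rewrite /csq; case: (x i) (u i) => ? ? [? ?] /=; ring.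
by rewrite cE; congr (_ - _); [ring|rewrite !mulrA; congr (_ / _); ring].
Qed.

Section random_codeword.
Variables (N : nat) (a : R).
Hypothesis a01 : 0 <= a <= 1.
Local Notation I := ('I_N * 'I_NR)%type.
Local Notation mu := (@random_codeword R NT N a a01).
Local Notation S := (mu \x P)%E.
Local Notation power := (fun i : I => signal_power alpha r a i).

Lemma codeword_second_moment : exists K eps : R, [/\ 0 <= K, 0 < eps &
  forall rho, 0 < rho -> rho <= eps ->
  (\int[noise_law]_y ((output_density H rho mu y) ^+ 2 /
     product_reference (fun i => rho * power i) y)%:E <= (1 + K * rho ^+ 3)%:E)%E].
Proof.
have [e e0 Ie] := fading_signal_exp channel N a01.
have p0 (i : I) : 0 <= power i := signal_power_ge0 separable a01 i.
(* The sum is a common upper bound for the powers, so no maximum over a possibly empty index set is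
   needed. *)
pose M := \sum_(i : I) power i.
have M0 : 0 <= M by exact: sumr_ge0.
have pM (i : I) : power i <= M by rewrite /M (bigD1 i)//= lerDl sumr_ge0.
pose s := chi_size I M.
have s0 : 0 < s by rewrite /s /chi_size !ltr_wpDr ?mulr_ge0.
pose X (i : I) := fading_signal H i.
pose K := chi_constant S X M e * chi_moment S X e.
have mX i : measurable_fun setT (X i) by exact: measurable_fading_signal.
have Mom0 : 0 <= chi_moment S X e by apply: Rintegral_ge0 => // w _; exact: expR_ge0.
(* These are the two smallness conditions of [chi_square_double]. *)
exists K, (Num.min 1 (e / (2 * s))); split.
- rewrite /K mulr_ge0// /chi_constant mulr_ge0// mulr_ge0 ?expR_ge0//.
  have s_ge0 := ltW s0; have e_ge0 := ltW e0.
  have se (k : R) : 0 <= k -> 0 <= k * s / e by move=> k0; rewrite divr_ge0 ?mulr_ge0.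
  rewrite /chi_coef; apply: addr_ge0; [apply: addr_ge0|].
  - by apply: mulr_ge0; [exact: mulr_ge0|exact: se].
  - by apply: exprn_ge0; exact: se.
  - by apply: exprn_ge0; exact: se.
- by rewrite lt_min ltr01 divr_gt0// mulr_gt0.
move=> rho rho0; rewrite le_min => /andP[rho1 rhoe].
have {}rhoe : rho * (2 * s) <= e by rewrite -ler_pdivlMr// mulr_gt0.
pose Y (i : I) (s : input_block N * Omega) := (Num.sqrt rho)%:C%C * X i s.
have YE : (fun (i : I) (s : input_block N * Omega) => signal H rho 0 s.1 i s.2) = Y.
  by apply/funext => i; apply/funext => w; rewrite signal_scale.
have mY i : measurable_fun setT (Y i) by rewrite -YE; exact: measurable_signal2.
under eq_integral do rewrite output_density_likelihood YE.
apply: (le_trans (second_moment_le S mY _)).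
  by move=> i; rewrite mulr_ge0// ltW.
have := chi_square_double p0 pM M0 (fading_signal_square_integrable channel a01)
  (fading_signal_mean channel a01) (fading_signal_cov channel separable a01)
  (fading_signal_pcov channel a01) e0 Ie rho0 rho1 rhoe.
rewrite [(K * _)%R]mulrC; apply: le_trans.
rewrite le_eqVlt; apply/orP; left; apply/eqP.
apply: eq_integral => s' _; apply: eq_integral => s'' _.
by rewrite (overlap_chi _ (X ^~ s'') (X ^~ s') (ltW rho0)).
Qed.

(** Sum over the receive antennas of the squared Hilbert-Schmidt norm of the Toeplitz matrix of
    [r l]; it grows like [N] times the sum of the [lambda (r l)]. *)
Definition correlation_sum : R :=
  \sum_l \sum_(n < N) \sum_(m < N) csq (r l (n%:Z - m%:Z)).

Lemma codeword_cov rho x (i j : I) :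
  covariance alpha r rho (codeword R NT x : input_block N) i j =
  if i.2 == j.2 then
    (rho * total_gain alpha * (codeword_amplitude R x i.1 * codeword_amplitude R x j.1))%:C%C *
      r i.2 (i.1%:Z - j.1%:Z)
  else 0.
Proof.
rewrite /covariance; case: eqP => // _.
rewrite (eq_bigr (fun k => (alpha k)%:C%C *
   (codeword_amplitude R x i.1 * codeword_amplitude R x j.1)%:C%C)); last first.
  move=> k _; rewrite !tnth_codeword conj_Creal ?complex_real//.
  by rewrite -rmorphM.
by rewrite -mulr_suml /total_gain !rmorphM rmorph_sum /=; ring.
Qed.

Lemma codeword_energy rho x :
  signal_energy alpha r rho (codeword R NT x : input_block N) =
  (x != None)%:R * (rho * total_gain alpha * (N%:R * \sum_l Re (r l 0))).
Proof.
rewrite /signal_energy (eq_bigr (fun i : I => (x != None)%:R * (rho * total_gain alpha) * Re (r i.2 0))); last first.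
  move=> i _; rewrite codeword_cov eqxx subrr -expr2 codeword_amplitude_sqr.
  by case: (r i.2 0) => u w /=; ring.
rewrite (sum_block (fun n l => (x != None)%:R * (rho * total_gain alpha) * Re (r l 0))).
by rewrite sumr_const card_ord -mulr_sumr -mulr_natl; ring.
Qed.

(** In an active codeword all amplitudes have modulus 1, so the signs drop out and every lag
    contributes fully. *)
Lemma codeword_cov_energy rho x :
  cov_energy alpha r rho (codeword R NT x : input_block N) =
  (x != None)%:R * ((rho * total_gain alpha) ^+ 2 * correlation_sum).
Proof.
have E (i j : I) : csq (covariance alpha r rho (codeword R NT x : input_block N) i j) =
    if i.2 == j.2 then
      (x != None)%:R * (rho * total_gain alpha) ^+ 2 * csq (r i.2 (i.1%:Z - j.1%:Z)) else 0.
  rewrite codeword_cov; case: eqP => _; last by rewrite /csq /= expr0n addr0.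
  have : (codeword_amplitude R x i.1 * codeword_amplitude R x j.1) ^+ 2 = (x != None)%:R.
    by rewrite exprMn !codeword_amplitude_sqr; case: (x); rewrite /= ?mulr1 ?mulr0.
  move=> <-; rewrite /csq; case: (r _ _) => u w /=; ring.
rewrite /cov_energy (eq_bigr (fun i : I => \sum_(m < N)
    (x != None)%:R * (rho * total_gain alpha) ^+ 2 * csq (r i.2 (i.1%:Z - m%:Z)))); last first.
  move=> i _; rewrite (eq_bigr _ (fun j _ => E i j)).
  rewrite (sum_block (fun m l' => if i.2 == l' then
    (x != None)%:R * (rho * total_gain alpha) ^+ 2 * csq (r i.2 (i.1%:Z - m%:Z)) else 0)).
  apply: eq_bigr => m _; rewrite (bigD1 i.2)//= eqxx big1 ?addr0// => l' l'i.
  by rewrite eq_sym (negbTE l'i).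
rewrite (sum_block (fun n l => \sum_(m < N)
  (x != None)%:R * (rho * total_gain alpha) ^+ 2 * csq (r l (n%:Z - m%:Z)))).
rewrite exchange_big /correlation_sum /= mulrA [RHS]mulr_sumr; apply: eq_bigr => l _.
by rewrite [RHS]mulr_sumr; apply: eq_bigr => n _; rewrite [RHS]mulr_sumr.
Qed.

Lemma correlation_sum_ge0 : 0 <= correlation_sum.
Proof. by do 3! (apply: sumr_ge0 => ? _); exact: csq_ge0. Qed.

Lemma codeword_information_ge beta : 1 <= beta -> a <= beta^-1 ->
  exists C eps : R, [/\ 0 <= C, 0 < eps &
  forall rho, 0 < rho -> rho <= eps ->
  ((rho ^+ 2 / 2 * (a * total_gain alpha ^+ 2 * correlation_sum
      - N%:R * (a * total_gain alpha) ^+ 2 * \sum_l Re (r l 0) ^+ 2)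
    - C * rho ^+ 3)%R%:E <= block_information H W rho mu)%E].
Proof.
move=> beta1 ab.
have [K [eps [K0 eps0 hK]]] := codeword_second_moment.
have mu_power := @random_codeword_power R NT N a a01 beta beta1 ab.
have S0 : 0 <= total_gain alpha := total_gain_ge0 separable.
have a0 : 0 <= a by case/andP: a01.
pose Sr := \sum_l Re (r l 0).
have Sr0 : 0 <= Sr by exact: sumr_ge0.
(* [D] collects the cubic term of [ln_density_mean_bounds], and [K] bounds the cost [ln c] of the
   normalisation. *)
pose D := a * (total_gain alpha ^+ 3 * correlation_sum * (N%:R * Sr)) / 3.
have D0 : 0 <= D by rewrite !mulr_ge0 ?exprn_ge0 ?correlation_sum_ge0.
exists (D + K), eps; split => //; first exact: addr_ge0.
move=> rho rho0 rhoe; have rho_ge0 := ltW rho0.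
pose c := 1 + K * rho ^+ 3.
have c1 : 1 <= c by rewrite lerDl mulr_ge0// exprn_ge0.
have c0 : 0 < c by exact: lt_le_trans c1.
pose v (i : I) := rho * Re (r i.2 0) * mean_power alpha mu i.1.
have vE : v = fun i => rho * power i.
  by apply/funext => i; rewrite /v (codeword_mean_power separable) /signal_power; ring.
have v_ge0 i : 0 <= v i by rewrite vE mulr_ge0// (signal_power_ge0 separable).
pose q := product_reference v.
have q0 y : 0 < q y by exact: product_reference_gt0.
have mq : measurable_fun setT q by exact: measurable_product_reference.
pose dens := @chan_density R NT NR d Omega P H rho N.
have dens0 p : 0 < dens p by exact: (chan_density_gt0 channel separable rho_ge0 p).
have mdens : measurable_fun setT dens by exact: measurable_chan_density.
(* Written as an exponential, so that positivity and the logarithm are immediate; [c] turns the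
   second-moment bound into a total integral of at most 1. *)
pose g p := expR (ln (dens p) - ln (q p.2) - ln c).
have mqs : measurable_fun setT (fun p : input_block N * output_block N => ln (q p.2)).
  by apply: (measurableT_comp (@measurable_ln R)); exact: measurableT_comp.
have mg : measurable_fun setT g.
  apply: measurableT_comp => //; apply: measurable_funB => //; apply: measurable_funB => //.
  exact: (measurableT_comp (@measurable_ln R)).
have g0 p : 0 < g p by exact: expR_gt0.
have gE p : g p = dens p * ((q p.2)^-1 * c^-1).
  by rewrite /g !expRB !lnK ?posrE// mulrA.
have [Iq Eq] := integrable_ln_reference channel separable rho_ge0 mu_power.
have [ID ED] := integrable_ln_density_mean channel separable rho_ge0 mu_power.
have Iln := integrable_ln_density channel separable rho_ge0 mu_power.
have lngE s : ln (g (s.1, channel_output H W rho s)) =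
    ln (dens (s.1, channel_output H W rho s)) - ln (q (channel_output H W rho s)) - ln c.
  exact: expRK.
have Ig : S.-integrable setT (EFin \o (fun s => ln (g (s.1, channel_output H W rho s)))).
  rewrite (_ : (fun s => _) = (fun s => ln (dens (s.1, channel_output H W rho s)) -
    ln (q (channel_output H W rho s)) - ln c)); last exact/funext.
  apply: (integrable_EFinB measurableT); last exact: integrable_prob_cst.
  exact: (integrable_EFinB measurableT).
have mO := measurable_output_density rho mu.
have O0 y : 0 <= output_density H rho mu y by exact: output_density_ge0.
apply: le_trans (block_information_ge channel separable rho_ge0 mu_power mg g0 _ Ig); last first.
  rewrite (@fubini_tonelli _ _ _ _ _ mu noise_law (fun p => (g p * output_density H rho mu p.2)%:E))//; last 2 first.
  - by apply/measurable_EFinP; exact: (measurable_funM mg (measurableT_comp mO measurable_snd)).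
  - by move=> p; rewrite lee_fin; exact: (mulr_ge0 (ltW (g0 p)) (O0 p.2)).
  have E y : (\int[mu]_z (g (z, y) * output_density H rho mu y)%:E =
      ((output_density H rho mu y) ^+ 2 / q y * c^-1)%:E)%E.
    transitivity (\int[mu]_z (((q y)^-1 * c^-1 * output_density H rho mu y)%:E * (dens (z, y))%:E))%E.
      by apply: eq_integral => z _; rewrite gE -EFinM; congr _%:E; rewrite [RHS]mulrC [RHS]mulrA.
    have c_ge0 : 0 <= (q y)^-1 * c^-1 * output_density H rho mu y.
      by rewrite !mulr_ge0// invr_ge0 ltW.
    rewrite ge0_integralZl_EFin//; last 2 first.
    - by move=> z _; rewrite lee_fin ltW.
    - by apply/measurable_EFinP; exact: (measurable_density_l H rho y).
    by rewrite -EFin_output_density -EFinM; congr _%:E; ring.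
  under [X in (X <= _)%E]eq_integral do rewrite /= E.
  under eq_integral do rewrite EFinM muleC.
  rewrite ge0_integralZl_EFin//; last 3 first.
  - by move=> y _; rewrite lee_fin divr_ge0 ?sqr_ge0// ltW.
  - apply/measurable_EFinP; apply: measurable_funM; first exact: measurable_funX.
    rewrite (_ : (fun y => (q y)^-1) = (fun y => expR (- ln (q y)))).
      apply: measurableT_comp => //; apply: measurableT_comp => //.
      exact: (measurableT_comp (@measurable_ln R)).
    by apply/funext => y; rewrite expRN lnK ?posrE.
  - by rewrite invr_ge0 ltW.
  apply: (@le_trans _ _ ((c^-1)%:E * c%:E)%E); last by rewrite -EFinM mulVf ?gt_eqF.
  apply: lee_wpmul2l; first by rewrite lee_fin invr_ge0 ltW.
  by rewrite /q vE; exact: hK.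
rewrite lee_fin (_ : (fun s => ln (g (s.1, channel_output H W rho s))) =
    (fun s => ln (dens (s.1, channel_output H W rho s)) - ln (q (channel_output H W rho s)) - ln c));
  last exact/funext.
have Id := integrable_EFinB measurableT Iln Iq.
rewrite (RintegralB measurableT Id (integrable_prob_cst _ _)) Rintegral_prob_cst.
rewrite (RintegralB measurableT Iln Iq) Eq ED.
have hc : ln c <= K * rho ^+ 3 by rewrite /c; apply: le_ln1Dx; rewrite (lt_le_trans _ (mulr_ge0 K0 (exprn_ge0 _ rho_ge0))) ?ltrN10.
have hv : \sum_i (v i - ln (1 + v i)) <= rho ^+ 2 / 2 *
    (N%:R * (a * total_gain alpha) ^+ 2 * \sum_l Re (r l 0) ^+ 2).
  apply: (@le_trans _ _ (\sum_(i : I) rho ^+ 2 / 2 * (a * total_gain alpha) ^+ 2 * Re (r i.2 0) ^+ 2)).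
    apply: ler_sum => i _; apply: (le_trans (ln1D_ge (v_ge0 i))).
    by rewrite vE /signal_power le_eqVlt; apply/orP; left; apply/eqP; ring.
  rewrite (sum_block (fun n l => rho ^+ 2 / 2 * (a * total_gain alpha) ^+ 2 * Re (r l 0) ^+ 2)).
  by rewrite sumr_const card_ord -mulr_sumr -mulr_natl le_eqVlt; apply/orP; left; apply/eqP; ring.
have hD : a * (rho ^+ 2 / 2 * (total_gain alpha ^+ 2 * correlation_sum)) - D * rho ^+ 3 <=
    \int[mu]_z ln_density_mean H W rho z.
  have mD : measurable_fun setT (fun z : input_block N => ln_density_mean H W rho z).
    by apply/measurable_EFinP; exact: measurable_int ID.
  have [_ ->] := Rintegral_mixture None (@codeword R NT N) (codeword_weight_ge0 a01) (codeword_weight_sum N a) mD.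
  pose B := rho ^+ 2 / 2 * (total_gain alpha ^+ 2 * correlation_sum) -
    rho ^+ 3 * (total_gain alpha ^+ 3 * correlation_sum * (N%:R * Sr)) / 3.
  rewrite (_ : _ - _ = a * B); last by rewrite /B /D; field.
  (* [a] is the total weight of the active codewords; the silent one contributes zero. *)
  rewrite -[X in X * B](codeword_weight_active N a) mulr_suml; apply: ler_sum => x _.
  rewrite -mulrA; apply: ler_wpM2l; first exact: codeword_weight_ge0.
  have [_ _] := ln_density_mean_bounds channel separable rho_ge0 (codeword R NT x : input_block N).
  apply: le_trans; rewrite codeword_energy codeword_cov_energy -/Sr.
  by case: (x) => [s|] /=; rewrite le_eqVlt; apply/orP; left; apply/eqP; rewrite /B; field.
by move: hc hv hD; lra.
Qed.

End random_codeword.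
End codeword_information.

(** * Superadditivity and the low-SNR limit *)

Section same_law.
Context d1 d2 d3 (T1 : measurableType d1) (T2 : measurableType d2) (T : measurableType d3)
  (R : realType) (P1 : probability T1 R) (P2 : probability T2 R).
Variables (U : T1 -> T) (V : T2 -> T).
Hypotheses (mU : measurable_fun setT U) (mV : measurable_fun setT V).
Hypothesis UV : forall A, measurable A -> P1 (U @^-1` A) = P2 (V @^-1` A).
Let Y : {mfun T2 >-> T} := HB.pack V (isMeasurableFun.Build _ _ _ _ _ mV).

Lemma integrable_same_law (h : T -> R) : measurable_fun setT h ->
  P2.-integrable setT (EFin \o (h \o V)) -> P1.-integrable setT (EFin \o (h \o U)).
Proof.
move=> mh; have mEh : measurable_fun setT (EFin \o h) by exact/measurable_EFinP.
have := integrable_image (m1 := P2) (m2 := distribution P2 Y) mV (fun A mA => erefl) mEh.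
have := integrable_image (m1 := P1) (m2 := distribution P2 Y) mU (fun A mA => UV mA) mEh.
by move=> -[h1 _] [_ h2] /h2 /h1.
Qed.

Lemma Rintegral_same_law (h : T -> R) : measurable_fun setT h ->
  \int[P1]_x h (U x) = \int[P2]_x h (V x).
Proof.
move=> mh.
by rewrite -(Rintegral_image (m2 := distribution P2 Y) mU)// (Rintegral_image (m1 := P2) mV).
Qed.

End same_law.

Section concatenation.
Context d (A : measurableType d) (R : realType) (M N : nat).
Local Notation block N := (N.-tuple A).

Definition concat (z : block M * block N) : block (M + N) := [tuple of z.1 ++ z.2].

Definition left_block (z : block (M + N)) : block M := [tuple tnth z (lshift N i) | i < M].

Definition right_block (z : block (M + N)) : block N := [tuple tnth z (rshift M i) | i < N].

Lemma tnth_left_block z i : tnth (left_block z) i = tnth z (lshift N i).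
Proof. by rewrite tnth_mktuple. Qed.

Lemma tnth_right_block z i : tnth (right_block z) i = tnth z (rshift M i).
Proof. by rewrite tnth_mktuple. Qed.

Lemma left_concat z : left_block (concat z) = z.1.
Proof. by apply: eq_from_tnth => i; rewrite tnth_left_block tnth_lshift. Qed.

Lemma right_concat z : right_block (concat z) = z.2.
Proof. by apply: eq_from_tnth => i; rewrite tnth_right_block tnth_rshift. Qed.

Lemma measurable_concat : measurable_fun setT concat.
Proof.
apply/measurable_fun_tnthP => n; case: (split_ordP n) => i ->.
  rewrite (_ : _ \o _ = (fun z : block M * block N => tnth z.1 i)).
    exact: (measurableT_comp (measurable_tnth i)).
  by apply/funext => z; rewrite /= tnth_lshift.
rewrite (_ : _ \o _ = (fun z : block M * block N => tnth z.2 i)).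
  exact: (measurableT_comp (measurable_tnth i)).
by apply/funext => z; rewrite /= tnth_rshift.
Qed.

Lemma measurable_left_block : measurable_fun setT left_block.
Proof.
apply/measurable_fun_tnthP => i; rewrite (_ : _ \o _ = (fun z => tnth z (lshift N i))).
  exact: measurable_tnth.
by apply/funext => z; rewrite /= tnth_left_block.
Qed.

Lemma measurable_right_block : measurable_fun setT right_block.
Proof.
apply/measurable_fun_tnthP => i; rewrite (_ : _ \o _ = (fun z => tnth z (rshift M i))).
  exact: measurable_tnth.
by apply/funext => z; rewrite /= tnth_right_block.
Qed.

HB.instance Definition _ := @isMeasurableFun.Build _ _ _ _ concat measurable_concat.

Variables (mu1 : probability (block M) R) (mu2 : probability (block N) R).

Definition product_input : probability (block (M + N)) R :=
  distribution (mu1 \x mu2)%E concat.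

Lemma product_input_left B : measurable B -> product_input (left_block @^-1` B) = mu1 B.
Proof.
move=> mB; rewrite -(law_fst mu1 mu2 mB) /product_input /distribution /pushforward.
by congr ((mu1 \x mu2)%E _); apply/seteqP; split => z /=; rewrite left_concat.
Qed.

Lemma law_snd B : measurable B -> (mu1 \x mu2)%E (snd @^-1` B) = mu2 B.
Proof.
move=> mB; rewrite (_ : snd @^-1` B = setT `*` B); last first.
  by apply/seteqP; split => [[a b] //=|[a b] []].
by rewrite product_measure1E// -[RHS]mul1e; congr (_ * _)%E; exact: (@probability_setT _ _ _ mu1).
Qed.

Lemma product_input_right B : measurable B -> product_input (right_block @^-1` B) = mu2 B.
Proof.
move=> mB; rewrite -(law_snd mB) /product_input /distribution /pushforward.
by congr ((mu1 \x mu2)%E _); apply/seteqP; split => z /=; rewrite right_concat.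
Qed.

Lemma ge0_integral_product_input (f : block M * block N -> \bar R) :
  measurable_fun setT f -> (forall z, (0 <= f z)%E) ->
  (\int[product_input]_z f (left_block z, right_block z) =
   \int[mu1]_z1 \int[mu2]_z2 f (z1, z2))%E.
Proof.
move=> mf f0; rewrite -fubini_tonelli1//.
have mlr : measurable_fun setT (fun z => (left_block z, right_block z)).
  by apply: measurable_fun_pair; [exact: measurable_left_block|exact: measurable_right_block].
rewrite (ge0_integral_image (m1 := (mu1 \x mu2)%E) (m2 := product_input) measurable_concat (fun A mA => erefl)).
- by apply: eq_integral => z _; rewrite left_concat right_concat; case: z.
- exact: (measurableT_comp mf mlr).
- by [].
Qed.

End concatenation.

Section superadditivity.
Context (R : realType) (NT NR : nat) d (Omega : measurableType d)
  (P : probability Omega R)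
  (H : 'I_NT -> 'I_NR -> int -> {RV P >-> R[i]})
  (W : 'I_NR -> nat -> {RV P >-> R[i]})
  (channel : rayleigh_mimo H W)
  (alpha : 'I_NT -> R) (r : 'I_NR -> int -> R[i])
  (separable : transmit_separable H alpha r) (rho beta : R).
Hypothesis rho_ge0 : 0 <= rho.
Local Notation input_block N := (N.-tuple (NT.-tuple R[i])).
Local Notation output_block N := (N.-tuple (NR.-tuple R[i])).
Local Notation out N := (@channel_output R NT NR d Omega P H W rho N).
Local Notation dens N := (@chan_density R NT NR d Omega P H rho N).

Section one_block.
Variables (N : nat) (mu : probability (input_block N) R).
Hypothesis mu_power : power_constraints beta mu.

Definition input_info (p : input_block N * output_block N) : R := info_density mu (dens N) p.

Let mdens : measurable_fun setT (dens N). Proof. exact: measurable_chan_density. Qed.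
Let dens_gt0 p : 0 < dens N p. Proof. exact: (chan_density_gt0 channel separable rho_ge0). Qed.
Let dens_le z y : dens N (z, y) <= energy_bound y. Proof. exact: (chan_density_le channel). Qed.
Let floor_gt0 : 0 < density_floor alpha r rho N. Proof. exact: density_floor_gt0. Qed.
Let dens_ge y : {ae mu, forall z, density_floor alpha r rho N <= dens N (z, y)}.
Proof. exact: (chan_density_ge channel separable rho_ge0 mu_power). Qed.

Lemma measurable_input_info : measurable_fun setT input_info.
Proof. exact: measurable_info_density. Qed.

Lemma expR_input_info p : expR (input_info p) * output_density H rho mu p.2 = dens N p.
Proof. exact: (expR_info_density mdens dens_gt0 dens_le floor_gt0 dens_ge). Qed.

Lemma output_density_gt0 y : 0 < output_density H rho mu y.
Proof. exact: (marginal_gt0 mdens dens_gt0 dens_le floor_gt0 dens_ge). Qed.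

(** For fixed [y] the integrand is the posterior density of the input relative to [mu]. *)
Lemma expR_input_info_int1 y : (\int[mu]_z (expR (input_info (z, y)))%:E = 1)%E.
Proof.
have o0 := output_density_gt0 y.
transitivity (\int[mu]_z (((output_density H rho mu y)^-1)%:E * (dens N (z, y))%:E))%E.
  apply: eq_integral => z _; rewrite -expR_input_info -EFinM; congr _%:E.
  by rewrite mulrCA mulVf ?mulr1// gt_eqF.
rewrite ge0_integralZl_EFin//.
- by rewrite -(EFin_output_density channel) -EFinM mulVf// gt_eqF.
- by move=> z _; rewrite lee_fin ltW.
- by apply/measurable_EFinP; exact: (measurable_density_l H rho y).
- by rewrite invr_ge0 ltW.
Qed.

Lemma output_density_int1 : (\int[noise_law]_y (output_density H rho mu y)%:E = 1)%E.
Proof.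
transitivity (\int[noise_law]_y \int[mu]_z (dens N (z, y))%:E)%E.
  by apply: eq_integral => y _; exact: (EFin_output_density channel).
rewrite -(@fubini_tonelli _ _ _ _ _ mu noise_law (fun p => (dens N p)%:E)); last 2 first.
- exact/measurable_EFinP.
- by move=> p; rewrite lee_fin ltW.
rewrite -(integral_prob_cst mu 1); apply: eq_integral => z _.
exact: (density_int1 channel separable rho_ge0).
Qed.

Lemma integrable_input_info :
  (mu \x P)%E.-integrable setT (EFin \o (fun s => input_info (s.1, out N s))).
Proof.
exact: (integrable_info_density (Y := out N) mdens dens_gt0 dens_le floor_gt0 dens_ge
  (ln_energy_bound channel separable rho_ge0 mu_power)
  (integrable_ln_density channel separable rho_ge0 mu_power)).
Qed.

End one_block.

Section component.
Variables (tau Na Nb : nat).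
Variables (mua : probability (input_block Na) R) (mub : probability (input_block Nb) R).
Variable pr : input_block Na -> input_block Nb.
Hypothesis mpr : measurable_fun setT pr.
Hypothesis law_pr : forall B, measurable B -> mua (pr @^-1` B) = mub B.

Lemma power_constraints_at (i : 'I_Nb) (j : 'I_Na) :
  (forall z, tnth (pr z) i = tnth z j) -> power_constraints beta mub -> forall k,
  {ae mua, forall z, Normc.normc (tnth (tnth z j) k) ^+ 2 <= 1} /\
  (\int[mua]_z (Normc.normc (tnth (tnth z j) k) ^+ 2)%:E <= (beta^-1)%:E)%E.
Proof.
move=> ij hb k; have [h1 h2] := hb k i.
have mc : measurable_fun setT (fun z : input_block Nb => csq (tnth (tnth z i) k)).
  exact: (measurableT_comp measurable_csq (measurable_coord_input i k)).
split.
  pose B := [set z : input_block Nb | Normc.normc (tnth (tnth z i) k) ^+ 2 <= 1].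
  have mB : measurable B.
    rewrite (_ : B = (fun z => csq (tnth (tnth z i) k)) @^-1` `]-oo, 1]).
      by rewrite -[X in measurable X]setTI; apply: mc.
    by apply/seteqP; split => z /=; rewrite /B in_itv /= normc_sqr.
  have mBc := measurableC mB.
  have B0 : mub (~` B) = 0 by apply/negligibleP.
  exists (pr @^-1` (~` B)); split.
  - by rewrite -[X in measurable X]setTI; apply: mpr.
  - by rewrite law_pr.
  - by move=> z /=; rewrite /B /= ij.
apply: le_trans h2; rewrite (ge0_integral_image mpr law_pr).
- by under [X in (_ <= X)%E]eq_integral do rewrite ij.
- by apply/measurable_EFinP; under eq_fun do rewrite normc_sqr.
- by move=> z; rewrite lee_fin normc_sqr csq_ge0.
Qed.

(** Input and output of a sub-block that starts at time offset [tau] inside a longer block; [pr]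
    extracts its input. *)
Definition shifted_pair (s : input_block Na * Omega) : input_block Nb * output_block Nb :=
  (pr s.1, block (received H W rho tau (pr s.1) ^~ s.2)).

Lemma measurable_shifted_pair : measurable_fun setT shifted_pair.
Proof.
have m1 : measurable_fun setT (fun s : input_block Na * Omega => pr s.1).
  exact: (measurableT_comp mpr).
apply: measurable_fun_pair => //.
apply: (measurable_block (f := fun i s => received H W rho tau (pr s.1) i s.2)) => i.
apply: measurable_complexD; last exact: (measurableT_comp _ measurable_snd).
apply: (measurableT_comp (@measurable_signal2 _ _ _ _ _ _ H rho tau Nb i) (g := fun s => (pr s.1, s.2))).
exact: measurable_fun_pair.
Qed.

(** The offset [tau] does not appear on the right: the transition density of a sub-block is that of
    a block at offset 0. *)
Lemma ge0_integral_shifted_pair (f : input_block Nb * output_block Nb -> \bar R) :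
  measurable_fun setT f -> (forall p, (0 <= f p)%E) ->
  (\int[mua \x P]_s f (shifted_pair s) = \int[mub \x P]_s f (s.1, out Nb s))%E.
Proof.
move=> mf f0.
pose h (p : input_block Nb * output_block Nb) := (f p * (dens Nb p)%:E)%E.
have dens0 p : (0 <= (dens Nb p)%:E)%E.
  by rewrite lee_fin ltW// (chan_density_gt0 channel separable rho_ge0).
have h0 p : (0 <= h p)%E by rewrite mule_ge0.
have mh : measurable_fun setT h.
  by apply: emeasurable_funM => //; apply/measurable_EFinP; exact: measurable_chan_density.
have m1 : measurable_fun setT (fun s => f (shifted_pair s)).
  exact: (measurableT_comp mf measurable_shifted_pair).
have m2 : measurable_fun setT (fun s => f (s.1, out Nb s)).
  by apply: (measurableT_comp mf); exact: measurable_fun_pair.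
rewrite (@fubini_tonelli1 _ _ _ _ _ mua P _ m1 (fun s => f0 _)).
rewrite (@fubini_tonelli1 _ _ _ _ _ mub P _ m2 (fun s => f0 _)).
transitivity (\int[mua]_z \int[noise_law]_y h (pr z, y))%E.
  apply: eq_integral => z _; rewrite /fubini_F /shifted_pair /=.
  rewrite (@expect_received_density _ _ _ _ _ _ _ _ channel _ _ separable _ rho_ge0 tau Nb (pr z)
    (fun y => f (pr z, y)))//.
  exact: (measurableT_comp mf (pair1_measurable (pr z))).
rewrite -(ge0_integral_image mpr law_pr (f := fun z => (\int[noise_law]_y h (z, y))%E)).
- apply: eq_integral => z _; rewrite /fubini_F /=.
  rewrite (chan_kernel channel separable rho_ge0 z (f := fun y => f (z, y)))//.
  exact: (measurableT_comp mf (pair1_measurable z)).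
- exact: (@measurable_fun_fubini_tonelli_F _ _ _ _ R noise_law h).
- by move=> z; apply: integral_ge0.
Qed.

Lemma shifted_pair_law B : measurable B ->
  (mua \x P)%E (shifted_pair @^-1` B) = (mub \x P)%E ((fun s => (s.1, out Nb s)) @^-1` B).
Proof.
move=> mB.
have mV : measurable_fun setT (fun s => (s.1, out Nb s)) by exact: measurable_fun_pair.
have m1 : measurable (shifted_pair @^-1` B).
  by rewrite -[X in measurable X]setTI; apply: measurable_shifted_pair.
have m2 : measurable ((fun s => (s.1, out Nb s)) @^-1` B).
  by rewrite -[X in measurable X]setTI; apply: mV.
have mi : measurable_fun setT (fun p : input_block Nb * output_block Nb => (\1_B p : R)%:E).
  by apply/measurable_EFinP; exact: measurable_indic.
have E := ge0_integral_shifted_pair mi (fun p => ltac:(by rewrite lee_fin)).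
have := E; rewrite -[X in X = _]/((\int[mua \x P]_s (\1_(shifted_pair @^-1` B) s)%:E)%E).
rewrite -[X in _ = X]/((\int[mub \x P]_s (\1_((fun s => (s.1, out Nb s)) @^-1` B) s)%:E)%E).
by rewrite !integral_indic// !setIT.
Qed.

End component.

Section two_blocks.
Variables (M N : nat).
Variables (mu1 : probability (input_block M) R) (mu2 : probability (input_block N) R).
Hypothesis mu1_power : power_constraints beta mu1.
Hypothesis mu2_power : power_constraints beta mu2.
Local Notation mu := (product_input mu1 mu2).
Local Notation lb := (@left_block _ _ M N).
Local Notation rb := (@right_block _ _ M N).

Let mlz : measurable_fun setT (lb : input_block (M + N) -> input_block M).
Proof. exact: measurable_left_block. Qed.
Let mrz : measurable_fun setT (rb : input_block (M + N) -> input_block N).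
Proof. exact: measurable_right_block. Qed.
Let mly : measurable_fun setT (lb : output_block (M + N) -> output_block M).
Proof. exact: measurable_left_block. Qed.
Let mry : measurable_fun setT (rb : output_block (M + N) -> output_block N).
Proof. exact: measurable_right_block. Qed.

Lemma product_input_power : power_constraints beta mu.
Proof.
move=> k n; case: (split_ordP n) => i ->.
  by apply: (power_constraints_at mlz (product_input_left mu1 mu2) _ mu1_power k) => z; exact: tnth_left_block.
by apply: (power_constraints_at mrz (product_input_right mu1 mu2) _ mu2_power k) => z; exact: tnth_right_block.
Qed.

Lemma out_left (s : input_block (M + N) * Omega) :
  lb (out (M + N) s) = (shifted_pair 0 lb s).2.
Proof.
case: s => z w; rewrite block_received /shifted_pair /=.
apply: eq_from_tnth => i; rewrite tnth_left_block /block !tnth_mktuple.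
apply: eq_from_tnth => l; rewrite !tnth_mktuple /received /signal /=; congr (_ + _).
by apply: eq_bigr => k _; rewrite tnth_left_block.
Qed.

Lemma out_right (s : input_block (M + N) * Omega) :
  rb (out (M + N) s) = (shifted_pair M rb s).2.
Proof.
case: s => z w; rewrite block_received /shifted_pair /=.
apply: eq_from_tnth => i; rewrite tnth_right_block /block !tnth_mktuple.
apply: eq_from_tnth => l; rewrite !tnth_mktuple /received /signal /=; congr (_ + _).
by apply: eq_bigr => k _; rewrite tnth_right_block.
Qed.

Let i1 := input_info mu1.
Let i2 := input_info mu2.
Let mi1 : measurable_fun setT i1. Proof. exact: measurable_input_info. Qed.
Let mi2 : measurable_fun setT i2. Proof. exact: measurable_input_info. Qed.
Let U1 := shifted_pair 0 lb.
Let U2 := shifted_pair M rb.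

Let first_info : (mu \x P)%E.-integrable setT (EFin \o (i1 \o U1)) /\
  \int[(mu \x P)%E]_s i1 (U1 s) = \int[(mu1 \x P)%E]_s i1 (s.1, out M s).
Proof.
have law A : measurable A -> mu (lb @^-1` A) = mu1 A by exact: product_input_left.
have mU := measurable_shifted_pair 0 mlz.
have mV : measurable_fun setT (fun s => (s.1, out M s)) by exact: measurable_fun_pair.
have UV A (mA : measurable A) := shifted_pair_law 0 mlz law mA.
split; last exact: (Rintegral_same_law mU mV UV).
exact: (integrable_same_law mU mV UV mi1 (integrable_input_info mu1_power)).
Qed.

Let second_info : (mu \x P)%E.-integrable setT (EFin \o (i2 \o U2)) /\
  \int[(mu \x P)%E]_s i2 (U2 s) = \int[(mu2 \x P)%E]_s i2 (s.1, out N s).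
Proof.
have law A : measurable A -> mu (rb @^-1` A) = mu2 A by exact: product_input_right.
have mU := measurable_shifted_pair M mrz.
have mV : measurable_fun setT (fun s => (s.1, out N s)) by exact: measurable_fun_pair.
have UV A (mA : measurable A) := shifted_pair_law M mrz law mA.
split; last exact: (Rintegral_same_law mU mV UV).
exact: (integrable_same_law mU mV UV mi2 (integrable_input_info mu2_power)).
Qed.

(** Product of the posterior densities of the two input blocks, each computed from its own output
    block only. *)
Let g (p : input_block (M + N) * output_block (M + N)) : R :=
  expR (i1 (lb p.1, left_block p.2) + i2 (rb p.1, right_block p.2)).

Let mg : measurable_fun setT g.
Proof.
apply: (measurableT_comp (@measurable_expR R)); apply: measurable_funD.
  apply: (measurableT_comp mi1); apply: measurable_fun_pair.
    exact: (measurableT_comp mlz measurable_fst).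
  exact: (measurableT_comp mly measurable_snd).
apply: (measurableT_comp mi2); apply: measurable_fun_pair.
  exact: (measurableT_comp mrz measurable_fst).
exact: (measurableT_comp mry measurable_snd).
Qed.

Let g_int1 y : (\int[mu]_z (g (z, y))%:E = 1)%E.
Proof.
have m1 : measurable_fun setT (fun z1 => expR (i1 (z1, left_block y))).
  exact: (measurableT_comp (@measurable_expR R) (measurableT_comp mi1 (pair2_measurable (left_block y)))).
have m2 : measurable_fun setT (fun z2 => expR (i2 (z2, right_block y))).
  exact: (measurableT_comp (@measurable_expR R) (measurableT_comp mi2 (pair2_measurable (right_block y)))).
pose f (z : input_block M * input_block N) : \bar R :=
  (expR (i1 (z.1, left_block y)) * expR (i2 (z.2, right_block y)))%:E.
have mf : measurable_fun setT f.
  by apply/measurable_EFinP; exact: (measurable_funM (measurableT_comp m1 measurable_fst) (measurableT_comp m2 measurable_snd)).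
have f0 z : (0 <= f z)%E by rewrite lee_fin mulr_ge0 ?expR_ge0.
transitivity (\int[mu]_z f (lb z, rb z))%E.
  by apply: eq_integral => z _; rewrite /g expRD.
rewrite ge0_integral_product_input//.
rewrite -(expR_input_info_int1 mu1_power (left_block y)).
apply: eq_integral => z1 _.
transitivity (\int[mu2]_z2 ((expR (i1 (z1, left_block y)))%:E * (expR (i2 (z2, right_block y)))%:E))%E.
  by apply: eq_integral => z2 _; rewrite -EFinM.
rewrite ge0_integralZl_EFin ?expR_ge0//; last exact/measurable_EFinP.
by rewrite (expR_input_info_int1 mu2_power) mule1.
Qed.

(** The memory of the fading can make the two outputs dependent, so the information need not split.
    The lower bound with [g] tolerates this: for every [y], [g] integrates to 1 against the product
    input, and the mean of [ln g] is the sum of the two block informations, since each term involves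
    the law of one sub-block only. *)
Lemma block_information_superadditive :
  (block_information H W rho mu1 + block_information H W rho mu2 <=
   block_information H W rho mu)%E.
Proof.
have [I1 E1] := first_info; have [I2 E2] := second_info.
have lng : (fun s => ln (g (s.1, out (M + N) s))) = fun s => i1 (U1 s) + i2 (U2 s).
  by apply/funext => s; rewrite /g expRK /= out_left out_right.
have mu_power := product_input_power.
apply: le_trans (block_information_ge channel separable rho_ge0 mu_power mg _ _ _).
- rewrite lng RintegralD// E1 E2.
  rewrite (block_information_real channel separable rho_ge0 mu1_power).
  by rewrite (block_information_real channel separable rho_ge0 mu2_power).
- by move=> p; exact: expR_gt0.
- rewrite (@fubini_tonelli _ _ _ _ _ mu noise_law
    (fun p => (g p * output_density H rho mu p.2)%:E)); last 2 first.
  + apply/measurable_EFinP; apply: (measurable_funM mg).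
    exact: (measurableT_comp (measurable_output_density H rho mu) measurable_snd).
  + by move=> p; rewrite lee_fin; apply: mulr_ge0; [exact: expR_ge0|exact: output_density_ge0].
  rewrite -(output_density_int1 mu) le_eqVlt; apply/orP; left; apply/eqP.
  apply: eq_integral => y _.
  transitivity (\int[mu]_z ((output_density H rho mu y)%:E * (g (z, y))%:E))%E.
    by apply: eq_integral => z _; rewrite -EFinM; congr _%:E; exact: mulrC.
  rewrite ge0_integralZl_EFin.
  + by rewrite g_int1 mule1.
  + by [].
  + by move=> z _; rewrite lee_fin expR_ge0.
  + by apply/measurable_EFinP; exact: (measurableT_comp mg (pair2_measurable y)).
  + exact: output_density_ge0.
- by rewrite lng; exact: integrable_EFinD.
Qed.

End two_blocks.
End superadditivity.

Section fekete.
Context (R : realType) (s : nat -> R) (U : R).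
Hypothesis s_ge0 : forall n, 0 <= s n.
Hypothesis s_super : forall m n, s m + s n <= s (m + n)%N.
Hypothesis s_le : forall n, s n <= n%:R * U.

Lemma superadditive_mul m q k : q%:R * s m <= s (q * m + k)%N.
Proof.
elim: q => [|q ih]; first by rewrite mul0r.
rewrite mulSn -addnA -natr1 mulrDl mul1r addrC.
by apply: le_trans (s_super _ _); rewrite lerD2l.
Qed.

(** The limit is the supremum of [n%:R^-1 * s n] over positive [n], which is why every fixed block
    length bounds it from below. *)
Lemma superadditive_cvg : exists2 L : R,
  (n%:R^-1 * s n @[n --> \oo] --> L) & L <= U /\ forall m, (0 < m)%N -> s m <= m%:R * L.
Proof.
pose A := [set n%:R^-1 * s n | n in [set n | (0 < n)%N]].
have A_ub : ubound A U.
  move=> _ [n /= n0 <-]; rewrite mulrC ler_pdivrMr ?ltr0n// mulrC; exact: s_le.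
have A1 : A (1%:R^-1 * s 1%N) by exists 1%N.
have supA : has_sup A by split; [exists (1%:R^-1 * s 1%N)|exists U].
have Lm m : (0 < m)%N -> m%:R^-1 * s m <= sup A.
  by move=> m0; apply: ub_le_sup; [exists U|exists m].
exists (sup A); last first.
  split; first by apply: ge_sup => //; exists (1%:R^-1 * s 1%N).
  by move=> m m0; rewrite mulrC -ler_pdivrMr ?ltr0n// mulrC; exact: Lm.
apply/cvgrPdist_le => e e0.
have [_ [m /= m0 <-] hm] := sup_adherent (divr_gt0 e0 (ltr0n R 2)) supA.
have mR : 0 < m%:R :> R by rewrite ltr0n.
near=> n.
have n0 : (0 < n)%N by near: n; exists 1%N.
have nR : 0 < n%:R :> R by rewrite ltr0n.
have hn : n%:R^-1 * s m <= e / 2.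
  rewrite mulrC ler_pdivrMr// -ler_pdivrMl ?divr_gt0//.
  by near: n; exact: nbhs_infty_ger.
have ub := Lm n n0.
rewrite ger0_norm ?subr_ge0//.
(* Division of [n] by [m] gives [s n >= (n %/ m)%:R * s m], and the integer quotient is at least n /
   m - 1. *)
suff : m%:R^-1 * s m - n%:R^-1 * s m <= n%:R^-1 * s n by lra.
have h := superadditive_mul m (n %/ m) (n %% m); rewrite -divn_eq in h.
have hq : n%:R - m%:R <= (n %/ m)%:R * m%:R :> R.
  rewrite lerBlDr -natrM -natrD ler_nat {1}(divn_eq n m) leq_add2l.
  by rewrite ltnW// ltn_pmod.
rewrite -mulrBl ler_pdivlMl// mulrCA mulrA.
apply: le_trans h; apply: ler_wpM2r; first exact: s_ge0.
rewrite (_ : _ * _ = (n%:R - m%:R) / m%:R); last by field; rewrite !gt_eqF.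
by rewrite ler_pdivrMr.
Unshelve. all: by end_near.
Qed.

End fekete.

Section capacity_bounds.
Context (R : realType) (NT NR : nat) d (Omega : measurableType d)
  (P : probability Omega R)
  (H : 'I_NT -> 'I_NR -> int -> {RV P >-> R[i]})
  (W : 'I_NR -> nat -> {RV P >-> R[i]})
  (channel : rayleigh_mimo H W)
  (alpha : 'I_NT -> R) (r : 'I_NR -> int -> R[i])
  (separable : transmit_separable H alpha r) (rho beta : R).
Hypothesis rho_ge0 : 0 <= rho.
Hypothesis beta_ge1 : 1 <= beta.
Hypothesis phi_fin : forall l, (phi (r l) < +oo)%E.
Local Notation Re := (@complex.Re R).
Local Notation input_block N := (N.-tuple (NT.-tuple R[i])).
Let r0_ge0 l : 0 <= Re (r l 0).
Proof. by have [_ + _] := separable => /(_ l)/autocorrelation_facts[]. Qed.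

Lemma lambda_ge0 l : 0 <= lambda (r l).
Proof.
rewrite addr_ge0 ?sqr_ge0// mulr_ge0// fine_ge0//.
by apply: nneseries_ge0 => n _ _; rewrite lee_fin sqr_ge0.
Qed.

Definition low_snr_gain (a : R) : R :=
  \sum_l (a * lambda (r l) - a ^+ 2 * Re (r l 0) ^+ 2).

Definition low_snr_gains : set R := [set low_snr_gain a | a in `[0, beta^-1]].

Lemma low_snr_gainE a : low_snr_gain a =
  a * \sum_l lambda (r l) - a ^+ 2 * \sum_l Re (r l 0) ^+ 2.
Proof. by rewrite /low_snr_gain sumrB -!mulr_sumr. Qed.

Let beta_gt0 : 0 < beta. Proof. exact: lt_le_trans beta_ge1. Qed.
Let beta_le1 : beta^-1 <= 1. Proof. by rewrite invf_le1. Qed.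

Lemma low_snr_gains_sup : has_sup low_snr_gains.
Proof.
split; first by exists (low_snr_gain 0), 0 => //=; rewrite in_itv /= lexx invr_ge0 ltW.
exists (\sum_l lambda (r l)) => _ [a /= + <-]; rewrite in_itv /= => /andP[a0 ab].
have L0 : 0 <= \sum_l lambda (r l) by apply: sumr_ge0 => l _; exact: lambda_ge0.
have G0 : 0 <= a ^+ 2 * \sum_l Re (r l 0) ^+ 2.
  by rewrite mulr_ge0 ?sqr_ge0// sumr_ge0// => l _; exact: sqr_ge0.
rewrite low_snr_gainE; have : a * \sum_l lambda (r l) <= 1 * \sum_l lambda (r l).
  by apply: ler_wpM2r => //; exact: le_trans ab _.
lra.
Qed.

Definition rate_bound : R := rho ^+ 2 * (2^-1 * total_gain alpha ^+ 2 * sup low_snr_gains)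
  + rho ^+ 3 * ((\sum_l Re (r l 0) ^+ 3) * total_gain alpha ^+ 3 / 3).

Lemma block_information_rate N (mu : probability (input_block N) R) :
  power_constraints beta mu ->
  (block_information H W rho mu <= (N%:R * rate_bound)%:E)%E.
Proof.
move=> mu_power.
apply: (le_trans (information_upper channel separable rho_ge0 mu_power phi_fin)).
have S0 : 0 <= total_gain alpha := total_gain_ge0 separable.
rewrite lee_fin; set S := total_gain alpha in S0 *.
set La := \sum_l lambda (r l); set Ga := \sum_l Re (r l 0) ^+ 2; set Q := \sum_l Re (r l 0) ^+ 3.
have Q0 : 0 <= Q by apply: sumr_ge0 => l _; rewrite exprn_ge0.
pose m n := mean_power alpha mu n.
have m0 n : 0 <= m n := mean_power_ge0 separable mu n.
have mS n : m n <= S / beta := mean_power_le separable mu_power n.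
have mS1 n : m n <= S.
  by apply: le_trans (mS n) _; rewrite ler_pdivrMr// ler_peMr.
have cube n : m n ^+ 3 <= S ^+ 3 by rewrite lerXn2r ?nnegrE.
(* The ratio [m n / S] lies between 0 and [beta^-1] and plays the role of [a]; the case [S = 0] is
   separate because of the division. *)
have gain n : S * La * m n - Ga * m n ^+ 2 <= S ^+ 2 * sup low_snr_gains.
  have [S00|S00] := eqVneq S 0.
    have -> : m n = 0 by apply/eqP; rewrite eq_le m0 andbT -S00.
    by rewrite S00 expr0n /= !mulr0 !mul0r subrr.
  have Sp : 0 < S by rewrite lt_neqAle eq_sym S00.
  rewrite (_ : _ - _ = S ^+ 2 * low_snr_gain (m n / S)); last first.
    by rewrite low_snr_gainE -/La -/Ga; field.
  rewrite ler_wpM2l ?sqr_ge0//; apply: sup_upper_bound; first exact: low_snr_gains_sup.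
  exists (m n / S) => //=; rewrite in_itv /= divr_ge0//=.
  by rewrite ler_pdivrMr// mulrC.
have h1 : S * La * (\sum_n m n) - Ga * (\sum_n m n ^+ 2) <= N%:R * (S ^+ 2 * sup low_snr_gains).
  rewrite [S * La * _]mulr_sumr [Ga * _]mulr_sumr -sumrB (le_trans (ler_sum _ (fun n _ => gain n)))//.
  by rewrite sumr_const card_ord -[leLHS]mulr_natl.
have h2 : \sum_n m n ^+ 3 <= N%:R * S ^+ 3.
  rewrite (le_trans (ler_sum _ (fun n _ => cube n)))//.
  by rewrite sumr_const card_ord -[leLHS]mulr_natl.
have h3 := ler_wpM2l (mulr_ge0 (exprn_ge0 3 rho_ge0) Q0) h2.
have h4 := ler_wpM2l (exprn_ge0 2 rho_ge0) h1.
rewrite /rate_bound -/S -/Q.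
rewrite (_ : N%:R * _ = (rho ^+ 2 * (N%:R * (S ^+ 2 * sup low_snr_gains))) / 2 +
  (rho ^+ 3 * Q * (N%:R * S ^+ 3)) / 3); last by field.
rewrite -/m; lra.
Qed.

(** The variational lower bound with [g = 1]. *)
Lemma block_information_ge0 N (mu : probability (input_block N) R) :
  power_constraints beta mu -> (0 <= block_information H W rho mu)%E.
Proof.
move=> mu_power.
have m1 : measurable_fun setT (fun _ : input_block N * (N.-tuple (NR.-tuple R[i])) => 1 : R).
  exact: measurable_cst.
have := block_information_ge channel separable rho_ge0 mu_power m1 (fun=> ltr01).
rewrite (_ : (fun s => ln 1) = (fun=> 0 : R)); last by apply/funext => s; rewrite ln1.
rewrite Rintegral_prob_cst; apply; last exact: integrable_prob_cst.
rewrite -[leRHS](integral_prob_cst mu 1) le_eqVlt; apply/orP; left; apply/eqP.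
apply: eq_integral => z _.
rewrite -(output_density_int1 channel separable rho_ge0 mu).
by apply: eq_integral => y _; rewrite mul1r.
Qed.

Definition block_capacity N : \bar R :=
  ereal_sup [set block_information H W rho mu | mu in @power_constraints R NT beta N].

(** The supremum over inputs thus ranges over a nonempty set. *)
Lemma silent_input N : exists mu : probability (input_block N) R, power_constraints beta mu.
Proof.
have a01 : 0 <= (0 : R) <= 1 by rewrite lexx ler01.
exists (random_codeword NT N a01); apply: random_codeword_power => //.
by rewrite invr_ge0 ltW.
Qed.

Lemma block_capacity_ge0 N : (0 <= block_capacity N)%E.
Proof.
have [mu hmu] := silent_input N.
apply: (le_trans (block_information_ge0 hmu)).
by apply: ereal_sup_ubound; exists mu.
Qed.

Lemma block_capacity_le N : (block_capacity N <= (N%:R * rate_bound)%:E)%E.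
Proof. by apply: ge_ereal_sup => _ [mu hmu <-]; exact: block_information_rate. Qed.

Lemma block_capacity_fin N : block_capacity N \is a fin_num.
Proof.
rewrite ge0_fin_numE ?block_capacity_ge0//.
exact: le_lt_trans (block_capacity_le N) (ltry _).
Qed.

Lemma block_capacity_super M N : (block_capacity M + block_capacity N <= block_capacity (M + N))%E.
Proof.
have key (mu1 : probability (input_block M) R) (mu2 : probability (input_block N) R) :
    power_constraints beta mu1 -> power_constraints beta mu2 ->
    (block_information H W rho mu1 + block_information H W rho mu2 <= block_capacity (M + N))%E.
  move=> h1 h2.
  apply: (le_trans (block_information_superadditive channel separable rho_ge0 h1 h2)).
  apply: ereal_sup_ubound; exists (product_input mu1 mu2) => //.
  exact: product_input_power.
have fI K (mu : probability (input_block K) R) :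
    power_constraints beta mu -> block_information H W rho mu \is a fin_num.
  by move=> h; rewrite (block_information_real channel separable rho_ge0 h).
(* Finiteness lets each of the two suprema be isolated in turn by a subtraction. *)
rewrite -leeBrDr ?block_capacity_fin//.
apply: ge_ereal_sup => _ [mu1 h1 <-]; rewrite leeBrDr ?block_capacity_fin//.
rewrite addeC -leeBrDr ?fI//.
apply: ge_ereal_sup => _ [mu2 h2 <-]; rewrite leeBrDr ?fI// addeC; exact: key.
Qed.

(** [C_mimo_i] is a [limn], which is informative only once convergence is known; superadditivity and
    [rate_bound] provide it, together with the bound of every block information by [N%:R * L]. *)
Lemma capacity_bounds : exists L : R, [/\ C_mimo_i H W rho beta = L%:E, L <= rate_bound &
  forall N (mu : probability (input_block N) R), (0 < N)%N -> power_constraints beta mu ->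
    (block_information H W rho mu <= (N%:R * L)%:E)%E].
Proof.
pose s N := fine (block_capacity N).
have sE N : (s N)%:E = block_capacity N by rewrite fineK ?block_capacity_fin.
have s0 N : 0 <= s N by rewrite fine_ge0// block_capacity_ge0.
have ss m n : s m + s n <= s (m + n)%N.
  by rewrite -lee_fin EFinD !sE block_capacity_super.
have sU n : s n <= n%:R * rate_bound by rewrite -lee_fin sE block_capacity_le.
have [L sL [LU hL]] := superadditive_cvg s0 ss sU.
exists L; split => //.
- rewrite /C_mimo_i; apply: (@cvg_lim (\bar R)) => //.
  rewrite (_ : (fun N => _) = EFin \o (fun n => n%:R^-1 * s n)); last first.
    by apply/funext => n; rewrite /= EFinM sE.
  by apply: cvg_EFin; [exact: nearW|exact: sL].
- move=> N mu N0 hmu; apply: (@le_trans _ _ (block_capacity N)).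
    by apply: ereal_sup_ubound; exists mu.
  by rewrite -sE lee_fin hL.
Qed.

End capacity_bounds.

(** * Growth of the correlation sum and the limit *)

Section correlation_growth.
Context (R : realType) (NT NR : nat) d (Omega : measurableType d)
  (P : probability Omega R)
  (H : 'I_NT -> 'I_NR -> int -> {RV P >-> R[i]})
  (alpha : 'I_NT -> R) (r : 'I_NR -> int -> R[i])
  (separable : transmit_separable H alpha r)
  (phi_fin : forall l, (phi (r l) < +oo)%E).

(** Half of [e] pays for the loss [2 * e'] per receive antenna, the other half for the boundary
    terms [D], once [N] is large. The 1 in [NR%:R + 1] guards against division by zero. *)
Lemma correlation_sum_large (e : R) : 0 < e -> exists2 N, (0 < N)%N &
  N%:R * (\sum_l lambda (r l) - e) <= correlation_sum r N.
Proof.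
move=> e0.
pose e' := e / (4 * (NR%:R + 1)).
have NR1 : 0 < NR%:R + 1 :> R by rewrite ltr_wpDl.
have e'0 : 0 < e' by rewrite divr_gt0// mulr_gt0.
have /boolp.choice[K hK] : forall l, exists K : nat, forall N : nat,
    N%:R * (lambda (r l) - 2 * e') - 2 * K%:R * lambda (r l) <=
    \sum_(n < N) \sum_(m < N) csq (r l (n%:Z - m%:Z)).
  move=> l; have [_ /(_ l)/autocorrelation_facts[rN r0 _] _] := separable.
  exact: (double_sum_ge rN r0 (phi_fin l) e'0).
pose D := \sum_l 2 * (K l)%:R * lambda (r l).
have [N hN] : exists N : nat, 2 * D / e <= N%:R.
  by exists (Num.truncn (2 * D / e)).+1; rewrite ltW// truncnS_gt.
exists N.+1 => //.
apply: (@le_trans _ _ (\sum_l (N.+1%:R * (lambda (r l) - 2 * e') - 2 * (K l)%:R * lambda (r l)))); last first.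
  by apply: ler_sum => l _; exact: hK.
rewrite sumrB -mulr_sumr sumrB sumr_const card_ord -/D.
have hN1 : D <= N.+1%:R * (e / 2).
  move: hN; rewrite ler_pdivrMr// -[N.+1%:R]natr1; lra.
have he : 2 * e' *+ NR <= e / 2.
  rewrite -mulr_natr /e' (_ : _ * _ = (e / 2) * (NR%:R / (NR%:R + 1))); last by field; rewrite gt_eqF.
  apply: ler_piMr; first by rewrite divr_ge0// ltW.
  by rewrite ler_pdivrMr// mul1r lerDl.
have := ler_wpM2l (ler0n R N.+1) he; lra.
Qed.

End correlation_growth.

Theorem mainTheorem3 (R : realType) (NT NR : nat)
    (NT_gt0 : (0 < NT)%N) (NR_gt0 : (0 < NR)%N)
    (d : measure_display) (Omega : measurableType d) (P : probability Omega R)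
    (H : 'I_NT -> 'I_NR -> int -> {RV P >-> R[i]})
    (W : 'I_NR -> nat -> {RV P >-> R[i]})
    (channel : rayleigh_mimo H W)
    (beta : R) (beta_ge1 : 1 <= beta)
    (alpha : 'I_NT -> R) (r : 'I_NR -> int -> R[i])
    (separable : transmit_separable H alpha r)
    (phi_fin : forall l, (phi (r l) < +oo)%E) :
  (C_mimo_i H W rho beta * ((rho ^+ 2)^-1)%:E)%E @[rho --> (0 : R)^'+] -->
  (2^-1 * (\sum_(k < NT) alpha k) ^+ 2 *
   sup [set \sum_(l < NR) (a * lambda (r l) - a ^+ 2 * complex.Re (r l 0) ^+ 2)
       | a in `[0, beta^-1]])%:E.
Proof.
rewrite -/(total_gain alpha) -/(low_snr_gains r beta).
set S := total_gain alpha; set V := sup _.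
have S0 : 0 <= S := total_gain_ge0 separable.
have bounds rho : 0 < rho -> exists L : R, [/\ C_mimo_i H W rho beta = L%:E,
    L <= rate_bound alpha r rho beta &
    forall N (mu : probability (N.-tuple (NT.-tuple R[i])) R), (0 < N)%N ->
      power_constraints beta mu -> (block_information H W rho mu <= (N%:R * L)%:E)%E].
  by move=> rho0; exact: (capacity_bounds channel separable (ltW rho0) beta_ge1 phi_fin).
apply/fine_cvgP; split.
  near=> rho; have rho0 : 0 < rho by near: rho; exact: nbhs_right_gt.
  by have [L [-> _ _]] := bounds rho rho0.
apply/cvgrPdist_le => e e0.
pose C3 := (\sum_l complex.Re (r l 0) ^+ 3) * S ^+ 3 / 3.
(* [e1] is spent twice, on the choice of [a] and on the growth of [correlation_sum]; multiplied by
   [S ^+ 2] it stays below [e / 2], and the 1 covers [S = 0]. *)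
pose e1 := e / (2 * (S ^+ 2 + 1)).
have S1 : 0 < S ^+ 2 + 1 by rewrite ltr_wpDl ?sqr_ge0.
have e10 : 0 < e1 by rewrite divr_gt0// mulr_gt0.
have [_ [a /= + <-] ha] := sup_adherent e10 (low_snr_gains_sup r beta_ge1).
rewrite in_itv /= => /andP[a0 ab].
have b1 : beta^-1 <= 1 by rewrite invf_le1 ?(lt_le_trans _ beta_ge1).
have a1 : a <= 1 by exact: le_trans ab b1.
have a01 : 0 <= a <= 1 by rewrite a0.
(* [a] and [N] are fixed before [rho], so [C] and [eps], which depend on them, are constants in the
   limit. *)
have [N N0 hN] := correlation_sum_large separable phi_fin e10.
have [C [eps [C0 eps0 hC]]] :=
  codeword_information_ge channel separable N a01 beta_ge1 ab.
have mu_power := @random_codeword_power R NT N a a01 beta beta_ge1 ab.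
have NR0 : 0 < N%:R :> R by rewrite ltr0n.
have C31 : 0 < `|C3| + 1 by rewrite ltr_wpDl.
have C1 : 0 < C + 1 by rewrite ltr_wpDl.
near=> rho.
have rho0 : 0 < rho by near: rho; exact: nbhs_right_gt.
have rho_eps : rho <= eps by near: rho; exact: nbhs_right_le.
have rho3 : rho * `|C3| <= e.
  have : rho <= e / (`|C3| + 1) by near: rho; apply: nbhs_right_le; rewrite divr_gt0.
  by rewrite ler_pdivlMr// mulrDr mulr1; lra.
have rhoC : rho * C <= e / 2.
  have : rho <= e / 2 / (C + 1) 
    by near: rho; apply: nbhs_right_le; apply: divr_gt0 => //; exact: divr_gt0.
  by rewrite ler_pdivlMr// mulrDr mulr1; lra.
have [L [CE LU hL]] := bounds rho rho0.
rewrite CE /=.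
have r2 : 0 < rho ^+ 2 by rewrite exprn_gt0.
have IL := le_trans (hC rho rho0 rho_eps) (hL N _ N0 mu_power).
rewrite lee_fin -/S in IL.
rewrite ler_distlC; apply/andP; split; last first.
  rewrite ler_pdivrMr//; apply: (le_trans LU); rewrite /rate_bound -/S -/V -/C3.
  have h1 := ler_wpM2l (ltW r2) rho3.
  have h2 := ler_wpM2l (ltW (exprn_gt0 3 rho0)) (ler_norm C3).
  rewrite (_ : rho ^+ 2 * (rho * `|C3|) = rho ^+ 3 * `|C3|) in h1; last by ring.
  lra.
rewrite ler_pdivlMr//.
set La := \sum_l lambda (r l) in hN IL; set Ga := \sum_l complex.Re (r l 0) ^+ 2 in IL.
set T := correlation_sum r N in hN IL.
have q1 : N%:R * (V - 2 * e1) <= a * T - N%:R * a ^+ 2 * Ga.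
  have h1 := ler_wpM2l a0 hN.
  have h2 : a * e1 <= 1 * e1 by rewrite ler_wpM2r// ltW.
  have h3 : V - 2 * e1 <= a * La - a ^+ 2 * Ga - a * e1.
    by move: ha; rewrite low_snr_gainE -/La -/Ga -/V; lra.
  have h4 := ler_wpM2l (ltW NR0) h3.
  lra.
have q2 := ler_wpM2l (mulr_ge0 (ltW r2) (exprn_ge0 2 S0)) q1.
(* As [N] is at least 1, the error may be enlarged by the factor [N], which then cancels in [q4]. *)
have q3 : C * rho ^+ 3 <= N%:R * (C * rho ^+ 3).
  by rewrite ler_peMl ?mulr_ge0 ?exprn_ge0 ?(ltW rho0)// ler1n.
have q4 : rho ^+ 2 / 2 * S ^+ 2 * (V - 2 * e1) - C * rho ^+ 3 <= L.
  by rewrite -(ler_pM2l NR0); apply: le_trans IL; lra.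
have q5 : S ^+ 2 * e1 <= e / 2.
  have -> : e / 2 = (S ^+ 2 + 1) * e1 by rewrite /e1; field; rewrite gt_eqF.
  by rewrite mulrDl mul1r lerDl ltW.
have q6 := ler_wpM2l (ltW r2) q5.
have q7 := ler_wpM2l (ltW r2) rhoC.
rewrite (_ : rho ^+ 2 * (rho * C) = C * rho ^+ 3) in q7; last by ring.
lra.
Unshelve. all: by end_near.
Qed.
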